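(* The variety $X(3,6)$ is irreducible of dimension $4$. The variety $X\times_YX$ has only one irreducible component of dimension $4$, and all its other components have lower dimension. The map $h:X(3,6)\to X\times_YX$ establishes a birational isomorphism of $X(3,6)$ with the $4$-dimensional irreducible component of $X\times_YX$.
   Context: Let $F$ be an algebraically closed field of characteristic zero. ''GIT moduli space of 6-dimensional representations'' means the affine GIT quotient by $GL(6)$, acting by conjugation, of the affine variety of the representations in question. Algebras (all unital, associative over $F$). - $B=B_{\frac16}(\Gamma_{3,3})$: generators $p_1,p_2,p_3,q_1,q_2,q_3$; relations $p_i^2=p_i$, $q_j^2=q_j$, $p_ip_{i'}=0$ for $i\ne i'$, $q_jq_{j'}=0$ for $j\neq j'$, $p_iq_jp_i=\frac16p_i$, $q_jp_iq_j=\frac16q_j$. - $B_{3,6}$: generators $p_1,p_2,p_3,q_1,\dots,q_6$ with relations of the same form (for all $i\le 3$, $j\leq 6$), and additionally $\sum_{j=1}^6q_j=1$. - $A_3$: generators $P,q_1,q_2,q_3$; relations $P^2=P$, $q_j^2=q_j$, $q_iq_j=0$ for $i\neq j$, $q_jPq_j=\frac12q_j$. It has the involution $\sigma$: $P\mapsto1-P$, $q_j\mapsto q_j$. Moduli spaces. $X$ (resp. $X(3,6)$) is the GIT moduli space of 6-dimensional representations of $B$ (resp. $B_{3,6}$) in which all $p_i$ and $q_j$ are represented by rank 1 projectors. $Y$ is the GIT moduli space of 6-dimensional representations of $A_3$ in which $P$ is represented by a rank 3 projector and each $q_j$ by a rank 1 projector; $\sigma$ also denotes the induced involution of $Y$.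 Maps. Let $f':X\to Y$ be induced by the homomorphism $A_3\to B$, $P\mapsto q_1+q_2+q_3$, $q_i\mapsto p_i$. The fiber product $X\times_YX$ is formed with respect to $f'$ on the first factor and $\sigma\circ f'$ on the second. The map $h$ has as components the two maps $X(3,6)\to X$ given by restricting representations along the homomorphisms $B\to B_{3,6}$ given by $p_i\mapsto p_i$, $q_j\mapsto q_j$ and by $p_i\mapsto p_i$, $q_j\mapsto q_{j+3}$ ($i,j=1,2,3$), respectively. *)

(* Defs.v *)
From mathcomp Require Import all_boot all_order all_algebra.
From mathcomp Require Import boolp classical_sets.
From mathcomp.multinomials Require Import mpoly.

Set Implicit Arguments.
Unset Strict Implicit.
Unset Printing Implicit Defensive.

Import GRing.Theory.
Local Open Scope classical_set_scope.
Local Open Scope ring_scope.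

(** * Affine varieties

    An affine variety over the algebraically closed field [F] is given by its
    set of [F]-points together with its algebra of regular functions, viewed as
    functions on the points (so varieties are reduced).  The record carries no
    axioms: it is only inhabited below by closed subsets of affine spaces,
    spectra of algebras of invariants, products, and closed subsets of these. *)

Record variety (F : closedFieldType) := Variety {
  point :> Type;
  regular : set (point -> F)
}.

Lemma eq_exist (T : Type) (P : T -> Prop) (u v : {x | P x}) :
  sval u = sval v -> u = v.
Proof.
by case: u v => [x px] [y py] /= xy; case: y / xy py => py;
  congr exist; exact: Prop_irrelevance.
Qed.

Section Topology.
Variables (F : closedFieldType) (X : variety F).

Definition zclosed (Z : set X) : Prop :=
  exists S : set (X -> F),
    S `<=` @regular F X /\ Z = [set x | forall f, S f -> f x = 0].

Definition zopen (U : set X) : Prop := zclosed (~` U).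

Definition irreducible (Z : set X) : Prop :=
  Z !=set0 /\
  forall A B : set X, zclosed A -> zclosed B -> Z `<=` A `|` B ->
    Z `<=` A \/ Z `<=` B.

Definition irreducible_component (Z : set X) : Prop :=
  [/\ zclosed Z, irreducible Z &
      forall Z' : set X, zclosed Z' -> irreducible Z' -> Z `<=` Z' -> Z' = Z].

(* [Z 0 `<` Z 1 `<` ... `<` Z d], of length [d]. *)
Definition has_chain (d : nat) : Prop :=
  exists Z : nat -> set X,
    (forall i, (i <= d)%N -> zclosed (Z i) /\ irreducible (Z i)) /\
    (forall i, (i < d)%N -> Z i `<` Z i.+1).

(* Krull dimension *)
Definition has_dim (d : nat) : Prop := has_chain d /\ ~ has_chain d.+1.

(* Sections over an open set [U] of the structure sheaf; the values of [f]
   outside [U] are irrelevant. *)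
Definition regular_on (U : set X) (f : X -> F) : Prop :=
  forall x, U x -> exists a b : X -> F,
    [/\ regular a, regular b, b x != 0 &
        forall y, U y -> b y != 0 -> f y = a y / b y].

End Topology.

Definition is_irreducible (F : closedFieldType) (X : variety F) : Prop :=
  irreducible [set: X].

Definition subvariety (F : closedFieldType) (X : variety F) (Z : set X) :
    variety F :=
  @Variety F {x : X | Z x}
    [set f | exists2 g : X -> F, regular g & forall z, f z = g (sval z)].

(* The algebra of the product is the tensor product of the two algebras. *)
Definition product (F : closedFieldType) (X1 X2 : variety F) : variety F :=
  @Variety F (X1 * X2)%type
    [set f | exists (m : nat) (a : 'I_m -> X1 -> F) (b : 'I_m -> X2 -> F),
       [/\ forall i, regular (a i), forall i, regular (b i) &
           forall x, f x = \sum_(i < m) a i x.1 * b i x.2]].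

Definition fiber_product (F : closedFieldType) (X1 X2 Y : variety F)
    (f1 : X1 -> Y) (f2 : X2 -> Y) : variety F :=
  subvariety (X := product X1 X2) [set x | f1 x.1 = f2 x.2].

(* [phi] restricts to a morphism of varieties from the open set [U] to the
   open set [V]. *)
Definition morphism_on (F : closedFieldType) (X Y : variety F)
    (U : set X) (V : set Y) (phi : X -> Y) : Prop :=
  (forall x, U x -> V (phi x)) /\
  forall (W : set Y) (f : Y -> F), zopen W -> W `<=` V -> regular_on W f ->
    zopen (U `&` phi @^-1` W) /\
    regular_on (U `&` phi @^-1` W) (f \o phi).

(* To be used for irreducible [X] and [Y], where nonempty open sets are
   dense. *)
Definition birational (F : closedFieldType) (X Y : variety F) (phi : X -> Y) :
    Prop :=
  exists (U : set X) (V : set Y) (psi : Y -> X),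
    [/\ zopen U /\ U !=set0, zopen V /\ V !=set0,
        morphism_on U V phi /\ morphism_on V U psi,
        forall x, U x -> psi (phi x) = x &
        forall y, V y -> phi (psi y) = y].

(** * Affine GIT quotients

    [orb x y] means that [x] and [y] are in the same orbit of the group acting
    on [R]. *)

Section GIT.
Variables (F : closedFieldType) (R : variety F) (orb : R -> R -> Prop).

Definition invariant : set (R -> F) :=
  [set f | regular f /\ forall x y, orb x y -> f x = f y].

Definition invariants := {f : R -> F | invariant f}.

Definition is_character (chi : invariants -> F) : Prop :=
  [/\ forall (c : F) a, (forall x, sval a x = c) -> chi a = c,
      forall a b s, (forall x, sval s x = sval a x + sval b x) ->
        chi s = chi a + chi b &
      forall a b s, (forall x, sval s x = sval a x * sval b x) ->
        chi s = chi a * chi b].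

(* The quotient is the spectrum of the algebra of invariant regular functions:
   its points are the [F]-algebra homomorphisms from this algebra to [F]. *)
Definition git_quotient : variety F :=
  @Variety F {chi : invariants -> F | is_character chi}
    [set f | exists a : invariants, forall chi, f chi = sval chi a].

End GIT.

Definition equivariant_morphism (F : closedFieldType) (R1 R2 : variety F)
    (orb1 : R1 -> R1 -> Prop) (orb2 : R2 -> R2 -> Prop) (phi : R1 -> R2) :
    Prop :=
  (forall f : R2 -> F, regular f -> regular (f \o phi)) /\
  (forall x y, orb1 x y -> orb2 (phi x) (phi y)).

Section GITMap.
Variables (F : closedFieldType) (R1 R2 : variety F).
Variables (orb1 : R1 -> R1 -> Prop) (orb2 : R2 -> R2 -> Prop).
Variables (phi : R1 -> R2) (phiE : equivariant_morphism orb1 orb2 phi).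

Lemma invariant_pullback (f : R2 -> F) :
  invariant orb2 f -> invariant orb1 (f \o phi).
Proof.
case: phiE => reg eqv [freg finv]; split; first exact: reg.
by move=> x y xy; apply/finv/eqv.
Qed.

Definition pullback (a : invariants orb2) : invariants orb1 :=
  exist _ (sval a \o phi) (invariant_pullback (svalP a)).

Lemma is_character_pullback (chi : invariants orb1 -> F) :
  is_character chi -> is_character (chi \o pullback).
Proof.
case=> chiC chiD chiM; split=> [c a ac|a b s abs|a b s abs] /=.
- by apply: chiC => x /=.
- by apply: chiD => x /=.
- by apply: chiM => x /=.
Qed.

Definition git_map (chi : git_quotient orb1) : git_quotient orb2 :=
  exist _ (sval chi \o pullback) (is_character_pullback (svalP chi)).

End GITMap.

(** * Varieties of representations *)

Section Representations.
Variables (F : closedFieldType) (n : nat).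

(* Representations are given by the images in ['M_n] of generators indexed by
   [I]; the condition [C] consists of the relations and of the ranks prescribed
   for some idempotents.  In characteristic zero the rank of an idempotent is its
   trace, so the conditions [C] used below are Zariski closed. *)
Section Variety.
Variables (I : finType) (C : set (I -> 'M[F]_n)).

Definition entry (rho : I -> 'M[F]_n) (k : 'I_#|{: I * 'I_n * 'I_n}|) : F :=
  rho (enum_val k).1.1 (enum_val k).1.2 (enum_val k).2.

Definition rep_variety : variety F :=
  @Variety F {rho : I -> 'M[F]_n | C rho}
    [set f | exists p : {mpoly F[#|{: I * 'I_n * 'I_n}|]},
       forall rho, f rho = p.@[entry (sval rho)]].

Definition conjugate (rho rho' : rep_variety) : Prop :=
  exists2 g : 'M[F]_n, g \in unitmx &
    forall i, sval rho' i = g *m sval rho i *m invmx g.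

Definition moduli : variety F := git_quotient conjugate.

End Variety.

Lemma entryE (I : finType) (rho : I -> 'M[F]_n) i a b :
  entry rho (enum_rank (i, a, b)) = rho i a b.
Proof. by rewrite /entry enum_rankK. Qed.

Lemma equivariant_rep (I J : finType)
    (C : set (I -> 'M[F]_n)) (D : set (J -> 'M[F]_n))
    (phi : rep_variety C -> rep_variety D) :
  (forall j a b, exists p : {mpoly F[#|{: I * 'I_n * 'I_n}|]},
     forall rho, sval (phi rho) j a b = p.@[entry (sval rho)]) ->
  (forall (rho rho' : rep_variety C) (g : 'M[F]_n), g \in unitmx ->
     (forall i, sval rho' i = g *m sval rho i *m invmx g) ->
     forall j, sval (phi rho') j = g *m sval (phi rho) j *m invmx g) ->
  equivariant_morphism (@conjugate I C) (@conjugate J D) phi.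
Proof.
move=> phiP phiJ; split; last first.
  by move=> rho rho' [g gu gP]; exists g => //; exact: phiJ.
move=> f [p fp].
have /fin_all_exists [q qP] : forall k : 'I_#|{: J * 'I_n * 'I_n}|,
    exists q : {mpoly F[#|{: I * 'I_n * 'I_n}|]},
    forall rho, entry (sval (phi rho)) k = q.@[entry (sval rho)].
  by move=> k; apply: phiP.
exists (p \mPo [tuple q k | k < _]) => rho /=.
rewrite comp_mpoly_meval fp; apply: meval_eq => k.
by rewrite tnth_mktuple -qP.
Qed.

End Representations.

(** * Relations

    The relations are stated in an arbitrary [F]-algebra. *)

Section Relations.
Variables (F : closedFieldType) (A : algType F).

Definition orthogonal_idempotents (I : finType) (e : I -> A) : Prop :=
  (forall i, e i * e i = e i) /\ (forall i j, i != j -> e i * e j = 0).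

Definition B_relations (r : F) (m n : nat) (p : 'I_m -> A) (q : 'I_n -> A) :
    Prop :=
  [/\ orthogonal_idempotents p, orthogonal_idempotents q,
      forall i j, p i * q j * p i = r *: p i &
      forall i j, q j * p i * q j = r *: q j].

Definition A3_relations (P : A) (q : 'I_3 -> A) : Prop :=
  [/\ P * P = P, orthogonal_idempotents q &
      forall j, q j * P * q j = 2%:R^-1 *: q j].

Lemma sum_idem (I : finType) (e : I -> A) : orthogonal_idempotents e ->
  (\sum_i e i) * (\sum_i e i) = \sum_i e i.
Proof.
case=> ee eo; rewrite mulr_suml; apply: eq_bigr => i _.
rewrite mulr_sumr (bigD1 i) //= ee big1 ?addr0 // => j ji.
by rewrite eo // eq_sym.
Qed.

(* The homomorphism [A_3 -> B] *)
Lemma A3_to_B (p q : 'I_3 -> A) : [pchar F] =i pred0 ->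
  B_relations 6%:R^-1 p q -> A3_relations (\sum_j q j) p.
Proof.
move=> F0 [pp qq pqp _]; split=> // [|i]; first exact: sum_idem.
rewrite mulr_sumr mulr_suml (eq_bigr (fun=> 6%:R^-1 *: p i)) //.
rewrite sumr_const card_ord -scaler_nat scalerA; congr (_ *: _).
have nz k : k.+1%:R != 0 :> F by have /pcharf0P -> := F0.
have -> : 6%:R = 3%:R * 2%:R :> F by rewrite -natrM.
by rewrite invfM mulrA divff ?mul1r ?(nz 2).
Qed.

(* The involution of [A_3] *)
Lemma A3_involution (P : A) (q : 'I_3 -> A) : [pchar F] =i pred0 ->
  A3_relations P q -> A3_relations (1 - P) q.
Proof.
move=> F0 [PP qq qPq]; split=> // [|j].
  by rewrite mulrBl !mulrBr PP !(mul1r, mulr1) subrr subr0.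
rewrite mulrBr mulrBl mulr1 (proj1 qq) qPq -[X in X - _]scale1r -scalerBl.
congr (_ *: _); apply/eqP; rewrite subr_eq -[X in _ == X]mulr2n.
  rewrite -[X in _ == X]mulr_natl divff //.
by have /pcharf0P -> := F0.
Qed.

(* The two homomorphisms [B -> B_{3,6}], for [s = lshift 3] and
   [s = rshift 3] *)
Lemma B_restrict (r : F) (m n k : nat) (p : 'I_m -> A) (q : 'I_n -> A)
    (s : 'I_k -> 'I_n) :
  injective s -> B_relations r p q -> B_relations r p (q \o s).
Proof.
move=> sI [pp [qi qo] pqp qpq]; split=> //=; split=> //= i j ij.
by apply: qo; rewrite (inj_eq sI).
Qed.

End Relations.

Section Rank.
Variables (F : closedFieldType) (n : nat).
Implicit Types e f : 'M[F]_n.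

Lemma rank_idemD e f : e *m e = e -> f *m f = f -> e *m f = 0 -> f *m e = 0 ->
  \rank (e + f)%R = (\rank e + \rank f)%N.
Proof.
move=> ee ff ef fe.
have cap : (e :&: f)%MS = 0.
  apply/eqP/rowV0P => v; rewrite sub_capmx => /andP[/submxP[x ->] /submxP[y xy]].
  by rewrite -ee mulmxA xy -mulmxA fe mulmx0.
rewrite -(mxrank_disjoint_sum cap); apply/eqmx_rank/andP; split.
  by apply: addmx_sub_adds; exact: submx_refl.
rewrite addsmx_sub; apply/andP; split; apply/submxP.
  by exists e; rewrite mulmxDr ee ef addr0.
by exists f; rewrite mulmxDr ff fe add0r.
Qed.

End Rank.

(** * The moduli spaces and the maps *)

Section Moduli.
Variables (F : closedFieldType).

(* [inl i] indexes [p_i] and [inr j] indexes [q_j]. *)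
Definition X_rep (m : nat) : set ('I_3 + 'I_m -> 'M[F]_6) :=
  fun rho => B_relations 6%:R^-1 (fun i => rho (inl i)) (fun j => rho (inr j)) /\
             forall i, \rank (rho i) = 1%N.

Definition X36_rep : set ('I_3 + 'I_6 -> 'M[F]_6) :=
  fun rho => X_rep rho /\ \sum_(j < 6) rho (inr j) = 1.

(* [None] indexes [P] and [Some j] indexes [q_j]. *)
Definition Y_rep : set (option 'I_3 -> 'M[F]_6) :=
  fun rho => [/\ A3_relations (rho None) (fun j => rho (Some j)),
                 \rank (rho None) = 3%N & forall j, \rank (rho (Some j)) = 1%N].

Definition X := moduli (@X_rep 3).
Definition X36 := moduli X36_rep.
Definition Y := moduli Y_rep.

Hypothesis F0 : [pchar F] =i pred0.

Definition fprime_tuple (rho : 'I_3 + 'I_3 -> 'M[F]_6) :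
    option 'I_3 -> 'M[F]_6 :=
  fun k => if k is Some i then rho (inl i) else \sum_j rho (inr j).

Lemma fprime_subproof rho : @X_rep 3 rho -> Y_rep (fprime_tuple rho).
Proof.
case=> Brho rk; split=> [| |j]; last exact: rk.
  exact: A3_to_B.
case: Brho => _ [qi qo] _ _ /=.
have qi' i : rho (inr i) *m rho (inr i) = rho (inr i) by exact: qi.
have qo' i j : i != j -> rho (inr i) *m rho (inr j) = 0 by exact: qo.
rewrite !big_ord_recr big_ord0 /= add0r.
by rewrite !rank_idemD ?mulmxDr ?mulmxDl ?qi' ?qo' ?addr0 ?add0r ?rk.
Qed.

Definition fprime_rep (rho : rep_variety (@X_rep 3)) : rep_variety Y_rep :=
  exist _ (fprime_tuple (sval rho)) (fprime_subproof (svalP rho)).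

Lemma fprime_equivariant :
  equivariant_morphism (@conjugate _ _ _ _) (@conjugate _ _ _ _) fprime_rep.
Proof.
apply: equivariant_rep => [[i|] a b|rho rho' g gu gP [i|]] /=.
- by exists 'X_(enum_rank (inl i, a, b)) => rho; rewrite mevalXU entryE.
- exists (\sum_(j < 3) 'X_(enum_rank (inr j, a, b))) => rho.
  rewrite raddf_sum summxE; apply: eq_bigr => j _.
  by rewrite /= mevalXU entryE.
- exact: gP.
- by rewrite mulmx_sumr mulmx_suml; apply: eq_bigr => j _; exact: gP.
Qed.

Definition fprime : X -> Y := git_map fprime_equivariant.

Definition sigma_tuple (rho : option 'I_3 -> 'M[F]_6) :
    option 'I_3 -> 'M[F]_6 :=
  fun k => if k is Some i then rho (Some i) else 1 - rho None.

Lemma sigma_subproof rho : Y_rep rho -> Y_rep (sigma_tuple rho).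
Proof.
case=> Arho rkP rkq; split=> //=; first exact: A3_involution.
have PP : rho None *m rho None = rho None by case: Arho.
have rkD : \rank (rho None + (1 - rho None))%R = 6 by rewrite addrC subrK mxrank1.
move: rkD; rewrite rank_idemD // ?rkP ?mulmxBr ?mulmxBl ?mulmx1 ?mul1mx ?PP
  ?subrr ?subr0 //.
by case.
Qed.

Definition sigma_rep (rho : rep_variety Y_rep) : rep_variety Y_rep :=
  exist _ (sigma_tuple (sval rho)) (sigma_subproof (svalP rho)).

Lemma sigma_equivariant :
  equivariant_morphism (@conjugate _ _ _ _) (@conjugate _ _ _ _) sigma_rep.
Proof.
apply: equivariant_rep => [[i|] a b|rho rho' g gu gP [i|]] /=.
- by exists 'X_(enum_rank (Some i, a, b)) => rho; rewrite mevalXU entryE.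
- exists ((a == b)%:R%:MP - 'X_(enum_rank (None, a, b))) => rho.
  by rewrite mevalB mevalC mevalXU entryE !mxE.
- exact: gP.
- by rewrite gP mulmxBr mulmxBl mulmx1 mulmxV.
Qed.

Definition sigma : Y -> Y := git_map sigma_equivariant.

(* Restriction along [p_i |-> p_i], [q_j |-> q_(s j)]. *)
Section Restriction.
Variables (s : 'I_3 -> 'I_6) (sI : injective s).

Definition restrict_tuple (rho : 'I_3 + 'I_6 -> 'M[F]_6) :
    'I_3 + 'I_3 -> 'M[F]_6 :=
  fun k => match k with inl i => rho (inl i) | inr j => rho (inr (s j)) end.

Lemma restrict_subproof rho : X36_rep rho -> @X_rep 3 (restrict_tuple rho).
Proof.
case=> -[Brho rk] _; split; first exact: (B_restrict sI Brho).
by case=> i; exact: rk.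
Qed.

Definition restrict_rep (rho : rep_variety X36_rep) :
    rep_variety (@X_rep 3) :=
  exist _ (restrict_tuple (sval rho)) (restrict_subproof (svalP rho)).

Lemma restrict_equivariant :
  equivariant_morphism (@conjugate _ _ _ _) (@conjugate _ _ _ _) restrict_rep.
Proof.
apply: equivariant_rep => [[i|j] a b|rho rho' g gu gP [i|j]] /=.
- by exists 'X_(enum_rank (inl i, a, b)) => rho; rewrite mevalXU entryE.
- by exists 'X_(enum_rank (inr (s j), a, b)) => rho; rewrite mevalXU entryE.
- exact: gP.
- exact: gP.
Qed.

Definition restrict : X36 -> X := git_map restrict_equivariant.

End Restriction.

Definition h1 : X36 -> X := restrict (@lshift_inj 3 3).
Definition h2 : X36 -> X := restrict (@rshift_inj 3 3).

Definition XYX : variety F := fiber_product fprime (sigma \o fprime).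

Lemma h_subproof (x : X36) : fprime (h1 x) = sigma (fprime (h2 x)).
Proof.
apply: eq_exist; apply: funext => a /=; congr (sval x _).
apply: eq_exist; apply: funext => rho /=; congr (sval a _).
apply: eq_exist; apply: funext => -[i|] //=.
by rewrite -(svalP rho).2 (@big_split_ord _ _ _ 3 3) /= addrK.
Qed.

Definition h (x : X36) : XYX :=
  exist _ (h1 x, h2 x) (h_subproof x).

(* [h] as a map to the component [Z], when its image lies in [Z] *)
Definition h_into (Z : set XYX) (hZ : forall x, Z (h x)) (x : X36) :
    subvariety Z :=
  exist _ (h x) (hZ x).

End Moduli.

(* Main.v *)
(** Write the idempotents as [p_i = u_i alpha_i] and [q_j = v_j beta_j].  The
    matrix [a_ij = alpha_i v_j] has nonzero entries, and, up to rescaling its rows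
    and columns, it determines all the invariants: [X] is a torus of dimension 4,
    and [X(3,6)] is the subvariety of a torus of dimension 10 where, for all
    [i <> k], the sum of [a_ij / a_kj] over the six columns vanishes.  The two
    halves [T], [T'] of such a point thus have opposite row sums, whereas the fiber
    product only imposes that the products of row sums that are invariant under
    rescaling the rows agree up to signs.  When no sum vanishes, rescaling the rows
    of [T'] makes the sums opposite, which inverts [h].

    Dimensions are transcendence degrees, computed with derivations: 8 equations
    on 12 coordinates give at least 4; and the point of a component of the fiber
    product has transcendence degree at most 3 if some sum vanishes, while
    otherwise every derivation killing [T] kills [T'].

    Irreducibility amounts to the uniqueness of the ideal of a point with
    transcendence degree 4.  Over [F(T)], the product [xi] of the first row of [T']
    is a root of a quadratic polynomial whose discriminant is not a square, it
    determines [T'] up to permuting columns, and the Vandermonde determinant of the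
    first row is not in [F(T)(xi)].  Hence the ideal is determined up to a
    permutation of the columns of [T'], and it is stable under one transposition.
    Exchanging the two halves turns permutations of [T] into permutations of [T'],
    and these two actions commute, so all the permutations fix the ideal. *)
Require Import Defs.
From HB Require Import structures.
From mathcomp Require Import all_boot all_order all_fingroup all_algebra.
From mathcomp Require Import boolp classical_sets.
From mathcomp.multinomials Require Import mpoly.
From mathcomp Require Import ring zify.

Set Implicit Arguments.
Unset Strict Implicit.
Unset Printing Implicit Defensive.

Import Order.TTheory GRing.Theory.
Local Open Scope ring_scope.

(** * Prime ideals and points over extension fields *)

Local Open Scope classical_set_scope.
Local Open Scope quotient_scope.
Local Open Scope ring_scope.

(** A prime of a polynomial ring is handled through its generic point, whose coordinates lie in the
    residue field [K]; irreducible sets, chains and dimensions are all read off from such points.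
    The main obstacle is that the sums of [T] need not determine [T] up to finitely many choices,
    even when none of them vanishes. If some derivation kills the sums but moves an entry, then the
    sextic satisfied by this entry vanishes identically, and this forces [invA], [invD] and [invE]
    to depend on a single parameter. Each half adds at most one parameter along its fibre, so the
    pair has transcendence degree at most 1 + 1 + 1 and cannot be generic in a component of
    dimension 4. The algebras of invariants are computed on explicit slices: for [X] because every
    representation degenerates to one determined by its Gram matrix, for X(3,6) because the vectors
    of the [q_j] form a basis. That an element of a rational function field is not a square is
    certified at one rational point where it has a simple zero. *)

Record is_ideal (R : comNzRingType) (P : set R) : Prop := Ideal {
  ideal0 : P 0;
  idealD : forall x y, P x -> P y -> P (x + y);
  idealM : forall x y, P y -> P (x * y) }.

Record is_prime (R : comNzRingType) (P : set R) : Prop := Prime {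
  prime_ideal :> is_ideal P;
  prime1 : ~ P 1;
  primeM : forall x y, P (x * y) -> P x \/ P y }.

Section Ideals.
Variable R : comNzRingType.
Implicit Types (P M : set R) (x y : R).

Lemma idealN P x : is_ideal P -> P x -> P (- x).
Proof. by move=> idP Px; rewrite -mulN1r; apply: idealM. Qed.

Lemma idealB P x y : is_ideal P -> P x -> P y -> P (x - y).
Proof. by move=> idP Px Py; apply: idealD => //; apply: idealN. Qed.

Definition gen_ideal m (f : 'I_m -> R) : set R :=
  [set x | exists c : 'I_m -> R, x = \sum_i c i * f i].

Lemma gen_idealP m (f : 'I_m -> R) : is_ideal (gen_ideal f).
Proof.
split=> [|_ _ [c ->] [d ->]|x _ [c ->]].
- by exists (fun=> 0); rewrite big1 // => i _; rewrite mul0r.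
- exists (fun i => c i + d i); rewrite -big_split /=.
  by apply: eq_bigr => i _; rewrite mulrDl.
- exists (fun i => x * c i); rewrite mulr_sumr.
  by apply: eq_bigr => i _; rewrite mulrA.
Qed.

Lemma gen_ideal_mem m (f : 'I_m -> R) i : gen_ideal f (f i).
Proof.
exists (fun j => (j == i)%:R); rewrite (bigD1 i) //= eqxx mul1r big1 ?addr0 //.
by move=> j /negPf ->; rewrite mul0r.
Qed.

(** An ideal maximal among those that contain [I] and miss [M] is prime: otherwise adjoining [x] and
    [y] in turn produces two elements of [M] whose product lies in the ideal. *)
Lemma exists_prime (I M : set R) : is_ideal I -> M 1 ->
  (forall x y, M x -> M y -> M (x * y)) -> (forall x, I x -> ~ M x) ->
  exists P : set R, [/\ is_prime P, I `<=` P & forall x, P x -> ~ M x].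
Proof.
move=> idI M1 MM IM.
pose good A := [/\ is_ideal A, I `<=` A & forall x, A x -> ~ M x].
have [F FP Ftot|P [PP Pmax]] := @Zorn_bigcup R [set A | A = set0 \/ good A].
  have [[A0 FA0 gA0]|noA] := pselect (exists2 A, F A & good A); last first.
    left; apply/seteqP; split=> // x [A FA Ax].
    by have [A0|gA] := FP _ FA; [rewrite A0 in Ax|case: noA; exists A].
  have gF A x : F A -> A x -> good A.
    by move=> FA Ax; have [AE|//] := FP _ FA; rewrite AE in Ax.
  right; split.
  - split=> [|x y [A FA Ax] [B FB By]|x y [A FA Ay]].
    + by exists A0 => //; case: gA0 => /ideal0.
    + have [AB|BA] := Ftot _ _ FA FB; [exists B|exists A] => //.
        by apply: idealD => //; [case: (gF _ _ FB By)|exact: AB].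
      by apply: idealD => //; [case: (gF _ _ FA Ax)|exact: BA].
    + by exists A => //; apply: idealM => //; case: (gF _ _ FA Ay).
  - by move=> x Ix; exists A0 => //; case: gA0 => _ h _; exact: h.
  - by move=> x [A FA Ax]; case: (gF _ _ FA Ax) => _ _ h; exact: h.
have gI : good I by split.
have {PP} gP : good P.
  have [P0|//] := PP; case: (Pmax I); last by right.
  by split; [rewrite P0|move=> /(_ _ (ideal0 idI)); rewrite P0].
case: gP => idP IP PM; exists P; split=> //; split=> [//|P1|x y Pxy].
  exact: (PM _ P1).
apply: contrapT => /not_orP[Px Py].
have ext z : ~ P z -> exists2 u, P u & exists c, M (u + c * z).
  move=> Pz; apply: contrapT => noM.
  pose B := [set w | exists2 u, P u & exists c, w = u + c * z].
  apply: (Pmax B).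
    split; last by move=> /(_ z) H; apply: Pz; apply: H; exists 0;
      [exact: ideal0|exists 1; rewrite add0r mul1r].
    by move=> u Pu; exists u => //; exists 0; rewrite mul0r addr0.
  right; split.
  - split=> [|_ _ [u Pu [c ->]] [v Pv [d ->]]|w _ [u Pu [c ->]]].
    + by exists 0; [exact: ideal0|exists 0; rewrite mul0r addr0].
    + by exists (u + v); [exact: idealD|exists (c + d); ring].
    + by exists (w * u); [exact: idealM|exists (w * c); ring].
  - by move=> w Iw; exists w; [exact: IP|exists 0; rewrite mul0r addr0].
  - by move=> _ [u Pu [c ->]] Mw; apply: noM; exists u => //; exists c.
have [u Pu [c Mu]] := ext _ Px; have [v Pv [d Mv]] := ext _ Py.
apply: (PM _ _ (MM _ _ Mu Mv)).
have -> : (u + c * x) * (v + d * y) =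
  (v + d * y) * u + (c * x) * v + (c * d) * (x * y) by ring.
apply: idealD => //; last exact: idealM.
by apply: idealD => //; exact: idealM.
Qed.

End Ideals.

Section PrimeField.
Variables (R : comNzRingType) (P : set R) (pP : is_prime P).


Let S : {pred R} := fun x => `[< P x >].

Fact prime_idealr_closed_S : idealr_closed S.
Proof.
split=> [||a x y /asboolP Px /asboolP Py].
- exact/asboolP/(ideal0 pP).
- by apply/asboolP/(prime1 pP).
- by apply/asboolP; apply: (idealD pP) => //; apply: (idealM pP).
Qed.

Fact prime_prime_S : prime_idealr_closed S.
Proof.
move=> x y /asboolP /(primeM pP)[]/asboolP Pz; apply/orP; [by left|by right].
Qed.

HB.instance Definition _ := isIdealr.Build R S prime_idealr_closed_S.
HB.instance Definition _ := isPrimeIdealrClosed.Build R S prime_prime_S.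

Definition prime_quot := {ideal_quot S}.
HB.instance Definition _ := GRing.ComNzRing.on prime_quot.
Local Notation Q := prime_quot.

(** The structure of integral domain requires a unit test and an inverse; on the quotient both are
    obtained classically. *)
Let unit : {pred Q} := fun x => `[< exists y : Q, y * x = 1 >].
Let inv (x : Q) : Q :=
  if pselect (exists y : Q, y * x = 1) is left h then sval (cid h) else x.

Fact quot_mulVx : {in unit, left_inverse 1 inv *%R}.
Proof.
by move=> x /asboolP ux; rewrite /inv; case: pselect => // h; case: (cid h).
Qed.
Fact quot_unitPl (x y : Q) : y * x = 1 -> x \in unit.
Proof. by move=> yx; apply/asboolP; exists y. Qed.
Fact quot_invr_out : {in [predC unit], inv =1 id}.
Proof.
move=> x; rewrite inE => /asboolP nx; rewrite /inv.
by case: pselect.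
Qed.
HB.instance Definition _ := GRing.ComNzRing_hasMulInverse.Build Q
  quot_mulVx quot_unitPl quot_invr_out.
HB.instance Definition _ := GRing.ComUnitRing_isIntegral.Build Q
  (@Quotient.rquot_IdomainAxiom R S).

Lemma prime_domain : exists (A : idomainType) (psi : {rmorphism R -> A}),
  (forall x, psi x = 0 <-> P x) /\ (forall y, exists x, psi x = y).
Proof.
exists Q, \pi_Q; split=> [x|y]; last first.
  by exists (generic_quotient.repr (y : {ideal_quot S})); apply: (@reprK _ {ideal_quot S}).
rewrite (rwP eqP); have -> : (0 : Q) = \pi_Q 0 by rewrite rmorph0.
rewrite -[X in is_true X]/(\pi_{ideal_quot S} x == \pi_{ideal_quot S} 0).
by rewrite -Quotient.idealrBE subr0; split=> /asboolP.
Qed.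

Lemma prime_field : exists (K : fieldType) (phi : {rmorphism R -> K}),
  [/\ (forall x, phi x = 0 <-> P x) &
  (forall k : K, exists x y, phi y != 0 /\ k = phi x / phi y)].
Proof.
pose phi : {rmorphism R -> {fraction Q}} := (@FracField.tofrac Q \o \pi_Q)%FUN.
have pi0 x : (\pi_Q x == 0) = `[< P x >].
  have -> : (0 : Q) = \pi_Q 0 by rewrite rmorph0.
  rewrite -[LHS]/(\pi_{ideal_quot S} x == \pi_{ideal_quot S} 0).
  by rewrite -Quotient.idealrBE subr0.
have phi0 x : phi x = 0 <-> P x.
  by rewrite (rwP eqP) /phi /= tofrac_eq0 pi0; split=> /asboolP.
exists {fraction Q}, phi; split=> // k.
elim/quotW: k => r.
exists (generic_quotient.repr \n_r), (generic_quotient.repr \d_r).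
have dr : @FracField.tofrac Q (\pi_Q (generic_quotient.repr \d_r)) != 0.
  by rewrite tofrac_eq0 reprK denom_ratioP.
split=> //; apply: (mulIf dr); rewrite divfK //= !reprK.
apply/eqP; rewrite eq_sym; apply/eqP.
rewrite /tofrac; unlock FracField.tofrac; rewrite -[RHS]FracField.pi_mul.
apply/eqmodP => /=; rewrite FracField.equivfE /FracField.mulf /=.
rewrite !numden_Ratio ?mulf_neq0 ?oner_neq0 ?denom_ratioP // ?mulr1 ?mul1r.
exact: eqxx.
Qed.
End PrimeField.

Local Close Scope quotient_scope.

Section Points.
Variables (F : comNzRingType).

Lemma mmap_unique n (S : comNzRingType) (phi : {rmorphism {mpoly F[n]} -> S})
    (p : {mpoly F[n]}) :
  phi p = mmap (phi \o @mpolyC n F) (fun i => phi 'X_i) p.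
Proof.
rewrite {1}[p]mpolyE rmorph_sum; apply: eq_bigr => m _ /=.
rewrite -mul_mpolyC rmorphM; congr (_ * _).
rewrite mpolyXE_id rmorph_prod; apply: eq_bigr => i _.
by rewrite rmorphXn.
Qed.

Lemma eq_mmap n (S : comNzRingType) (f g : F -> S) (z y : 'I_n -> S) p :
  f =1 g -> z =1 y -> mmap f z p = mmap g y p.
Proof.
move=> fg zy; apply: eq_bigr => m _; rewrite fg; congr (_ * _).
exact: mmap1_eq.
Qed.

Lemma rmorph_mmap n (S T : comNzRingType) (f : {rmorphism F -> S})
    (psi : {rmorphism S -> T}) (z : 'I_n -> S) p :
  psi (mmap f z p) = mmap (psi \o f) (psi \o z) p.
Proof.
have /= -> := mmap_unique (psi \o mmap f z) p.
by apply: eq_mmap => c /=; rewrite ?mmapC ?mmapX ?mmap1U.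
Qed.

Lemma mmap_comp n k (S : comNzRingType) (f : {rmorphism F -> S})
    (z : 'I_k -> S) (q : 'I_n -> {mpoly F[k]}) p :
  mmap f z (p \mPo [tuple q i | i < n]) = mmap f (fun i => mmap f z (q i)) p.
Proof.
rewrite /comp_mpoly rmorph_mmap; apply: eq_mmap => c /=; first by rewrite mmapC.
by rewrite tnth_mktuple.
Qed.

(** Evaluation with the last variable set apart, for inductions on the number of coordinates. *)
Lemma mmap_muni n (S : comNzRingType) (f : {rmorphism F -> S})
    (z : 'I_n.+1 -> S) p :
  mmap f z p =
  (map_poly (mmap f (fun i => z (widen_ord (leqnSn n) i))) (muni p)).[z ord_max].
Proof.
rewrite muniE rmorph_sum horner_sum /=; apply: eq_bigr => m _.
rewrite !map_polyZ map_polyXn !hornerZ hornerXn /= mmapZ mmapX -mulrA.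
congr (_ * _); rewrite /mmap1 big_ord_recr /=; congr (_ * _).
by apply: eq_bigr => i _; rewrite mnmE.
Qed.

End Points.

Definition alg_indep (F K : comNzRingType) (f : F -> K) n (z : 'I_n -> K) :=
  forall p : {mpoly F[n]}, mmap f z p = 0 -> p = 0.

Section KPoint.
Variables (F : fieldType) (n : nat) (P : set {mpoly F[n]}) (pP : is_prime P).

(** The generic point of [P]: the classes of the variables in the fraction field of the quotient,
    which they generate. *)
Lemma kpoint : exists (K : fieldType) (f : {rmorphism F -> K}) (z : 'I_n -> K),
  (forall p, mmap f z p = 0 <-> P p) /\
  (forall k, exists p q, mmap f z q != 0 /\ k = mmap f z p / mmap f z q).
Proof.
have [K [phi [phi0 phiV]]] := prime_field pP.
exists K, (phi \o @mpolyC n F), (fun i => phi 'X_i).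
by split=> [p|k]; [rewrite -mmap_unique|have [x [y]] := phiV k;
  exists x, y; rewrite -!mmap_unique].
Qed.

End KPoint.

Section Kernel.
Variables (R : comNzRingType) (K : fieldType) (phi : {rmorphism R -> K}).

Lemma prime_kernel : is_prime [set x | phi x = 0].
Proof.
split=> [|/= /eqP|x y /= /eqP]; last 2 first.
- by rewrite rmorph1 oner_eq0.
- by rewrite rmorphM mulf_eq0 => /orP[]/eqP; [left|right].
split=> /= [|x y x0 y0|x y y0]; first exact: rmorph0.
  by rewrite rmorphD x0 y0 addr0.
by rewrite rmorphM y0 mulr0.
Qed.

End Kernel.

Lemma factor_rmorphism (R A L : comNzRingType) (psi : {rmorphism R -> A})
    (y : {rmorphism R -> L}) :
  (forall a, exists x, psi x = a) -> (forall x, psi x = 0 -> y x = 0) ->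
  exists g : {rmorphism A -> L}, forall x, g (psi x) = y x.
Proof.
move=> surj ker; pose g a := y (sval (cid (surj a))).
have gE x : g (psi x) = y x.
  rewrite /g; case: cid => x' /= x'x; apply/eqP; rewrite -subr_eq0 -rmorphB.
  by apply/eqP/ker; rewrite rmorphB x'x subrr.
have gz : zmod_morphism g.
  by move=> a b; case: (surj a) (surj b) => [x <-] [x' <-];
    rewrite -rmorphB !gE rmorphB.
have gm : monoid_morphism g.
  split=> [|a b]; first by rewrite -(rmorph1 psi) gE rmorph1.
  by case: (surj a) (surj b) => [x <-] [x' <-]; rewrite -rmorphM !gE rmorphM.
pose gA := GRing.isZmodMorphism.Build A L g gz.
pose gM := GRing.isMonoidMorphism.Build A L g gm.
by exists (HB.pack g gA gM : {rmorphism A -> L}).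
Qed.

(** * Specialisation of a point with one more coordinate *)

Section Extension.
Variables (F : closedFieldType) (K : fieldType).

(** One step of Chevalley's extension theorem, for the adjunction of [w] to [A]. If [w] is
    transcendental, any [t] outside the roots of the specialised [g] will do; otherwise [t] is a
    root of the specialisation of a relation [m] of least degree, and [a] keeps both its leading
    coefficient and its resultant with [g] nonzero. *)
Lemma extend_point_domain (A : idomainType) (phi : {rmorphism A -> K}) w g :
  injective phi -> (map_poly phi g).[w] != 0 ->
  exists2 a, a != 0 & forall y : {rmorphism A -> F}, y a != 0 ->
    exists2 t, (map_poly y g).[t] != 0 &
      forall r, (map_poly phi r).[w] = 0 -> (map_poly y r).[t] = 0.
Proof.
move=> phiI gw.
have phi0 x : (phi x == 0) = (x == 0) by rewrite -(rmorph0 phi) (inj_eq phiI).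
have g0 : g != 0 by apply: contraNneq gw => ->; rewrite rmorph0 horner0.
have [algw|trw] := pselect (exists r : {poly A}, r != 0 /\ (map_poly phi r).[w] = 0);
    last first.
  exists (lead_coef g) => [|y yg]; first by rewrite lead_coef_eq0.
  have : map_poly y g != 0.
    apply: contraNneq yg => /polyP/(_ (size g).-1).
    by rewrite coef_map coef0 /= -lead_coefE => ->.
  case/closed_nonrootP => t gt; exists t => // r rw.
  suff -> : r = 0 by rewrite rmorph0 horner0.
  by apply: contrapT => /eqP r0; apply: trw; exists r.
pose Q k := `[< exists r : {poly A}, [/\ r != 0, size r = k & (map_poly phi r).[w] = 0] >].
have exQ : exists k, Q k.
  by have [r [r0 rw]] := algw; exists (size r); apply/asboolP; exists r.
case: (ex_minnP exQ) => _ /asboolP[m [m0 <- mw]] mmin.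
have min r : (map_poly phi r).[w] = 0 -> (size r < size m)%N -> r = 0.
  move=> rw; apply: contraTeq => r0; rewrite -leqNgt.
  by apply: mmin; apply/asboolP; exists r.
have lm0 : lead_coef m != 0 by rewrite lead_coef_eq0.
have sm : (1 < size m)%N.
  rewrite ltn_neqAle size_poly_gt0 m0 andbT eq_sym; apply/eqP => /eqP/size_poly1P.
  case=> c c0 mE; move: mw; rewrite mE map_polyC hornerC => /eqP.
  by rewrite phi0 (negPf c0).
(* Over a domain this is pseudo-division, up to a power of the leading coefficient; hence the
   condition on [y (lead_coef m)] in [rooty]. *)
have mdvd r : (map_poly phi r).[w] = 0 -> m %| r.
  move=> rw; have := Pdiv.Idomain.divp_eq r m => rE.
  rewrite /dvdp; apply/eqP/min; last by rewrite ltn_modp.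
  have /(congr1 (fun p => (map_poly phi p).[w])) := rE.
  rewrite map_polyZ rmorphD rmorphM /= hornerZ hornerD hornerM rw mw.
  by rewrite !mulr0 add0r => <-.
have rooty (y : {rmorphism A -> F}) t r : y (lead_coef m) != 0 ->
    (map_poly y m).[t] = 0 -> (map_poly phi r).[w] = 0 -> (map_poly y r).[t] = 0.
  move=> ylm mt /mdvd; rewrite Pdiv.Idomain.dvdp_eq => /eqP.
  move=> /(congr1 (fun p => (map_poly y p).[t])).
  rewrite map_polyZ rmorphM /= hornerZ hornerM mt mulr0 => /eqP.
  by rewrite rmorphXn /= mulf_eq0 expf_eq0 (negPf ylm) andbF => /eqP.
have exroot (y : {rmorphism A -> F}) : y (lead_coef m) != 0 ->
    exists t, (map_poly y m).[t] = 0.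
  move=> ylm; have /closed_rootP[t /rootP mt] : size (map_poly y m) != 1%N.
    by rewrite size_map_poly_id0 // neq_ltn sm orbT.
  by exists t.
have [sg|sg] := leqP (size g) 1.
  move: (size1_polyC sg); move: g`_0 => c cg; subst g; rewrite polyC_eq0 in g0.
  exists (c * lead_coef m) => [|y]; first by rewrite mulf_neq0.
  rewrite rmorphM mulf_eq0 negb_or => /andP[yc ylm].
  have [t mt] := exroot y ylm; exists t; last by move=> r; apply: (rooty y).
  by rewrite map_polyC hornerC.
(* If [g] and [m] had a common factor, this factor or its cofactor in [m] would vanish at [w]: the
   former contradicts [gw], the latter the minimality of [m]. *)
have res0 : resultant g m != 0.
  rewrite resultant_eq0 -leqNgt leqNgt; apply/negP => sd.
  have /Pdiv.Idomain.dvdpP[[c q] /= c0 cm] := dvdp_gcdr g m.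
  have /Pdiv.Idomain.dvdpP[[c' q'] /= c'0 cg] := dvdp_gcdl g m.
  set d := gcdp g m in sd cm cg.
  have /eqP := congr1 (fun p => (map_poly phi p).[w]) cm.
  rewrite map_polyZ rmorphM /= hornerZ hornerM mw mulr0 eq_sym mulf_eq0.
  case/orP => /eqP dw; last first.
    have /eqP := congr1 (fun p => (map_poly phi p).[w]) cg.
    rewrite map_polyZ rmorphM /= hornerZ hornerM dw mulr0 mulf_eq0 phi0.
    by rewrite (negPf c'0) (negPf gw).
  have d0 : d != 0 by rewrite -size_poly_gt0 (ltn_trans _ sd).
  have q0 : q != 0.
    by apply: contraNneq m0 => q0; move/eqP: cm;
      rewrite q0 mul0r -mul_polyC mulf_eq0 polyC_eq0 (negPf c0).
  have := congr1 (fun p : {poly A} => size p) cm.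
  rewrite size_scale // size_mul // => szm.
  suff q00 : q = 0 by rewrite q00 eqxx in q0.
  apply: min => //; rewrite szm; case: (size d) sd => [//|[//|k] _].
  by rewrite addnS /= addnS ltnS leq_addr.
have [[u v] /= _ uv] := resultant_in_ideal sg sm.
exists (resultant g m * lead_coef m) => [|y]; first by rewrite mulf_neq0.
rewrite rmorphM mulf_eq0 negb_or => /andP[yr ylm].
have [t mt] := exroot y ylm; exists t; last by move=> r; apply: (rooty y).
apply: contraNneq yr => gt.
have := congr1 (fun p => (map_poly y p).[t]) uv.
by rewrite rmorphD !rmorphM /= map_polyC hornerC hornerD !hornerM gt mt !mulr0 addr0 => ->.
Qed.

Lemma extend_point (R : comNzRingType) (phi : {rmorphism R -> K}) w
    (g : {poly R}) : (map_poly phi g).[w] != 0 ->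
  exists2 a, phi a != 0 & forall y : {rmorphism R -> F},
    (forall x, phi x = 0 -> y x = 0) -> y a != 0 ->
    exists2 t, (map_poly y g).[t] != 0 &
      forall r, (map_poly phi r).[w] = 0 -> (map_poly y r).[t] = 0.
Proof.
move=> gw; have [A [psi [psi0 psiS]]] := prime_domain (prime_kernel phi).
have [|phi' phi'E] := factor_rmorphism (y := phi) psiS; first by move=> x /psi0.
have mapE (S : comNzRingType) (f' : {rmorphism A -> S}) (f : {rmorphism R -> S}) :
    (forall x, f' (psi x) = f x) -> forall p, map_poly f' (map_poly psi p) = map_poly f p.
  by move=> ff p; rewrite -map_poly_comp; apply: eq_map_poly.
have inj : injective phi'.
  move=> a b; have [x <-] := psiS a; have [x' <-] := psiS b.
  rewrite !phi'E => /eqP; rewrite -subr_eq0 -rmorphB => /eqP/psi0/eqP.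
  by rewrite rmorphB subr_eq0 => /eqP.
have [|a a0 ext] := @extend_point_domain A phi' w (map_poly psi g) inj.
  by rewrite (mapE _ phi' phi).
have [b ba] := psiS a; exists b.
  by rewrite -phi'E ba -(rmorph0 phi') (inj_eq inj).
move=> y yphi yb; have [|y' y'E] := factor_rmorphism (y := y) psiS.
  by move=> x /psi0/yphi.
have [|t gt rt] := ext y'; first by rewrite -ba y'E.
exists t => [|r rw]; first by rewrite -(mapE _ y' y).
by rewrite -(mapE _ y' y) // rt // (mapE _ phi' phi).
Qed.

End Extension.

Section Lift.
Variables (F : closedFieldType) (K : fieldType) (f : {rmorphism F -> K}).

Lemma lift_point_step n (z : 'I_n.+1 -> K) g : mmap f z g != 0 ->
  let z' i := z (widen_ord (leqnSn n) i) in
  exists2 a, mmap f z' a != 0 & forall y' : 'I_n -> F,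
    (forall p, mmap f z' p = 0 -> p.@[y'] = 0) -> a.@[y'] != 0 ->
    exists y : 'I_n.+1 -> F,
      [/\ forall i, y (widen_ord (leqnSn n) i) = y' i, g.@[y] != 0 &
          forall p, mmap f z p = 0 -> p.@[y] = 0].
Proof.
move=> gz z'; rewrite mmap_muni in gz.
have [a az ext] := @extend_point F _ _ (mmap f z') _ _ gz.
exists a => // y' y'z ay.
have [t gt rt] := ext (meval y') y'z ay.
pose y i := if unlift ord_max i is Some j then y' j else t.
have ymax : y ord_max = t by rewrite /y unlift_none.
have yw i : y (widen_ord (leqnSn n) i) = y' i.
  rewrite /y (_ : widen_ord _ _ = lift ord_max i) ?liftK //.
  by apply: val_inj; rewrite /= /bump leqNgt ltn_ord.
have yE p : p.@[y] = (map_poly (meval y') (muni p)).[t].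
  rewrite /meval mmap_muni ymax; congr (horner _ t).
  by apply: eq_map_poly => q; apply: eq_mmap.
exists y; split=> // [|p]; first by rewrite yE.
by rewrite mmap_muni => /rt; rewrite yE.
Qed.

(** The independent coordinates can be prescribed outside a hypersurface; the other [k] coordinates
    are found one at a time, each of them shrinking the open set. *)
Lemma lift_point d k (z : 'I_(k + d) -> K) g : mmap f z g != 0 ->
  let z' i := z (widen_ord (leq_addl k d) i) in alg_indep f z' ->
  exists2 a : {mpoly F[d]}, a != 0 & forall y' : 'I_d -> F, a.@[y'] != 0 ->
    exists y : 'I_(k + d) -> F,
      [/\ forall i, y (widen_ord (leq_addl k d) i) = y' i, g.@[y] != 0 &
          forall p, mmap f z p = 0 -> p.@[y] = 0].
Proof.
elim: k z g => [|k IH] z g gz z' z'I.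
  have wE (i : 'I_d) : widen_ord (leq_addl 0 d) i = i by apply: val_inj.
  exists g => [|y' gy]; first by apply: contraNneq gz => ->; rewrite rmorph0.
  exists y'; split=> // [i|p pz]; first by rewrite wE.
  rewrite (z'I p) ?rmorph0 // -[RHS]pz; apply: eq_mmap => // i.
  by rewrite /z' wE.
have [a az ext] := lift_point_step gz.
have wE (i : 'I_d) : widen_ord (leqnSn (k + d)) (widen_ord (leq_addl k d) i) =
    widen_ord (leq_addl k.+1 d) i by apply: val_inj.
have [|b b0 extb] := IH _ _ az.
  move=> p pz; apply: z'I; rewrite -[RHS]pz; apply: eq_mmap => // i.
  by rewrite wE.
exists b => // y' /extb[y'' [y''E ay'' y''z]].
have [y [yE gy yz]] := ext y'' y''z ay''.
by exists y; split=> // i; rewrite -wE yE y''E.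
Qed.

(** A form of the Nullstellensatz: the closure of [z] has [F]-points in each open set that contains
    [z]. *)
Lemma exists_point n (z : 'I_n -> K) g : mmap f z g != 0 ->
  exists2 y : 'I_n -> F, g.@[y] != 0 & forall p, mmap f z p = 0 -> p.@[y] = 0.
Proof.
elim: n z g => [|n IH] z g gz.
  have C (p : {mpoly F[0]}) : p = (p@_0)%:MP.
    apply/mpolyP => m; have -> : m = 0%MM by apply/mnmP => -[].
    by rewrite mcoeffC eqxx mulr1.
  exists (fun=> 0) => [|p pz].
    by move: gz; apply: contraNneq; rewrite [g]C mevalC mmapC => /eqP; rewrite fmorph_eq0.
  move/eqP: pz; rewrite [p]C mevalC mmapC fmorph_eq0.
  by move/eqP.
have [a az ext] := lift_point_step gz.
have [y' ay' y'z] := IH _ _ az.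
by have [y [_ gy yz]] := ext y' y'z ay'; exists y.
Qed.

End Lift.

Local Close Scope classical_set_scope.

(** * Krull's dimension bound *)

Section Growth.
Variables (F : fieldType) (n : nat).
Local Notation R := {mpoly F[n]}.
Implicit Types (p q : R) (J : set R).

(* [low k p]: [p] lies in the [k]-th power of the maximal ideal at the origin. *)
Definition low k p := forall m, (mdeg m < k)%N -> p@_m = 0.

Lemma lowM j k p q : low j p -> low k q -> low (j + k) (p * q).
Proof.
move=> jp kq m mjk; rewrite mcoeffM big1 // => -[m1 m2] /= /eqP mE.
have [/jp -> |jm1] := ltnP (mdeg m1) j; first by rewrite mul0r.
rewrite kq ?mulr0 // -(ltn_add2l j); apply: leq_ltn_trans mjk.
by rewrite [X in (_ <= X)%N](congr1 (@mdeg n) mE) mdegD leq_add2r.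
Qed.

Lemma lowMl k p q : low k q -> low k (p * q).
Proof. by move=> kq; rewrite -[k]add0n; apply: lowM. Qed.

Lemma lowD k p q : low k p -> low k q -> low k (p + q).
Proof. by move=> kp kq m mk; rewrite mcoeffD kp // kq // addr0. Qed.

Lemma low0 k : low k 0.
Proof. by move=> m _; rewrite mcoeff0. Qed.

Definition low_spans J k N := exists e : 'I_N -> R, forall p,
  exists (c : 'I_N -> F) (j l : R),
    [/\ J j, low k l & p = \sum_i c i *: e i + j + l].

(** A bound by a multiple of [k ^ d] for the Hilbert-Samuel function of [J] at the origin; it
    measures the dimension of the zero set there. *)
Definition grows J d := exists C, forall k, exists2 N,
  (N <= C * k ^ d)%N & low_spans J k N.

(** One equation lowers the degree of growth by at most one: a family spanning modulo [J'] at level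
    [k + 1], together with [f] times a family spanning modulo [J] at level [k], spans modulo [J] at
    level [k + 1]. *)
Lemma grows_cut J J' f d : is_ideal J -> low 1 f ->
  (forall x, J' x -> exists j q, J j /\ x = j + q * f) ->
  grows J' d -> grows J d.+1.
Proof.
move=> iJ f1 J'E [C CJ']; exists C.
elim=> [|k [N NC [e espan]]].
  exists 0%N; first by rewrite leq0n.
  exists (fun=> 0) => p; exists (fun=> 0), 0, p; split=> //; first exact: ideal0.
  by rewrite big_ord0 !add0r.
have [N' N'C [e' e'span]] := CJ' k.+1; exists (N' + N)%N.
  rewrite expnS; apply: leq_trans (leq_add N'C NC) _.
  have : (k ^ d <= k.+1 ^ d)%N by case: (d) => // d'; rewrite leq_exp2r // leqnSn.
  rewrite expnS; nia.
exists (fun i => match split i with inl i' => e' i' | inr i' => e i' * f end) => p.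
have [c' [j' [l' [J'j' l'k pE]]]] := e'span p.
have [j1 [q [Jj1 j'E]]] := J'E _ J'j'.
have [c [j [l [Jj lk qE]]]] := espan q.
exists (fun i => match split i with inl i' => c' i' | inr i' => c i' end).
exists (j1 + f * j), (l' + l * f); split.
- by apply: idealD => //; apply: idealM.
- by apply: lowD => //; rewrite -addn1; apply: lowM.
have qfE : q * f = \sum_i c i *: (e i * f) + f * j + l * f.
  rewrite {1}qE !mulrDl [j * f]mulrC mulr_suml; congr (_ + _ + _).
  by apply: eq_bigr => i _; rewrite scalerAl.
rewrite big_split_ord /= pE j'E qfE.
under [in RHS]eq_bigr do rewrite (unsplitK (inl _)).
under [X in _ = _ + X + _ + _]eq_bigr do rewrite (unsplitK (inr _)).
ring.
Qed.

Lemma grows0 d : grows [set x : R | x = 0]%classic d -> (n <= d)%N.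
Proof.
move=> [C CN]; rewrite leqNgt; apply/negP => dn.
have n0 : (0 < n)%N by apply: leq_ltn_trans dn.
(* With this [t], [C * (n * t) ^ d < t ^ d.+1 <= t ^ n], and the right side counts the monomials
   with exponents below [t], all of degree below [n * t]. *)
pose t := (C * n ^ d).+1.
have [N NC [e espan]] := CN (n * t)%N.
have tN : (t ^ n <= N)%N; last first.
  have := leq_trans tN NC.
  have : (t ^ d.+1 <= t ^ n)%N by rewrite leq_pexp2l.
  rewrite expnMn expnS.
  have : (0 < t ^ d)%N by rewrite expn_gt0.
  rewrite /t; nia.
pose A := {ffun 'I_n -> 'I_t}.
pose mon (x : A) : 'X_{1..n} := [multinom (x i : nat) | i < n].
have monI : injective mon.
  move=> x y /mnmP xy; apply/ffunP => i; apply: val_inj.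
  by have := xy i; rewrite !mnmE.
have mond x : (mdeg (mon x) < n * t)%N.
  rewrite mdegE; under eq_bigr do rewrite mnmE.
  apply: leq_ltn_trans (_ : \sum_(i < n) t.-1 < _)%N.
    by apply: leq_sum => i _; rewrite -ltnS prednK.
  by rewrite sum_nat_const card_ord ltn_pmul2l.
have cA : #|A| = (t ^ n)%N by rewrite card_ffun !card_ord.
rewrite leqNgt; apply/negP => Nt.
have /fin_all_exists[c cP] : forall x : A, exists c : 'I_N -> F,
    low (n * t) ('X_[mon x] - \sum_i c i *: e i).
  move=> x; have [c [j [l [/= -> lk ->]]]] := espan 'X_[mon x].
  by exists c; rewrite addr0 addrC addKr.
pose M : 'M[F]_(#|A|, N) := \matrix_(x, i) c (enum_val x) i.
have : kermx M != 0.
  rewrite kermx_eq0 /row_free; apply/eqP => rM.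
  by have := rank_leq_col M; rewrite rM cA leqNgt Nt.
case/rowV0Pn => v /sub_kermxP vM /eqP; apply; apply/rowP => x.
rewrite mxE.
have vlow : low (n * t) (\sum_y v 0 y *: 'X_[mon (enum_val y)]).
  have -> : \sum_y v 0 y *: 'X_[mon (enum_val y)] =
      \sum_y v 0 y *: ('X_[mon (enum_val y)] - \sum_i c (enum_val y) i *: e i).
    rewrite [RHS](eq_bigr (fun y => v 0 y *: 'X_[mon (enum_val y)] -
      v 0 y *: \sum_i c (enum_val y) i *: e i)); last by move=> y _; rewrite scalerBr.
    rewrite sumrB; apply/esym/eqP; rewrite subr_eq addrC -subr_eq subrr eq_sym.
    apply/eqP; under eq_bigr do rewrite scaler_sumr.
    rewrite exchange_big /= big1 // => i _.
    under eq_bigr do rewrite scalerA.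
    rewrite -scaler_suml (_ : \sum_y _ = 0) ?scale0r //.
    have /rowP/(_ i) := vM; rewrite !mxE => vMi; rewrite -[RHS]vMi.
    by apply: eq_bigr => y _; rewrite mxE.
  elim/big_ind: _ => [|p q|y _]; [exact: low0|exact: lowD|].
  by rewrite -mul_mpolyC; apply: lowMl.
have := vlow _ (mond (enum_val x)).
rewrite raddf_sum (bigD1 x) //= big1 ?addr0 => [|y yx].
  by rewrite mcoeffZ mcoeffX eqxx mulr1.
rewrite mcoeffZ mcoeffX (inj_eq monI) (inj_eq enum_val_inj) (negPf yx).
by rewrite mulr0.
Qed.

(** A factor [u] that is a unit at the origin does not change the smallest monomial, which thus
    plays the role of a leading monomial in the local ring. *)
Lemma mcoeffM_mlast (u q : R) : u@_0 != 0 -> q != 0 ->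
  (u * q)@_(mlast q) = u@_0 * q@_(mlast q) /\
  forall m, m \in msupp (u * q) -> (mlast q <= m)%O.
Proof.
move=> u0 q0; split; last first.
  move=> m /msuppM_le/allpairsP[[m1 m2] /= [_ m2q ->]].
  exact: le_trans (mlast_lemc m2q) (lemc_addl _ _).
rewrite mcoeffM (bigD1 (bm0, BMultinom (ltnSn (mdeg (mlast q))))) /=; last first.
  by rewrite add0m.
rewrite [X in _ + X]big1 ?addr0 // => -[m1 m2] /= /andP[/eqP mE].
rewrite xpair_eqE !bmeqP /= negb_and => m12.
have [m2q|m2q] := leP (mlast q) m2; last by rewrite (mcoeff_lt_mlast m2q) mulr0.
have m2q' : mlast q = m2 :> 'X_{1..n}.
  by apply: le_anti; apply/andP; split=> //; rewrite [X in (_ <= X)%O]mE lemc_addl.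
suff m10' : m1 = 0%MM :> 'X_{1..n}.
  by case/orP: m12 => /eqP; case=> //; apply/esym.
apply: (@addIm _ m2); rewrite add0m; exact: etrans (esym mE) m2q'.
Qed.


(** Modulo [J], a monomial with at least [s] large exponents is divisible by [mlast q] for one of
    the given [q], and can be replaced by larger monomials, until the degree reaches [k]. There
    remain the monomials with fewer than [s] exponents above a fixed bound, and their number is
    bounded by a multiple of [k ^ s.-1]. *)
Lemma grows_indep J s : is_ideal J -> (0 < s)%N ->
  (forall S : {set 'I_n}, #|S| = s -> exists (q u : R),
     [/\ q != 0, u@_0 != 0, J (u * q) &
         forall m i, m \in msupp q -> i \notin S -> m i = 0%N]) ->
  grows J s.-1.
Proof.
move=> iJ s0 JS.
have /fin_all_exists[Q QP] : forall S : {set 'I_n}, exists q, #|S| = s -> exists u,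
    [/\ q != 0, u@_0 != 0, J (u * q) &
        forall m i, m \in msupp q -> i \notin S -> m i = 0%N].
  move=> S; have [/JS[q [u H]]|Ss] := eqVneq #|S| s; last first.
    by exists 0 => /eqP; rewrite (negPf Ss).
  by exists q => _; exists u.
pose r := (\max_(S : {set 'I_n}) msize (Q S)).+1.
exists (2 ^ n * r ^ n)%N => -[|k'].
  exists 0%N => //; exists (fun=> 0) => p; exists (fun=> 0), 0, p.
  by split=> //; [exact: ideal0|rewrite big_ord0 !add0r].
set k := k'.+1; pose A := {x : {ffun 'I_n -> 'I_k} | (#|[set i | r <= x i]%SET| < s)%N}.
pose mon (x : A) : 'X_{1..n} := [multinom (val x i : nat) | i < n].
exists #|{: A}|.
  pose S (x : A) := [set i | (r <= val x i)%N]%SET.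
  (* A remaining monomial is encoded by the positions of its large exponents, by its exponents below
     [r], and by the list of the large ones, which has at most [s.-1] terms. *)
  pose enc (x : A) : {set 'I_n} * {ffun 'I_n -> 'I_r} * {ffun 'I_s.-1 -> 'I_k} :=
    (S x, [ffun i => inord (if (val x i < r)%N then val x i : nat else 0%N)],
     [ffun j => nth ord0 [seq val x i | i <- enum (S x)] (nat_of_ord j)]).
  suff /leq_card : injective enc.
    have cS : #|{: {set 'I_n}}| = (2 ^ n)%N.
      by rewrite -[in RHS](card_ord n) -(cardsT 'I_n) -card_powerset powersetT cardsT.
    by rewrite !card_prod !card_ffun !card_ord cS.
  move=> x y [Sxy /ffunP gxy /ffunP hxy]; apply: val_inj; apply/ffunP => i.
  have [ri|ri] := boolP (i \in S x); last first.
    have ri' : i \notin S y by rewrite -Sxy.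
    rewrite !inE -!ltnNge in ri ri'.
    have /(congr1 (@nat_of_ord _)) := gxy i.
    by rewrite !ffunE ri ri' !inordK // => /val_inj.
  have lt_i : (index i (enum (S x)) < s.-1)%N.
    rewrite -ltnS prednK //; apply: leq_ltn_trans (valP x).
    by rewrite cardE index_mem mem_enum.
  have := hxy (Ordinal lt_i); rewrite !ffunE /= -Sxy.
  by rewrite !(nth_map i) ?index_mem ?mem_enum ?nth_index ?mem_enum.
exists (fun i => 'X_[mon (enum_val i)]) => p.
pose inspan p := exists (c : 'I_#|{: A}| -> F) j l,
  [/\ J j, low k l & p = \sum_i c i *: 'X_[mon (enum_val i)] + j + l].
have spanD p1 p2 : inspan p1 -> inspan p2 -> inspan (p1 + p2).
  move=> [c1 [j1 [l1 [J1 L1 ->]]]] [c2 [j2 [l2 [J2 L2 ->]]]].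
  exists (fun i => c1 i + c2 i), (j1 + j2), (l1 + l2).
  split; [exact: idealD|exact: lowD|].
  by under [in RHS]eq_bigr do rewrite scalerDl; rewrite big_split /=; ring.
have spanZ a p1 : inspan p1 -> inspan (a *: p1).
  move=> [c1 [j1 [l1 [J1 L1 ->]]]].
  exists (fun i => a * c1 i), (a%:MP * j1), (a%:MP * l1).
  split; [exact: idealM|exact: lowMl|].
  rewrite !scalerDr !mul_mpolyC scaler_sumr; congr (_ + _ + _).
  by apply: eq_bigr => i _; rewrite scalerA.
have span0 : inspan 0.
  exists (fun=> 0), 0, 0; split; [exact: ideal0|exact: low0|].
  by under eq_bigr do rewrite scale0r; rewrite big1 ?addr0.
have spanJ j : J j -> inspan j.
  move=> Jj; exists (fun=> 0), j, 0; split; [by []|exact: low0|].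
  by under eq_bigr do rewrite scale0r; rewrite big1 ?addr0 ?add0r.
have span_sum (I : eqType) (w : seq I) (f : I -> R) :
    (forall i, i \in w -> inspan (f i)) -> inspan (\sum_(i <- w) f i).
  by move=> fw; rewrite big_seq; elim/big_ind: _.
suff spanX m : inspan 'X_[m].
  by change (inspan p); rewrite [p]mpolyE; apply/span_sum => m _; apply/spanZ.
have spanlow m1 : (k <= mdeg m1)%N -> inspan 'X_[m1].
  move=> km; exists (fun=> 0), 0, 'X_[m1]; split; first exact: ideal0.
    move=> m' m'k; rewrite mcoeffX; case: eqP => // mm'.
    by move: m'k; rewrite -mm' ltnNge km.
  by under eq_bigr do rewrite scale0r; rewrite big1 ?addr0 ?add0r.
have [d dE] : exists d, #|[pred x : 'X_{1..n < k} | m < x]%O| = d by eexists.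
elim/ltn_ind: d m dE => d IH m dE.
have [km|mk] := leqP k (mdeg m); first exact: spanlow.
have [sm|sm] := ltnP #|[set i | (r <= m i)%N]%SET| s.
  have mi i : (m i < k)%N.
    by apply: leq_ltn_trans mk; rewrite mdegE (bigD1 i) //= leq_addr.
  pose x0 : {ffun 'I_n -> 'I_k} := [ffun i => Ordinal (mi i)].
  have x0s : (#|[set i | r <= x0 i]%SET| < s)%N.
    apply: leq_ltn_trans sm; apply: subset_leq_card.
    by apply/fintype.subsetP => i; rewrite !inE ffunE.
  pose x : A := Sub x0 x0s.
  have -> : m = mon x by apply/mnmP => i; rewrite mnmE /= ffunE.
  exists (fun i => (i == enum_rank x)%:R), 0, 0.
  split; [exact: ideal0|exact: low0|]; rewrite !addr0 (bigD1 (enum_rank x)) //=.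
  rewrite eqxx scale1r enum_rankK big1 ?addr0 // => i /negPf ->.
  by rewrite scale0r.
have [S Sm Ss] : exists2 S : {set 'I_n}, S \subset [set i | (r <= m i)%N]%SET & #|S| = s.
  exists [set i in take s (enum [set i | (r <= m i)%N]%SET)]%SET.
    by apply/fintype.subsetP => i; rewrite inE => /mem_take; rewrite mem_enum.
  rewrite cardsE; have /card_uniqP -> : uniq (take s (enum [set i | (r <= m i)%N]%SET)).
    by rewrite take_uniq ?enum_uniq.
  by rewrite size_take -cardE; case: ltngtP sm.
have [u [q0 u0 Juq qS]] := QP S Ss; set q := Q S in q0 Juq qS.
set b := mlast q.
have bm : (b <= m)%MM.
  apply/mnm_lepP => i; have [iS|iS] := boolP (i \in S); last first.
    by rewrite (qS b) ?mlast_supp.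
  have : (r <= m i)%N by have /fintype.subsetP/(_ i iS) := Sm; rewrite inE.
  apply: leq_trans; apply: leq_trans (_ : mdeg b <= _)%N.
    by rewrite mdegE (bigD1 i) //= leq_addr.
  rewrite ltnW // ltnS; apply: leq_trans (leq_bigmax S).
  by rewrite ltnW // msize_mdeg_lt // mlast_supp.
have [cb lb] := mcoeffM_mlast u0 q0.
have cb0 : (u * q)@_b != 0.
  by rewrite cb mulf_neq0 // -mcoeff_msupp mlast_supp.
have uqE : 'X_[(m - b)%MM] * (u * q) =
    (u * q)@_b *: 'X_[m] + \sum_(x <- msupp (u * q) | x != b) (u * q)@_x *: 'X_[(m - b + x)%MM].
  rewrite {1}[u * q]mpolyE mulr_sumr (bigD1_seq b) ?msupp_uniq ?mcoeff_msupp //=.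
  congr (_ + _); first by rewrite -scalerAr -mpolyXD submK.
  by apply: eq_bigr => x _; rewrite -scalerAr -mpolyXD.
have -> : 'X_[m] = ((u * q)@_b)^-1 *: ('X_[(m - b)%MM] * (u * q) +
    (-1) *: \sum_(x <- msupp (u * q) | x != b) (u * q)@_x *: 'X_[(m - b + x)%MM]).
  by rewrite uqE scaleN1r addrK scalerA mulVf // scale1r.
apply/spanZ; apply/spanD; first by apply: spanJ; apply: idealM.
apply/spanZ; rewrite big_mkcond; apply/span_sum => x xuq; case: ifP => [xb|_]; last exact: span0.
apply/spanZ; have mx : (m < (m - b + x)%MM)%O.
  rewrite -{1}(submK bm) ltmc_add2r lt_neqAle eq_sym xb /=.
  exact: lb.
have [kx|xk] := leqP k (mdeg (m - b + x)%MM); first exact: spanlow.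
apply: (IH _ _ _ erefl); rewrite -dE; apply: proper_card; apply/properP; split.
  by apply/fintype.subsetP => y; rewrite !inE; apply: lt_trans.
by exists (BMultinom xk); rewrite !inE //= ltxx.
Qed.

End Growth.

Section Krull.
Variables (F : fieldType) (n : nat).
Local Notation R := {mpoly F[n]}.
Implicit Types (p q : R).

Lemma mcoeff0_meval p : p@_0 = p.@[fun=> 0].
Proof.
rewrite {2}[p]mpolyE raddf_sum /=.
have E m : (p@_m *: 'X_[m]).@[fun=> 0] = p@_m * (m == 0%MM)%:R.
  rewrite mevalZ mevalX; congr (_ * _).
  case: eqP => [->|/eqP m0]; first by rewrite big1 // => i _; rewrite mnm0E expr0.
  have [i mi] : exists i, m i != 0%N.
    apply/existsP; apply: contraNT m0; rewrite negb_exists => /forallP m0.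
    by apply/eqP/mnmP => i; rewrite mnm0E; apply/eqP; move: (m0 i); rewrite negbK.
  by rewrite (bigD1 i) //= expr0n (negPf mi) mul0r.
under eq_bigr do rewrite E.
have [p0|p0] := boolP (0%MM \in msupp p).
  rewrite (bigD1_seq 0%MM) ?msupp_uniq //= eqxx mulr1 big1 ?addr0 //.
  by move=> m /negPf ->; rewrite mulr0.
rewrite (memN_msupp_eq0 p0) big_seq big1 // => m mp.
by case: eqP mp p0 => [->|_ _ _]; rewrite ?mulr0 // => ->.
Qed.

Section Substitution.
Variables (s : nat) (g : 'I_s -> 'I_n).

Definition subvars (Q : {mpoly F[s]}) : R := Q \mPo [tuple 'X_(g j) | j < s].

Lemma mmap_subvars (S : comNzRingType) (f : {rmorphism F -> S}) z Q :
  mmap f z (subvars Q) = mmap f (z \o g) Q.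
Proof. by rewrite mmap_comp; apply: eq_mmap => // i; rewrite mmapX mmap1U. Qed.

Lemma subvars_eq0 Q : injective g -> subvars Q = 0 -> Q = 0.
Proof.
move=> gI Q0.
pose z (i : 'I_n) : {mpoly F[s]} := if [pick j | g j == i] is Some j then 'X_j else 0.
have zg j : z (g j) = 'X_j.
  by rewrite /z; case: pickP => [k /eqP/gI -> //|/(_ j)]; rewrite eqxx.
have := mmap_subvars (@mpolyC s F) z Q; rewrite Q0 rmorph0.
rewrite (eq_mmap (g := @mpolyC s F) (y := fun j => 'X_j)) // => E.
by rewrite E -[LHS]comp_mpoly_id /comp_mpoly; apply: eq_mmap => // i;
  rewrite tnth_mktuple.
Qed.

Lemma msupp_subvars Q m i : m \in msupp (subvars Q) -> i \notin codom g -> m i = 0%N.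
Proof.
move=> + ig; pose ok p := forall m, m \in msupp p -> m i = 0%N.
have okM p q : ok p -> ok q -> ok (p * q).
  move=> okp okq m' /msuppM_le/allpairsP[[m1 m2] /= [/okp m1i /okq m2i ->]].
  by rewrite mnmDE m1i m2i.
have okD p q : ok p -> ok q -> ok (p + q).
  by move=> okp okq m' /msuppD_le; rewrite mem_cat => /orP[/okp|/okq].
have okC c : ok c%:MP.
  move=> m'; rewrite msuppC; case: eqP => // _; rewrite inE => /eqP ->.
  by rewrite mnm0E.
suff : ok (subvars Q) by move=> h; apply: h.
rewrite /subvars /comp_mpoly /mmap.
elim/big_ind: _ => [|p q|m' _]; [by rewrite -mpolyC0|exact/okD|].
apply/okM => //; rewrite /mmap1; elim/big_ind: _ => [|p q|j _]; first exact/okC.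
  exact/okM.
rewrite tnth_mktuple; elim: (m' j) => [|k IH]; first by rewrite expr0; apply/okC.
rewrite exprS; apply/okM => // m''; rewrite msuppX inE => /eqP ->.
rewrite mnm1E; case: eqP => // gj.
by rewrite -gj codom_f in ig.
Qed.

End Substitution.

Lemma grows_gen m (f : 'I_m -> R) d : (forall i, (f i)@_0 = 0) ->
  grows (gen_ideal f) d -> (n <= d + m)%N.
Proof.
elim: m f d => [|m IH] f d f0 gr.
  rewrite addn0; apply: grows0; case: gr => C CN; exists C => k.
  have [N NC [e es]] := CN k; exists N => //; exists e => p.
  have [c [j [l [[c' ->] lk pE]]]] := es p; exists c, 0, l.
  by split=> //; rewrite pE big_ord0.
rewrite addnS -addSn; apply: (IH (fun i => f (widen_ord (leqnSn m) i))) => //.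
apply: grows_cut gr; first exact: gen_idealP.
  instantiate (1 := f ord_max) => m'; rewrite ltnS leqn0 mdeg_eq0 => /eqP ->.
  exact: f0.
move=> _ [c ->]; rewrite big_ord_recr /=.
by eexists; exists (c ord_max); split; first by exists (fun i => c (widen_ord (leqnSn m) i)).
Qed.

(** If no such prime existed, each set of [n - m] coordinates would give a product of a power of [h]
    and a nonzero polynomial in these coordinates inside the ideal; the growth would then be less
    than [n - m], against [grows_gen]. *)
Lemma krull0 m (f : 'I_m -> R) (h : R) : (m < n)%N ->
  (forall i, (f i)@_0 = 0) -> h@_0 != 0 ->
  exists P, [/\ is_prime P, forall i, P (f i), ~ P h &
    exists2 g : 'I_(n - m) -> 'I_n, injective g & forall Q, P (subvars g Q) -> Q = 0].
Proof.
move=> mn f0 h0; apply: contrapT => noP.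
have : grows (gen_ideal f) (n - m).-1.
  apply: grows_indep; [exact: gen_idealP|by rewrite subn_gt0|] => S Ss.
  pose g (j : 'I_(n - m)) := enum_val (cast_ord (esym Ss) j).
  have gI : injective g by move=> i j /enum_val_inj/cast_ord_inj.
  apply: contrapT => noq; apply: noP.
  pose M : set R := fun x => exists k Q, Q != 0 /\ x = h ^+ k * subvars g Q.
  have sub1 : subvars g 1 = 1 by rewrite /subvars rmorph1.
  have [||x y|x Ix [k [Q [Q0 xE]]]|P [pP fP PM]] := @exists_prime R (gen_ideal f) M.
  - exact: gen_idealP.
  - by exists 0%N, 1; rewrite oner_eq0 expr0 mul1r sub1.
  - move=> [k [Q [Q0 ->]]] [l [Q' [Q'0 ->]]]; exists (k + l)%N, (Q * Q').
    split; first by rewrite mulf_neq0.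
    by rewrite exprD /subvars rmorphM /=; ring.
  - apply: noq; exists (subvars g Q), (h ^+ k); split.
    + by apply: contraNneq Q0 => /subvars_eq0 ->.
    + by move: h0; rewrite !mcoeff0_meval rmorphXn /= expf_eq0 => /negPf ->; rewrite andbF.
    + by rewrite -xE.
    + move=> m' i m'Q iS; apply: (msupp_subvars m'Q); apply: contraNN iS.
      by case/codomP => j ->; apply: enum_valP.
  exists P; split=> //.
  - by move=> i; apply/fP/gen_ideal_mem.
  - by move=> Ph; apply: (PM _ Ph); exists 1%N, 1; rewrite oner_eq0 sub1 mulr1 expr1.
  - exists g => // Q PQ; apply: contrapT => /eqP Q0; apply: (PM _ PQ).
    by exists 0%N, Q; rewrite expr0 mul1r.
move/(grows_gen f0); lia.
Qed.

End Krull.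

Section Translation.
Variables (F : fieldType).

Definition shift n (w : 'I_n -> F) (p : {mpoly F[n]}) :=
  p \mPo [tuple 'X_i + (w i)%:MP | i < n].

Lemma mmap_shift n (w : 'I_n -> F) (S : comNzRingType) (f : {rmorphism F -> S}) z p :
  mmap f z (shift w p) = mmap f (fun i => z i + f (w i)) p.
Proof.
rewrite mmap_comp; apply: eq_mmap => // i.
by rewrite mmapD mmapX mmap1U mmapC.
Qed.

Lemma shift_eq0 n (w : 'I_n -> F) p : shift w p = 0 -> p = 0.
Proof.
move=> p0; have := mmap_shift w (@mpolyC n F) (fun i => 'X_i - (w i)%:MP) p.
rewrite p0 rmorph0 (eq_mmap (g := @mpolyC n F) (y := fun j => 'X_j)) //; last first.
  by move=> i; rewrite subrK.
move=> E; rewrite E -[LHS]comp_mpoly_id /comp_mpoly; apply: eq_mmap => // i.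
by rewrite tnth_mktuple.
Qed.

(** The origin is moved to [w]; the polynomial [h] keeps the component in a prescribed neighbourhood
    of [w]. *)
Theorem krull n m (f : 'I_m -> {mpoly F[n]}) (h : {mpoly F[n]}) (w : 'I_n -> F) :
  (m < n)%N -> (forall i, (f i).@[w] = 0) -> h.@[w] != 0 ->
  exists P, [/\ is_prime P, forall i, P (f i), ~ P h &
    exists2 g : 'I_(n - m) -> 'I_n, injective g & forall Q, P (subvars g Q) -> Q = 0].
Proof.
move=> mn fw hw.
have sh0 p : (shift w p)@_0 = p.@[w].
  by rewrite mcoeff0_meval /meval mmap_shift; apply: eq_mmap => // i; rewrite add0r.
have [||P [pP Pf Ph [g gI PQ]]] := @krull0 F n m (fun i => shift w (f i)) (shift w h) mn.
- by move=> i; rewrite sh0.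
- by rewrite sh0.
exists (fun p => P (shift w p)); split=> //.
  split; [split=> [|x y Px Py|x y Py]|by rewrite /shift rmorph1 => /(prime1 pP)|].
  - by rewrite /shift rmorph0; apply: (ideal0 pP).
  - by rewrite /shift rmorphD; apply: (idealD pP).
  - by rewrite /shift rmorphM; apply: (idealM pP).
  - by move=> x y; rewrite /shift rmorphM => /(primeM pP).
exists g => // Q PQ'; apply: (@shift_eq0 _ (w \o g)); apply: PQ.
rewrite (_ : subvars _ _ = shift w (subvars g Q)) //.
rewrite /subvars /shift /comp_mpoly !rmorph_mmap; apply: eq_mmap => c /=.
  by rewrite !mmapC.
by rewrite !tnth_mktuple mmapD mmapC !mmapX !mmap1U !tnth_mktuple.
Qed.

End Translation.

(** * Derivations *)

Lemma size_sub_lead (R : nzRingType) (p q : {poly R}) : p != 0 ->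
  size q = size p -> lead_coef q = lead_coef p -> (size (p - q)%R < size p)%N.
Proof.
move=> p0 szE lcE; rewrite -[X in (_ < X)%N]prednK ?size_poly_gt0 // ltnS.
apply/leq_sizeP => j; rewrite coefB leq_eqVlt => /predU1P[<-|].
  by move: lcE; rewrite /lead_coef szE => ->; rewrite subrr.
by rewrite prednK ?size_poly_gt0 // => pj; rewrite !nth_default ?subrr // szE.
Qed.

Record derivation (F K : comNzRingType) (f : F -> K) (D : K -> K) : Prop := Derivation {
  derC : forall c, D (f c) = 0;
  derD : forall x y, D (x + y) = D x + D y;
  derM : forall x y, D (x * y) = x * D y + y * D x }.

Section Derivations.
Variables (F K : fieldType) (f : {rmorphism F -> K}).
Hypothesis K0 : [pchar K] =i pred0.

(* A derivation is built through its graph, viewed as a subfield of the dual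
   numbers over [K]. *)
Record ring_graph (G : set (K * K)) : Prop := RingGraph {
  graphC : forall c, G (f c, 0);
  graphD : forall x y x' y', G (x, y) -> G (x', y') -> G (x + x', y + y');
  graphM : forall x y x' y', G (x, y) -> G (x', y') -> G (x * x', x * y' + x' * y);
  graph_fun : forall y, G (0, y) -> y = 0 }.

(** The extension to fractions, by the quotient rule. *)
Definition frac_graph (G : set (K * K)) : set (K * K) :=
  fun u => exists x y x' y', [/\ G (x, y), G (x', y'), x' != 0 &
    u = (x / x', (y * x' - x * y') / x' ^+ 2)].

Lemma graphN (G : set (K * K)) x y : ring_graph G -> G (x, y) -> G (- x, - y).
Proof.
move=> rG Gxy; have := graphM rG (graphC rG (-1)) Gxy.
by rewrite rmorphN1 mulr0 addr0 !mulN1r.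
Qed.

Lemma frac_graphP (G : set (K * K)) : ring_graph G ->
  [/\ ring_graph (frac_graph G), (G `<=` frac_graph G)%classic &
      forall x y, frac_graph G (x, y) -> x != 0 -> frac_graph G (x^-1, - y / x ^+ 2)].
Proof.
move=> rG; have G1 : G (1, 0) by have := graphC rG 1; rewrite rmorph1.
have sub : (G `<=` frac_graph G)%classic.
  move=> [x y] Gxy; exists x, y, 1, 0; split=> //; first exact: oner_neq0.
  by rewrite divr1 expr1n divr1 mulr1 mulr0 subr0.
split=> //.
  split=> [c|x1 y1 x2 y2|x1 y1 x2 y2|y]; first exact/sub/(graphC rG).
  - move=> [a [b [a' [b' [Ga Ga' a'0 [-> ->]]]]]] [c [d [c' [d' [Gc Gc' c'0 [-> ->]]]]]].
    exists (a * c' + c * a'), (a * d' + c' * b + (c * b' + a' * d)), (a' * c'),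
      (a' * d' + c' * b'); split.
    + by apply: graphD => //; apply: graphM.
    + exact: graphM.
    + by rewrite mulf_neq0.
    + by congr (_, _); field; rewrite a'0 c'0.
  - move=> [a [b [a' [b' [Ga Ga' a'0 [-> ->]]]]]] [c [d [c' [d' [Gc Gc' c'0 [-> ->]]]]]].
    exists (a * c), (a * d + c * b), (a' * c'), (a' * d' + c' * b'); split.
    + exact: graphM.
    + exact: graphM.
    + by rewrite mulf_neq0.
    + by congr (_, _); field; rewrite a'0 c'0.
  - move=> [a [b [a' [b' [Ga Ga' a'0 [/esym/eqP]]]]]].
    rewrite mulf_eq0 invr_eq0 (negPf a'0) orbF => /eqP a0.
    by rewrite a0 in Ga; rewrite a0 (graph_fun rG Ga) !mul0r subrr mul0r.
move=> x y [a [b [a' [b' [Ga Ga' a'0 [-> ->]]]]]].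
rewrite mulf_eq0 negb_or invr_eq0 => /andP[a0 _].
exists a', b', a, b; split=> //; congr (_, _); field; by rewrite a0 a'0.
Qed.

Section Extend.
Variable (G : set (K * K)).
Hypothesis rG : ring_graph G.
Hypothesis GV : forall x y, G (x, y) -> x != 0 -> G (x^-1, - y / x ^+ 2).

(** [PQ.2] arises from [PQ.1] by deriving the coefficients; if [w] has derivative [v], then P(w)
    must have derivative Q(w) + P'(w) v. *)
Definition poly_graph (PQ : {poly K} * {poly K}) := forall i, G (PQ.1`_i, PQ.2`_i).

Lemma graph0 : G (0, 0).
Proof. by have := graphC rG 0; rewrite rmorph0. Qed.

Lemma graph_sum (I : Type) (s : seq I) (g h : I -> K) :
  (forall i, G (g i, h i)) -> G (\sum_(i <- s) g i, \sum_(i <- s) h i).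
Proof.
move=> gh; elim: s => [|i s IH]; first by rewrite !big_nil; apply: graph0.
by rewrite !big_cons; apply: graphD.
Qed.

Lemma poly_graphM P Q P' Q' : poly_graph (P, Q) -> poly_graph (P', Q') ->
  poly_graph (P * P', P * Q' + Q * P').
Proof.
move=> PQ PQ' i /=; rewrite coefD !coefM -big_split /=; apply: graph_sum => j.
rewrite [Q`_j * _]mulrC; apply: graphM => //.
Qed.

Lemma poly_graphD P Q P' Q' : poly_graph (P, Q) -> poly_graph (P', Q') ->
  poly_graph (P + P', Q + Q').
Proof. by move=> PQ PQ' i /=; rewrite !coefD; apply: graphD. Qed.

Lemma poly_graphC x y : G (x, y) -> poly_graph (x%:P, y%:P).
Proof.
move=> Gxy i /=; rewrite !coefC; case: eqP => // _; exact: graph0.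
Qed.

Lemma poly_graphX : poly_graph ('X, 0).
Proof.
move=> i /=; rewrite coefX coef0; case: eqP => _; last exact: graph0.
by have := graphC rG 1; rewrite rmorph1.
Qed.

Lemma poly_graphXn k : poly_graph ('X^k, 0).
Proof.
move=> i /=; rewrite coefXn coef0; case: eqP => _; last exact: graph0.
by have := graphC rG 1; rewrite rmorph1.
Qed.

(** If [w] is transcendental its derivative is free, and 0 is taken. Otherwise it is forced by a
    relation [P1] of least degree, whose derivative does not vanish at [w] in characteristic zero;
    the other relations reduce to [P1] by division. *)
Lemma extend_graph w : exists v, exists2 G', ring_graph G' &
  (G `<=` G')%classic /\ G' (w, v).
Proof.
pose ev v (PQ : {poly K} * {poly K}) := (PQ.1.[w], PQ.2.[w] + PQ.1^`().[w] * v).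
suff [v vP] : exists v, forall P Q, poly_graph (P, Q) -> P.[w] = 0 ->
    Q.[w] + P^`().[w] * v = 0.
  exists v, (fun u => exists2 PQ, poly_graph PQ & u = ev v PQ).
    split=> [c|x y x' y'|x y x' y'|y].
    - exists ((f c)%:P, 0%:P); first by apply: poly_graphC; apply: graphC.
      by rewrite /ev /= derivC !hornerC mul0r addr0.
    - move=> [[P Q] PQ [-> ->]] [[P' Q'] PQ' [-> ->]].
      exists (P + P', Q + Q'); first exact: poly_graphD.
      by rewrite /ev /= derivD !hornerD; congr (_, _); ring.
    - move=> [[P Q] PQ [-> ->]] [[P' Q'] PQ' [-> ->]].
      exists (P * P', P * Q' + Q * P'); first exact: poly_graphM.
      by rewrite /ev /= derivM !hornerD !hornerM; congr (_, _); ring.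
    - by move=> [[P Q] PQ [/esym P0 ->]]; apply: vP.
  split=> [[x y] Gxy|].
    exists (x%:P, y%:P); first exact: poly_graphC.
    by rewrite /ev /= derivC !hornerC mul0r addr0.
  exists ('X, 0); first exact: poly_graphX.
  by rewrite /ev /= derivX hornerX !hornerC add0r mul1r.
have Pzero P Q : poly_graph (P, Q) -> P = 0 -> Q = 0.
  move=> PQ P0; apply/polyP => i; have := PQ i.
  by rewrite P0 /= !coef0; apply: graph_fun.
have [alg|tr] := pselect (exists P Q, [/\ poly_graph (P, Q), P != 0 & P.[w] = 0]);
    last first.
  exists 0 => P Q PQ Pw; rewrite mulr0 addr0.
  have P0 : P = 0 by apply: contrapT => /eqP P0; apply: tr; exists P, Q.
  by rewrite (Pzero _ _ PQ P0) horner0.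
pose T k := `[< exists P Q, [/\ poly_graph (P, Q), P != 0, P.[w] = 0 & size P = k] >].
have exT : exists k, T k.
  by have [P [Q [PQ P0 Pw]]] := alg; exists (size P); apply/asboolP; exists P, Q.
case: (ex_minnP exT) => k /asboolP[P1 [Q1 [PQ1 P10 P1w <-]]] kmin.
have min P Q : poly_graph (P, Q) -> P.[w] = 0 -> (size P < size P1)%N -> P = 0.
  move=> PQ Pw; apply: contraTeq => P0; rewrite -leqNgt; apply: kmin.
  by apply/asboolP; exists P, Q.
have P1d : P1^`().[w] != 0.
  have sP1 : (1 < size P1)%N.
    rewrite ltnNge; apply/negP => /size1_polyC P1E; move: P1w P10.
    by rewrite P1E hornerC => ->; rewrite eqxx.
  apply/eqP => P1dw; have : P1^`() = 0.
    apply: (min _ Q1^`()) => //; last by rewrite lt_size_deriv.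
    move=> i /=; rewrite !coef_deriv -[X in G (X, _)]mulr_natr -[X in G (_, X)]mulr_natr.
    have := graphM rG (graphC rG i.+1%:R) (PQ1 i.+1).
    by rewrite rmorph_nat mulr0 addr0 ![i.+1%:R * _]mulrC.
  move/polyP/(_ (size P1).-2); rewrite coef_deriv coef0 -mulr_natr => /eqP.
  have -> : (size P1).-2.+1 = (size P1).-1 by case: (size P1) sP1 => [|[]].
  rewrite mulf_eq0 -lead_coefE lead_coef_eq0 (negPf P10) /=.
  move/pcharf0P: K0 => ->; by case: (size P1) sP1 => [|[]].
exists (- Q1.[w] / P1^`().[w]); set v := _ / _.
have v0 : Q1.[w] + P1^`().[w] * v = 0 by rewrite /v mulrC divfK // subrr.
clearbody v.
move=> P Q PQ; have [d] := ubnP (size P); elim: d P Q PQ => // d IH P Q PQ Pd Pw.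
have [|sP] := ltnP (size P) (size P1).
  move=> /(min _ _ PQ Pw) P0; rewrite (Pzero _ _ PQ P0) P0 derivC.
  by rewrite !horner0 mul0r addr0.
have P0 : P != 0 by rewrite -size_poly_gt0 (leq_trans _ sP) // size_poly_gt0.
pose e := (size P - size P1)%N.
pose a := lead_coef P / lead_coef P1.
have lP1 : lead_coef P1 != 0 by rewrite lead_coef_eq0.
have [b Gab] : exists b, G (a, b).
  rewrite /a; have := graphM rG (PQ (size P).-1) (GV (PQ1 (size P1).-1) lP1).
  by move=> h; eexists; exact: h.
pose P2 := P - a%:P * 'X^e * P1.
pose Q2 := Q - (a%:P * 'X^e * Q1 + b%:P * 'X^e * P1).
have PQ2 : poly_graph (P2, Q2).
  have := poly_graphM (poly_graphM (poly_graphC Gab) (poly_graphXn e)) PQ1.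
  rewrite mulr0 add0r => h; apply: poly_graphD => // i /=.
  by rewrite !coefN; apply: graphN => //; apply: h.
have P2w : P2.[w] = 0 by rewrite !hornerE Pw P1w; ring.
have <- : Q2.[w] + P2^`().[w] * v = Q.[w] + P^`().[w] * v.
  rewrite /Q2 /P2 derivB !derivM derivC !hornerE P1w.
  have -> : Q1.[w] = - (P1^`().[w] * v) by apply/eqP; rewrite -addr_eq0 v0.
  by ring.
apply: IH => //; rewrite ltnS in Pd; apply: leq_trans Pd.
have szE : size (a%:P * 'X^e * P1) = size P.
  rewrite mul_polyC -scalerAl size_scale ?mulf_neq0 ?invr_eq0 ?lead_coef_eq0 //.
  by rewrite mulrC size_mulXn // /e subnK.
rewrite /P2 size_sub_lead // /lead_coef szE -/(lead_coef P) mul_polyC -scalerAl.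
rewrite coefZ [_ * P1]mulrC coefMXn ltnNge.
have -> : ((size P).-1 - e)%N = (size P1).-1.
  have := sP; have : (0 < size P1)%N by rewrite size_poly_gt0.
  rewrite /e; lia.
have -> : (e <= (size P).-1)%N.
  have : (0 < size P1)%N by rewrite size_poly_gt0.
  rewrite /e; lia.
by rewrite -lead_coefE /a /= divfK.
Qed.

End Extend.

(** The derivation is given on the polynomials in [u]. A maximal graph closed under inverses is
    defined on all of [K], by [extend_graph] followed by [frac_graphP]. *)
Lemma derivation_extend m (u v : 'I_m -> K) : alg_indep f u ->
  exists2 D, derivation f D & forall j, D (u j) = v j.
Proof.
move=> uI.
pose G0 : set (K * K) := fun xy => exists p : {mpoly F[m]},
  xy = (mmap f u p, \sum_j mmap f u p^`M(j) * v j).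
have rG0 : ring_graph G0.
  split=> [c|_ _ _ _ [p [-> ->]] [q [-> ->]]|_ _ _ _ [p [-> ->]] [q [-> ->]]|_ [p [/esym/uI -> ->]]].
  - exists c%:MP; rewrite mmapC big1 // => j _.
    by rewrite mderivC rmorph0 mul0r.
  - exists (p + q); rewrite rmorphD -big_split; congr (_, _).
    by apply: eq_bigr => j _; rewrite /= mderivD rmorphD mulrDl.
  - exists (p * q); rewrite rmorphM !mulr_sumr -big_split; congr (_, _).
    by apply: eq_bigr => j _; rewrite /= mderivM rmorphD !rmorphM /=; ring.
  - by rewrite big1 // => j _; rewrite mderiv0 rmorph0 mul0r.
pose good (G : set (K * K)) := [/\ ring_graph G, (G0 `<=` G)%classic &
  forall x y, G (x, y) -> x != 0 -> G (x^-1, - y / x ^+ 2)].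
have gG1 : good (frac_graph G0) by have [? ? ?] := frac_graphP rG0; split.
have [C CP Ctot|G [PG Gmax]] := @Zorn_bigcup _ [set G | G = set0 \/ good G]%classic.
  have [[A0 CA0 gA0]|noA] := pselect (exists2 A, C A & good A); last first.
    left; apply/seteqP; split=> // x [A CA Ax].
    by have [A0|gA] := CP _ CA; [rewrite A0 in Ax|case: noA; exists A].
  have gC A x : C A -> A x -> good A.
    by move=> CA Ax; have [AE|//] := CP _ CA; rewrite AE in Ax.
  have both A B x y : C A -> C B -> A x -> B y ->
      exists2 E, C E & [/\ good E, E x & E y].
    move=> CA CB Ax By; have [AB|BA] := Ctot _ _ CA CB.
      by exists B => //; split=> //; [exact: gC By|exact: AB].
    by exists A => //; split=> //; [exact: gC Ax|exact: BA].
  right; split.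
  - split=> [c|x y x' y' [A CA Ax] [B CB Bx]|x y x' y' [A CA Ax] [B CB Bx]|y [A CA Ay]].
    + by exists A0 => //; apply: graphC; case: gA0.
    + have [E CE [[rE _ _] Ex Ey]] := both _ _ _ _ CA CB Ax Bx.
      by exists E => //; apply: graphD.
    + have [E CE [[rE _ _] Ex Ey]] := both _ _ _ _ CA CB Ax Bx.
      by exists E => //; apply: graphM.
    + by have [rA _ _] := gC _ _ CA Ay; apply: (graph_fun rA).
  - by move=> x Gx; exists A0 => //; case: gA0 => _ h _; apply: h.
  - by move=> x y [A CA Axy] x0; exists A => //; have [_ _ h] := gC _ _ CA Axy; apply: h.
have {PG} gG : good G.
  have [G0E|//] := PG; case: (Gmax (frac_graph G0)); last by right.
  split; first by rewrite G0E.
  move=> h; have := h (f 0, 0); rewrite G0E; apply.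
  by case: gG1 => r _ _; apply: graphC.
have [rG G0G GV] := gG.
have tot w : exists y, G (w, y).
  have [y [G' rG' [GG' G'w]]] := extend_graph rG GV w; exists y.
  have [rF FG' FV] := frac_graphP rG'.
  apply: contrapT => nG; apply: (Gmax (frac_graph G')).
    split; first by move=> x Gx; apply/FG'/GG'.
    by move=> h; apply: nG; apply: h; apply: FG'.
  by right; split=> // x Gx; apply/FG'/GG'/G0G.
pose D w := sval (cid (tot w)).
have GD w : G (w, D w) by rewrite /D; case: cid.
have DE w y : G (w, y) -> D w = y.
  move=> Gw; apply/eqP; rewrite -subr_eq0; apply/eqP/(graph_fun rG).
  by rewrite -(subrr w); apply: graphD => //; apply: graphN.
exists D => [|j]; last first.
  apply/DE/G0G; exists 'X_j; rewrite mmapX mmap1U; congr (_, _).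
  rewrite (bigD1 j) //= big1 ?addr0 => [|i ij].
    have Ujj : (U_(j) - U_(j) = 0)%MM.
      by apply/mnmP => k; rewrite mnmBE mnm0E subnn.
    by rewrite mderivX mnm1E eqxx scale1r Ujj mpolyX0 rmorph1 mul1r.
  by rewrite mderivX mnm1E eq_sym (negPf ij) scale0r rmorph0 mul0r.
split=> [c|x y|x y]; apply: DE; [exact: graphC|exact: graphD|].
exact: graphM.
Qed.

End Derivations.

Section ChainRule.
Variables (F K : comNzRingType) (f : {rmorphism F -> K}) (D : K -> K).
Hypothesis dD : derivation f D.

Lemma der0 : D 0 = 0. Proof. by rewrite -{1}(rmorph0 f) (derC dD). Qed.
Lemma der_mmap n (z : 'I_n -> K) p :
  D (mmap f z p) = \sum_i mmap f z p^`M(i) * D (z i).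
Proof.
pose T (p : {mpoly F[n]}) := D (mmap f z p) = \sum_i mmap f z p^`M(i) * D (z i).
have TD p1 p2 : T p1 -> T p2 -> T (p1 + p2).
  rewrite /T rmorphD (derD dD) => -> ->; rewrite -big_split.
  by apply: eq_bigr => i _; rewrite /= mderivD rmorphD mulrDl.
have TM p1 p2 : T p1 -> T p2 -> T (p1 * p2).
  rewrite /T rmorphM (derM dD) => -> ->; rewrite !mulr_sumr -big_split.
  by apply: eq_bigr => i _; rewrite /= mderivM rmorphD !rmorphM /=; ring.
have TC c : T c%:MP.
  by rewrite /T mmapC (derC dD) big1 // => i _; rewrite mderivC rmorph0 mul0r.
have TX i : T 'X_i.
  rewrite /T mmapX mmap1U (bigD1 i) //= big1 ?addr0 => [|j ij].
    have Uii : (U_(i) - U_(i) = 0)%MM.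
      by apply/mnmP => k; rewrite mnmBE mnm0E subnn.
    by rewrite mderivX mnm1E eqxx scale1r Uii mpolyX0 rmorph1 mul1r.
  by rewrite mderivX mnm1E eq_sym (negPf ij) scale0r rmorph0 mul0r.
suff : T p by [].
rewrite [p]mpolyE; elim/big_ind: _ => [|//|m _]; first by rewrite -mpolyC0.
rewrite -mul_mpolyC; apply/TM => //; rewrite mpolyXE_id.
elim/big_ind: _ => [|//|i _]; first by rewrite -mpolyC1.
by elim: (m i) => [|k IH]; rewrite ?expr0 -?mpolyC1 // exprS; apply/TM.
Qed.

End ChainRule.

Section Constants.
Variables (F K : fieldType) (f : {rmorphism F -> K}).
Hypothesis K0 : [pchar K] =i pred0.
Variable D : K -> K.
Hypothesis dD : derivation f D.

Lemma der1 : D 1 = 0. Proof. by rewrite -(rmorph1 f) (derC dD). Qed.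

Lemma derN x : D (- x) = - D x.
Proof. by apply/eqP; rewrite -addr_eq0 -(derD dD) addNr (der0 dD). Qed.

Lemma constD x y : D x = 0 -> D y = 0 -> D (x + y) = 0.
Proof. by move=> x0 y0; rewrite (derD dD) x0 y0 addr0. Qed.

Lemma constN x : D x = 0 -> D (- x) = 0.
Proof. by move=> x0; rewrite derN x0 oppr0. Qed.

Lemma constM x y : D x = 0 -> D y = 0 -> D (x * y) = 0.
Proof. by move=> x0 y0; rewrite (derM dD) x0 y0 !mulr0 addr0. Qed.

Lemma constV x : D x = 0 -> D x^-1 = 0.
Proof.
have [->|x0 Dx] := eqVneq x 0; first by rewrite invr0.
have := der1; rewrite -(divff x0) (derM dD) Dx mulr0 addr0 => /eqP.
by rewrite mulf_eq0 (negPf x0) => /eqP.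
Qed.

Lemma constX x n : D x = 0 -> D (x ^+ n) = 0.
Proof.
by move=> x0; elim: n => [|n IH]; rewrite ?expr0 ?der1 // exprS constM.
Qed.

Lemma const_nat n : D n%:R = 0.
Proof. by rewrite -(rmorph_nat f) (derC dD). Qed.

Lemma const_sum (I : Type) (r : seq I) (P : pred I) (g : I -> K) :
  (forall i, P i -> D (g i) = 0) -> D (\sum_(i <- r | P i) g i) = 0.
Proof. by move=> g0; elim/big_ind: _ => //; [exact: (der0 dD)|exact: constD]. Qed.

Lemma der_horner (p : {poly K}) x : (forall i, D p`_i = 0) ->
  D p.[x] = p^`().[x] * D x.
Proof.
elim/poly_ind: p => [|p c IH] cp; first by rewrite deriv0 !horner0 (der0 dD) mul0r.
have cc : D c = 0 by have := cp 0%N; rewrite coefD coefMX coefC add0r.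
have {}cp i : D p`_i = 0.
  by have := cp i.+1; rewrite coefD coefMX coefC addr0.
rewrite derivD derivM derivX derivC !hornerE (derD dD) (derM dD) IH // cc; ring.
Qed.

(** An element algebraic over the constants is constant: either [D x] vanishes or [x] is a root of
    the derivative of [p], of smaller degree. *)
Lemma const_root (p : {poly K}) x : (forall i, D p`_i = 0) -> p != 0 ->
  p.[x] = 0 -> D x = 0.
Proof.
have [n] := ubnP (size p); elim: n p => // n IH p pn cp p0 px.
have [sp|sp] := leqP (size p) 1.
  have pE := size1_polyC sp; move: px p0; rewrite pE hornerC => ->.
  by rewrite polyC0 eqxx.
have := der_horner x cp; rewrite px (der0 dD) => /esym/eqP.
rewrite mulf_eq0 => /orP[/eqP dx|/eqP //]; apply: (IH p^`()) => //.
- by rewrite -ltnS; apply: leq_trans pn; rewrite ltnS lt_size_deriv.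
- by move=> i; rewrite coef_deriv -mulr_natr constM // const_nat.
apply/eqP => /polyP/(_ (size p).-2); rewrite coef_deriv coef0 -mulr_natr => /eqP.
have -> : (size p).-2.+1 = (size p).-1 by case: (size p) sp => [|[]].
rewrite mulf_eq0 -lead_coefE lead_coef_eq0 (negPf p0) /=.
by move/pcharf0P: K0 => ->; case: (size p) sp => [|[]].
Qed.

End Constants.

Ltac const dD := repeat first [ assumption | exact: (const_nat dD) | exact: (der1 dD)
  | exact: (der0 dD) | apply: (constD dD) | apply: (constN dD) | apply: (constM dD)
  | apply: (constV dD) | apply: (constX dD) ].

Section Independence.
Variables (F K : fieldType) (f : {rmorphism F -> K}).
Hypothesis K0 : [pchar K] =i pred0.

Lemma derivation_comb m (D : 'I_m -> K -> K) (c : 'I_m -> K) :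
  (forall i, derivation f (D i)) -> derivation f (fun x => \sum_i c i * D i x).
Proof.
move=> dD; split=> [a|x y|x y].
- by rewrite big1 // => i _; rewrite (derC (dD i)) mulr0.
- by rewrite -big_split; apply: eq_bigr => i _; rewrite (derD (dD i)) mulrDr.
- rewrite !mulr_sumr -big_split; apply: eq_bigr => i _ /=.
  by rewrite (derM (dD i)); ring.
Qed.

Lemma dual_derivations m (u : 'I_m -> K) : alg_indep f u ->
  exists D : 'I_m -> K -> K, (forall i, derivation f (D i)) /\
    forall i j, D i (u j) = (i == j)%:R.
Proof.
move=> uI; have H (i : 'I_m) : exists D, derivation f D /\ forall j, D (u j) = (i == j)%:R.
  by have [D dD uD] := derivation_extend K0 (fun j => (i == j)%:R) uI; exists D.
have [D DP] := choice H; exists D.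
by split=> [i|i j]; have [] := DP i.
Qed.

(** The values of the [m] dual derivations on [k < m] elements are linearly dependent. This is the
    tool for all upper bounds on transcendence degrees. *)
Lemma derivation_kill m k (u : 'I_m -> K) (t : 'I_k -> K) : alg_indep f u ->
  (k < m)%N -> exists D, [/\ derivation f D, forall i, D (t i) = 0 &
                            exists j, D (u j) != 0].
Proof.
move=> uI km; have [D [dD Du]] := dual_derivations uI.
pose M : 'M[K]_(m, k) := \matrix_(i, j) D i (t j).
have : kermx M != 0.
  rewrite kermx_eq0 /row_free; apply/eqP => rM.
  by have := rank_leq_col M; rewrite rM leqNgt km.
case/rowV0Pn => v /sub_kermxP vM /eqP v0.
exists (fun x => \sum_i v 0 i * D i x); split; first exact: derivation_comb.
  move=> j; have /rowP/(_ j) := vM; rewrite !mxE => vMj; rewrite -[RHS]vMj.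
  by apply: eq_bigr => i _; rewrite mxE.
apply: contrapT => nj; apply: v0; apply/rowP => j; rewrite mxE.
apply: contrapT => vj; apply: nj; exists j.
rewrite (bigD1 j) //= Du eqxx mulr1 big1 ?addr0; first exact/eqP.
by move=> i ij; rewrite Du (negPf ij) mulr0.
Qed.

(** The Jacobian matrix of [x] along the derivations dual to [u] is invertible. The partial
    derivatives of a relation between the [x j] are therefore relations of smaller degree, hence
    zero, and the relation is a constant. *)
Lemma indep_of_derivations m (u x : 'I_m -> K) : alg_indep f u ->
  (forall D, derivation f D -> (forall j, D (x j) = 0) -> forall j, D (u j) = 0) ->
  alg_indep f x.
Proof.
move=> uI ux; have [D [dD Du]] := dual_derivations uI.
pose M : 'M[K]_m := \matrix_(i, j) D i (x j).
have freeM : row_free M.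
  rewrite -kermx_eq0; apply: contrapT => /negP/rowV0Pn[v /sub_kermxP vM /eqP]; apply.
  apply/rowP => j; rewrite mxE.
  have := ux _ (derivation_comb (fun i => v 0 i) dD); move=> /(_ _ j) E.
  rewrite -E; last first.
    move=> k; have /rowP/(_ k) := vM; rewrite !mxE => vMk; rewrite -[RHS]vMk.
    by apply: eq_bigr => i _; rewrite mxE.
  rewrite (bigD1 j) //= Du eqxx mulr1 big1 ?addr0 // => i ij.
  by rewrite Du (negPf ij) mulr0.
have F0 n : (n.+1%:R == 0 :> F) = false.
  by rewrite -(fmorph_eq0 f) rmorph_nat; have /pcharf0P -> := K0.
move=> Q; have [n] := ubnP (msize Q); elim: n Q => // n IH Q Qn Qx.
have dQ j : mmap f x Q^`M(j) = 0.
  pose v : 'rV[K]_m := \row_j mmap f x Q^`M(j).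
  suff : v = 0 by move/rowP/(_ j); rewrite !mxE.
  apply: (row_free_inj (A := M^T)); first by rewrite /row_free mxrank_tr.
  rewrite mul0mx; apply/rowP => i; rewrite !mxE.
  have := der_mmap (dD i) x Q; rewrite Qx (der0 (dD i)) => E; rewrite [RHS]E.
  by apply: eq_bigr => k _; rewrite !mxE.
have dQ0 j : Q^`M(j) = 0.
  have [->|Q0] := eqVneq Q 0; first by rewrite mderiv0.
  apply: IH => //; rewrite ltnS in Qn.
  apply: leq_trans Qn; rewrite ltnNge; apply/negP => Qd.
  have [Qj0|Qj0] := eqVneq Q^`M(j) 0.
    by move: Qd; rewrite Qj0 msize0 leqn0 msize_poly_eq0 (negPf Q0).
  have := mlead_supp Qj0; rewrite mcoeff_msupp mcoeff_deriv => lc.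
  have := msize_mdeg_lt (p := Q) (m := (mlead Q^`M(j) + U_(j))%MM).
  have nz : Q@_(mlead Q^`M(j) + U_(j)) != 0 by apply: contraNneq lc => ->; rewrite mul0rn.
  rewrite mcoeff_msupp => /(_ nz).
  by rewrite mdegD mdeg1 addn1 => /leq_trans/(_ Qd); rewrite -(mlead_deg Qj0) ltnn.
have Qk k : k != 0%MM -> Q@_k = 0.
  move=> /eqP k0; have [j kj] : exists j, k j != 0%N.
    apply: contrapT => nj; apply: k0; apply/mnmP => j; rewrite mnm0E.
    by apply: contrapT => /eqP kj; apply: nj; exists j.
  have := congr1 (mcoeff (k - U_(j))) (dQ0 j).
  rewrite mcoeff_deriv mcoeff0 submK ?lep1mP // => /eqP.
  by rewrite -mulr_natr mulf_eq0 F0 orbF => /eqP.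
have Qc : Q = (Q@_0)%:MP.
  apply/mpolyP => k; rewrite mcoeffC; have [<-|k0] := eqVneq 0%MM k.
    by rewrite mulr1.
  by rewrite mulr0 Qk // eq_sym.
by move: Qx; rewrite Qc mmapC => /eqP; rewrite fmorph_eq0 => /eqP ->.
Qed.

End Independence.

(** * Chains of primes and algebraic independence *)

Definition indep_mod (F : fieldType) n (P : set {mpoly F[n]}) m
    (u : 'I_m -> {mpoly F[n]}) : Prop :=
  forall Q : {mpoly F[m]}, P (Q \mPo [tuple u j | j < m]) -> Q = 0.

Section Chains.
Variables (F : fieldType) (n : nat).
Implicit Types P : set {mpoly F[n]}.

Lemma indep_modP P m (u : 'I_m -> {mpoly F[n]}) (K : fieldType)
    (f : {rmorphism F -> K}) (z : 'I_n -> K) : (forall p, mmap f z p = 0 <-> P p) ->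
  indep_mod P u <-> alg_indep f (fun j => mmap f z (u j)).
Proof.
by move=> zP; split=> uI Q Qu; apply: uI; move: Qu; rewrite -?zP mmap_comp // zP -mmap_comp.
Qed.

(** The element [a] is added to [u]. In a relation modulo [P], viewed as a polynomial in [a], the
    constant coefficient is a relation modulo [P'], hence zero, and [a] can be divided out because
    [P] is prime. *)
Lemma indep_step P P' m (u : 'I_m -> {mpoly F[n]}) (a : {mpoly F[n]}) :
  is_prime P -> is_prime P' -> (P `<=` P')%classic -> P' a -> ~ P a ->
  indep_mod P' u -> exists u' : 'I_m.+1 -> {mpoly F[n]}, indep_mod P u'.
Proof.
move=> pP pP' PP' P'a Pa uI.
pose u' (j : 'I_m.+1) := if insub (j : nat) is Some j' then u j' else a.
exists u' => Q Qu.
pose ev : {mpoly F[m]} -> {mpoly F[n]} := mmap (@mpolyC n F) u.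
have evE p : ev p = p \mPo [tuple u j | j < m].
  by apply: eq_mmap => // i; rewrite tnth_mktuple.
have H q : P (map_poly ev q).[a] -> q = 0.
  elim/poly_ind: q => // q c IH.
  rewrite rmorphD rmorphM /= map_polyX map_polyC !hornerE => Pq.
  have c0 : c = 0.
    apply: uI; rewrite -evE -[ev c](addKr ((map_poly ev q).[a] * a)).
    by apply: (idealD pP'); [apply/(idealN pP')/(idealM pP')|exact: PP'].
  move: Pq; rewrite c0 raddf0 addr0 => Pq; case: (primeM pP Pq) => [/IH->|//].
  by rewrite mul0r add0r polyC0.
have u'E : Q \mPo [tuple u' j | j < m.+1] = (map_poly ev (muni Q)).[a].
  rewrite /comp_mpoly mmap_muni tnth_mktuple; congr (_.[_]); last first.
    by rewrite /u' insubF //= ltnn.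
  apply: eq_map_poly => p; apply: eq_mmap => // i; rewrite tnth_mktuple /u'.
  by rewrite (insubT (fun i => i < m)%N) ?ltn_ord //= => lt; congr u; apply: val_inj.
have Q0 : muni Q = 0 by apply: H; rewrite -u'E.
have -> : Q = mmap (@mpolyC _ F) (fun i => 'X_i) Q.
  by rewrite -[LHS]/(idfun Q) (mmap_unique idfun).
by rewrite mmap_muni Q0 map_poly0 horner0.
Qed.

Lemma indep_chain d (P : nat -> set {mpoly F[n]}) :
  (forall i, (i <= d)%N -> is_prime (P i)) ->
  (forall i, (i < d)%N -> (P i.+1 `<` P i)%classic) ->
  exists u : 'I_d -> {mpoly F[n]}, indep_mod (P d) u.
Proof.
elim: d => [|d IH] pP sP.
  exists (fun _ => 0) => Q; have [c ->] : exists c, Q = c%:MP.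
    exists Q@_0; apply/mpolyP => m; have -> : m = 0%MM by apply/mnmP => -[].
    by rewrite mcoeffC eqxx mulr1.
  rewrite comp_mpolyC; have [-> //|c0] := eqVneq c 0 => Pc.
  have := prime1 (pP 0%N isT); case; rewrite -mpolyC1 -(divff c0) mulrC mpolyCM.
  exact: (idealM (pP 0%N isT)).
have [i id|i id|u uI] := IH; [exact/pP/leqW|exact/sP/leqW|].
have [PP /existsNP[a /not_implyP[Pa nPa]]] := sP d (ltnSn d).
exact: (indep_step (pP d.+1 (leqnn _)) (pP d (leqnSn d)) PP Pa nPa uI).
Qed.

End Chains.

Section Lift.
Variables (F : closedFieldType) (K : fieldType) (f : {rmorphism F -> K}).

(** The [u j] are put in front of the coordinates as [d] new ones, so that [lift_point] applies. *)
Lemma lift_family n d (z : 'I_n -> K) (u : 'I_d -> {mpoly F[n]}) g :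
  alg_indep f (fun j => mmap f z (u j)) -> mmap f z g != 0 ->
  exists2 a : {mpoly F[d]}, a != 0 & forall t : 'I_d -> F, a.@[t] != 0 ->
    exists y : 'I_n -> F, [/\ forall j, (u j).@[y] = t j, g.@[y] != 0 &
      forall p, mmap f z p = 0 -> p.@[y] = 0].
Proof.
move=> uI gz.
pose w (i : 'I_(n + d)) := if insub (i : nat) is Some j then mmap f z (u j)
  else if insub (i - d)%N is Some j then z j else 0.
have lt1 (j : 'I_d) : (j < n + d)%N by rewrite ltn_addl.
have lt2 (j : 'I_n) : (j + d < n + d)%N by rewrite ltn_add2r.
have w1 j : w (Ordinal (lt1 j)) = mmap f z (u j) by rewrite /w /= valK.
have w2 j : w (Ordinal (lt2 j)) = z j.
  by rewrite /w /= insubF ?addnK ?valK // ltnNge leq_addl.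
pose em p := p \mPo [tuple 'X_(Ordinal (lt2 j)) : {mpoly F[n + d]} | j < n].
have emw p : mmap f w (em p) = mmap f z p.
  by rewrite mmap_comp; apply: eq_mmap => // i; rewrite mmapX mmap1U w2.
have wI : alg_indep f (fun i => w (widen_ord (leq_addl n d) i)).
  move=> Q Qw; apply: uI; rewrite -[RHS]Qw; apply: eq_mmap => // j.
  by rewrite -w1; congr w; apply: val_inj.
have [|a a0 aP] := lift_point _ wI (g := em g); first by rewrite emw.
exists a => // t /aP[y [yt gy yP]]; exists (fun j => y (Ordinal (lt2 j))).
have emy p : (em p).@[y] = p.@[fun j => y (Ordinal (lt2 j))].
  by rewrite comp_mpoly_meval; apply: meval_eq => j; rewrite tnth_mktuple mevalXU.
split=> [j||p pz]; rewrite -?emy //; last by rewrite yP ?emw.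
have := yP (em (u j) - 'X_(Ordinal (lt1 j))).
rewrite mevalB mevalXU rmorphB /= emw mmapX mmap1U w1 subrr => /(_ erefl)/eqP.
by rewrite subr_eq0 => /eqP->; rewrite -yt; congr y; apply: val_inj.
Qed.

End Lift.

Lemma meval_neq0 (F : closedFieldType) n (p : {mpoly F[n]}) :
  p != 0 -> exists t, p.@[t] != 0.
Proof.
move=> p0; have P0 : is_prime [set q : {mpoly F[n]} | q = 0]%classic.
  split=> [||x y /= /eqP]; last by rewrite mulf_eq0 => /orP[]/eqP; [left|right].
    by split=> //= [x y -> ->|x y ->]; rewrite ?addr0 ?mulr0.
  by apply/eqP; rewrite oner_neq0.
have [K [f [z [zP _]]]] := kpoint P0.
have [|y py _] := @exists_point F K f n z p; last by exists y.
by apply: contraNneq p0 => /zP ->.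
Qed.

Section ChainExistence.
Variables (F : closedFieldType) (n : nat).

(** The last [u] is set equal to a constant [c], a coordinate of a point [t] to which [lift_family]
    applies. Lifting nearby points with this coordinate shows that the ideal obtained misses all
    products of powers of [g] and nonzero polynomials in the other [u]. *)
Lemma prime_above (P : set {mpoly F[n]}) d (u : 'I_d.+1 -> {mpoly F[n]}) g :
  is_prime P -> ~ P g -> indep_mod P u ->
  exists (P' : set {mpoly F[n]}) (u' : 'I_d -> {mpoly F[n]}),
    [/\ is_prime P', (P `<` P')%classic, ~ P' g & indep_mod P' u'].
Proof.
move=> pP Pg uI; have [K [f [z [zP _]]]] := kpoint pP.
have gz : mmap f z g != 0 by apply/eqP => /zP.
have [a a0 aP] := lift_family (proj1 (indep_modP u zP) uI) gz.
have [t at0] := meval_neq0 a0; pose c := t ord_max.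
pose u' j := u (widen_ord (leqnSn d) j).
pose v := u ord_max - c%:MP.
have PI : is_ideal [set x | exists y b, P y /\ x = y + b * v]%classic.
  split=> /= [|_ _ [y [b [Py ->]]] [y' [b' [Py' ->]]]|x _ [y [b [Py ->]]]].
  - by exists 0, 0; split; [exact: (ideal0 pP)|rewrite mul0r addr0].
  - exists (y + y'), (b + b'); split; first exact: (idealD pP).
    by rewrite mulrDl addrACA.
  - exists (x * y), (x * b); split; first exact: (idealM pP).
    by rewrite mulrDr mulrA.
pose a' : {mpoly F[d]} := a \mPo [tuple
  (if insub (j : nat) is Some j' then 'X_j' else c%:MP) | j < d.+1].
pose M := (fun x : {mpoly F[n]} => exists N h, h != 0 /\ x = g ^+ N * (h \mPo [tuple u' j | j < d])) : set {mpoly F[n]}.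
have [|x y [N [h [h0 ->]]] [N' [h' [h'0 ->]]]|x [y [b [Py ->]]] [N [h [h0 E]]]|
    P' [pP' IP' MP']] := @exists_prime _ _ M PI.
- by exists 0%N, 1; rewrite oner_neq0 expr0 rmorph1 mulr1.
- exists (N + N')%N, (h * h'); rewrite mulf_neq0 //; split=> //.
  by rewrite exprD rmorphM /=; ring.
- have a'0 : a' != 0.
    apply: contraTneq at0 => a'0; rewrite negbK.
    have : a'.@[fun j => t (widen_ord (leqnSn d) j)] = 0 by rewrite a'0 meval0.
    rewrite comp_mpoly_meval => <-; apply/eqP/meval_eq => j; rewrite tnth_mktuple.
    case: insubP => [j' _ jj'|]; first by rewrite mevalXU; congr t; apply: val_inj.
    rewrite -leqNgt mevalC => dj; congr t; apply: val_inj => /=.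
    by apply/eqP; rewrite eqn_leq dj -ltnS ltn_ord.
  have [s] := meval_neq0 (mulf_neq0 a'0 h0); rewrite mevalM mulf_eq0 negb_or => /andP[as0 hs0].
  pose s' (j : 'I_d.+1) := if insub (j : nat) is Some j' then s j' else c.
  have [|r [ru gr rP]] := aP s'.
    apply: contraNneq as0 => E'; rewrite comp_mpoly_meval -[X in _ == X]E'; apply/eqP.
    apply: meval_eq => j; rewrite tnth_mktuple /s'.
    by case: insubP => [j' _ _|_]; rewrite ?mevalXU ?mevalC.
  have := congr1 (meval r) E; rewrite mevalD mevalM (rP y); last exact/zP.
  have -> : v.@[r] = 0.
    by rewrite mevalB mevalC ru /s' insubF ?subrr //= ltnn.
  rewrite add0r mulr0 mevalM rmorphXn /= => /esym/eqP; rewrite mulf_eq0 expf_eq0.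
  rewrite (negPf gr) andbF orFb comp_mpoly_meval.
  rewrite (meval_eq _ (v2 := s)) ?(negPf hs0) // => j.
  rewrite tnth_mktuple ru /s' (insubT (fun i => i < d)%N) ?ltn_ord //= => lt.
  by congr s; apply: val_inj.
exists P', u'; split=> //.
- split=> [x Px|PP']; first by apply: IP'; exists x, 0; rewrite mul0r addr0.
  have /(congr1 (meval (fun=> c + 1))) : 'X_ord_max - c%:MP = 0 :> {mpoly F[d.+1]}.
    apply: uI; apply/PP'/IP'; exists 0, 1; split; first exact: (ideal0 pP).
    by rewrite rmorphB /= comp_mpolyC comp_mpolyXU -tnth_nth tnth_mktuple add0r mul1r.
  by rewrite mevalB mevalXU mevalC meval0 addrAC subrr add0r => /eqP; rewrite oner_eq0.
- by move=> /MP'; apply; exists 1%N, 1; rewrite oner_neq0 expr1 rmorph1 mulr1.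
- move=> h Ph; apply: contrapT => /eqP h0; apply: MP' Ph _.
  by exists 0%N, h; rewrite expr0 mul1r.
Qed.

Lemma exists_chain (P : set {mpoly F[n]}) d (u : 'I_d -> {mpoly F[n]}) g :
  is_prime P -> ~ P g -> indep_mod P u -> exists Q : nat -> set {mpoly F[n]},
  [/\ Q d = P, forall i, (i <= d)%N -> is_prime (Q i) /\ ~ Q i g &
      forall i, (i < d)%N -> (Q i.+1 `<` Q i)%classic].
Proof.
elim: d P u => [|d IH] P u pP Pg uI.
  by exists (fun=> P); split.
have [P' [u' [pP' PP' Pg' uI']]] := prime_above pP Pg uI.
have [Q [Qd Qp Qs]] := IH _ _ pP' Pg' uI'.
exists (fun i => if i == d.+1 then P else Q i); split; first by rewrite eqxx.
  by move=> i; rewrite leq_eqVlt; case: eqP => //= _; rewrite ltnS => /Qp.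
move=> i; rewrite ltnS => id; rewrite eqSS [i == _.+1]ltn_eqF ?ltnS //.
have [->|nid] := eqVneq i d; rewrite ?eqxx ?Qd //.
by apply: Qs; rewrite ltn_neqAle nid.
Qed.

End ChainExistence.

(** * Column triples *)

Section ConstPoly.
Variables (F K : fieldType) (f : {rmorphism F -> K}).
Hypothesis K0 : [pchar K] =i pred0.
Variable D : K -> K.
Hypothesis dD : derivation f D.

Definition cpoly (P : {poly K}) := forall i, D P`_i = 0.

Lemma cpolyC c : D c = 0 -> cpoly c%:P.
Proof. by move=> c0 i; rewrite coefC; case: eqP => // _; exact: (der0 dD). Qed.

Lemma cpolyX : cpoly 'X.
Proof. by move=> i; rewrite coefX; exact: (const_nat dD). Qed.

Lemma cpolyD P Q : cpoly P -> cpoly Q -> cpoly (P + Q).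
Proof. by move=> cP cQ i; rewrite coefD (constD dD). Qed.

Lemma cpolyN P : cpoly P -> cpoly (- P).
Proof. by move=> cP i; rewrite coefN (constN dD). Qed.

Lemma cpolyM P Q : cpoly P -> cpoly Q -> cpoly (P * Q).
Proof. by move=> cP cQ i; rewrite coefM (const_sum dD) // => j _; rewrite (constM dD). Qed.

Lemma cpolyXn P n : cpoly P -> cpoly (P ^+ n).
Proof.
move=> cP; elim: n => [|n IH]; last by rewrite exprS; exact: cpolyM.
by rewrite expr0 -[1]/(1%:P); exact/cpolyC/(der1 dD).
Qed.

Lemma moving_poly (P : {poly K}) x : cpoly P -> P.[x] = 0 -> D x != 0 -> P = 0.
Proof.
move=> cP Px Dx; apply: contrapT => /eqP P0; move/eqP: Dx; apply.
exact: (const_root K0 dD cP).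
Qed.

Lemma moving2 e2 e1 e0 x : D e2 = 0 -> D e1 = 0 -> D e0 = 0 -> D x != 0 ->
  e2 * x ^+ 2 + e1 * x + e0 = 0 -> [/\ e2 = 0, e1 = 0 & e0 = 0].
Proof.
move=> c2 c1 c0 Dx E.
have /polyP P0 : e2%:P * 'X ^+ 2 + e1%:P * 'X + e0%:P = 0.
  apply: (moving_poly _ _ Dx); last first.
    by rewrite -[RHS]E !(hornerD, hornerM, hornerC, hornerX, horner_exp).
  by do ?[apply: cpolyD|apply: cpolyM|apply: cpolyXn|exact: cpolyX|exact: cpolyC].
have := (P0 0%N, P0 1%N, P0 2%N); rewrite !(coefD, coefCM, coefX, coefXn, coefC) /=.
by rewrite !(mulr0, mulr1, addr0, add0r) => -[[-> ->] ->].
Qed.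

Lemma const2 e2 e1 e0 x : D e2 = 0 -> D e1 = 0 -> D e0 = 0 ->
  e2 * x ^+ 2 + e1 * x + e0 = 0 -> [|| e2 != 0, e1 != 0 | e0 != 0] -> D x = 0.
Proof.
move=> c2 c1 c0 E n0; apply: contrapT => /eqP Dx.
by have [z2 z1 z0] := moving2 c2 c1 c0 Dx E; move: n0; rewrite z2 z1 z0 eqxx.
Qed.

Lemma const_pair x y : D (x + y) = 0 -> D (x * y) = 0 -> D x = 0 /\ D y = 0.
Proof.
move=> Ds Dp; split; apply: (@const2 1 (- (x + y)) (x * y)); rewrite ?(der1 dD) ?oner_neq0 //.
- exact: (constN dD).
- by ring.
- exact: (constN dD).
- by ring.
Qed.

Lemma const_pairV x y : x != 0 -> y != 0 -> x + y != 0 ->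
  D (x + y) = 0 -> D (x^-1 + y^-1) = 0 -> D x = 0 /\ D y = 0.
Proof.
move=> x0 y0 xy Ds Dp; apply: const_pair => //.
have -> : x * y = (x + y) / (x^-1 + y^-1) by field; rewrite x0 y0 [y + x]addrC xy.
by apply: (constM dD) => //; exact: (constV dD).
Qed.

End ConstPoly.

Section Elimination.
Variable K : fieldType.
Implicit Types a b c X Y Z : K.

(* A column [(X, Y, Z)] of a triple whose rows have sums [a', b', c'] and sums of
   inverses [a, b, c] satisfies [p Y^2 + q Y + r = 0 = p' Y^2 + q' Y + r'] with
   the six coefficients below.  The resultant of the two in [Y] is a sextic in
   [X], namely a quadratic form in [X^3 - a' X^2] and [a X - 1] with
   coefficients [h_2, h_1, h_0]. *)
Definition qp a a' b b' c c' X := ((a' * c' - b) - 2 * c' * X) * X.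
Definition qq a a' b b' c c' X :=
  (b' * c' - a) * X ^+ 2 - 2 * a' + (a * a' + b * b' + c * c' - a' * b' * c') * X.
Definition qr a a' b b' c c' X := (a' * b' - c) - 2 * b' * X.
Definition qp' a a' b b' c c' X := ((a * b - c') * X - 2 * b) * X.
Definition qq' a a' b b' c c' X :=
  (b * c - a') - 2 * a * X ^+ 2 + (a * a' + b * b' + c * c' - a * b * c) * X.
Definition qr' a a' b b' c c' X := (a * c - b') * X - 2 * c.

Definition eI a a' b b' c c' := (b' * c' - a) * (a * b - c') - 4 * a * c'.
Definition eII a a' b b' c c' := (b' * c' - a) * (a * c - b') - 4 * a * b'.
Definition h_2 a a' b b' c c' := eI a a' b b' c c' * eII a a' b b' c c'.
Definition h_0 a a' b b' c c' := eI a' a b' b c' c * eII a' a b' b c' c.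
Definition h_1 a a' b b' c c' :=
  - a^+2*a'^+2*b*b'-a^+2*a'^+2*c*c'+a^+2*a'*b^+2*b'*c+a^+2*a'*b*c^+2*c'
  - 6*a^+2*a'*b*c-2*a^+2*b^+2*c^+2+a*a'^+2*b*b'^+2*c'+a*a'^+2*b'*c*c'^+2
  - 6*a*a'^+2*b'*c'-a*a'*b^+2*b'^+2*c*c'-a*a'*b^+2*b'^+2-a*a'*b*b'*c^+2*c'^+2
  + 14*a*a'*b*b'*c*c'-9*a*a'*b*b'-a*a'*c^+2*c'^+2-9*a*a'*c*c'+a*b^+3*b'^+2*c
  - 3*a*b^+2*b'*c+a*b*c^+3*c'^+2-3*a*b*c^+2*c'-2*a'^+2*b'^+2*c'^+2
  + a'*b^+2*b'^+3*c'-3*a'*b*b'^+2*c'+a'*b'*c^+2*c'^+3-3*a'*b'*c*c'^+2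
  - b^+3*b'^+3+9*b^+2*b'^+2-18*b*b'*c*c'-c^+3*c'^+3+9*c^+2*c'^+2.

Lemma resultant2 p q r p' q' r' Y : p * Y ^+ 2 + q * Y + r = 0 ->
  p' * Y ^+ 2 + q' * Y + r' = 0 ->
  (p * r' - p' * r) ^+ 2 - (p * q' - p' * q) * (q * r' - q' * r) = 0 :> K.
Proof.
move=> E E'; have -> : r = - (p * Y ^+ 2 + q * Y) by apply/eqP; rewrite -addr_eq0 addrC E.
have -> : r' = - (p' * Y ^+ 2 + q' * Y) by apply/eqP; rewrite -addr_eq0 addrC E'.
ring.
Qed.

Lemma sextic_resultant a a' b b' c c' X :
  let p := qp a a' b b' c c' X in let q := qq a a' b b' c c' X in
  let r := qr a a' b b' c c' X in let p' := qp' a a' b b' c c' X in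
  let q' := qq' a a' b b' c c' X in let r' := qr' a a' b b' c c' X in
  (p * r' - p' * r) ^+ 2 - (p * q' - p' * q) * (q * r' - q' * r) =
  X * (h_2 a a' b b' c c' * (X ^+ 3 - a' * X ^+ 2) ^+ 2
       - h_1 a a' b b' c c' * (X ^+ 3 - a' * X ^+ 2) * (a * X - 1)
       + h_0 a a' b b' c c' * (a * X - 1) ^+ 2).
Proof.
rewrite /= /qp /qq /qr /qp' /qq' /qr' /h_2 /h_1 /h_0 /eI /eII; ring.
Qed.

(** The third row of the triple is the inverse of the product of the other two, so that [c] is its
    sum of inverses and [c'] its sum. *)
Lemma column_relation X1 X2 X3 Y1 Y2 Y3 :
  X1 != 0 -> X2 != 0 -> X3 != 0 -> Y1 != 0 -> Y2 != 0 -> Y3 != 0 ->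
  let a := X1^-1 + X2^-1 + X3^-1 in let a' := X1 + X2 + X3 in
  let b := Y1^-1 + Y2^-1 + Y3^-1 in let b' := Y1 + Y2 + Y3 in
  let c := X1 * Y1 + X2 * Y2 + X3 * Y3 in
  let c' := (X1 * Y1)^-1 + (X2 * Y2)^-1 + (X3 * Y3)^-1 in
  qp a a' b b' c c' X1 * Y1 ^+ 2 + qq a a' b b' c c' X1 * Y1 + qr a a' b b' c c' X1 = 0 /\
  qp' a a' b b' c c' X1 * Y1 ^+ 2 + qq' a a' b b' c c' X1 * Y1 + qr' a a' b b' c c' X1 = 0.
Proof.
move=> x1 x2 x3 y1 y2 y3 /=; rewrite /qp /qq /qr /qp' /qq' /qr'.
by split; field; rewrite ?x1 ?x2 ?x3 ?y1 ?y2 ?y3.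
Qed.
End Elimination.

(** * Relations between the invariants when a whole column moves *)

Section Hexagon.
Variables (F K : fieldType) (f : {rmorphism F -> K}).
Hypothesis K0 : [pchar K] =i pred0.
Implicit Types A B C D E : K.

Lemma nat_neq0 k : k.+1%:R != 0 :> K.
Proof. by have /pcharf0P -> := K0. Qed.

(** The form taken by the vanishing of one factor of [h_2] or [h_0] in terms of the invariants, by
    [eI_rel]. *)
Definition rel3 (V P Q R S : K) := V - 3 = P / Q + R / S.

(** Transcendence degree at most one, phrased with derivations. *)
Definition spanned1 A B C D E := exists t, forall d, derivation f d -> d t = 0 ->
  [/\ d A = 0, d B = 0, d C = 0, d D = 0 & d E = 0].

Lemma spanned1_cyc A B C D E : spanned1 A B C D E -> spanned1 B C A D E.
Proof. by case=> t tP; exists t => d dd dt; have [] := tP d dd dt. Qed.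

Lemma spanned1_swap A B C D E : spanned1 A B C D E -> spanned1 A B C E D.
Proof. by case=> t tP; exists t => d dd dt; have [] := tP d dd dt. Qed.

Lemma const3 d e3 e2 e1 e0 x : derivation f d ->
  d e3 = 0 -> d e2 = 0 -> d e1 = 0 -> d e0 = 0 -> e3 != 0 ->
  e3 * x ^+ 3 + e2 * x ^+ 2 + e1 * x + e0 = 0 -> d x = 0.
Proof.
move=> dd c3 c2 c1 c0 n3 E; apply: contrapT => /eqP dx.
have /polyP/(_ 3%N) : e3%:P * 'X ^+ 3 + e2%:P * 'X ^+ 2 + e1%:P * 'X + e0%:P = 0.
  apply: (moving_poly K0 dd _ _ dx); last first.
    by rewrite -[RHS]E !(hornerD, hornerM, hornerC, hornerX, horner_exp).
  by do ?[apply: (cpolyD dd)|apply: (cpolyM dd)|apply: (cpolyXn dd)|exact: (cpolyX dd)|exact: (cpolyC dd)].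
rewrite !(coefD, coefCM, coefX, coefXn, coefC) /= !(mulr0, mulr1, addr0, add0r).
by apply/eqP.
Qed.

(** With [p = D / A], [q = D / B] and [r = D / C], two of the relations express [D] and [p] through
    [q] and [r], and the third becomes the cubic [G] for [q]; the parameter is [r]. *)
Lemma hexagon_triple A B C D E : A * B * C = D * E -> D != 0 -> E != 0 ->
  rel3 B E A D C -> rel3 C E B D A -> rel3 A E C D B -> spanned1 A B C D E.
Proof.
move=> ABC D0 E0; have : A * B * C != 0 by rewrite ABC mulf_neq0.
rewrite !mulf_eq0 !negb_or => /andP[/andP[A0 B0] C0] e1 e2 e3.
pose p := D / A; pose q := D / B; pose r := D / C.
have [p0 q0 r0] : [/\ p != 0, q != 0 & r != 0] by rewrite !mulf_neq0 ?invr_neq0.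
have AE : A = D / p by rewrite /p; field; rewrite A0 D0.
have BE : B = D / q by rewrite /q; field; rewrite B0 D0.
have CE : C = D / r by rewrite /r; field; rewrite C0 D0.
have EE : E = D ^+ 2 / (p * q * r).
  by apply: (mulfI D0); rewrite -ABC AE BE CE; field; rewrite p0 q0 r0.
clearbody p q r; subst A B C E; clear ABC E0 A0 B0 C0.
have x1 : D * (r - 1) = q * r * (r + 3).
  apply/eqP; rewrite -subr_eq0; apply/eqP; rewrite -(mulr0 (q * r)).
  move/eqP: e1; rewrite -subr_eq0 => /eqP <-; field; rewrite ?p0 ?q0 ?r0 ?D0 //.
have x2 : D * (p - 1) = p * r * (p + 3).
  apply/eqP; rewrite -subr_eq0; apply/eqP; rewrite -(mulr0 (p * r)).
  move/eqP: e2; rewrite -subr_eq0 => /eqP <-; field; rewrite ?p0 ?q0 ?r0 ?D0 //.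
have x3 : D * (q - 1) = p * q * (q + 3).
  apply/eqP; rewrite -subr_eq0; apply/eqP; rewrite -(mulr0 (p * q)).
  move/eqP: e3; rewrite -subr_eq0 => /eqP <-; field; rewrite ?p0 ?q0 ?r0 ?D0 //.
have one (u v : K) : u != 0 -> D * (u - 1) = v * u * (u + 3) -> v != 0 -> (u - 1 != 0) && (u + 3 != 0).
  move=> u0 uv v0.
  have u1 : u - 1 != 0.
    apply/eqP => u1; move/eqP: uv; rewrite u1 mulr0 eq_sym !mulf_eq0 (negPf u0) (negPf v0) /=.
    have -> : u + 3 = (u - 1) + 4 by ring.
    by rewrite u1 add0r (negPf (nat_neq0 3)).
  rewrite u1; apply: contraNneq u1 => u3; move/eqP: uv.
  by rewrite u3 mulr0 mulf_eq0 (negPf D0).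
have /andP[r1 r3] := one r q r0 x1 q0.
have /andP[q1 q3] := one q p q0 x3 p0.
have DE : D = q * r * (r + 3) / (r - 1) by rewrite -x1; field.
have pE : p = r * (r + 3) * (q - 1) / ((q + 3) * (r - 1)).
  have : p * q * (q + 3) = q * r * (r + 3) / (r - 1) * (q - 1) by rewrite -x3 {1}DE.
  move=> pq; have -> : p = (p * q * (q + 3)) / (q * (q + 3)) by field; rewrite q0 q3.
  by rewrite pq; field; rewrite q3 r1 q0.
have y2 : q * (q + 3) * (p - 1) = r * (p + 3) * (q - 1).
  apply: (mulfI (mulf_neq0 p0 D0)).
  have -> : p * D * (q * (q + 3) * (p - 1)) = (p * q * (q + 3)) * (D * (p - 1)) by ring.
  by rewrite -x3 x2; ring.
have G : (r + 1) ^+ 2 * q ^+ 3 +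
   (3 * (r + 1) ^+ 2 - (r + 1) * (r * (r + 3) + 3 * (r - 1))) * q ^+ 2 +
   (r * ((r * (r + 3) - 9 * (r - 1)) + (r * (r + 3) + 3 * (r - 1)))
     - 3 * (r * (r + 3) + 3 * (r - 1))) * q
   - r * (r * (r + 3) - 9 * (r - 1)) = 0.
  move/eqP: y2; rewrite -subr_eq0 => /eqP y2.
  rewrite -[RHS](mul0r ((q + 3) * (r - 1))) -y2 pE; field; rewrite ?q3 ?r1 //.
exists r => d dd dr.
have dq : d q = 0.
  (* The leading coefficient of [G] vanishes only for [r = -1], where [G] reduces to
     [16 * (q + 1) = 0]. *)
  have [re|re] := eqVneq (r + 1) 0; last first.
    by apply: (const3 dd _ _ _ _ _ G); rewrite ?expf_neq0 //; const dd.
  have rE : r = -1 by apply/eqP; rewrite -addr_eq0 re.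
  have : 16 * (q + 1) = 0 by rewrite -[RHS]G rE; ring.
  move/eqP; rewrite mulf_eq0 (negPf (nat_neq0 15)) /= addr_eq0 => /eqP ->.
  by const dd.
have dp : d p = 0 by rewrite pE; const dd.
have dD : d D = 0 by rewrite DE; const dd.
by split; const dd.
Qed.

(** The differences of the relations factor: either [A = B = C], or [D = E] and then [B = C], the
    other factor [D = B * C] leading to [-4 = 0]. In both cases [key] expresses [B] through
    [s = D / B]. *)
Lemma hexagon_quad A B C D E : A * B * C = D * E -> D != 0 -> E != 0 ->
  rel3 B E A D C -> rel3 B D A E C -> rel3 C E A D B -> rel3 C D A E B ->
  spanned1 A B C D E.
Proof.
move=> ABC D0 E0; have : A * B * C != 0 by rewrite ABC mulf_neq0.
rewrite !mulf_eq0 !negb_or => /andP[/andP[A0 B0] C0]; rewrite /rel3 => e1 e1' e2 e2'.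
have key (s B' : K) : s != 0 -> B' != 0 -> B' - 3 = B' / s + s -> (s - 1 != 0) /\ B' = s * (s + 3) / (s - 1).
  move=> s0 B'0 E1; have s1 : s - 1 != 0.
    apply/eqP => s1; have sE : s = 1 by apply/eqP; rewrite -subr_eq0 s1.
    move/eqP: E1; rewrite sE divr1 -subr_eq0.
    have -> : B' - 3 - (B' + 1) = - 4 by ring.
    by rewrite oppr_eq0 (negPf (nat_neq0 3)).
  split=> //; have -> : s * (s + 3) = B' * (s - 1).
    move/eqP: E1; rewrite -subr_eq0 => /eqP E1; apply/eqP; rewrite -subr_eq0; apply/eqP.
    rewrite -[RHS](mulr0 (- s)) -E1; field; exact: s0.
  by field.
have h1 : (E - D) * (A^-1 - C^-1) = 0.
  have -> : (E - D) * (A^-1 - C^-1) = (E / A + D / C) - (D / A + E / C) by ring.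
  by rewrite -e1 -e1' subrr.
have h2 : (E - D) * (A^-1 - B^-1) = 0.
  have -> : (E - D) * (A^-1 - B^-1) = (E / A + D / B) - (D / A + E / B) by ring.
  by rewrite -e2 -e2' subrr.
have [ED|ED] := eqVneq (E - D) 0; last first.
  have : A = C /\ A = B.
    by split; apply: invr_inj; apply/eqP; rewrite -subr_eq0;
      [move/eqP: h1|move/eqP: h2]; rewrite mulf_eq0 (negPf ED).
  case=> AC AB; subst B C; pose s := D / A.
  have s0 : s != 0 by rewrite mulf_neq0 ?invr_neq0.
  have DE : D = s * A by rewrite /s; field.
  have EE : E = A ^+ 2 / s.
    by apply: (mulfI D0); rewrite -ABC DE; field.
  have [|s1 AE] := key s A s0 A0; first by rewrite e1 EE DE; field; rewrite A0 s0.
  exists s => d dd ds; have dA : d A = 0 by rewrite AE; const dd.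
  by split=> //; rewrite ?EE ?DE; const dd.
have EE : E = D by apply/eqP; rewrite -subr_eq0 ED.
subst E; clear h1 h2 ED e1' e2'.
have : (B - C) * (1 - D / (B * C)) = 0.
  have -> : (B - C) * (1 - D / (B * C)) = (B - 3 - (D / A + D / C)) - (C - 3 - (D / A + D / B)).
    by field; rewrite A0 B0 C0.
  by rewrite e1 e2 !subrr.
move/eqP; rewrite mulf_eq0 subr_eq0 => /orP[/eqP BC|]; last first.
  rewrite subr_eq0 eq_sym => /eqP DBC.
  have DE : D = B * C by rewrite -[RHS]mul1r -DBC; field; rewrite B0 C0.
  have DA : D = A.
    by apply: (mulfI D0); rewrite -ABC {1}DE; ring.
  move/eqP: e1; rewrite -DA DE divff ?mulf_neq0 // mulfK // -subr_eq0.
  have -> : B - 3 - (1 + B) = -4 by ring.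
  by rewrite oppr_eq0 (negPf (nat_neq0 3)).
subst C; pose s := D / B.
have s0 : s != 0 by rewrite mulf_neq0 ?invr_neq0.
have DE : D = s * B by rewrite /s; field.
have AE : A = s ^+ 2.
  by apply: (mulIf (mulf_neq0 B0 B0)); rewrite mulrA ABC DE; ring.
have [|s1 BE] := key s B s0 B0; first by rewrite e1 AE DE; field; rewrite s0 B0.
exists s => d dd ds; have dB : d B = 0 by rewrite BE; const dd.
by split=> //; rewrite ?AE ?DE; const dd.
Qed.

(** Up to [sym] only six relations occur, each in two of the six disjunctions: they are the edges of
    a hexagon whose vertices are the disjunctions. A set of edges that meets all the vertices
    contains three alternate edges, as in [hexagon_triple], or all but two opposite edges, as in
    [hexagon_quad]; there are two sets of the first kind and three of the second. *)
Lemma hexagon A B C D E : A * B * C = D * E -> D != 0 -> E != 0 ->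
  rel3 B E A D C \/ rel3 C E A D B -> rel3 B D A E C \/ rel3 C D A E B ->
  rel3 C E B D A \/ rel3 A E B D C -> rel3 C D B E A \/ rel3 A D B E C ->
  rel3 A E C D B \/ rel3 B E C D A -> rel3 A D C E B \/ rel3 B D C E A ->
  spanned1 A B C D E.
Proof.
move=> ABC D0 E0.
have sym V P Q R S : rel3 V P Q R S -> rel3 V R S P Q by rewrite /rel3 [P / Q + _]addrC.
have BCA : B * C * A = D * E by rewrite -ABC; ring.
have CAB : C * A * B = D * E by rewrite -ABC; ring.
have ABC' : A * B * C = E * D by rewrite ABC mulrC.
have T1 := hexagon_triple ABC D0 E0.
have T2 := hexagon_triple ABC' E0 D0.
have Q1 := hexagon_quad ABC D0 E0.
have Q2 := hexagon_quad BCA D0 E0.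
have Q3 := hexagon_quad CAB D0 E0.
have S1 := @spanned1_swap A B C E D.
have S2 := @spanned1_cyc B C A D E; have S2' := @spanned1_cyc C A B D E.
have y1 := sym B E A D C; have y1' := sym B D A E C; have y2 := sym C E A D B.
have y2' := sym C D A E B; have y3 := sym A E B D C; have y3' := sym A D B E C.
have z1 := sym B D C E A; have z1' := sym B E C D A; have z2 := sym C D B E A.
have z2' := sym C E B D A; have z3 := sym A D C E B; have z3' := sym A E C D B.
clear -T1 T2 Q1 Q2 Q3 S1 S2 S2' y1 y1' y2 y2' y3 y3' z1 z1' z2 z2' z3 z3'.
tauto.
Qed.

End Hexagon.

Lemma ord3_ind (P : 'I_3 -> Prop) : P 0 -> P 1 -> P (1 + 1) -> forall i, P i.
Proof.
move=> P0 P1 P2 [[|[|[|//]]] ip].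
- by rewrite (_ : Ordinal ip = 0) //; apply: val_inj.
- by rewrite (_ : Ordinal ip = 1) //; apply: val_inj.
- by rewrite (_ : Ordinal ip = 1 + 1) //; apply: val_inj.
Qed.

Lemma ord3_cycle (i : 'I_3) : i + 1 + 1 + 1 = i.
Proof. by rewrite -!addrA (_ : 1 + (1 + 1) = 0) ?addr0 //; apply: val_inj. Qed.

Lemma ord3_orbit (P : 'I_3 -> Prop) i : P i -> P (i + 1) -> P (i + 1 + 1) -> forall k, P k.
Proof.
have c3 : 1 + 1 + 1 = 0 :> 'I_3 by apply: val_inj.
move: i; apply: ord3_ind; rewrite ?add0r => p q r; apply: ord3_ind => //; move: p q r;
  by rewrite ?c3 ?add0r.
Qed.

Lemma ord3_big (R : Type) (idx : R) (op : Monoid.com_law idx) (g : 'I_3 -> R) j :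
  \big[op/idx]_k g k = op (op (g j) (g (j + 1))) (g (j + 1 + 1)).
Proof.
have E : \big[op/idx]_k g k = op (op (g 0) (g 1)) (g (1 + 1)).
  rewrite !big_ord_recl big_ord0 Monoid.mulm1 Monoid.mulmA.
  have -> : lift ord0 ord0 = 1 :> 'I_3 by apply: val_inj.
  by have -> : lift ord0 (lift ord0 ord0) = 1 + 1 :> 'I_3 by apply: val_inj.
have c3 : 1 + 1 + 1 = 0 :> 'I_3 by apply: val_inj.
rewrite E; move: j; apply: ord3_ind; rewrite ?add0r ?c3 ?add0r //.
  by rewrite [RHS]Monoid.mulmC Monoid.mulmA.
by rewrite Monoid.mulmC Monoid.mulmA.
Qed.

Section Triple.
Variables (F K : fieldType) (f : {rmorphism F -> K}).
Hypothesis K0 : [pchar K] =i pred0.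
Implicit Types (T : 'I_3 -> 'I_3 -> K) (d : K -> K) (i j : 'I_3).

(* With [p_i = u_i alpha_i], [q_j = v_j beta_j] and [a_ij = alpha_i v_j], a
   triple holds the ratios [T i j = a_(i+1)j / a_ij], [i] being cyclic. *)
Definition is_triple T := forall j, \prod_i T i j = 1.
Definition sumV T i := \sum_j (T i j)^-1.
Definition sum T i := \sum_j T i j.
Definition kills d T := forall i j, d (T i j) = 0.
Definition kills_sums d T := forall i, d (sumV T i) = 0 /\ d (sum T i) = 0.
Definition at6 (h : K -> K -> K -> K -> K -> K -> K) T i :=
  h (sumV T i) (sum T i) (sumV T (i + 1)) (sum T (i + 1)) (sumV T (i + 1 + 1)) (sum T (i + 1 + 1)).
Definition spannedT T := exists t, forall d, derivation f d -> d t = 0 ->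
  [/\ forall i, d (sumV T i * sum T i) = 0, d (\prod_i sumV T i) = 0 & d (\prod_i sum T i) = 0].

Lemma triple_row T i j : is_triple T -> T i j * T (i + 1) j * T (i + 1 + 1) j = 1.
Proof. by move=> tT; rewrite -(tT j) (ord3_big _ _ i). Qed.

Lemma triple_neq0 T i j : is_triple T -> T i j != 0.
Proof.
move=> tT; apply: contraTneq (oner_neq0 K) => Tij; rewrite negbK -(triple_row i j tT).
by rewrite Tij !mul0r.
Qed.

Lemma triple_third T i j : is_triple T -> T (i + 1 + 1) j = (T i j * T (i + 1) j)^-1.
Proof.
move=> tT; rewrite -[RHS]mulr1 -(triple_row i j tT) mulKf //.
by rewrite mulf_neq0 ?triple_neq0.
Qed.

Lemma column_eqs T i j : is_triple T ->
  let h q := at6 (fun a a' b b' c c' => q a a' b b' c c' (T i j)) T i in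
  h (@qp K) * T (i + 1) j ^+ 2 + h (@qq K) * T (i + 1) j + h (@qr K) = 0 /\
  h (@qp' K) * T (i + 1) j ^+ 2 + h (@qq' K) * T (i + 1) j + h (@qr' K) = 0.
Proof.
move=> tT /=; have n k l := triple_neq0 k l tT.
have := column_relation (n i j) (n i (j + 1)) (n i (j + 1 + 1))
  (n (i + 1) j) (n (i + 1) (j + 1)) (n (i + 1) (j + 1 + 1)).
have cE : sumV T (i + 1 + 1) = \sum_k T i k * T (i + 1) k.
  by apply: eq_bigr => k _; rewrite triple_third // invrK.
have cE' : sum T (i + 1 + 1) = \sum_k (T i k * T (i + 1) k)^-1.
  by apply: eq_bigr => k _; rewrite triple_third.
rewrite /at6 cE cE' /sumV /sum; do 6 rewrite (ord3_big _ _ j).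
exact.
Qed.

(** * Derivations that kill the sums of a triple but not the triple *)

Section Moving.
Variables (T : 'I_3 -> 'I_3 -> K) (d : K -> K).
Hypotheses (tT : is_triple T) (dd : derivation f d) (dT : kills_sums d T).

Let n i j : T i j != 0. Proof. exact: triple_neq0. Qed.
Let s0 i : d (sumV T i) = 0. Proof. by have [] := dT i. Qed.
Let s1 i : d (sum T i) = 0. Proof. by have [] := dT i. Qed.

(** A moving entry is a root of the sextic, which has constant coefficients, so the sextic is zero.
    Its three coefficients are separated because [F0] vanishes at 0 and [F1] does not. *)
Lemma moving_sextic i j : d (T i j) != 0 ->
  [/\ at6 (@h_2 K) T i = 0, at6 (@h_1 K) T i = 0 & at6 (@h_0 K) T i = 0].
Proof.
move=> dX; have [E E'] := column_eqs i j tT; have := resultant2 E E'.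
rewrite {E E'} /at6 sextic_resultant => /eqP; rewrite mulf_eq0 (negPf (n i j)) /= => /eqP.
set h2 := h_2 _ _ _ _ _ _; set h1 := h_1 _ _ _ _ _ _; set h0 := h_0 _ _ _ _ _ _.
set a := sumV T i; set a' := sum T i => E.
have c2 : d h2 = 0 by rewrite /h2 /h_2 /eI /eII; const dd.
have c1 : d h1 = 0 by rewrite /h1 /h_1; const dd.
have c0 : d h0 = 0 by rewrite /h0 /h_0 /eI /eII; const dd.
pose F0 : {poly K} := 'X ^+ 3 - a'%:P * 'X ^+ 2; pose F1 : {poly K} := a%:P * 'X - 1%:P.
have P0 : h2%:P * F0 ^+ 2 - h1%:P * F0 * F1 + h0%:P * F1 ^+ 2 = 0.
  apply: (moving_poly K0 dd _ _ dX); last first.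
    by rewrite -[RHS]E /F0 /F1 !(hornerD, hornerN, hornerM, hornerC, hornerX, horner_exp).
  have s0' : d a = 0 := s0 i. have s1' : d a' = 0 := s1 i.
  rewrite /F0 /F1.
  do ?[apply: (cpolyD dd)|apply: (cpolyN dd)|apply: (cpolyM dd)|apply: (cpolyXn dd)
      |exact: (cpolyX dd)|apply: (cpolyC dd)]; const dd.
have F00 : F0.[0] = 0.
  by rewrite /F0 !(hornerD, hornerN, hornerM, hornerC, hornerX, horner_exp); ring.
have F10 : F1.[0] = -1.
  by rewrite /F1 !(hornerD, hornerN, hornerM, hornerC, hornerX, horner_exp); ring.
have F0n : F0 != 0.
  apply/eqP => /polyP/(_ 3%N); rewrite /F0 !(coefB, coefCM, coefXn, coef0) /=.
  by rewrite mulr0 subr0 => /eqP; rewrite oner_eq0.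
clearbody F0 F1.
have h00 : h0 = 0.
  have := congr1 (horner^~ 0) P0.
  rewrite /= !(hornerD, hornerN, hornerM, hornerC, horner_exp) F00 F10 ?horner0 => <-; ring.
have P1 : h2%:P * F0 - h1%:P * F1 = 0.
  by apply: (mulfI F0n); rewrite mulr0 -P0 h00; ring.
have h10 : h1 = 0.
  have := congr1 (horner^~ 0) P1.
  rewrite /= !(hornerD, hornerN, hornerM, hornerC, horner_exp) F00 F10 ?horner0 => <-; ring.
split=> //; move/eqP: P1; rewrite h10 polyC0 mul0r subr0 mulf_eq0 (negPf F0n) orbF.
by rewrite polyC_eq0 => /eqP.
Qed.

(** The product of a column is 1, so one moving entry entails another; of two rows, one follows the
    other cyclically. *)
Lemma two_moving i0 j : d (T i0 j) != 0 ->
  exists i, d (T i j) != 0 /\ d (T (i + 1 + 1) j) != 0.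
Proof.
move=> d0; have [d2|] := eqVneq (d (T (i0 + 1 + 1) j)) 0; last by exists i0.
have [d1|d1] := eqVneq (d (T (i0 + 1) j)) 0.
  case/eqP: d0; have := triple_third (i0 + 1) j tT; rewrite ord3_cycle => ->.
  by const dd.
by exists (i0 + 1); rewrite ord3_cycle.
Qed.

(** The triples with given sums form at most a curve, with parameter [T i j]. That [d] moves two
    entries ensures that the quadratic for the third entry of the column does not degenerate and
    that the other two entries of a moving row are not opposite; all entries are then algebraic over
    the parameter. *)
Lemma moving_column i j : d (T i j) != 0 -> d (T (i + 1 + 1) j) != 0 ->
  sum T (i + 1 + 1) != 0 ->
  forall e, derivation f e -> kills_sums e T -> e (T i j) = 0 -> kills e T.
Proof.
move=> dX dZ c'0 e de eT eX.
have t0 k : e (sumV T k) = 0 by have [] := eT k.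
have t1 k : e (sum T k) = 0 by have [] := eT k.
have eY : e (T (i + 1) j) = 0.
  have [E _] := column_eqs i j tT; move: E; rewrite /at6 /= => E.
  apply: (const2 K0 de _ _ _ E).
  - by rewrite /qp; const de.
  - by rewrite /qq; const de.
  - by rewrite /qr; const de.
  apply/orP; left; rewrite /qp mulf_neq0 ?n //; apply: contraNneq dX => /eqP.
  rewrite subr_eq0 => /eqP E'.
  have -> : T i j = (sum T i * sum T (i + 1 + 1) - sumV T (i + 1)) / (2 * sum T (i + 1 + 1)).
    by rewrite E' mulrC mulKf // mulf_neq0 // (nat_neq0 K0 1).
  by apply/eqP; const dd.
have eZ : e (T (i + 1 + 1) j) = 0 by rewrite triple_third //; const de.
have row k : e (T k j) = 0 -> d (T k j) != 0 -> forall l, e (T k l) = 0.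
  move=> ek dk; have := t0 k; have := t1 k; rewrite /sumV /sum !(ord3_big _ _ j) => es eV.
  have [|||e1 e2] := const_pairV K0 de (n k (j + 1)) (n k (j + 1 + 1)).
  - apply: contraNneq dk => sk.
    have -> : T k j = sum T k by rewrite /sum (ord3_big _ _ j) /= -addrA sk addr0.
    by rewrite s1.
  - have -> : T k (j + 1) + T k (j + 1 + 1) = (T k j + T k (j + 1) + T k (j + 1 + 1)) - T k j by ring.
    by const de.
  - have -> : (T k (j + 1))^-1 + (T k (j + 1 + 1))^-1 =
      ((T k j)^-1 + (T k (j + 1))^-1 + (T k (j + 1 + 1))^-1) - (T k j)^-1 by ring.
    by const de.
  exact: (@ord3_orbit _ j).
have r0 := row _ eX dX; have r2 := row _ eZ dZ.
move=> k l; move: k; apply: (@ord3_orbit _ i) => //.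
have -> : T (i + 1) l = (T i l * T (i + 1 + 1) l)^-1.
  have := triple_third (i + 1 + 1) l tT; rewrite !ord3_cycle => ->.
  by rewrite mulrC.
by const de.
Qed.

(** When [y] is constant, the two quadratics become polynomials in the moving entry with constant
    coefficients, and these coefficients all vanish. *)
Lemma moving_const i j : d (T i j) != 0 -> d (T (i + 1) j) = 0 ->
  let a := sumV T i in let a' := sum T i in let b := sumV T (i + 1) in
  let b' := sum T (i + 1) in let c := sumV T (i + 1 + 1) in
  let c' := sum T (i + 1 + 1) in let y := T (i + 1) j in let k := b' - 2 * y in
  [/\ a = c' * k, c = a' * k, c' * ((k * b - 1) * y - 2 * k) = 0 &
     (a' * c' - b) * y ^+ 2 + (a * a' + b * b' + c * c' - a' * b' * c') * y - 2 * b' = 0].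
Proof.
move=> dX dY; have [E E'] := column_eqs i j tT; move: E E'; rewrite /at6 /=.
have := s0 (i + 1 + 1); have := s0 (i + 1); have := s0 i.
have := s1 (i + 1 + 1); have := s1 (i + 1); have := s1 i.
have := n (i + 1) j; move: dX dY; move: (T i j) (T (i + 1) j) => X y.
move: (sumV T i) (sumV T (i + 1)) (sumV T (i + 1 + 1)) => a b c.
move: (sum T i) (sum T (i + 1)) (sum T (i + 1 + 1)) => a' b' c' dX dy y0 ka' kb' kc' ka kb kc.
rewrite /qp /qq /qr /qp' /qq' /qr' => E E'.
have [|||||e2 e1 e0] := @moving2 _ _ _ K0 _ dd (- 2 * c' * y ^+ 2 + (b' * c' - a) * y)
  ((a' * c' - b) * y ^+ 2 + (a * a' + b * b' + c * c' - a' * b' * c') * y - 2 * b')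
  (- 2 * a' * y + (a' * b' - c)) X; try by const dd.
  by rewrite -[RHS]E; ring.
have [|||||e2' e1' e0'] := @moving2 _ _ _ K0 _ dd ((a * b - c') * y ^+ 2 - 2 * a * y)
  (- 2 * b * y ^+ 2 + (a * a' + b * b' + c * c' - a * b * c) * y + (a * c - b'))
  ((b * c - a') * y - 2 * c) X; try by const dd.
  by rewrite -[RHS]E'; ring.
have aE : a = c' * (b' - 2 * y).
  apply: (mulIf y0); apply/eqP; rewrite -subr_eq0; apply/eqP.
  by rewrite -[RHS]oppr0 -e2; ring.
split=> //.
  by apply/eqP; rewrite -subr_eq0; apply/eqP; rewrite -[RHS]oppr0 -e0; ring.
by apply: (mulIf y0); rewrite mul0r -e2' aE; ring.
Qed.

End Moving.
End Triple.

(** * Triples without vanishing sums *)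

Section Fibres.
Variables (F K : fieldType) (f : {rmorphism F -> K}).
Hypothesis K0 : [pchar K] =i pred0.
Implicit Types (T : 'I_3 -> 'I_3 -> K) (d : K -> K) (i j : 'I_3).

Definition invA T i := sumV T i * sum T i.
Definition invD T := \prod_i sumV T i.
Definition invE T := \prod_i sum T i.
Definition full T := forall i, sumV T i != 0 /\ sum T i != 0.

Lemma spannedT_row T i :
  spanned1 f (invA T i) (invA T (i + 1)) (invA T (i + 1 + 1)) (invD T) (invE T) ->
  spannedT f T.
Proof.
case=> t tP; exists t => d dd dt; have [d0 d1 d2 d3 d4] := tP d dd dt.
by split=> //; exact: (@ord3_orbit _ i).
Qed.

Lemma eI_rel (a a' b b' c c' : K) : a != 0 -> a' != 0 -> b != 0 -> b' != 0 ->
  c != 0 -> c' != 0 -> h_2 a a' b b' c c' = 0 ->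
  rel3 (b * b') (a' * b' * c') (a * a') (a * b * c) (c * c') \/
  rel3 (c * c') (a' * b' * c') (a * a') (a * b * c) (b * b').
Proof.
move=> a0 a0' b0 b0' c0 c0' /eqP; rewrite mulf_eq0 => /orP[]/eqP E; [left|right];
  apply/eqP; rewrite -subr_eq0; apply/eqP.
  apply: (mulfI (mulf_neq0 a0 c0')); rewrite mulr0 -E /eI.
  by field; rewrite a0 a0' c0 c0'.
apply: (mulfI (mulf_neq0 a0 b0')); rewrite mulr0 -E /eII.
by field; rewrite a0 a0' b0 b0'.
Qed.

(** After elimination of [a], [b], [b'] and [c] the last equation factors. If [k = y], the parameter
    is [c' * y * a']; if [a' * c' * k = 1], it is [k / y]. *)
Lemma const_case (a a' b b' c c' y : K) : y != 0 -> a != 0 -> a' != 0 ->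
  let k := b' - 2 * y in
  a = c' * k -> c = a' * k -> c' * ((k * b - 1) * y - 2 * k) = 0 ->
  (a' * c' - b) * y ^+ 2 + (a * a' + b * b' + c * c' - a' * b' * c') * y - 2 * b' = 0 ->
  spanned1 f (a * a') (b * b') (c * c') (a * b * c) (a' * b' * c').
Proof.
move=> y0 a0 a0' k aE cE /eqP; have : a != 0 by [].
rewrite {1}aE mulf_eq0 negb_or => /andP[c0' k0] E1 E2; move: E1; rewrite mulf_eq0 (negPf c0') /= => /eqP E1.
have bE : b = k^-1 + 2 / y.
  apply: (mulfI (mulf_neq0 k0 y0)); apply/eqP; rewrite -subr_eq0; apply/eqP.
  by rewrite -[RHS]E1; field; rewrite k0 y0.
have bE' : b' = k + 2 * y by rewrite /k subrK.
clearbody k; subst a b b' c.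
have : (k - y) * (a' * c' * k - 1) = 0.
  apply: (mulfI (mulf_neq0 y0 (invr_neq0 k0))); rewrite mulr0 -[RHS]E2.
  by field; rewrite k0 y0.
move/eqP; rewrite mulf_eq0 => /orP[]; rewrite subr_eq0 => /eqP E.
  subst k; exists (c' * y * a') => d dd dt.
  have e1 : (y^-1 + 2 / y) * (y + 2 * y) = 9 by field.
  have e2 : a' * y * c' = c' * y * a' by ring.
  have e3 : c' * y * (y^-1 + 2 / y) * (a' * y) = 3 * (c' * y * a') by field.
  have e4 : a' * (y + 2 * y) * c' = 3 * (c' * y * a') by ring.
  by rewrite e1 e2 e3 e4; split; const dd.
exists (k / y) => d dd dt.
have e0 : c' * k * a' = 1 by rewrite -E; ring.
have e1 : (k^-1 + 2 / y) * (k + 2 * y) = 5 + 2 * (k / y + (k / y)^-1).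
  by field; rewrite k0 y0.
have e2 : a' * k * c' = 1 by rewrite -E; ring.
have e3 : c' * k * (k^-1 + 2 / y) * (a' * k) = 1 + 2 * (k / y).
  have -> : 1 + 2 * (k / y) = (c' * k * a') * (1 + 2 * (k / y)) by rewrite e0 mul1r.
  by field; rewrite k0 y0.
have e4 : a' * (k + 2 * y) * c' = 1 + 2 * (k / y)^-1.
  have -> : 1 + 2 * (k / y)^-1 = (c' * k * a') * (1 + 2 * (k / y)^-1) by rewrite e0 mul1r.
  by field; rewrite k0 y0.
by rewrite e0 e1 e2 e3 e4; split; const dd.
Qed.

Lemma const_case0 (a a' b b' c c' y : K) : y != 0 -> b = 0 -> c' != 0 ->
  let k := b' - 2 * y in
  a = c' * k -> c = a' * k -> c' * ((k * b - 1) * y - 2 * k) = 0 ->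
  (a' * c' - b) * y ^+ 2 + (a * a' + b * b' + c * c' - a' * b' * c') * y - 2 * b' = 0 ->
  [/\ a * a' = 1, c * c' = 1 & a' * b' * c' = - 3].
Proof.
move=> y0 b0 c0' k aE cE /eqP; rewrite mulf_eq0 (negPf c0') b0 /= => /eqP E1 E2.
have yE : y = - 2 * k.
  by apply/eqP; rewrite -subr_eq0; apply/eqP; rewrite -[RHS]oppr0 -E1; ring.
have bE' : b' = - 3 * k by rewrite -[LHS](subrK (2 * y)) -/k yE; ring.
have k0 : k != 0 by apply: contraNneq y0 => k0; rewrite yE k0 mulr0.
clearbody k; have mk : a' * c' * k = 1.
  apply/eqP; rewrite -subr_eq0; apply/eqP; apply: (mulfI (mulf_neq0 (nat_neq0 K0 5) k0)).
  by rewrite mulr0 -[RHS]oppr0 -E2 aE cE ?b0 bE' yE; ring.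
split.
- by rewrite aE -[RHS]mk; ring.
- by rewrite cE -[RHS]mk; ring.
have -> : a' * b' * c' = - 3 * (a' * c' * k) by rewrite bE'; ring.
by rewrite mk mulr1.
Qed.

(** Infinite fibres occur over a one-parameter family of invariants only: by [const_case] if the
    third entry of the moving column is constant, by [hexagon] if all three entries move. The
    element [u] is a parameter along the fibre. *)
Lemma moving_span T d i0 j : is_triple T -> full T -> derivation f d -> kills_sums d T ->
  d (T i0 j) != 0 -> spannedT f T /\
  exists u, forall e, derivation f e -> kills_sums e T -> e u = 0 -> kills e T.
Proof.
move=> tT fT dd dT dm; have [i [dX dZ]] := two_moving tT dd dm.
have u1 k := (fT k).1; have u2 k := (fT k).2.
split; last first.
  by exists (T i j) => e de eT eu; apply: (moving_column K0 tT dd dT dX dZ _ de eT eu).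
apply: (@spannedT_row _ i); rewrite /invD /invE !(ord3_big _ _ i) /=.
have [dY|dY] := eqVneq (d (T (i + 1) j)) 0.
  have [e1 e2 e3 e4] := moving_const K0 tT dd dT dX dY.
  exact: (const_case (triple_neq0 _ _ tT) _ _ e1 e2 e3 e4).
have rels k : d (T k j) != 0 ->
    (rel3 (invA T (k + 1)) (\prod_i sum T i) (invA T k) (\prod_i sumV T i) (invA T (k + 1 + 1)) \/
     rel3 (invA T (k + 1 + 1)) (\prod_i sum T i) (invA T k) (\prod_i sumV T i) (invA T (k + 1))) /\
    (rel3 (invA T (k + 1)) (\prod_i sumV T i) (invA T k) (\prod_i sum T i) (invA T (k + 1 + 1)) \/
     rel3 (invA T (k + 1 + 1)) (\prod_i sumV T i) (invA T k) (\prod_i sum T i) (invA T (k + 1))).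
  move=> dk; have [E2 _ E0] := moving_sextic K0 tT dd dT dk.
  rewrite !(ord3_big _ _ k) /= /invA; split; first exact: eI_rel.
  have := eI_rel (u2 k) (u1 k) (u2 (k + 1)) (u1 (k + 1)) (u2 (k + 1 + 1)) (u1 (k + 1 + 1)) E0.
  by rewrite ![sum T _ * sumV T _]mulrC.
have [r1 r1'] := rels _ dX; have [r2 r2'] := rels _ dY; have [r3 r3'] := rels _ dZ.
rewrite ?ord3_cycle in r2 r2' r3 r3'; rewrite !(ord3_big _ _ i) /= in r1 r1' r2 r2' r3 r3'.
apply: (@hexagon _ _ f K0 _ _ _ _ _ _ _ _ r1 r1' r2 r2' r3 r3').
- by rewrite /invA; ring.
- by rewrite !mulf_neq0.
- by rewrite !mulf_neq0.
Qed.

(** The vectors [alpha_i] are defined up to scalars; on the ratios of a triple this amounts to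
    factors [l i] of product 1. *)
Definition rescale (l : 'I_3 -> K) T i j := l i * T i j.

Section Rescale.
Variables (l : 'I_3 -> K) (T : 'I_3 -> 'I_3 -> K).
Hypothesis l1 : \prod_i l i = 1.

Lemma rescale_neq0 i : l i != 0.
Proof.
apply: contraTneq (oner_neq0 K) => li; rewrite negbK -l1 (ord3_big _ _ i) /= li.
by rewrite !mul0r.
Qed.

Lemma rescale_triple : is_triple T -> is_triple (rescale l T).
Proof. by move=> tT j; rewrite big_split /= l1 mul1r tT. Qed.

Lemma sumV_rescale i : sumV (rescale l T) i = sumV T i / l i.
Proof. by rewrite /sumV mulr_suml; apply: eq_bigr => j _; rewrite invfM mulrC. Qed.

Lemma sum_rescale i : sum (rescale l T) i = l i * sum T i.
Proof. by rewrite /sum mulr_sumr. Qed.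

Lemma invA_rescale i : invA (rescale l T) i = invA T i.
Proof.
by rewrite /invA sumV_rescale sum_rescale mulrA divfK // rescale_neq0.
Qed.

Lemma invE_rescale : invE (rescale l T) = invE T.
Proof.
by rewrite /invE (eq_bigr _ (fun i _ => sum_rescale i)) big_split /= l1 mul1r.
Qed.

Lemma invD_rescale : invD (rescale l T) = invD T.
Proof.
rewrite /invD (eq_bigr _ (fun i _ => sumV_rescale i)) big_split /=.
by rewrite prodfV l1 invr1 mulr1.
Qed.

End Rescale.

Definition inverse_triple T i j := (T i j)^-1.

Lemma inverse_tripleP T : is_triple T -> is_triple (inverse_triple T).
Proof. by move=> tT j; rewrite prodfV tT invr1. Qed.

Lemma sumV_inverse T i : sumV (inverse_triple T) i = sum T i.
Proof. by apply: eq_bigr => j _; rewrite invrK. Qed.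

Lemma sum_inverse T i : sum (inverse_triple T) i = sumV T i. Proof. by []. Qed.

Lemma kills_kills_sums T d : derivation f d -> kills d T -> kills_sums d T.
Proof.
move=> dd kT i; split; apply: (const_sum dd) => j _ //.
by rewrite (constV dd).
Qed.

(* The scaling [a = b = 1] makes all the sums functions of the invariants. *)
Definition nscale T (i : 'I_3) :=
  if i == 0 then sumV T 0 else if i == 1 then sumV T 1 else (sumV T 0 * sumV T 1)^-1.

Lemma nscale1 T : full T -> \prod_i nscale T i = 1.
Proof.
move=> fT; rewrite (ord3_big _ _ 0) /= add0r /nscale /= divff //.
by rewrite mulf_neq0 // (fT _).1.
Qed.

Definition normal T := rescale (nscale T) T.

Lemma kills_normal_sums T d : full T -> derivation f d ->
  (forall i, d (invA T i) = 0) -> d (invD T) = 0 -> kills_sums d (normal T).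
Proof.
move=> fT dd dA; rewrite /invD (ord3_big _ _ 0) /= add0r => dD.
have u1 k := (fT k).1; have u2 k := (fT k).2.
apply: ord3_ind; rewrite !sumV_rescale !sum_rescale /nscale /=.
- by rewrite divff //; split; [exact: (der1 dd)|exact: dA].
- by rewrite divff //; split; [exact: (der1 dd)|exact: dA].
rewrite invrK mulrC; split=> //.
have -> : (sumV T 0 * sumV T 1)^-1 * sum T (1 + 1) =
    invA T (1 + 1) / (sumV T 0 * sumV T 1 * sumV T (1 + 1)).
  by rewrite /invA; field; rewrite !u1.
by apply: (constM dd) => //; apply: (constV dd).
Qed.

Lemma kills_inv T d : derivation f d -> kills d T ->
  [/\ forall i, d (invA T i) = 0, d (invD T) = 0 & d (invE T) = 0].
Proof.
move=> dd /(kills_kills_sums dd) kT; split=> [i||].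
- by have [] := kT i; rewrite /invA => *; const dd.
- by rewrite /invD; apply: (big_ind (fun x => d x = 0)) => [|x y dx dy|i _]; [const dd|const dd|case: (kT i)].
- by rewrite /invE; apply: (big_ind (fun x => d x = 0)) => [|x y dx dy|i _]; [const dd|const dd|case: (kT i)].
Qed.

Definition spans k (t : 'I_k -> K) T := forall d, derivation f d ->
  (forall l, d (t l) = 0) -> kills d T.

Lemma normal_full T : full T -> full (normal T).
Proof.
move=> fT i; rewrite sumV_rescale sum_rescale.
have n := rescale_neq0 (nscale1 fT) i.
by have [u1 u2] := fT i; rewrite !mulf_neq0 ?invr_neq0.
Qed.

Lemma normal_dichotomy T : is_triple T -> full T ->
  (forall d, derivation f d -> (forall i, d (invA T i) = 0) -> d (invD T) = 0 ->
     kills d (normal T)) \/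
  exists t u, (forall d, derivation f d -> d t = 0 ->
     (forall i, d (invA T i) = 0) /\ d (invD T) = 0) /\
   forall d, derivation f d -> (forall i, d (invA T i) = 0) -> d (invD T) = 0 ->
     d u = 0 -> kills d (normal T).
Proof.
move=> tT fT; apply: contrapT => /not_orP[/existsNP[d /not_implyP[dd]]].
move=> /not_implyP[dA /not_implyP[dD /existsNP[i /existsNP[j /eqP dm]]]]; apply.
have tN := rescale_triple (nscale1 fT) tT.
have [[t tP] [u uP]] := moving_span tN (normal_full fT) dd (kills_normal_sums fT dd dA dD) dm.
exists t, u; split=> [e de et|e de eA eD eu].
  have [eA eD _] := tP e de et; split=> [k|].
    by have := eA k; rewrite -/(invA _ _) invA_rescale // nscale1.
  by move: eD; rewrite -/(invD _) invD_rescale // nscale1.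
by apply: uP => //; exact: kills_normal_sums.
Qed.

(** As soon as one of the two fibres is infinite, the common invariants depend on one parameter, and
    each half adds at most one: three in all. Otherwise [T] gives the invariants, and these
    determine [T'] up to scale and finitely many choices. *)
Lemma full_dichotomy T T' : is_triple T -> is_triple T' -> full T -> full T' ->
  (forall i, invA T' i = invA T i) -> invD T' = - invD T ->
  (exists t : 'I_3 -> K, spans t (normal T) /\ spans t (normal T')) \/
  forall d, derivation f d -> kills d (normal T) -> kills d (normal T').
Proof.
move=> tT tT' fT fT' AE DE.
have conv d : derivation f d -> (forall i, d (invA T i) = 0) -> d (invD T) = 0 ->
    (forall i, d (invA T' i) = 0) /\ d (invD T') = 0.
  by move=> dd dA dD; split=> [i|]; rewrite ?AE ?DE //; const dd.
have conv' d : derivation f d -> (forall i, d (invA T' i) = 0) -> d (invD T') = 0 ->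
    (forall i, d (invA T i) = 0) /\ d (invD T) = 0.
  move=> dd dA dD; split=> [i|]; rewrite -?AE // -[invD T]opprK -DE.
  by const dd.
have three (x y z : K) : exists t : 'I_3 -> K, forall d : K -> K, (forall i, d (t i) = 0) ->
    [/\ d x = 0, d y = 0 & d z = 0].
  exists (fun i => if i == 0 then x else if i == 1 then y else z) => d dt.
  by have := (dt 0, dt 1, dt (1 + 1)) => -[[]] /=.
have [n'|[t' [u' [t'P u'P]]]] := normal_dichotomy tT' fT';
  have [n|[t [u [tP uP]]]] := normal_dichotomy tT fT.
- right=> d dd /(kills_inv dd)[dA dD _].
  have [] := conv d dd; first by move=> i; have := dA i; rewrite invA_rescale // nscale1.
    by move: dD; rewrite invD_rescale // nscale1.
  exact: n'.
- left; have [s sP] := three t u u; exists s.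
  split=> d dd /sP[dt du _]; have [dA dD] := tP d dd dt; first exact: uP.
  by have [dA' dD'] := conv d dd dA dD; exact: n'.
- left; have [s sP] := three t' u' u'; exists s.
  split=> d dd /sP[dt du _]; have [dA' dD'] := t'P d dd dt; last exact: u'P.
  by have [dA dD] := conv' d dd dA' dD'; exact: n.
- left; have [s sP] := three t u u'; exists s.
  split=> d dd /sP[dt du du']; have [dA dD] := tP d dd dt; first exact: uP.
  by have [dA' dD'] := conv d dd dA dD; exact: u'P.
Qed.

End Fibres.

Lemma ord3_cases (i k : 'I_3) : [\/ k = i, k + 1 = i | k + 1 + 1 = i].
Proof.
suff : [|| k == i, k + 1 == i | k + 1 + 1 == i].
  by case/or3P => /eqP; [constructor 1|constructor 2|constructor 3].
by case: i k => [[|[|[|//]]] ?] [[|[|[|//]]] ?].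
Qed.

Lemma ord3_neq (i : 'I_3) :
  [/\ i + 1 == i = false, i + 1 + 1 == i = false & i + 1 + 1 == i + 1 = false].
Proof. by case: i => [[|[|[|//]]] ?]. Qed.

(** * Triples with a vanishing sum *)

Section Degenerate.
Variables (F K : fieldType) (f : {rmorphism F -> K}).
Hypothesis K0 : [pchar K] =i pred0.
Implicit Types (T : 'I_3 -> 'I_3 -> K) (d : K -> K) (i j : 'I_3).

(** The representative up to rescaling whose first column is 1, provided [T] is a triple; the halves
    of a point are seen in this form in [X]. *)
Definition colratio T := rescale (fun i => (T i 0)^-1) T.

Lemma colratio1 T : is_triple T -> \prod_i (T i 0)^-1 = 1.
Proof. by move=> tT; rewrite prodfV tT invr1. Qed.

Lemma colratio0 T i : is_triple T -> colratio T i 0 = 1.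
Proof. by move=> tT; rewrite /colratio /rescale mulVf // triple_neq0. Qed.

Lemma colratio_triple T : is_triple T -> is_triple (colratio T).
Proof. by move=> tT; apply: rescale_triple => //; exact: colratio1. Qed.

Lemma colratio_rescale l T i j : l i != 0 -> colratio (rescale l T) i j = colratio T i j.
Proof. by move=> l0; rewrite /colratio /rescale invfM mulrACA mulVf // mul1r. Qed.

Lemma kills_ratio T d : derivation f d -> kills d T -> kills d (colratio T).
Proof.
by move=> dd dT i j; have := (dT i j, dT i 0); rewrite /colratio /rescale => -[*]; const dd.
Qed.

Lemma kills_ratio_rescale l T d : derivation f d -> \prod_i l i = 1 ->
  kills d (rescale l T) -> kills d (colratio T).
Proof.
move=> dd l1 /(kills_ratio dd) dT i j; rewrite -(@colratio_rescale l) //.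
exact: rescale_neq0.
Qed.

(** Only the triples up to rescaling are considered here: this is what a point of the fiber product
    retains. *)
Definition spans2 T T' := exists t : 'I_3 -> K, spans f t (colratio T) /\ spans f t (colratio T').

Lemma three (x y z : K) : exists t : 'I_3 -> K, forall d, (forall i, d (t i) = 0) ->
  [/\ d x = 0, d y = 0 & d z = 0].
Proof.
exists (fun i => if i == 0 then x else if i == 1 then y else z) => d dt.
by have := (dt 0, dt 1, dt (1 + 1)) => -[[]] /=.
Qed.

Lemma spans2_intro x y z T T' : (forall d, derivation f d -> d x = 0 -> d y = 0 -> d z = 0 ->
  kills d (colratio T) /\ kills d (colratio T')) -> spans2 T T'.
Proof.
move=> H; have [t tP] := three x y z; exists t.
by split=> d dd /tP[dx dy dz]; have [] := H d dd dx dy dz.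
Qed.

Section OneZero.
Variables (T : 'I_3 -> 'I_3 -> K) (i : 'I_3).
Hypotheses (tT : is_triple T) (zi : sumV T i = 0) (ni : sum T i != 0).
Hypotheses (n1 : invA T (i + 1) != 0) (n2 : invA T (i + 1 + 1) != 0).

(** For [sumV T i = 0] the coefficient [h_2] of row [i] is a nonzero product of sums of the other
    rows, so row [i] does not move. The moving column has a constant entry there, and [const_case0]
    fixes the invariants. *)
Lemma one_zero_moving d i0 j : derivation f d -> kills_sums d T -> d (T i0 j) != 0 ->
  [/\ invA T (i + 1) = 1, invA T (i + 1 + 1) = 1 & invE T = - 3] /\
  exists u, forall e, derivation f e -> kills_sums e T -> e u = 0 -> kills e T.
Proof.
move=> dd dT dm; have := n1; have := n2; rewrite /invA !mulf_eq0 !negb_or.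
move=> /andP[c0 c0'] /andP[b0 b0'].
have di l : d (T i l) = 0.
  apply: contrapT => /eqP /(moving_sextic K0 tT dd dT)[E _ _].
  move/eqP: E; rewrite /at6 /h_2 /eI /eII zi mulf_eq0.
  have -> : (sum T (i + 1) * sum T (i + 1 + 1) - 0) * (0 * sumV T (i + 1) - sum T (i + 1 + 1)) -
    4 * 0 * sum T (i + 1 + 1) = - (sum T (i + 1) * sum T (i + 1 + 1) ^+ 2) by ring.
  have -> : (sum T (i + 1) * sum T (i + 1 + 1) - 0) * (0 * sumV T (i + 1 + 1) - sum T (i + 1)) -
    4 * 0 * sum T (i + 1) = - (sum T (i + 1) ^+ 2 * sum T (i + 1 + 1)) by ring.
  by rewrite !oppr_eq0 !mulf_eq0 ?expf_eq0 /= (negPf b0') (negPf c0').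
have [k [d1 d2]] := two_moving tT dd dm.
have [ki|ki|ki] := ord3_cases i k; [by rewrite ki di eqxx in d1| |by rewrite ki di eqxx in d2].
move: zi ni n1 n2 di c0 c0' b0 b0'; rewrite -ki ord3_cycle => zk nk m1 m2 di c0 c0' b0 b0'.
have [e1 e2 e3 e4] := moving_const K0 tT dd dT d1 (di j).
have [f1 f2 f3] := const_case0 K0 (triple_neq0 _ _ tT) zk b0' e1 e2 e3 e4.
split; first by rewrite /invE (ord3_big _ _ k).
exists (T k j) => e de eT eu; exact: (moving_column K0 tT dd dT d1 d2 b0' de eT eu).
Qed.

End OneZero.

Section OneZeroFibre.
Variables (T : 'I_3 -> 'I_3 -> K) (i : 'I_3).
Hypotheses (tT : is_triple T) (zi : sumV T i = 0) (ni : sum T i != 0).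
Hypotheses (n1 : invA T (i + 1) != 0) (n2 : invA T (i + 1 + 1) != 0).

(** The analogue of [nscale] when row [i] has a zero sum of inverses: the sum of row [i] and the sum
    of inverses of row [i + 1] become 1, and the remaining sums are functions of the invariants. *)
Definition zscale k := if k == i then (sum T i)^-1 else if k == i + 1 then sumV T (i + 1)
  else sum T i / sumV T (i + 1).

Lemma zscaleE : [/\ zscale i = (sum T i)^-1, zscale (i + 1) = sumV T (i + 1) &
  zscale (i + 1 + 1) = sum T i / sumV T (i + 1)].
Proof. by have [e1 e2 e3] := ord3_neq i; rewrite /zscale !eqxx e1 e2 e3. Qed.

Lemma zscale1 : \prod_k zscale k = 1.
Proof.
have [e1 e2 e3] := zscaleE; rewrite (ord3_big _ _ i) /= e1 e2 e3.
by field; rewrite ni; have := n1; rewrite /invA mulf_eq0 negb_or => /andP[->].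
Qed.

Lemma one_zero_dichotomy :
  (forall d, derivation f d -> d (invA T (i + 1)) = 0 -> d (invA T (i + 1 + 1)) = 0 ->
     d (invE T) = 0 -> kills d (colratio T)) \/
  (forall d, derivation f d -> [/\ d (invA T (i + 1)) = 0, d (invA T (i + 1 + 1)) = 0 &
     d (invE T) = 0]) /\
  exists u, forall d, derivation f d -> d u = 0 -> kills d (colratio T).
Proof.
pose M := rescale zscale T.
have tM : is_triple M := rescale_triple zscale1 tT.
have [e1 e2 e3] := zscaleE.
have sM d : derivation f d -> d (invA T (i + 1)) = 0 -> d (invA T (i + 1 + 1)) = 0 ->
     d (invE T) = 0 -> kills_sums d M.
  move=> dd; have := n1; have := n2; rewrite /invE (ord3_big _ _ i) /= /invA.
  rewrite !mulf_eq0 !negb_or => /andP[c0 c0'] /andP[b0 b0'] dB dC dE.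
  apply: (@ord3_orbit _ i); rewrite sumV_rescale sum_rescale ?e1 ?e2 ?e3.
  - by rewrite zi mul0r mulVf //; split; const dd.
  - by rewrite divff //; split=> //; const dd.
  split.
    have -> : sumV T (i + 1 + 1) / (sum T i / sumV T (i + 1)) =
       (sumV T (i + 1 + 1) * sum T (i + 1 + 1)) * (sumV T (i + 1) * sum T (i + 1)) /
       (sum T i * sum T (i + 1) * sum T (i + 1 + 1)).
      by field; rewrite ni b0 b0' c0'.
    by apply: (constM dd); [exact: (constM dd)|exact: (constV dd)].
  have -> : sum T i / sumV T (i + 1) * sum T (i + 1 + 1) =
     (sum T i * sum T (i + 1) * sum T (i + 1 + 1)) / (sumV T (i + 1) * sum T (i + 1)).
    by field; rewrite b0 b0'.
  by apply: (constM dd) => //; exact: (constV dd).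
apply: contrapT => /not_orP[/existsNP[d /not_implyP[dd]]].
move=> /not_implyP[dB /not_implyP[dC /not_implyP[dE nk]]]; apply.
have [i0 [j dm]] : exists i0 j, d (M i0 j) != 0.
  apply: contrapT => nm; apply: nk; apply: (kills_ratio_rescale dd zscale1) => i0 j.
  by apply: contrapT => /eqP dm; apply: nm; exists i0, j.
have AM k : invA M k = invA T k by rewrite invA_rescale // zscale1.
have EM : invE M = invE T by rewrite invE_rescale // zscale1.
have zM : sumV M i = 0 by rewrite sumV_rescale zi mul0r.
have nM : sum M i != 0 by rewrite sum_rescale e1 mulVf // oner_neq0.
have [||[f1 f2 f3] [u uP]] := one_zero_moving tM zM nM _ _ dd (sM d dd dB dC dE) dm.
- by rewrite AM.
- by rewrite AM.
have cst e : derivation f e -> [/\ e (invA T (i + 1)) = 0, e (invA T (i + 1 + 1)) = 0 &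
    e (invE T) = 0].
  by move=> de; rewrite -!AM -EM f1 f2 f3; split; const de.
split=> //; exists u => e de eu; apply: (kills_ratio_rescale de zscale1).
by have [eB eC eE] := cst e de; apply: (uP e de (sM e de eB eC eE) eu).
Qed.

End OneZeroFibre.

(** At most three parameters in every case: either three invariants, or one along each infinite
    fibre, the invariants being then constant. *)
Lemma one_zero T T' i : is_triple T -> is_triple T' -> sumV T i = 0 -> sum T i != 0 ->
  sumV T' i = 0 -> sum T' i != 0 ->
  invA T (i + 1) != 0 -> invA T (i + 1 + 1) != 0 ->
  (forall k, invA T' k = invA T k) -> invE T' = - invE T -> spans2 T T'.
Proof.
move=> tT tT' zi ni zi' ni' n1 n2 AE EE.
have n1' : invA T' (i + 1) != 0 by rewrite AE.
have n2' : invA T' (i + 1 + 1) != 0 by rewrite AE.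
have conv d : derivation f d -> d (invE T') = 0 <-> d (invE T) = 0.
  by move=> dd; rewrite EE; split=> [|dE]; [rewrite (derN dd) => /eqP; rewrite oppr_eq0 => /eqP|const dd].
have [n|[c [u uP]]] := one_zero_dichotomy tT zi ni n1 n2;
  have [n'|[c' [u' u'P]]] := one_zero_dichotomy tT' zi' ni' n1' n2'.
- apply: (@spans2_intro (invA T (i + 1)) (invA T (i + 1 + 1)) (invE T)) => d dd dB dC dE.
  by split; [exact: n|apply: n'; rewrite ?AE //; apply/conv].
- apply: (@spans2_intro u' u' u') => d dd du _ _; split; last exact: u'P.
  by have [] := c' d dd; rewrite !AE => dB dC /(conv _ dd) dE; exact: n.
- apply: (@spans2_intro u u u) => d dd du _ _; split; first exact: uP.
  by have [dB dC dE] := c d dd; apply: n'; rewrite ?AE //; apply/conv.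
- apply: (@spans2_intro u u' u') => d dd du du' _; split; [exact: uP|exact: u'P].
Qed.

Lemma row_sums T i : is_triple T -> sumV (colratio T) i = sumV T i * T i 0 /\
  sum (colratio T) i = sum T i / T i 0.
Proof. by move=> tT; rewrite sumV_rescale sum_rescale invrK mulrC [X in _ /\ X = _]mulrC. Qed.

Lemma colratio_sums T i : is_triple T ->
  sumV (colratio T) i = 1 + (colratio T i 1)^-1 + (colratio T i (1 + 1))^-1 /\
  sum (colratio T) i = 1 + colratio T i 1 + colratio T i (1 + 1).
Proof.
by move=> tT; rewrite /sumV /sum !(ord3_big _ _ 0) /= add0r colratio0 // invr1.
Qed.

Lemma kills_rows T d i : is_triple T -> derivation f d ->
  (forall j, d (colratio T i j) = 0) -> (forall j, d (colratio T (i + 1) j) = 0) -> kills d (colratio T).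
Proof.
move=> tT dd d0 d1 k j; move: k; apply: (@ord3_orbit _ i) => //.
rewrite triple_third; last exact: colratio_triple.
by apply: (constV dd); apply: (constM dd).
Qed.

Lemma kills_row T d i : is_triple T -> derivation f d -> d (colratio T i 1) = 0 ->
  d (colratio T i (1 + 1)) = 0 -> forall j, d (colratio T i j) = 0.
Proof.
by move=> tT dd d1 d2; apply: ord3_ind => //; rewrite colratio0 //; const dd.
Qed.

Lemma half_row T d i : is_triple T -> derivation f d -> invA T i = 0 ->
  d (colratio T i 1) = 0 -> forall j, d (colratio T i j) = 0.
Proof.
move=> tT dd /eqP; rewrite mulf_eq0 => zi d1; apply: kills_row => //.
have [e1 e2] := row_sums i tT; have [e1' e2'] := colratio_sums i tT.
case/orP: zi => /eqP zi; [move: e1'; rewrite e1|move: e2'; rewrite e2]; rewrite zi mul0r => /esym/eqP.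
  by rewrite addrC addr_eq0 => /eqP e; rewrite -[colratio T i (1 + 1)]invrK e; const dd.
by rewrite addrC addr_eq0 => /eqP ->; const dd.
Qed.

(** Such a row is proportional to the three cube roots of unity: [y ^ 2 + y + 1 = 0]. *)
Lemma both_zero T i d : is_triple T -> derivation f d -> sumV T i = 0 -> sum T i = 0 ->
  forall j, d (colratio T i j) = 0.
Proof.
move=> tT dd z1 z2; apply: half_row => //; first by rewrite /invA z1 mul0r.
have [e1 e2] := row_sums i tT; have [e1' e2'] := colratio_sums i tT.
move: e1 e2; rewrite z1 z2 !mul0r e1' e2'.
have := triple_neq0 i 1 (colratio_triple tT); have := triple_neq0 i (1 + 1) (colratio_triple tT).
move: (colratio T i 1) (colratio T i (1 + 1)) => y w w0 y0 E1 E2.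
have wE : w = - (1 + y) by apply/eqP; rewrite -addr_eq0 addrC E2.
apply: (@const2 _ _ _ K0 d dd 1 1 1); rewrite ?oner_neq0 //; try by const dd.
have -> : 1 * y ^+ 2 + 1 * y + 1 = - (y * w + w + y) by rewrite wE; ring.
have -> : - (y * w + w + y) = - (y * w) * (1 + y^-1 + w^-1) by field; rewrite y0 w0.
by rewrite E1 mulr0.
Qed.

(** Row [i] is constant on both sides. Row [i + 1] has two parameters on each side, and the equality
    of its [invA] removes one of the four. *)
Lemma one_double_zero T T' i : is_triple T -> is_triple T' -> sumV T i = 0 -> sum T i = 0 ->
  sumV T' i = 0 -> sum T' i = 0 -> (forall k, invA T' k = invA T k) -> spans2 T T'.
Proof.
move=> tT tT' z1 z2 z1' z2' AE.
have tR' := colratio_triple tT'.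
pose y := colratio T' (i + 1) 1; pose w := colratio T' (i + 1) (1 + 1).
have y0 : y != 0 by exact: triple_neq0. have w0 : w != 0 by exact: triple_neq0.
have BE : (1 + y^-1 + w^-1) * (1 + y + w) = invA (colratio T) (i + 1).
  rewrite invA_rescale ?colratio1 // -AE -(invA_rescale T' (colratio1 tT')) /invA.
  by have [-> ->] := colratio_sums (i + 1) tT'.
(* For [y = -1] the relation between [y] and [w] is void, but [y] is constant and [w] is the third
   parameter. *)
apply: (@spans2_intro (colratio T (i + 1) 1) (colratio T (i + 1) (1 + 1)) (if y == -1 then w else y)).
move=> d dd d1 d2 d3.
have kT : kills d (colratio T).
  by apply: (@kills_rows _ _ i) => //; [exact: both_zero|exact: kills_row].
split=> //; have [dB _ _] := kills_inv dd kT; have {}dB := dB (i + 1).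
apply: (@kills_rows _ _ i) => //; first exact: both_zero.
move: d3; case: eqP => [ym|/eqP ym] d3; apply: kills_row => //.
  by rewrite -/y ym; const dd.
apply: (@const2 _ _ _ K0 d dd (y + 1)
  ((1 + y) ^+ 2 + y - invA (colratio T) (i + 1) * y) ((1 + y) * y) w); try by const dd.
  by rewrite -BE; field; rewrite ?y0 ?w0.
by rewrite addr_eq0 ym.
Qed.

Lemma two_zero_cubic d x s y w C : derivation f d -> x != 0 -> s != 0 -> y != 0 -> w != 0 ->
  x != s -> d x = 0 -> d s = 0 -> d C = 0 -> 1 + y + w = 0 ->
  C = (1 + x * y + s * w) * (1 + (x * y)^-1 + (s * w)^-1) -> d y = 0.
Proof.
move=> dd x0 s0 y0 w0 xs dx ds dC yw CE.
have wE : w = - (1 + y) by apply/eqP; rewrite -addr_eq0 addrC yw.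
apply: (@const3 _ _ f K0 d (- (x * s * (x - s)))
  (- (x * s * (1 - s)) + (x - s) * (x - s - x * s) + C * x * s)
  ((1 - s) * (x - s - x * s) - s * (x - s) + C * x * s) (- (s * (1 - s))) y dd);
  try by const dd.
  by rewrite oppr_eq0 !mulf_neq0 // subr_eq0.
transitivity ((1 + x * y + s * w) * (x * y * (s * w) + s * w + x * y) - C * (x * y * (s * w))).
  by rewrite wE; ring.
by rewrite CE; field; rewrite x0 s0 y0 w0.
Qed.

(** The rows [i] and [i + 1] have one parameter each, on both sides, and the equality of the third
    [invA] removes one of the four. *)
Lemma two_zero T T' i : is_triple T -> is_triple T' -> invA T i = 0 -> invA T (i + 1) = 0 ->
  (forall k, invA T' k = invA T k) -> spans2 T T'.
Proof.
move=> tT tT' z0 z1 AE; have tR' := colratio_triple tT'.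
have z0' : invA T' i = 0 by rewrite AE. have z1' : invA T' (i + 1) = 0 by rewrite AE.
pose x := colratio T' i 1; pose s := colratio T' i (1 + 1).
pose y := colratio T' (i + 1) 1; pose w := colratio T' (i + 1) (1 + 1).
have n k l : colratio T' k l != 0 by exact: triple_neq0.
have CE : invA (colratio T) (i + 1 + 1) =
    (1 + x * y + s * w) * (1 + (x * y)^-1 + (s * w)^-1).
  rewrite invA_rescale ?colratio1 // -AE -(invA_rescale T' (colratio1 tT')) /invA.
  have [-> ->] := colratio_sums (i + 1 + 1) tT'.
  by rewrite !triple_third // !invrK.
(* The cubic for [y] over [x] degenerates when [x = s]; in that case [x] is -2 or -1/2, and [y] is
   the parameter. *)
apply: (@spans2_intro (colratio T i 1) (colratio T (i + 1) 1) (if x == s then y else x)).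
move=> d dd d1 d2 d3.
have kT : kills d (colratio T) by apply: (@kills_rows _ _ i) => //; exact: half_row.
split=> //; have [dC _ _] := kills_inv dd kT; have {}dC := dC (i + 1 + 1).
have [e1 e2] := row_sums i tT'; have [e1' e2'] := colratio_sums i tT'.
have [g1 g2] := row_sums (i + 1) tT'; have [g1' g2'] := colratio_sums (i + 1) tT'.
rewrite -/x -/s -/y -/w in e1' e2' g1' g2'.
have dx : d x = 0.
  move: d3; case: eqP => // xs _; move: z0' => /eqP; rewrite mulf_eq0 => /orP[]/eqP z.
    have /eqP : 1 + x^-1 * 2 = 0 by rewrite -(mul0r (T' i 0)) -z -e1 e1' -xs; ring.
    rewrite addr_eq0 => /eqP E; have -> : x = - 2.
      by transitivity (x * - (x^-1 * 2)); [rewrite -E mulr1|rewrite mulrN mulVKf ?n].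
    by const dd.
  have /eqP : 1 + x * 2 = 0 by rewrite -(mul0r (T' i 0)^-1) -z -e2 e2' -xs; ring.
  rewrite addr_eq0 eq_sym eqr_oppLR => /eqP E.
  have -> : x = - 1 / 2 by rewrite -E mulfK ?(nat_neq0 K0 1).
  by const dd.
have kx j : d (colratio T' i j) = 0 by apply: half_row.
have ds : d s = 0 by exact: kx.
have dy : d y = 0.
  move: d3; case: eqP => // /eqP xs _; move: z1' => /eqP; rewrite mulf_eq0 => /orP[]/eqP z.
    rewrite -[y]invrK; apply: (constV dd).
    apply: (@two_zero_cubic d x^-1 s^-1 y^-1 w^-1 (invA (colratio T) (i + 1 + 1))) => //;
      rewrite ?invr_eq0 ?n //; try by const dd.
    - by rewrite (inj_eq invr_inj).
    - by rewrite -g1' g1 z mul0r.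
    - by rewrite CE -!invfM !invrK mulrC.
  apply: (@two_zero_cubic d x s y w (invA (colratio T) (i + 1 + 1))) => //; rewrite ?n //.
  by rewrite -g2' g2 z mul0r.
by apply: (@kills_rows _ _ i) => //; exact: half_row.
Qed.

(** When [invA] vanishes for row [i] only, the equalities for [invD] and [invE] show that the same
    sums of row [i] vanish for [T] and [T']. Inverting the triples exchanges the two kinds of
    sums. *)
Lemma zero_spans2 T T' i : is_triple T -> is_triple T' -> invA T i = 0 ->
  (forall k, invA T' k = invA T k) -> invD T' = - invD T -> invE T' = - invE T -> spans2 T T'.
Proof.
move=> tT tT' zi AE DE EE.
have [z1|n1] := eqVneq (invA T (i + 1)) 0; first exact: (two_zero (i := i)).
have [z2|n2] := eqVneq (invA T (i + 1 + 1)) 0.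
  by apply: (two_zero (i := i + 1 + 1)) => //; rewrite ord3_cycle.
have [r1 r2] : (sumV T' i == 0) = (sumV T i == 0) /\ (sum T' i == 0) = (sum T i == 0).
  have m1 : invA T' (i + 1) != 0 by rewrite AE. have m2 : invA T' (i + 1 + 1) != 0 by rewrite AE.
  move: n1 n2 m1 m2; rewrite /invA !mulf_eq0 !negb_or => /andP[a a'] /andP[b b'] /andP[c c'] /andP[e e'].
  have := congr1 (eq_op^~ 0) DE; have := congr1 (eq_op^~ 0) EE; rewrite /invD /invE !(ord3_big _ _ i) /=.
  by rewrite !oppr_eq0 !mulf_eq0 !(negPf a, negPf a', negPf b, negPf b', negPf c, negPf c', negPf e, negPf e') !orbF.
have [zv|nv] := eqVneq (sumV T i) 0; have [zs|ns] := eqVneq (sum T i) 0.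
- by apply: (one_double_zero (i := i)) => //; apply/eqP; rewrite ?r1 ?r2; apply/eqP.
- apply: (one_zero (i := i)) => //; first by apply/eqP; rewrite r1; apply/eqP.
  by rewrite r2.
- have [t [t1 t2]] : spans2 (inverse_triple T) (inverse_triple T').
    apply: (one_zero (i := i)); rewrite ?sumV_inverse ?sum_inverse //.
    + exact: inverse_tripleP.
    + exact: inverse_tripleP.
    + by apply/eqP; rewrite r2 zs.
    + by rewrite r1.
    + by rewrite /invA sumV_inverse mulrC.
    + by rewrite /invA sumV_inverse mulrC.
    + by move=> k; rewrite /invA !sumV_inverse ![sum T' _ * _]mulrC -[LHS]/(invA T' k) AE mulrC.
  have rI S d : derivation f d -> kills d (colratio (inverse_triple S)) -> kills d (colratio S).
    move=> dd k1 k j; have := k1 k j; rewrite /colratio /rescale /inverse_triple invrK => k2.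
    have -> : (S k 0)^-1 * S k j = (S k 0 * (S k j)^-1)^-1 by rewrite invfM invrK.
    by const dd.
  by exists t; split=> d dd dt; apply: (rI _ _ dd); [exact: t1|exact: t2].
- by move: zi => /eqP; rewrite mulf_eq0 (negPf nv) (negPf ns).
Qed.

(** The bounds obtained so far concern [T'] up to scale. The scale of row [k] is recovered from its
    sums unless both vanish, and two scales give the third. If two rows have only zero sums,
    everything is constant up to scale, and the scales of these rows are the only parameters. *)
Lemma opposite_spans T T' : is_triple T -> is_triple T' -> (forall i, T i 0 = 1) ->
  (forall i, sumV T' i = - sumV T i /\ sum T' i = - sum T i) ->
  (exists t : 'I_3 -> K, spans f t T /\ spans f t T') \/
  (full T /\ forall d, derivation f d -> kills d T -> kills d T').
Proof.
move=> tT tT' T1 opp.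
have AE k : invA T' k = invA T k by rewrite /invA; have [-> ->] := opp k; ring.
have DE : invD T' = - invD T.
  rewrite /invD !(ord3_big _ _ 0) /= add0r; have [-> _] := opp 0; have [-> _] := opp 1.
  by have [-> _] := opp (1 + 1); ring.
have EE : invE T' = - invE T.
  rewrite /invE !(ord3_big _ _ 0) /= add0r; have [_ ->] := opp 0; have [_ ->] := opp 1.
  by have [_ ->] := opp (1 + 1); ring.
have RT : colratio T = T by apply: funext => k; apply: funext => j; rewrite /colratio /rescale T1 invr1 mul1r.
have back d : derivation f d -> (forall k, d (T' k 0) = 0) -> kills d (colratio T') -> kills d T'.
  move=> dd d0 kR k j; have -> : T' k j = T' k 0 * colratio T' k j.
    by rewrite /colratio /rescale mulVKf // triple_neq0.
  by apply: (constM dd).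
have [fT|nf] := pselect (full T).
  have fT' : full T' by move=> k; have [-> ->] := opp k; rewrite !oppr_eq0; exact: fT.
  have nb S d : is_triple S -> full S -> derivation f d -> kills d (normal S) ->
      kills d (colratio S) by move=> tS fS dd; apply: kills_ratio_rescale => //; exact: nscale1.
  have T'S d : derivation f d -> kills d T -> kills d (normal T') -> kills d T'.
    move=> dd kT kN k j; have -> : T' k j = (nscale T' k)^-1 * normal T' k j.
      by rewrite mulKf // (rescale_neq0 (nscale1 fT')).
    apply: (constM dd) => //; apply: (constV dd).
    have s1 l : d (sumV T' l) = 0.
      by have [-> _] := opp l; have [e _] := kills_kills_sums dd kT l; const dd.
    by rewrite /nscale; do 2 case: eqP => // _; const dd.
  have [[t [t1 t2]]|H] := full_dichotomy f K0 tT tT' fT fT' AE DE; [left|right].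
    exists t; split=> d dd dt; have kT : kills d T by rewrite -RT; apply/nb/t1.
      by [].
    by apply: T'S => //; exact: t2.
  split=> // d dd kT; apply: T'S => //; apply: H => //.
  move=> k j; apply: (constM dd) => //; rewrite /nscale.
  have s1 l : d (sumV T l) = 0 by have [e _] := kills_kills_sums dd kT l.
  by do 2 case: eqP => // _; const dd.
have [i zi] : exists i, invA T i = 0.
  apply: contrapT => ni; apply: nf => k; have : invA T k != 0 by apply/eqP => ?; apply: ni; exists k.
  by rewrite mulf_eq0 negb_or => /andP[].
left; have [t [t1 t2]] := zero_spans2 tT tT' zi AE DE EE.
pose scaled k := (sumV T k != 0) || (sum T k != 0).
have sc k d : scaled k -> derivation f d -> kills d (colratio T) -> kills d (colratio T') -> d (T' k 0) = 0.
  rewrite RT => sk dd kT kR; have [s1 s2] := kills_kills_sums dd kT k.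
  have [r1 r2] := kills_kills_sums dd kR k; have [e1 e2] := row_sums k tT'.
  have [o1 o2] := opp k; case/orP: sk => nz.
    have -> : T' k 0 = - (sumV (colratio T') k / sumV T k) by rewrite e1 o1; field.
    by const dd.
  have -> : T' k 0 = - (sum T k / sum (colratio T') k).
    by rewrite e2 o2; field; rewrite ?oppr_eq0 ?nz ?triple_neq0.
  by const dd.
have zero k d : ~~ scaled k -> derivation f d ->
    (forall j, d (colratio T k j) = 0) /\ (forall j, d (colratio T' k j) = 0).
  rewrite negb_or !negbK => /andP[/eqP z1 /eqP z2] dd; have [o1 o2] := opp k.
  by split; apply: both_zero; rewrite ?o1 ?o2 ?z1 ?z2 ?oppr0.
have third k d : derivation f d -> d (T' k 0) = 0 -> d (T' (k + 1) 0) = 0 -> forall l, d (T' l 0) = 0.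
  by move=> dd d0 d1; apply: (@ord3_orbit _ k) => //; rewrite triple_third //; const dd.
have twosc k : scaled k -> scaled (k + 1) -> exists t : 'I_3 -> K, spans f t T /\ spans f t T'.
  move=> k0 k1; exists t; split=> d dd dt; first by rewrite -RT; exact: t1.
  apply: back => //; last exact: t2.
  by apply: (third k) => //; apply: sc => //; [exact: t1|exact: t2|exact: t1|exact: t2].
have twozero k : ~~ scaled k -> ~~ scaled (k + 1) -> exists t : 'I_3 -> K, spans f t T /\ spans f t T'.
  move=> k0 k1; have [u uP] := three (T' k 0) (T' (k + 1) 0) 0; exists u.
  split=> d dd du; have [[a0 b0] [a1 b1]] := (zero k d k0 dd, zero (k + 1) d k1 dd).
    by rewrite -RT; apply: (@kills_rows _ _ k).
  apply: back => //; last exact: (@kills_rows _ _ k).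
  by have [u0 u1 _] := uP d du; exact: (third k).
(* Two of the three rows are of the same kind, and any two rows are cyclically consecutive. *)
have [s0|s0] := boolP (scaled 0); have [s1|s1] := boolP (scaled 1);
  have [s2|s2] := boolP (scaled (1 + 1)).
all: try by apply: (twosc 0); rewrite ?add0r.
all: try by apply: (twozero 0); rewrite ?add0r.
all: try by apply: (twosc 1).
all: try by apply: (twozero 1).
all: have c3 : 1 + 1 + 1 = 0 :> 'I_3 by apply: val_inj.
all: try by apply: (twosc (1 + 1)); rewrite ?c3.
all: by apply: (twozero (1 + 1)); rewrite ?c3.
Qed.

End Degenerate.

(** * Conjugate points and nonsquares *)

Lemma extend_fractions (F : fieldType) n (E K : fieldType) (f : {rmorphism F -> E})
    (z : 'I_n -> E) (g : {rmorphism F -> K}) (y : 'I_n -> K) :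
  (forall k, exists p q, mmap f z q != 0 /\ k = mmap f z p / mmap f z q) ->
  (forall p, mmap f z p = 0 <-> mmap g y p = 0) ->
  exists phi : {rmorphism E -> K}, (forall c, phi (f c) = g c) /\ forall i, phi (z i) = y i.
Proof.
move=> frac ker.
have [num numP] : exists num : E -> {mpoly F[n]} * {mpoly F[n]},
    forall k, mmap f z (num k).2 != 0 /\ k = mmap f z (num k).1 / mmap f z (num k).2.
  suff /boolp.choice[h hP] : forall k, exists pq : {mpoly F[n]} * {mpoly F[n]},
      mmap f z pq.2 != 0 /\ k = mmap f z pq.1 / mmap f z pq.2 by exists h.
  by move=> k; have [p [q pq]] := frac k; exists (p, q).
pose phi k := mmap g y (num k).1 / mmap g y (num k).2.
have ker0 q : mmap f z q != 0 -> mmap g y q != 0 by apply: contraNneq => /ker->.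
have phiE p q : mmap f z q != 0 -> phi (mmap f z p / mmap f z q) = mmap g y p / mmap g y q.
  move=> q0; rewrite /phi; set k := mmap f z p / mmap f z q; have [k0 kE] := numP k.
  apply/eqP; rewrite eqr_div ?ker0 // -subr_eq0 -!rmorphM -rmorphB; apply/eqP/ker.
  rewrite rmorphB !rmorphM /=; apply/eqP; rewrite subr_eq0 -eqr_div //.
  by rewrite -kE.
have phiN p : phi (mmap f z p) = mmap g y p.
  by have := phiE p 1; rewrite !rmorph1 !divr1 => -> //; exact: oner_neq0.
have phi_zmod : zmod_morphism phi.
  move=> a b; have [a0 ->] := numP a; have [b0 ->] := numP b.
  set p := (num a).1; set q := (num a).2; set p' := (num b).1; set q' := (num b).2.
  have -> : mmap f z p / mmap f z q - mmap f z p' / mmap f z q' =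
      mmap f z (p * q' - p' * q) / mmap f z (q * q').
    by rewrite rmorphB !rmorphM /=; field; rewrite a0 b0.
  rewrite !phiE // ?rmorphM ?mulf_neq0 //= rmorphB !rmorphM /=.
  by field; rewrite !ker0.
have phi_mon : monoid_morphism phi.
  split=> [|a b]; first by rewrite -(rmorph1 (mmap f z)) phiN rmorph1.
  have [a0 ->] := numP a; have [b0 ->] := numP b.
  set p := (num a).1; set q := (num a).2; set p' := (num b).1; set q' := (num b).2.
  have -> : mmap f z p / mmap f z q * (mmap f z p' / mmap f z q') =
      mmap f z (p * p') / mmap f z (q * q').
    by rewrite !rmorphM /=; field; rewrite a0 b0.
  rewrite !phiE // ?rmorphM ?mulf_neq0 //= ?rmorphM /=.
  by field; rewrite !ker0.
pose gA := GRing.isZmodMorphism.Build E K phi phi_zmod.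
pose gM := GRing.isMonoidMorphism.Build E K phi phi_mon.
exists (HB.pack phi gA gM : {rmorphism E -> K}); split=> [c|i] /=.
  by rewrite -(mmapC z f) phiN mmapC.
by have := phiN 'X_i; rewrite !mmapX !mmap1U.
Qed.

(** Points with the same ideal generate isomorphic fields, and [E] is a common copy. Points over
    different fields are compared through such an [E]. *)
Lemma common_subfield (F : fieldType) n (K1 K2 : fieldType) (f1 : {rmorphism F -> K1})
    (f2 : {rmorphism F -> K2}) (z1 : 'I_n -> K1) (z2 : 'I_n -> K2) :
  (forall p, mmap f1 z1 p = 0 <-> mmap f2 z2 p = 0) ->
  exists (E : fieldType) (f : {rmorphism F -> E}) (z : 'I_n -> E)
    (phi1 : {rmorphism E -> K1}) (phi2 : {rmorphism E -> K2}),
    [/\ (forall p, mmap f z p = 0 <-> mmap f1 z1 p = 0),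
        (forall k, exists p q, mmap f z q != 0 /\ k = mmap f z p / mmap f z q),
        (forall c, phi1 (f c) = f1 c) /\ (forall i, phi1 (z i) = z1 i) &
        (forall c, phi2 (f c) = f2 c) /\ (forall i, phi2 (z i) = z2 i)].
Proof.
move=> ker; have [E [f [z [zP frac]]]] := kpoint (prime_kernel (mmap f1 z1)).
have [phi1 [a1 b1]] := extend_fractions frac zP.
have zP2 p : mmap f z p = 0 <-> mmap f2 z2 p = 0 by rewrite -ker; exact: zP.
have [phi2 [a2 b2]] := extend_fractions frac zP2.
by exists E, f, z, phi1, phi2; split.
Qed.

Lemma fresh_element (F : closedFieldType) (s : seq F) : exists c, c \notin s.
Proof.
pose p := \prod_(a <- s) ('X - a%:P) + 1 : {poly F}.
have [s0|s0] := eqVneq (size s) 0%N; first by exists 0; rewrite (size0nil s0).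
have [|c pc] := @closed_rootP F p _; last first.
  exists c; apply/negP => cs; move: pc; rewrite rootE hornerD hornerC horner_prod.
  by rewrite (big_rem c) //= !hornerE subrr mul0r add0r oner_eq0.
rewrite size_addl size_prod_XsubC ?size_polyC ?oner_eq0 //= ?eqSS //.
by rewrite ltnS lt0n.
Qed.

(** If [r] avoids the tail of the list but not its head, let [e] avoid the head: then [r + c * e]
    lies in each of the primes for at most one value of [c], and [F] is infinite. *)
Lemma prime_avoidance (F : closedFieldType) n (I : set {mpoly F[n]})
    (Ps : seq (set {mpoly F[n]})) : is_ideal I ->
  (forall i, (i < size Ps)%N -> is_prime (nth setT Ps i)) ->
  (forall i, (i < size Ps)%N -> exists2 r, I r & ~ nth setT Ps i r) ->
  exists2 r, I r & forall i, (i < size Ps)%N -> ~ nth setT Ps i r.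
Proof.
move=> iI; elim: Ps => [|P Ps IH] pP nP.
  by exists 0 => //; exact: (ideal0 iI).
have [||r Ir rP] := IH; [by move=> i; exact: (pP i.+1)|by move=> i; exact: (nP i.+1)|].
have [e Ie eP] := nP 0%N isT.
have [Pr|nPr] := pselect (P r); last by exists r => // -[|i] //=; exact: rP.
have [bad badP] : exists bad : nat -> F, forall i c, (i < size Ps)%N ->
    nth setT Ps i (r + c%:MP * e) -> c = bad i.
  suff /boolp.choice[g gP] : forall i, exists a, forall c, (i < size Ps)%N ->
    nth setT Ps i (r + c%:MP * e) -> c = a by exists g.
  move=> i; have [ip|nip] := ltnP i (size Ps); last by exists 0 => c.
  have pQ := pP i.+1 ip.
  have [[c Qc]|nQ] := pselect (exists c, nth setT Ps i (r + c%:MP * e)); last first.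
    by exists 0 => c _ Qc; case: nQ; exists c.
  exists c => c' _ Qc'; apply: contrapT => /eqP cc'; apply: (rP i ip).
  have Qe : nth setT Ps i e.
    have : nth setT Ps i ((c' - c)%:MP * e).
      have -> : (c' - c)%:MP * e = (r + c'%:MP * e) - (r + c%:MP * e).
        by rewrite mpolyCB; ring.
      exact: (idealB pQ).
    move=> /(idealM pQ (c' - c)^-1%:MP); rewrite mulrA -mpolyCM mulVf ?subr_eq0 //.
    by rewrite mpolyC1 mul1r.
  have -> : r = (r + c%:MP * e) - c%:MP * e by ring.
  by apply: (idealB pQ) => //; exact: (idealM pQ).
have [c] := fresh_element (0 :: [seq bad i | i <- iota 0 (size Ps)]).
rewrite inE negb_or => /andP[c0 /negP cb].
exists (r + c%:MP * e); first by apply: (idealD iI) => //; exact: (idealM iI).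
move=> [_ /= Pe|i ip /= Qi]; last first.
  by apply: cb; apply/mapP; exists i; [rewrite mem_iota|exact: (badP i)].
have pQ : is_prime P := pP 0%N isT.
apply: eP => /=; have : P (c%:MP * e).
  have -> : c%:MP * e = (r + c%:MP * e) - r by ring.
  exact: (idealB pQ).
move=> /(idealM pQ c^-1%:MP); rewrite mulrA -mpolyCM mulVf //.
by rewrite mpolyC1 mul1r.
Qed.

Section Symmetric.
Variables (E K : fieldType) (phi : {rmorphism E -> K}).

Lemma mmap_mesym n k (X : 'I_n -> K) : mmap phi X (mesym n E k) = (mesym n K k).@[X].
Proof.
rewrite !mesymE !raddf_sum /=; apply: eq_bigr => h _.
by rewrite mmapX mevalX /mmap1.
Qed.

Lemma symmetric_value n (r : {mpoly E[n]}) (c : 'I_n -> E) : r \is symmetric ->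
  exists v : E, forall (L : fieldType) (psi : {rmorphism E -> L}) (X : 'I_n -> L),
    (forall k : 'I_n, psi (c k) = mmap psi X (mesym n E k.+1)) -> mmap psi X r = psi v.
Proof.
move=> /sym_fundamental[t [<- _]]; exists (t.@[c]) => L psi X cX.
rewrite mmap_comp -[t.@[c]]/(mmap idfun c t) rmorph_mmap.
by apply: eq_mmap => // i /=; rewrite cX.
Qed.

Lemma mmap_msym n (s : 'S_n) (X : 'I_n -> K) (r : {mpoly E[n]}) :
  mmap phi X (msym s r) = mmap phi (fun i => X (s i)) r.
Proof.
rewrite rmorph_mmap; apply: eq_mmap => // i /=; first by rewrite mmapC.
by rewrite mmapX mmap1U.
Qed.

Lemma prod_msym_sym n (r : {mpoly E[n]}) : \prod_(s : 'S_n) msym s r \is symmetric.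
Proof.
apply/issymP => s; rewrite rmorph_prod /= (reindex_inj (mulIg s^-1%g)) /=.
by apply: eq_bigr => t _; rewrite -msymMm mulgKV.
Qed.

Lemma sum_msym_sym n (r : {mpoly E[n]}) : \sum_(s : 'S_n) msym s r \is symmetric.
Proof.
apply/issymP => s; rewrite rmorph_sum /= (reindex_inj (mulIg s^-1%g)) /=.
by apply: eq_bigr => t _; rewrite -msymMm mulgKV.
Qed.

End Symmetric.

(** * Nonsquares detected by a simple zero *)

Section Germs.
Variables (F : closedFieldType) (L : fieldType) (f : {rmorphism F -> L}) (n : nat).
Variables (x : 'I_n -> L) (p0 : 'I_n -> F) (i0 : 'I_n).
Hypothesis xI : alg_indep f x.
Hypothesis xfrac : forall k, exists p q, mmap f x q != 0 /\ k = mmap f x p / mmap f x q.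

(* The element [k] of [F(x)] is regular at [p0], with value [v] and
   partial derivative [dv] in the direction [i0]. *)
Definition germ (k : L) (v dv : F) := exists p q : {mpoly F[n]},
  [/\ q.@[p0] != 0, k = mmap f x p / mmap f x q, v = p.@[p0] / q.@[p0] &
      dv = (p^`M(i0).@[p0] * q.@[p0] - p.@[p0] * q^`M(i0).@[p0]) / q.@[p0] ^+ 2].

Let nz q : q.@[p0] != 0 -> mmap f x q != 0.
Proof.
by move=> q0; apply: contraNneq q0 => /xI->; rewrite meval0.
Qed.

Lemma germ_const c : germ (f c) c 0.
Proof.
by exists c%:MP, 1; rewrite meval1 mmapC rmorph1 !divr1 mevalC oner_neq0 -mpolyC1 !mderivC meval0; split=> //; ring.
Qed.

Lemma germ_nat k : germ k%:R k%:R 0.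
Proof. by have := germ_const k%:R; rewrite rmorph_nat. Qed.

Lemma germ_var i : germ (x i) (p0 i) (i == i0)%:R.
Proof.
exists 'X_i, 1; rewrite meval1 mmapX mmap1U rmorph1 !divr1 mevalXU oner_neq0 -mpolyC1 mderivC meval0.
split=> //; rewrite mderivX mnm1E mevalZ expr1n divr1 mulr1 mulr0 subr0.
have [->|_] := eqVneq i i0; last by rewrite mul0r.
by rewrite (_ : (U_(i0) - U_(i0) = 0)%MM) ?mpolyX0 ?meval1 ?mulr1 //; apply/mnmP => k; rewrite mnmBE mnm0E subnn.
Qed.

Lemma germD k k' v v' dv dv' : germ k v dv -> germ k' v' dv' -> germ (k + k') (v + v') (dv + dv').
Proof.
move=> [p [q [q0 -> -> ->]]] [p' [q' [q'0 -> -> ->]]]; exists (p * q' + p' * q), (q * q').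
rewrite !(mderivD, mderivM, mevalD, mevalM, rmorphD, rmorphM) /= mulf_neq0 //.
by split=> //; field; rewrite ?nz ?q0 ?q'0.
Qed.

Lemma germN k v dv : germ k v dv -> germ (- k) (- v) (- dv).
Proof.
move=> [p [q [q0 -> -> ->]]]; exists (- p), q.
by rewrite mderivN !mevalN rmorphN /= q0; split=> //; field; rewrite ?nz ?q0.
Qed.

Lemma germM k k' v v' dv dv' : germ k v dv -> germ k' v' dv' ->
  germ (k * k') (v * v') (v * dv' + dv * v').
Proof.
move=> [p [q [q0 -> -> ->]]] [p' [q' [q'0 -> -> ->]]]; exists (p * p'), (q * q').
rewrite !(mderivM, mevalD, mevalM, rmorphM) /= mulf_neq0 //.
by split=> //; field; rewrite ?nz ?q0 ?q'0.
Qed.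

Lemma germV k v dv : germ k v dv -> v != 0 -> germ k^-1 v^-1 (- dv / v ^+ 2).
Proof.
move=> [p [q [q0 -> -> ->]]]; rewrite mulf_eq0 invr_eq0 negb_or => /andP[p0' _]; exists q, p.
by rewrite p0'; split=> //; field; rewrite ?nz ?q0 ?p0'.
Qed.

Lemma germX k v dv m : germ k v dv -> germ (k ^+ m.+1) (v ^+ m.+1) (m.+1%:R * v ^+ m * dv).
Proof.
move=> g; elim: m => [|m IH]; first by rewrite !expr1 expr0 !mul1r.
rewrite exprS [v ^+ _.+2]exprS; have -> : m.+2%:R * v ^+ m.+1 * dv = v * (m.+1%:R * v ^+ m * dv) + dv * v ^+ m.+1.
  by rewrite -[m.+2]addn1 natrD exprS; ring.
exact: germM.
Qed.

Lemma germ_neq0 k v dv : germ k v dv -> v != 0 -> k != 0.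
Proof.
move=> [p [q [q0 -> -> _]]]; rewrite mulf_eq0 invr_eq0 negb_or => /andP[p0' _].
by rewrite mulf_neq0 ?invr_eq0 ?nz.
Qed.

(** On a general line through [p0], the two sides of [p * w ^ 2 = u ^ 2 * q] vanish at [p0] to
    orders of different parity. *)
Lemma germ_nonsquare k dv s : germ k 0 dv -> dv != 0 -> k <> s ^+ 2.
Proof.
move=> [p [q [q0 -> pv ->]]] pd0 /eqP.
have p00 : p.@[p0] = 0 by apply/eqP; move: pv => /esym/eqP; rewrite mulf_eq0 invr_eq0 (negPf q0) orbF.
have {pd0} dp : p^`M(i0).@[p0] != 0.
  by apply: contraNneq pd0 => ->; rewrite p00 !mul0r subr0 mul0r.
have [u [w [w0 ->]]] := xfrac s.
rewrite expr_div_n eqr_div ?expf_neq0 //; last exact: nz.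
move=> /eqP E'.
have E : p * w ^+ 2 = u ^+ 2 * q.
  apply/eqP; rewrite -subr_eq0; apply/eqP/xI; rewrite rmorphB !rmorphM /= -!expr2 E'.
  by rewrite subrr.
have {}w0 : w != 0 by apply: contraNneq w0 => ->; rewrite rmorph0.
have p_neq0 : p != 0 by apply: contraNneq dp => ->; rewrite linear0 meval0.
have u0 : u != 0.
  apply: contraNneq (mulf_neq0 p_neq0 (expf_neq0 2 w0)) => u0.
  by rewrite E u0 expr0n mul0r.
pose line v (g : {mpoly F[n]}) : {poly F} := mmap (@polyC F) (fun i => (p0 i)%:P + v i *: 'X) g.
have lineE v g t : (line v g).[t] = g.@[fun i => p0 i + v i * t].
  rewrite -[LHS]/(horner_eval t (line v g)) rmorph_mmap; apply: eq_mmap => // i /=.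
    by rewrite horner_evalE hornerC.
  by rewrite horner_evalE hornerD hornerC hornerZ hornerX.
pose sh g : {mpoly F[n]} := g \mPo [tuple (p0 i)%:MP + 'X_i | i < n].
have shE g v : (sh g).@[v] = g.@[fun i => p0 i + v i].
  by rewrite comp_mpoly_meval; apply: meval_eq => i; rewrite tnth_mktuple mevalD mevalC mevalXU.
have sh0 g : g != 0 -> sh g != 0.
  move=> /meval_neq0[t gt]; apply: contraNneq gt => sg.
  have := shE g (fun i => t i - p0 i); rewrite sg meval0 => /esym <-.
  by apply/eqP/meval_eq => i; rewrite addrC subrK.
pose dl : {mpoly F[n]} := \sum_i (p^`M(i).@[p0]) *: 'X_i.
have dl0 : dl != 0.
  apply: contraNneq dp => dl0; have := congr1 (meval (fun i => (i == i0)%:R)) dl0.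
  rewrite meval0 raddf_sum /= (bigD1 i0) //= big1 => [|i /negPf ii]; last by rewrite mevalZ mevalXU ii mulr0.
  by rewrite addr0 mevalZ mevalXU eqxx mulr1 => ->.
(* The direction [v] is such that neither [u] nor [w] vanishes identically on the line and that the
   derivative of [p] along it is nonzero. *)
have [v] := meval_neq0 (mulf_neq0 (mulf_neq0 (sh0 _ u0) (sh0 _ w0)) dl0).
rewrite !mevalM !mulf_eq0 !negb_or !shE => /andP[/andP[uv wv] dlv].
have at1 g : (line v g).[1] = g.@[fun i => p0 i + v i].
  by rewrite lineE; apply: meval_eq => i; rewrite mulr1.
have at0 g : (line v g).[0] = g.@[p0].
  by rewrite lineE; apply: meval_eq => i; rewrite mulr0 addr0.
have U0 : line v u != 0 by apply: contraNneq uv => e; rewrite -at1 e horner0.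
have W0 : line v w != 0 by apply: contraNneq wv => e; rewrite -at1 e horner0.
have Q0 : ~~ root (line v q) 0 by rewrite rootE at0.
have dpoly : derivation (@polyC F) (@deriv F).
  by split=> [c|a b|a b]; rewrite ?derivC ?derivD ?derivM //; ring.
have P' : (line v p)^`().[0] = dl.@[v].
  rewrite (der_mmap dpoly) raddf_sum horner_sum /=; apply: eq_bigr => i _.
  rewrite hornerM -/(line v _) at0 mevalZ mevalXU; congr (_ * _).
  by rewrite derivD derivC derivZ derivX add0r hornerZ hornerC mulr1.
have P0 : line v p != 0 by apply: contraNneq dlv => e; rewrite -P' e deriv0 horner0.
have mP : mup 0 (line v p) = 1%N.
  apply/eqP; rewrite eqn_leq mup_geq // expr1 dvdp_XsubCl rootE at0 p00 eqxx andbT.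
  rewrite mup_leq //; apply/negP => /dvdpP[g gE]; move/eqP: dlv; apply.
  by rewrite -P' gE polyC0 subr0 expr2 !(derivM, derivX, hornerD, hornerM, hornerX, mulr0, mul0r, addr0).
have EP : line v p * line v w ^+ 2 = line v u ^+ 2 * line v q.
  by have := congr1 (line v) E; rewrite /line !rmorphM /= -!expr2.
have Q0' : line v q != 0 by apply: contraNneq Q0 => ->; rewrite rootE horner0.
have := congr1 (mup 0) EP; rewrite !expr2 !mupM ?mulf_neq0 // mP (mupNroot Q0).
by rewrite addn0 !addnn => /(congr1 odd); rewrite addnC oddD !odd_double.
Qed.

End Germs.

Section Quantities.
Variable K : fieldType.
Implicit Types a b c : K.

Definition discr a a' b b' c c' :=
  h_1 a a' b b' c c' ^+ 2 - 4 * h_0 a a' b b' c c' * h_2 a a' b b' c c'.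

(* [V ^+ 2 = xi * (al * xi ^+ 2 + be * xi + ga)] for the Vandermonde [V]. *)
Definition van_al a := - 4 * a ^+ 3.
Definition van_be a a' := (a * a') ^+ 2 + 18 * (a * a') - 27.

(** The resultant of the quadratic equation of [xi] and of the quadratic factor of [V ^ 2]. *)
Definition van_res a a' b b' c c' :=
  let h2 := h_2 a a' b b' c c' in let h1 := h_1 a a' b b' c c' in
  let h0 := h_0 a a' b b' c c' in
  (van_al a * h0 - van_al a' * h2) ^+ 2
    - (van_al a * h1 - van_be a a' * h2) * (van_be a a' * h0 - van_al a' * h1).

(** The norm of [V ^ 2] over the field of the first half, multiplied by [h_2 ^ 4]. *)
Definition van_norm a a' b b' c c' :=
  h_2 a a' b b' c c' * (h_0 a a' b b' c c' * van_res a a' b b' c c').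

(* [p q' - p' q = X * (d3 X^3 + d2 X^2 + d1 X + d0)] *)
Definition lin3 a a' b b' c c' := 4 * a * c' - (b' * c' - a) * (a * b - c').
Definition lin2 a a' b b' c c' :=
  - 2 * c' * (a * a' + b * b' + c * c' - a * b * c) - 2 * a * (a' * c' - b)
  - (a * b - c') * (a * a' + b * b' + c * c' - a' * b' * c') + 2 * b * (b' * c' - a).
Definition lin1 a a' b b' c c' :=
  - 2 * c' * (b * c - a') + (a' * c' - b) * (a * a' + b * b' + c * c' - a * b * c)
  + 2 * a' * (a * b - c') + 2 * b * (a * a' + b * b' + c * c' - a' * b' * c').
Definition lin0 a a' b b' c c' := (a' * c' - b) * (b * c - a') - 4 * a' * b.

Lemma linE a a' b b' c c' X :
  qp a a' b b' c c' X * qq' a a' b b' c c' X - qp' a a' b b' c c' X * qq a a' b b' c c' X =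
  X * (lin3 a a' b b' c c' * X ^+ 3 + lin2 a a' b b' c c' * X ^+ 2
       + lin1 a a' b b' c c' * X + lin0 a a' b b' c c').
Proof. rewrite /qp /qq /qp' /qq' /lin3 /lin2 /lin1 /lin0; ring. Qed.

Lemma linE' a a' b b' c c' X :
  qp a a' b b' c c' X * qr' a a' b b' c c' X - qp' a a' b b' c c' X * qr a a' b b' c c' X =
  X * ((b * b' - c * c') * (2 * a * X ^+ 2 - (a * a' + 3) * X + 2 * a')) * 1.
Proof. rewrite /qp /qr /qp' /qr'; ring. Qed.

(* Remainder of [(2 a) ^ 2 (d3 X^3 + ...)] modulo [2 a X^2 - (A + 3) X + 2 a']. *)
Definition rem1 a a' b b' c c' :=
  lin3 a a' b b' c c' * ((a * a' + 3) ^+ 2 - 4 * (a * a'))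
  + lin2 a a' b b' c c' * (2 * a) * (a * a' + 3) + (2 * a) ^+ 2 * lin1 a a' b b' c c'.
Definition rem0 a a' b b' c c' :=
  - (lin3 a a' b b' c c' * (a * a' + 3) * (2 * a')) - lin2 a a' b b' c c' * (4 * (a * a'))
  + (2 * a) ^+ 2 * lin0 a a' b b' c c'.
Definition lin_res a a' b b' c c' :=
  let m1 := rem1 a a' b b' c c' in let m0 := rem0 a a' b b' c c' in
  2 * a * m0 ^+ 2 + (a * a' + 3) * m0 * m1 + 2 * a' * m1 ^+ 2.

Lemma lin_resP a a' b b' c c' X : 2 * a * X ^+ 2 - (a * a' + 3) * X + 2 * a' = 0 ->
  lin3 a a' b b' c c' * X ^+ 3 + lin2 a a' b b' c c' * X ^+ 2
       + lin1 a a' b b' c c' * X + lin0 a a' b b' c c' = 0 ->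
  lin_res a a' b b' c c' = 0.
Proof.
rewrite /lin_res; set m1 := rem1 _ _ _ _ _ _; set m0 := rem0 _ _ _ _ _ _.
move=> E; set d3 := lin3 _ _ _ _ _ _; set d2 := lin2 _ _ _ _ _ _.
set d1 := lin1 _ _ _ _ _ _; set d0 := lin0 _ _ _ _ _ _ => E'.
have M : m1 * X + m0 = 0.
  transitivity ((2 * a) ^+ 2 * (d3 * X ^+ 3 + d2 * X ^+ 2 + d1 * X + d0)
    - (2 * a * X ^+ 2 - (a * a' + 3) * X + 2 * a') * (d3 * (2 * a * X + (a * a' + 3)) + d2 * (2 * a))).
    by rewrite /m1 /m0 /rem1 /rem0 -/d3 -/d2 -/d1 -/d0; ring.
  by rewrite E E'; ring.
transitivity (m1 ^+ 2 * (2 * a * X ^+ 2 - (a * a' + 3) * X + 2 * a')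
  + (m1 * X + m0) * (2 * a * m0 + (a * a' + 3) * m1 - 2 * a * m1 * X)); last by rewrite E M; ring.
ring.
Qed.

End Quantities.

Definition vec4 (K : Type) (a b c d : K) : 'I_4 -> K := fun i => nth a [:: a; b; c; d] i.

Lemma germ_one (F : closedFieldType) (L : fieldType) (f : {rmorphism F -> L}) n
  (x : 'I_n -> L) p0 i0 : germ f x p0 i0 1 1 0.
Proof. exact: (germ_nat f x p0 i0 1). Qed.

Ltac germs := lazymatch goal with
  | |- @germ _ _ _ _ _ _ _ (?u + ?v) _ _ => eapply germD; [eassumption|germs|germs]
  | |- @germ _ _ _ _ _ _ _ (- ?u) _ _ => eapply germN; [eassumption|germs]
  | |- @germ _ _ _ _ _ _ _ (?u * ?v) _ _ => eapply germM; [eassumption|germs|germs]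
  | |- @germ _ _ _ _ _ _ _ (?u ^+ 2) _ _ => eapply germX; [eassumption|germs]
  | |- @germ _ _ _ _ _ _ _ (?u ^+ 3) _ _ => eapply germX; [eassumption|germs]
  | |- @germ _ _ _ _ _ _ _ (?u ^+ 4) _ _ => eapply germX; [eassumption|germs]
  | |- @germ _ _ _ _ _ _ _ (?u^-1) _ _ => eapply germV; [eassumption|germs|]
  | |- @germ _ _ _ _ _ _ _ (?n%:R) _ _ => eapply germ_nat
  | |- @germ _ _ _ _ _ _ _ 1 _ _ => eapply germ_one
  | |- _ => eassumption
  end.

Section Numeric.
Variables (F : closedFieldType) (L : fieldType) (f : {rmorphism F -> L}).
Hypothesis F0 : [pchar F] =i pred0.
Variables x2 x3 y2 y3 : L.
Let x := vec4 x2 x3 y2 y3.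
Hypothesis xI : alg_indep f x.
Hypothesis xfrac : forall k, exists p q, mmap f x q != 0 /\ k = mmap f x p / mmap f x q.

Let a := - (1 + x2^-1 + x3^-1).
Let a' := - (1 + x2 + x3).
Let b := - (1 + y2^-1 + y3^-1).
Let b' := - (1 + y2 + y3).
Let c := - (1 + x2 * y2 + x3 * y3).
Let c' := - (1 + (x2 * y2)^-1 + (x3 * y3)^-1).

Lemma germ_eq p0 i0 k v dv v' dv' : germ f x p0 i0 k v dv -> v = v' -> dv = dv' ->
  germ f x p0 i0 k v' dv'.
Proof. by move=> g <- <-. Qed.

Let n0 k : k.+1%:R != 0 :> F. Proof. by have /pcharf0P -> := F0. Qed.

Let n0' k : (k.+1%:R == 0 :> F) = false. Proof. exact/negbTE/n0. Qed.

Ltac nzs := rewrite ?(oppr_eq0, invr_eq0, mulf_eq0, expf_eq0, n0', oner_eq0) //.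
Ltac num := field; nzs.


Lemma germ_coord p0 i0 : [/\ germ f x p0 i0 x2 (p0 (@Ordinal 4 0 isT)) (@Ordinal 4 0 isT == i0)%:R,
  germ f x p0 i0 x3 (p0 (@Ordinal 4 1 isT)) (@Ordinal 4 1 isT == i0)%:R,
  germ f x p0 i0 y2 (p0 (@Ordinal 4 2 isT)) (@Ordinal 4 2 isT == i0)%:R &
  germ f x p0 i0 y3 (p0 (@Ordinal 4 3 isT)) (@Ordinal 4 3 isT == i0)%:R].
Proof.
split; [exact: (germ_var f x p0 i0 (@Ordinal 4 0 isT))|exact: (germ_var f x p0 i0 (@Ordinal 4 1 isT))
  |exact: (germ_var f x p0 i0 (@Ordinal 4 2 isT))|exact: (germ_var f x p0 i0 (@Ordinal 4 3 isT))].
Qed.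

Ltac germ_eval := eapply germ_eq; [germs| |];
  try by [nzs | num].

Lemma discr_nonsquare : h_2 a a' b b' c c' != 0 /\ forall s, discr a a' b b' c c' <> s ^+ 2.
Proof.
(* A rational zero of [discr], simple in the direction of [x3]. *)
pose p0 := vec4 (4 : F) (- 2^-1) (- 12^-1) (- (2 / 3)).
pose i0 : 'I_4 := @Ordinal 4 1 isT.
have [/= g2 g3 k2 k3] := germ_coord p0 i0.
rewrite /p0 /vec4 /= -/(vec4 _ _ _ _) -/p0 in g2 g3 k2 k3.
have ga : germ f x p0 i0 a (3 / 4) 4 by rewrite /a; germ_eval.
have ga' : germ f x p0 i0 a' (- (9 / 2)) (- 1) by rewrite /a'; germ_eval.
have gb : germ f x p0 i0 b (25 / 2) 0 by rewrite /b; germ_eval.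
have gb' : germ f x p0 i0 b' (- (1 / 4)) 0 by rewrite /b'; germ_eval.
have gc : germ f x p0 i0 c (- 1) (2 / 3) by rewrite /c; germ_eval.
have gc' : germ f x p0 i0 c' (- 1) (- 6) by rewrite /c'; germ_eval.
clearbody p0 i0 a a' b b' c c'.
have gh2 : germ f x p0 i0 (h_2 a a' b b' c c') (- (35 / 16)) (- (141 / 4)).
  by rewrite /h_2 /eI /eII; germ_eval.
have gh1 : germ f x p0 i0 (h_1 a a' b b' c c') (- (595 / 2)) (- (21 * 4363 / 32)).
  by rewrite /h_1; germ_eval.
have gh0 : germ f x p0 i0 (h_0 a a' b b' c c') (- (35 * 289)) (3 * (107 * 110 + 37) / 2).
  by rewrite /h_0 /eI /eII; germ_eval.
split; first by apply: (germ_neq0 xI gh2); nzs.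
move=> s; apply: (germ_nonsquare xI xfrac (dv := 945 * (121 * 121) / 32)).
  by rewrite /discr; germ_eval.
by nzs.
Qed.

Lemma van_norm_nonsquare : [/\ h_0 a a' b b' c c' != 0, a * a' != 1, b * b' != c * c',
  lin_res a a' b b' c c' != 0 & forall s, van_norm a a' b b' c c' <> s ^+ 2].
Proof.
(* Here [h_2] has a simple zero in the direction of [y3], while [h_0] and [van_res] do not vanish;
   hence [van_norm] has a simple zero. The other quantities are nonzero at the same point. *)
pose p0 := vec4 (1 : F) 2 3 (- 1).
pose i0 : 'I_4 := @Ordinal 4 3 isT.
have [/= g2 g3 k2 k3] := germ_coord p0 i0.
rewrite /p0 /vec4 /= -/(vec4 _ _ _ _) -/p0 in g2 g3 k2 k3.
have ga : germ f x p0 i0 a (- (5 / 2)) 0 by rewrite /a; germ_eval.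
have ga' : germ f x p0 i0 a' (- 4) 0 by rewrite /a'; germ_eval.
have gb : germ f x p0 i0 b (- (1 / 3)) 1 by rewrite /b; germ_eval.
have gb' : germ f x p0 i0 b' (- 3) (- 1) by rewrite /b'; germ_eval.
have gc : germ f x p0 i0 c (- 2) (- 2) by rewrite /c; germ_eval.
have gc' : germ f x p0 i0 c' (- (5 / 6)) (2^-1) by rewrite /c'; germ_eval.
clearbody p0 i0 a a' b b' c c'.
have gh2 : germ f x p0 i0 (h_2 a a' b b' c c') 0 (- (1000 / 9)).
  by rewrite /h_2 /eI /eII; germ_eval.
have gh1 : germ f x p0 i0 (h_1 a a' b b' c c') (- (3364 / 27)) (4372 / 27).
  by rewrite /h_1; germ_eval.
have gh0 : germ f x p0 i0 (h_0 a a' b b' c c') (106 * 100 / 27) (- (613 * 16 / 27)).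
  by rewrite /h_0 /eI /eII; germ_eval.
have nz k k' v dv : germ f x p0 i0 k v dv -> v = k' -> k' != 0 -> k != 0.
  by move=> g <-; apply: (germ_neq0 xI g).
split.
- by apply: (germ_neq0 xI gh0); nzs.
- rewrite -subr_eq0; eapply (nz _ 9); [germs|num|exact: n0].
- rewrite -subr_eq0; eapply (nz _ (- (2 / 3))); [germs|num|].
  by nzs.
- rewrite /lin_res /rem1 /rem0 /lin3 /lin2 /lin1 /lin0.
  eapply (nz _ (- (1250 * 1729))); [germs|num|].
  by nzs.
move=> s; rewrite /van_norm.
have [dv gr] : exists dv, germ f x p0 i0 (h_0 a a' b b' c c' * van_res a a' b b' c c')
    (106 * 100 / 27 * (4000 * 49 * 11 * 169 * 361 / 81)) dv.
  eexists; rewrite /van_res /van_al /van_be; eapply germ_eq; [germs| |reflexivity]; num.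
apply: (germ_nonsquare xI xfrac (dv := - (1000 / 9) * (106 * 100 / 27 * (4000 * 49 * 11 * 169 * 361 / 81)))).
  by eapply germ_eq; [exact: (germM xI gh2 gr)|rewrite mul0r|rewrite mul0r add0r].
by nzs.
Qed.

End Numeric.

(** * Generic points of X(3,6) *)

Section Points.
Variables (F : closedFieldType) (K : fieldType) (f : {rmorphism F -> K}).
Hypothesis K0 : [pchar K] =i pred0.
Implicit Types T : 'I_3 -> 'I_3 -> K.

(** The 12 coordinates are the rows 0 and 1 of the six columns, each row being cut into its two
    halves. *)
Definition two_blocks (R : Type) (g g' h h' : 'I_3 -> R) (i : 'I_(6 + 6)) : R :=
  match split i with
  | inl j => match split (j : 'I_(3 + 3)) with inl k => g k | inr k => g' k end
  | inr j => match split (j : 'I_(3 + 3)) with inl k => h k | inr k => h' k end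
  end.

Lemma two_blocksE (R : Type) (g g' h h' : 'I_3 -> R) k :
  [/\ two_blocks g g' h h' (@lshift 6 6 (@lshift 3 3 k)) = g k,
      two_blocks g g' h h' (@lshift 6 6 (@rshift 3 3 k)) = g' k,
      two_blocks g g' h h' (@rshift 6 6 (@lshift 3 3 k)) = h k &
      two_blocks g g' h h' (@rshift 6 6 (@rshift 3 3 k)) = h' k].
Proof.
have l m n (i : 'I_m) : split (@lshift m n i) = inl i by exact: (unsplitK (inl _)).
have r m n (i : 'I_n) : split (@rshift m n i) = inr i by exact: (unsplitK (inr _)).
by rewrite /two_blocks !(l, r).
Qed.

Definition coords T T' : 'I_(6 + 6) -> K := two_blocks (T 0) (T' 0) (T 1) (T' 1).

(* [T] and [T'] hold the first and the last three columns of a point of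
   [X(3,6)], normalised along the first column; [w_opp] expresses that
   [alpha_i u_k = 0] for [i != k] when the [q_j] add up to [1]. *)
Record wpoint T T' : Prop := WPoint {
  w_triple : is_triple T;
  w_triple' : is_triple T';
  w_norm : forall i, T i 0 = 1;
  w_opp : forall i, sumV T' i = - sumV T i /\ sum T' i = - sum T i }.

Definition xc T := vec4 (T 0 1) (T 0 (1 + 1)) (T 1 1) (T 1 (1 + 1)).

(** Transcendence degree at least 4 in a convenient form: by [generic_of_indep], the four free
    entries of [T] are then independent. *)
Definition generic T T' := wpoint T T' /\ alg_indep f (xc T).

Definition widl T T' : set {mpoly F[6 + 6]} := fun p => mmap f (coords T T') p = 0.

Lemma widl_prime T T' : is_prime (widl T T').
Proof. exact: (prime_kernel (mmap f (coords T T'))). Qed.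

Lemma kills_coords d T T' p : derivation f d -> kills d T -> kills d T' ->
  d (mmap f (coords T T') p) = 0.
Proof.
move=> dd dT dT'; rewrite (der_mmap dd) big1 // => i _.
suff -> : d (coords T T' i) = 0 by rewrite mulr0.
by rewrite /coords /two_blocks; case: split => j; case: split => k.
Qed.

Lemma kills_of_xc d T : is_triple T -> (forall i, T i 0 = 1) -> derivation f d ->
  (forall j, d (xc T j) = 0) -> kills d T.
Proof.
move=> tT T1 dd dx.
have d1 : d 1 = 0 by exact: (der1 dd).
have r0 : forall j, d (T 0 j) = 0.
  apply: ord3_ind; rewrite ?T1 //; [exact: (dx (@Ordinal 4 0 isT))|exact: (dx (@Ordinal 4 1 isT))].
have r1 : forall j, d (T (0 + 1) j) = 0.
  rewrite add0r; apply: ord3_ind; rewrite ?T1 //.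
    exact: (dx (@Ordinal 4 2 isT)). exact: (dx (@Ordinal 4 3 isT)).
move=> i j; move: i; apply: (@ord3_orbit _ 0) => //.
by rewrite triple_third //; apply: (constV dd); apply: (constM dd).
Qed.

Lemma kills_xc d T : kills d T -> forall j, d (xc T j) = 0.
Proof. by move=> dT [[|[|[|[|//]]]] ?]; exact: dT. Qed.

(** Four independent elements exclude the first case of [opposite_spans]; in the second, a
    derivation that kills the free entries of [T] kills everything. *)
Lemma generic_of_indep T T' (u : 'I_4 -> K) : wpoint T T' -> alg_indep f u ->
  (forall d, derivation f d -> kills d T -> kills d T' -> forall j, d (u j) = 0) ->
  generic T T'.
Proof.
move=> w uI uP; split=> //; have [tT tT' T1 opp] := w.
have [[t [t1 t2]]|[_ H]] := opposite_spans f K0 tT tT' T1 opp.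
  have [d [dd dt [j /eqP dj]]] := derivation_kill K0 t uI (ltnSn 3).
  by case: dj; apply: uP => //; [exact: t1|exact: t2].
apply: (indep_of_derivations K0 uI) => d dd dx.
have kT := kills_of_xc tT T1 dd dx; apply: uP => //; exact: H.
Qed.

Lemma generic_kills T T' : generic T T' ->
  full T /\ forall d, derivation f d -> kills d T -> kills d T'.
Proof.
move=> [w xI]; have [tT tT' T1 opp] := w.
have [[t [t1 t2]]|//] := opposite_spans f K0 tT tT' T1 opp.
have [d [dd dt [j /eqP dj]]] := derivation_kill K0 t xI (ltnSn 3).
by case: dj; apply: kills_xc; exact: t1.
Qed.

Lemma generic_no5 T T' (u : 'I_5 -> K) : generic T T' -> alg_indep f u ->
  (forall d, derivation f d -> kills d T -> kills d T' -> forall j, d (u j) = 0) -> False.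
Proof.
move=> g uI uP; have [_ H] := generic_kills g; have [[tT tT' T1 opp] xI] := g.
have [d [dd dt [j /eqP dj]]] := derivation_kill K0 (xc T) uI (ltnSn 4).
by case: dj; have kT := kills_of_xc tT T1 dd dt; apply: uP => //; exact: H.
Qed.

Definition rperm T (s : 'S_3) i j := T i (s j).

Lemma rperm_triple T s : is_triple T -> is_triple (rperm T s).
Proof. by move=> tT j; exact: tT. Qed.

Lemma sumV_rperm T s i : sumV (rperm T s) i = sumV T i.
Proof. by rewrite /sumV [RHS](reindex_inj (@perm_inj _ s)). Qed.

Lemma sum_rperm T s i : sum (rperm T s) i = sum T i.
Proof. by rewrite /sum [RHS](reindex_inj (@perm_inj _ s)). Qed.

Lemma generic_rperm T T' s : generic T T' -> generic T (rperm T' s).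
Proof.
move=> [[tT tT' T1 opp] xI]; split=> //; split=> //; first exact: rperm_triple.
by move=> i; rewrite sumV_rperm sum_rperm.
Qed.

End Points.

Section TwoPoints.
Variable F : closedFieldType.

Definition same (K1 K2 : fieldType) (f1 : {rmorphism F -> K1}) (f2 : {rmorphism F -> K2})
    (T1 T1' : 'I_3 -> 'I_3 -> K1) (T2 T2' : 'I_3 -> 'I_3 -> K2) :=
  forall p, mmap f1 (coords T1 T1') p = 0 <-> mmap f2 (coords T2 T2') p = 0.

Definition xpoly : 'I_4 -> {mpoly F[6 + 6]} := 
  vec4 'X_(@lshift 6 6 (@lshift 3 3 1)) 'X_(@lshift 6 6 (@lshift 3 3 (1 + 1)))
    'X_(@rshift 6 6 (@lshift 3 3 1)) 'X_(@rshift 6 6 (@lshift 3 3 (1 + 1))).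

Lemma xpoly_indep (K : fieldType) (f : {rmorphism F -> K}) T T' : generic f T T' ->
  indep_mod (widl f T T') xpoly.
Proof.
move=> [_ xI]; apply/(indep_modP xpoly (fun p => iff_refl _)) => Q Q0; apply: xI; rewrite -[RHS]Q0.
have E k := two_blocksE (T 0) (T' 0) (T 1) (T' 1) k.
have [e1 _ e3 _] := E 1; have [e2 _ e4 _] := E (1 + 1).
apply: eq_mmap => // -[[|[|[|[|//]]]] ?]; rewrite /xpoly /xc /vec4 /= mmapX mmap1U //.
Qed.

Variables (K1 K2 : fieldType) (f1 : {rmorphism F -> K1}) (f2 : {rmorphism F -> K2}).
Hypothesis K10 : [pchar K1] =i pred0.

(** A strict inclusion would give a fifth independent element. *)
Lemma generic_sub_same T1 T1' T2 T2' : generic f1 T1 T1' -> generic f2 T2 T2' ->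
  (widl f1 T1 T1' `<=` widl f2 T2 T2')%classic -> same f1 f2 T1 T1' T2 T2'.
Proof.
move=> g1 g2 sub p; split; first exact: sub.
move=> p2; apply: contrapT => p1; have uI := xpoly_indep g2.
have [u' /(indep_modP u' (fun p => iff_refl _)) u'I] :=
  indep_step (widl_prime f1 T1 T1') (widl_prime f2 T2 T2') sub p2 p1 uI.
by apply: (generic_no5 K10 g1 u'I) => d dd k k' j; exact: kills_coords.
Qed.

End TwoPoints.

Lemma char0_ext (F K : fieldType) (f : {rmorphism F -> K}) :
  [pchar F] =i pred0 -> [pchar K] =i pred0.
Proof. by move=> F0 p; rewrite -F0 (fmorph_pchar f). Qed.

Section OwnSums.
Variable K : fieldType.
Implicit Types u v : K.
Definition oppV u v := - (1 + u^-1 + v^-1).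
Definition oppS u v := - (1 + u + v).
End OwnSums.

Section Morphism.
Variables (L K : fieldType) (psi : {rmorphism L -> K}).
Ltac morph := rewrite ?(rmorphXn, rmorphD, rmorphN, rmorphM, rmorph_nat, rmorph1) //=.

Lemma h_2_morph a a' b b' c c' : psi (h_2 a a' b b' c c') =
  h_2 (psi a) (psi a') (psi b) (psi b') (psi c) (psi c').
Proof. by rewrite /h_2 /eI /eII; morph. Qed.
Lemma h_1_morph a a' b b' c c' : psi (h_1 a a' b b' c c') =
  h_1 (psi a) (psi a') (psi b) (psi b') (psi c) (psi c').
Proof. by rewrite /h_1; ring. Qed.
Lemma h_0_morph a a' b b' c c' : psi (h_0 a a' b b' c c') =
  h_0 (psi a) (psi a') (psi b) (psi b') (psi c) (psi c').
Proof. by rewrite /h_0 /eI /eII; morph. Qed.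
Lemma lin3_morph a a' b b' c c' : psi (lin3 a a' b b' c c') =
  lin3 (psi a) (psi a') (psi b) (psi b') (psi c) (psi c').
Proof. by rewrite /lin3; morph. Qed.
Lemma lin2_morph a a' b b' c c' : psi (lin2 a a' b b' c c') =
  lin2 (psi a) (psi a') (psi b) (psi b') (psi c) (psi c').
Proof. by rewrite /lin2; morph. Qed.
Lemma lin1_morph a a' b b' c c' : psi (lin1 a a' b b' c c') =
  lin1 (psi a) (psi a') (psi b) (psi b') (psi c) (psi c').
Proof. by rewrite /lin1; morph. Qed.
Lemma lin0_morph a a' b b' c c' : psi (lin0 a a' b b' c c') =
  lin0 (psi a) (psi a') (psi b) (psi b') (psi c) (psi c').
Proof. by rewrite /lin0; morph. Qed.
Lemma lin_res_morph a a' b b' c c' : psi (lin_res a a' b b' c c') =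
  lin_res (psi a) (psi a') (psi b) (psi b') (psi c) (psi c').
Proof.
rewrite /lin_res /rem1 /rem0 -lin3_morph -lin2_morph -lin1_morph -lin0_morph; ring.
Qed.
Lemma oppV_morph u v : psi (oppV u v) = oppV (psi u) (psi v).
Proof. by rewrite /oppV rmorphN !rmorphD /= rmorph1 !fmorphV. Qed.
Lemma oppS_morph u v : psi (oppS u v) = oppS (psi u) (psi v).
Proof. by rewrite /oppS rmorphN !rmorphD /= rmorph1. Qed.
End Morphism.

(** * The second half over the field of the first *)

Section Base.
Variables (F : closedFieldType) (L : fieldType) (f0 : {rmorphism F -> L}).
Hypothesis F0 : [pchar F] =i pred0.
Variables x2 x3 y2 y3 : L.
Hypothesis xI : alg_indep f0 (vec4 x2 x3 y2 y3).
Hypothesis xfrac : forall k, exists p q, mmap f0 (vec4 x2 x3 y2 y3) q != 0 /\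
  k = mmap f0 (vec4 x2 x3 y2 y3) p / mmap f0 (vec4 x2 x3 y2 y3) q.

Variables a a' b b' c c' h2 h1 h0 : L.
Hypotheses (aE : a = oppV x2 x3) (aE' : a' = oppS x2 x3) (bE : b = oppV y2 y3)
  (bE' : b' = oppS y2 y3) (cE : c = oppS (x2 * y2) (x3 * y3)) (cE' : c' = oppV (x2 * y2) (x3 * y3)).
Hypotheses (h2E : h2 = h_2 a a' b b' c c') (h1E : h1 = h_1 a a' b b' c c')
  (h0E : h0 = h_0 a a' b b' c c').

Let discr_facts : h2 != 0 /\ forall s, discr a a' b b' c c' <> s ^+ 2.
Proof. by rewrite h2E aE aE' bE bE' cE cE'; exact: (discr_nonsquare F0 xI xfrac). Qed.

Let norm_facts : [/\ h0 != 0, a * a' != 1, b * b' != c * c', lin_res a a' b b' c c' != 0 &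
  forall s, van_norm a a' b b' c c' <> s ^+ 2].
Proof. by rewrite h0E aE aE' bE bE' cE cE'; exact: (van_norm_nonsquare F0 xI xfrac). Qed.

Let h2n : h2 != 0. Proof. by have [] := discr_facts. Qed.
Let h0n : h0 != 0. Proof. by have [] := norm_facts. Qed.

Definition xi_poly : {poly L} := h2%:P * 'X ^+ 2 + h1%:P * 'X + h0%:P.


Lemma xi_polyE (t : L) : xi_poly.[t] = h2 * t ^+ 2 + h1 * t + h0.
Proof. by rewrite !(hornerD, hornerM, hornerC, hornerX, horner_exp). Qed.

Lemma xi_poly_root s : ~~ root xi_poly s.
Proof.
apply/negP; rewrite rootE xi_polyE => /eqP E; have [_ nsq] := discr_facts.
apply: (nsq (2 * h2 * s + h1)); rewrite /discr -h2E -h1E -h0E.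
transitivity (h1 ^+ 2 - 4 * h0 * h2 + 4 * h2 * (h2 * s ^+ 2 + h1 * s + h0)); last by ring.
by rewrite E mulr0 addr0.
Qed.

Lemma size_xi_poly : size xi_poly = 3%N.
Proof.
rewrite /xi_poly -addrA size_polyDl size_Cmul // size_polyXn //.
apply: (leq_ltn_trans (size_polyD _ _)); rewrite gtn_max !mul_polyC.
rewrite (leq_ltn_trans (size_scale_leq _ _)) ?size_polyX //=.
by rewrite (leq_ltn_trans (size_polyC_leq1 _)).
Qed.

Section Over.
Variables (K : fieldType) (f : {rmorphism F -> K}) (psi : {rmorphism L -> K}).
Variables T T' : 'I_3 -> 'I_3 -> K.
Hypothesis w : wpoint T T'.
Hypothesis xT : [/\ T 0 1 = psi x2, T 0 (1 + 1) = psi x3, T 1 1 = psi y2 & T 1 (1 + 1) = psi y3].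

Let tT : is_triple T := w_triple w.
Let tT' : is_triple T' := w_triple' w.

Lemma own_sums : [/\ sumV T' 0 = psi a /\ sum T' 0 = psi a',
  sumV T' 1 = psi b /\ sum T' 1 = psi b' &
  sumV T' (1 + 1) = psi c /\ sum T' (1 + 1) = psi c'].
Proof.
have [e1 e2 e3 e4] := xT; have opp := w_opp w; have n1 := w_norm w.
have third j : T (1 + 1) j = (T 0 j * T 1 j)^-1.
  by have := triple_third 0 j tT; rewrite !add0r.
split; split; rewrite ?(opp _).1 ?(opp _).2 /sumV /sum (ord3_big _ _ 0) /= add0r ?third ?n1
  ?e1 ?e2 ?e3 ?e4 ?aE ?aE' ?bE ?bE' ?cE ?cE' ?oppV_morph ?oppS_morph ?invr1 ?mul1r ?invr1 ?invrK //.
- by rewrite /oppS !rmorphM.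
- by rewrite /oppV !rmorphM.
Qed.

Definition xi := \prod_j T' 0 j.

Lemma esym_values : [/\ T' 0 0 + T' 0 1 + T' 0 (1 + 1) = psi a',
  T' 0 0 * T' 0 1 + T' 0 0 * T' 0 (1 + 1) + T' 0 1 * T' 0 (1 + 1) = psi a * xi &
  T' 0 0 * T' 0 1 * T' 0 (1 + 1) = xi].
Proof.
have [[e1 e2] _ _] := own_sums; rewrite -e1 -e2 /xi /sumV /sum !(ord3_big _ _ 0) /= !add0r.
by split=> //; field; rewrite !triple_neq0.
Qed.

Lemma cubic_root j : T' 0 j ^+ 3 - psi a' * T' 0 j ^+ 2 + psi a * xi * T' 0 j - xi = 0.
Proof.
have [<- <- <-] := esym_values; move: j; apply: ord3_ind; ring.
Qed.

Let X j := T' 0 j.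
Let Xn j : T' 0 j != 0. Proof. exact: triple_neq0. Qed.

(** By [cubic_root], [X ^ 3 - a' X ^ 2 = - xi (a X - 1)], which turns the sextic into
    [(a X - 1) ^ 2] times the quadratic in [xi]. The first factor is nonzero because
    [a * a' != 1]. *)
Lemma xi_quad : psi h2 * xi ^+ 2 + psi h1 * xi + psi h0 = 0.
Proof.
have [E E'] := column_eqs 0 0 tT'; have := resultant2 E E'.
have [[e1 e2] [e3 e4] [e5 e6]] := own_sums.
rewrite {E E'} /at6 !add0r e1 e2 e3 e4 e5 e6 sextic_resultant => /eqP.
rewrite mulf_eq0 (negPf (Xn 0)) /= -h_2_morph -h_1_morph -h_0_morph -h2E -h1E -h0E.
have E1 : T' 0 0 ^+ 3 - psi a' * T' 0 0 ^+ 2 = - xi * (psi a * T' 0 0 - 1).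
  by apply/eqP; rewrite -subr_eq0 -[X in _ == X](cubic_root 0); apply/eqP; ring.
rewrite E1; have -> : psi h2 * (- xi * (psi a * T' 0 0 - 1)) ^+ 2
  - psi h1 * (- xi * (psi a * T' 0 0 - 1)) * (psi a * T' 0 0 - 1)
  + psi h0 * (psi a * T' 0 0 - 1) ^+ 2 =
  (psi a * T' 0 0 - 1) ^+ 2 * (psi h2 * xi ^+ 2 + psi h1 * xi + psi h0) by ring.
rewrite mulf_eq0 expf_eq0 /= => /orP[/eqP aX|/eqP //].
have [_ A1 _ _ _] := norm_facts; case/eqP: A1.
apply: (fmorph_inj psi); rewrite rmorphM rmorph1 /=.
have X' : T' 0 0 = psi a'.
  move/eqP: E1; rewrite aX mulr0 -[_ - _]/(_) => /eqP E1.
  apply: (mulIf (expf_neq0 2 (Xn 0))); apply/eqP; rewrite -subr_eq0 -[X in _ == X]E1.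
  by apply/eqP; ring.
by apply/eqP; rewrite -subr_eq0 -X' aX.
Qed.

Lemma xi_poly_xi : (map_poly psi xi_poly).[xi] = 0.
Proof.
rewrite -xi_quad /xi_poly !(rmorphD, rmorphM, rmorphXn) /= !map_polyC map_polyX.
by rewrite !(hornerD, hornerM, hornerC, hornerX, horner_exp).
Qed.

Lemma xi_poly_dvd q : (map_poly psi q).[xi] = 0 -> xi_poly %| q.
Proof.
move=> q0; rewrite /dvdp; set r := q %% xi_poly.
have r0 : (map_poly psi r).[xi] = 0.
  have := q0; rewrite {1}(divp_eq q xi_poly) rmorphD rmorphM hornerD hornerM.
  by rewrite xi_poly_xi mulr0 add0r.
have sr : (size r <= 2)%N.
  by rewrite -ltnS -size_xi_poly ltn_modp -size_poly_eq0 size_xi_poly.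
have rE : r = (r`_1)%:P * 'X + (r`_0)%:P.
  apply/polyP => -[|[|i]]; rewrite coefD coefMX !coefC ?addr0 ?add0r //=.
  by rewrite nth_default // (leq_trans sr).
move: r0; rewrite rE rmorphD rmorphM /= !map_polyC map_polyX !hornerE => r0.
have [r1|r1] := eqVneq r`_1 0.
  have r00 : r`_0 = 0.
    apply/eqP; rewrite -(fmorph_eq0 psi); have p1 : psi r`_1 = 0 by apply/eqP; rewrite fmorph_eq0; apply/eqP.
    have r0' : psi r`_1 * xi + psi r`_0 = 0 by exact: r0.
    by move: r0'; rewrite p1 mul0r add0r => ->.
  by rewrite r1 r00 polyC0 mul0r addr0.
have xiE : xi = psi (- (r`_0 / r`_1)).
  rewrite rmorphN fmorph_div /=; apply: (mulfI (_ : psi r`_1 != 0)); first by rewrite fmorph_eq0.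
  rewrite mulrN mulrCA divff ?fmorph_eq0 // mulr1.
  by apply/eqP; rewrite -addr_eq0 r0.
have := xi_poly_xi; rewrite xiE horner_map => /eqP; rewrite fmorph_eq0.
by have := xi_poly_root (- (r`_0 / r`_1)); rewrite rootE => /negPf->.
Qed.

Lemma xi_linear q q' : (map_poly psi q').[xi] != 0 ->
  exists v0 v1, (map_poly psi q).[xi] / (map_poly psi q').[xi] = psi v0 + psi v1 * xi.
Proof.
move=> q'0; have cop : coprimep xi_poly q'.
  have [d dQ] : exists d, d = gcdp xi_poly q' by exists (gcdp xi_poly q').
  rewrite /coprimep -dQ; have dvd1 : d %| xi_poly by rewrite dQ dvdp_gcdl.
  have dvd2 : d %| q' by rewrite dQ dvdp_gcdr.
  have /dvdpP[e eE] := dvd1; have /dvdpP[e' e'E] := dvd2.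
  have := xi_poly_xi; rewrite eE rmorphM hornerM => /eqP; rewrite mulf_eq0 => /orP[/eqP/xi_poly_dvd Qe|/eqP dx].
    have e0 : e != 0.
      by apply/eqP => e0; have := size_xi_poly; rewrite eE e0 mul0r size_poly0.
    have d0 : d != 0.
      by apply/eqP => d0; have := size_xi_poly; rewrite eE d0 mulr0 size_poly0.
    have := dvdp_leq e0 Qe; rewrite eE size_mul // => s1.
    rewrite eqn_leq lt0n size_poly_eq0 d0 andbT.
    have : (0 < size e)%N by rewrite lt0n size_poly_eq0.
    by move: s1; lia.
  by case/eqP: q'0; rewrite e'E rmorphM hornerM dx mulr0.
have /Bezout_eq1_coprimepP[[u v] /= uv] := cop.
have vE : (map_poly psi v).[xi] = ((map_poly psi q').[xi])^-1.
  have := congr1 (fun p => (map_poly psi p).[xi]) uv.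
  rewrite rmorphD !rmorphM hornerD !hornerM xi_poly_xi mulr0 add0r rmorph1 hornerC => E.
  by apply: (mulIf q'0); rewrite E mulVf.
pose r := (q * v) %% xi_poly; exists r`_0, r`_1.
have sr : (size r <= 2)%N.
  by rewrite -ltnS -size_xi_poly ltn_modp -size_poly_eq0 size_xi_poly.
have rE : r = (r`_1)%:P * 'X + (r`_0)%:P.
  apply/polyP => -[|[|i]]; rewrite coefD coefMX !coefC ?addr0 ?add0r //=.
  by rewrite nth_default // (leq_trans sr).
rewrite -vE -hornerM -rmorphM {1}(divp_eq (q * v) xi_poly) -/r rmorphD rmorphM hornerD hornerM.
rewrite xi_poly_xi mulr0 add0r {1}rE rmorphD rmorphM /= !map_polyC map_polyX !hornerE.
by rewrite addrC.
Qed.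

Definition lin_at (x : K) := psi (lin3 a a' b b' c c') * x ^+ 3 +
  psi (lin2 a a' b b' c c') * x ^+ 2 + psi (lin1 a a' b b' c c') * x + psi (lin0 a a' b b' c c').

(** The combination of the two quadratics that eliminates the square of [T' 1 j]; by [lin_at_neq0]
    it expresses the second row through the first. *)
Lemma row_linear j : lin_at (T' 0 j) * T' 1 j +
  psi (b * b' - c * c') * (2 * psi a * T' 0 j ^+ 2 - (psi a * psi a' + 3) * T' 0 j + 2 * psi a') = 0.
Proof.
have [] := column_eqs 0 j tT'; have [[e1 e2] [e3 e4] [e5 e6]] := own_sums.
rewrite /at6 !add0r e1 e2 e3 e4 e5 e6.
set p := qp _ _ _ _ _ _ _; set q := qq _ _ _ _ _ _ _; set r := qr _ _ _ _ _ _ _.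
set p' := qp' _ _ _ _ _ _ _; set q' := qq' _ _ _ _ _ _ _; set r' := qr' _ _ _ _ _ _ _.
move=> E E'; apply: (mulfI (Xn j)); rewrite mulr0.
transitivity ((p * q' - p' * q) * T' 1 j + (p * r' - p' * r) * 1).
  rewrite linE /r' /p /p' /r linE' /lin_at lin3_morph lin2_morph lin1_morph lin0_morph.
  by rewrite rmorphB !rmorphM /=; ring.
transitivity (p * (p' * T' 1 j ^+ 2 + q' * T' 1 j + r') - p' * (p * T' 1 j ^+ 2 + q * T' 1 j + r)).
  by ring.
by rewrite E E' !mulr0 subrr.
Qed.

Lemma lin_at_neq0 j : lin_at (T' 0 j) != 0.
Proof.
apply/eqP => E; have := row_linear j; rewrite E mul0r add0r => /eqP.
have [_ _ BC res0 _] := norm_facts.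
rewrite mulf_eq0 fmorph_eq0 subr_eq0 (negPf BC) /= => /eqP E2.
move: E; rewrite /lin_at lin3_morph lin2_morph lin1_morph lin0_morph => E.
have /eqP := lin_resP E2 E; rewrite -lin_res_morph fmorph_eq0.
by rewrite (negPf res0).
Qed.

Lemma vandermonde_sq : ((T' 0 0 - T' 0 1) * (T' 0 1 - T' 0 (1 + 1)) * (T' 0 (1 + 1) - T' 0 0)) ^+ 2 =
  xi * (psi (van_al a) * xi ^+ 2 + psi (van_be a a') * xi + psi (van_al a')).
Proof.
have [e1 e2 e3] := esym_values; rewrite /van_al /van_be.
rewrite ?(rmorphXn, rmorphB, rmorphD, rmorphN, rmorphM, rmorph_nat) /=.
transitivity ((psi a' * (psi a * xi)) ^+ 2 - 4 * (psi a * xi) ^+ 3 - 4 * psi a' ^+ 3 * xi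
  + 18 * psi a' * (psi a * xi) * xi - 27 * xi ^+ 2); last by ring.
by rewrite -e2 -e1 -e3; ring.
Qed.

(* The norm of [V] from [F(x)(xi)] to [F(x)] would be a square root of
   [van_norm], up to a square. *)
Lemma vandermonde_not_linear v0 v1 :
  (T' 0 0 - T' 0 1) * (T' 0 1 - T' 0 (1 + 1)) * (T' 0 (1 + 1) - T' 0 0) <> psi v0 + psi v1 * xi.
Proof.
move=> V; have := vandermonde_sq; rewrite V => V2.
pose al := van_al a; pose be := van_be a a'; pose ga := van_al a'.
pose gp : {poly L} := (v0%:P + v1%:P * 'X) ^+ 2 - 'X * (al%:P * 'X ^+ 2 + be%:P * 'X + ga%:P).
have gpE (t : K) : (map_poly psi gp).[t] =
    (psi v0 + psi v1 * t) ^+ 2 - t * (psi al * t ^+ 2 + psi be * t + psi ga).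
  rewrite /gp !(rmorphXn, rmorphB, rmorphD, rmorphM) /= !map_polyC map_polyX.
  by rewrite !(hornerD, hornerN, hornerM, hornerC, hornerX, horner_exp).
have /dvdpP[e eE] : xi_poly %| gp by apply: xi_poly_dvd; rewrite gpE V2 subrr.
(* The conjugate of [xi]. The formula for [V ^ 2] carries over to it because [xi_poly] divides
   [gp]. *)
pose xi' := - psi (h1 / h2) - xi.
have E1 := xi_quad; have h2p : psi h2 != 0 by rewrite fmorph_eq0.
have xi'Q : psi h2 * xi' ^+ 2 + psi h1 * xi' + psi h0 = 0.
  by rewrite -E1 /xi' fmorph_div; field.
have V2' : (psi v0 + psi v1 * xi') ^+ 2 = xi' * (psi al * xi' ^+ 2 + psi be * xi' + psi ga).
  apply/eqP; rewrite -subr_eq0 -gpE eE rmorphM hornerM; apply/eqP.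
  rewrite [X in _ * X](_ : _ = 0) ?mulr0 // -xi'Q /xi_poly.
  rewrite !(rmorphD, rmorphM, rmorphXn) /= !map_polyC map_polyX.
  by rewrite !(hornerD, hornerM, hornerC, hornerX, horner_exp).
have xixi : xi * xi' = psi h0 / psi h2.
  have -> : psi h0 = - (psi h2 * xi ^+ 2 + psi h1 * xi) by apply/eqP; rewrite -addr_eq0 addrC E1.
  by rewrite /xi' fmorph_div; field.
have xi_xi : xi + xi' = - psi h1 / psi h2 by rewrite /xi' fmorph_div; ring.
have [_ _ _ _ nsq] := norm_facts.
apply: (nsq ((v0 ^+ 2 - v0 * v1 * h1 / h2 + v1 ^+ 2 * h0 / h2) * h2 ^+ 2)).
apply: (fmorph_inj psi).
rewrite /van_norm /van_res -h2E -h1E -h0E -/al -/be -/ga.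
rewrite [RHS]rmorphXn /=.
have -> : psi ((v0 ^+ 2 - v0 * v1 * h1 / h2 + v1 ^+ 2 * h0 / h2) * h2 ^+ 2) =
    (psi v0 + psi v1 * xi) * (psi v0 + psi v1 * xi') * psi h2 ^+ 2.
  transitivity ((psi v0 ^+ 2 + psi v0 * psi v1 * (xi + xi') + psi v1 ^+ 2 * (xi * xi')) * psi h2 ^+ 2).
    rewrite xi_xi xixi !(rmorphM, rmorphXn, rmorphD, rmorphN, fmorphV) /=; ring.
  ring.
move: V2 V2'; move: (psi v0 + psi v1 * xi) (psi v0 + psi v1 * xi') => u u' U U'.
have -> : (u * u' * psi h2 ^+ 2) ^+ 2 = u ^+ 2 * u' ^+ 2 * psi h2 ^+ 4 by ring.
rewrite U U'.
transitivity ((xi * xi') * (psi al ^+ 2 * (xi * xi') ^+ 2 + psi al * psi be * (xi * xi') * (xi + xi')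
  + psi al * psi ga * ((xi + xi') ^+ 2 - 2 * (xi * xi')) + psi be ^+ 2 * (xi * xi')
  + psi be * psi ga * (xi + xi') + psi ga ^+ 2) * psi h2 ^+ 4).
  rewrite xixi xi_xi ?(rmorphXn, rmorphB, rmorphD, rmorphN, rmorphM) /=; field; exact: h2p.
ring.
Qed.

End Over.
End Base.

(** The roots of [chi] are the first row of [T']; [delta] and [kappa] are the two coefficients of
    [row_linear], as polynomials in [T' 0 j]. *)
Definition chi (E : fieldType) (a a' xi : E) : {poly E} :=
  'X ^+ 3 - a'%:P * 'X ^+ 2 + (a * xi)%:P * 'X - xi%:P.
Definition delta (E : fieldType) (a a' b b' c c' : E) : {poly E} :=
  (lin3 a a' b b' c c')%:P * 'X ^+ 3 + (lin2 a a' b b' c c')%:P * 'X ^+ 2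
  + (lin1 a a' b b' c c')%:P * 'X + (lin0 a a' b b' c c')%:P.
Definition kappa (E : fieldType) (a a' b b' c c' : E) : {poly E} :=
  (b * b' - c * c')%:P * ((2 * a)%:P * 'X ^+ 2 - (a * a' + 3)%:P * 'X + (2 * a')%:P).

Section Rho.
Variables (F : closedFieldType) (L : fieldType) (f0 : {rmorphism F -> L}).
Hypothesis F0 : [pchar F] =i pred0.
Variables x2 x3 y2 y3 : L.
Hypothesis xI : alg_indep f0 (vec4 x2 x3 y2 y3).
Hypothesis xfrac : forall k, exists p q, mmap f0 (vec4 x2 x3 y2 y3) q != 0 /\
  k = mmap f0 (vec4 x2 x3 y2 y3) p / mmap f0 (vec4 x2 x3 y2 y3) q.
Variables (K : fieldType) (f : {rmorphism F -> K}) (psi : {rmorphism L -> K}).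
Variables T T' : 'I_3 -> 'I_3 -> K.
Hypothesis w : wpoint T T'.
Hypothesis xT : [/\ T 0 1 = psi x2, T 0 (1 + 1) = psi x3, T 1 1 = psi y2 & T 1 (1 + 1) = psi y3].
Variables A A' B B' C C' H0 : L.
Hypotheses (AE : A = oppV x2 x3) (AE' : A' = oppS x2 x3) (BE : B = oppV y2 y3)
  (BE' : B' = oppS y2 y3) (CE : C = oppS (x2 * y2) (x3 * y3)) (CE' : C' = oppV (x2 * y2) (x3 * y3))
  (H0E : H0 = h_0 A A' B B' C C').
Variables (E : fieldType) (phi : {rmorphism E -> K}) (a a' b b' c c' t : E).
Hypotheses (pa : phi a = psi A) (pa' : phi a' = psi A') (pb : phi b = psi B)
  (pb' : phi b' = psi B') (pc : phi c = psi C) (pc' : phi c' = psi C') (pt : phi t = xi T').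

Let esym := esym_values AE AE' BE BE' CE CE' w xT.

Let map_cubic l3 l2 l1 l0 : map_poly phi (l3%:P * 'X ^+ 3 + l2%:P * 'X ^+ 2 + l1%:P * 'X + l0%:P) =
  (phi l3)%:P * 'X ^+ 3 + (phi l2)%:P * 'X ^+ 2 + (phi l1)%:P * 'X + (phi l0)%:P.
Proof. by rewrite !(rmorphD, rmorphM, rmorphXn) /= map_polyX !map_polyC. Qed.

Lemma map_chi : map_poly phi (chi a a' t) = \prod_j ('X - (T' 0 j)%:P).
Proof.
have [e1 e2 e3] := esym.
have -> : chi a a' t = 1%:P * 'X ^+ 3 + (- a')%:P * 'X ^+ 2 + (a * t)%:P * 'X + (- t)%:P.
  by rewrite /chi polyC1 !polyCN; ring.
rewrite map_cubic rmorph1 !rmorphN rmorphM /= pa pa' pt -e2 -e1 -e3 (ord3_big _ _ 0) /= add0r.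
by rewrite !(polyCD, polyCM, polyCN, polyC1); ring.
Qed.

Lemma delta_value x : (map_poly phi (delta a a' b b' c c')).[x] =
  lin_at A A' B B' C C' psi x.
Proof.
rewrite /delta map_cubic /lin_at !(lin3_morph, lin2_morph, lin1_morph, lin0_morph) pa pa' pb pb' pc pc'.
by rewrite !(hornerD, hornerM, hornerC, hornerX, horner_exp).
Qed.

Lemma coprime_chi_delta : coprimep (chi a a' t) (delta a a' b b' c c').
Proof.
have ln := lin_at_neq0 F0 xI xfrac AE AE' BE BE' CE CE' H0E w xT.
rewrite -(coprimep_map phi) map_chi (ord3_big _ _ 0) /= add0r coprimep_sym.
by rewrite !coprimepMr !coprimep_XsubC !rootE !delta_value !ln.
Qed.

(** Modulo [chi], the polynomial [delta] has the inverse [v], so the fraction [- kappa / delta] is a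
    polynomial on the first row, with coefficients in [E]. *)
Lemma rho_value (u v rho : {poly E}) j : u * chi a a' t + v * delta a a' b b' c c' = 1 ->
  rho = - (kappa a a' b b' c c' * v) -> T' 1 j = (map_poly phi rho).[T' 0 j].
Proof.
move=> uv rhoE; have := congr1 (fun p => (map_poly phi p).[T' 0 j]) uv.
rewrite rmorphD !rmorphM hornerD !hornerM /= map_chi horner_prod (bigD1 j) //= hornerXsubC subrr.
rewrite mul0r mulr0 add0r rmorph1 hornerC delta_value => vd.
have := row_linear AE AE' BE BE' CE CE' w xT j.
set d := lin_at _ _ _ _ _ _ _ _ in vd *; set k := psi _ * _ => E1.
have -> : map_poly phi rho = - (map_poly phi (kappa a a' b b' c c') * map_poly phi v).
  by rewrite rhoE rmorphN rmorphM.
rewrite hornerN hornerM -[LHS]mulr1 -vd.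
have -> : (map_poly phi (kappa a a' b b' c c')).[T' 0 j] = k.
  have -> : kappa a a' b b' c c' = 0%:P * 'X ^+ 3 + ((b * b' - c * c') * (2 * a))%:P * 'X ^+ 2
     + (- ((b * b' - c * c') * (a * a' + 3)))%:P * 'X + ((b * b' - c * c') * (2 * a'))%:P.
    by rewrite /kappa !polyCM polyCN polyCM polyC0; ring.
  rewrite map_cubic !(hornerD, hornerM, hornerC, hornerX, horner_exp) /k.
  by rewrite !(rmorph0, rmorphN, rmorphM, rmorphB, rmorphD, rmorph_nat) /= pa pa' pb pb' pc pc'; ring.
have -> : k = - (d * T' 1 j) by apply/eqP; rewrite -addr_eq0 addrC E1.
ring.
Qed.

Lemma mesym_value (k : 'I_3) :
  phi (nth 0 [:: a'; a * t; t] k) = mmap phi (T' 0) (mesym 3 E k.+1).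
Proof.
have [e1 e2 e3] := esym; rewrite mmap_mesym.
have cs : \prod_(x <- [tuple T' 0 i | i < 3]) ('X - x%:P) = map_poly phi (chi a a' t).
  by rewrite map_chi big_tuple; apply: eq_bigr => i _; rewrite tnth_mktuple.
have k4 : (k.+1 < 4)%N by rewrite ltnS.
have := mroots_coeff [tuple T' 0 i | i < 3] (Ordinal k4); rewrite cs /= => E1.
have E2 : (mesym 3 K k.+1).@[tnth [tuple T' 0 i | i < 3]] = (mesym 3 K k.+1).@[T' 0].
  by apply: meval_eq => i; rewrite tnth_mktuple.
rewrite -E2; apply: (mulfI (_ : (-1) ^+ k.+1 != 0)); first by rewrite signr_eq0.
rewrite -E1 coef_map /chi.
case: k k4 E1 E2 => [[|[|[|//]]] ?] ? _ _ /=;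
  by rewrite !(coefD, coefN, coefCM, coefXn, coefX, coefC) /= ?(rmorphD, rmorphN, rmorphM, rmorph0, rmorph1, rmorphB) /=; ring.
Qed.

End Rho.

Section Pair.
Variables (F : closedFieldType) (K1 K2 : fieldType).
Variables (f1 : {rmorphism F -> K1}) (f2 : {rmorphism F -> K2}).
Hypothesis F0 : [pchar F] =i pred0.
Variables (T1 T1' : 'I_3 -> 'I_3 -> K1) (T2 T2' : 'I_3 -> 'I_3 -> K2).
Hypotheses (g1 : generic f1 T1 T1') (g2 : generic f2 T2 T2').

Definition vander (R : pzRingType) (X : 'I_3 -> R) := (X 0 - X 1) * (X 1 - X (1 + 1)) * (X (1 + 1) - X 0).

(** [E] is a common copy of the field generated by the first half and [xi]. It contains the
    symmetric functions of the first row of the second half and the coefficients of [rho], which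
    yields the second row, but not the Vandermonde determinant. *)
Lemma pair_field : exists (E : fieldType) (fE : {rmorphism F -> E}) (u0 u1 : 'I_3 -> E)
    (rho : {poly E}) (e : 'I_3 -> E) (phi1 : {rmorphism E -> K1}) (phi2 : {rmorphism E -> K2}),
  [/\ (forall c, phi1 (fE c) = f1 c) /\ (forall c, phi2 (fE c) = f2 c),
      (forall j, phi1 (u0 j) = T1 0 j /\ phi1 (u1 j) = T1 1 j) /\
      (forall j, phi2 (u0 j) = T2 0 j /\ phi2 (u1 j) = T2 1 j),
      (forall j, T1' 1 j = (map_poly phi1 rho).[T1' 0 j]) /\
      (forall j, T2' 1 j = (map_poly phi2 rho).[T2' 0 j]),
      (forall k : 'I_3, phi1 (e k) = mmap phi1 (T1' 0) (mesym 3 E k.+1)) /\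
      (forall k : 'I_3, phi2 (e k) = mmap phi2 (T2' 0) (mesym 3 E k.+1)) &
      forall v, vander (T1' 0) <> phi1 v].
Proof.
have [[w1 x1I] [w2 x2I]] := (g1, g2).
have ker4 p : mmap f1 (xc T1) p = 0 <-> mmap f2 (xc T2) p = 0.
  by split=> [/x1I->|/x2I->]; rewrite rmorph0.
have [L [f0 [x0 [psi1 [psi2 [ker0 frac0 [pf1 px1] [pf2 px2]]]]]]] := common_subfield ker4.
pose o4 k (lt : (k < 4)%N) := Ordinal lt.
pose x2 := x0 (@Ordinal 4 0 isT); pose x3 := x0 (@Ordinal 4 1 isT).
pose y2 := x0 (@Ordinal 4 2 isT); pose y3 := x0 (@Ordinal 4 3 isT).
have x0E : x0 = vec4 x2 x3 y2 y3.
  by apply: funext => -[[|[|[|[|//]]]] lt]; rewrite /vec4 /=; congr x0; apply: val_inj.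
have xI : alg_indep f0 (vec4 x2 x3 y2 y3) by move=> p; rewrite -x0E => /ker0/x1I.
have xfrac : forall k, exists p q, mmap f0 (vec4 x2 x3 y2 y3) q != 0 /\
  k = mmap f0 (vec4 x2 x3 y2 y3) p / mmap f0 (vec4 x2 x3 y2 y3) q by rewrite -x0E.
have xT1 : [/\ T1 0 1 = psi1 x2, T1 0 (1 + 1) = psi1 x3, T1 1 1 = psi1 y2 & T1 1 (1 + 1) = psi1 y3].
  by split; rewrite px1.
have xT2 : [/\ T2 0 1 = psi2 x2, T2 0 (1 + 1) = psi2 x3, T2 1 1 = psi2 y2 & T2 1 (1 + 1) = psi2 y3].
  by split; rewrite px2.
have [a aE] : exists a, a = oppV x2 x3 by exists (oppV x2 x3).
have [a' aE'] : exists a', a' = oppS x2 x3 by exists (oppS x2 x3).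
have [b bE] : exists b, b = oppV y2 y3 by exists (oppV y2 y3).
have [b' bE'] : exists b', b' = oppS y2 y3 by exists (oppS y2 y3).
have [c cE] : exists c, c = oppS (x2 * y2) (x3 * y3) by exists (oppS (x2 * y2) (x3 * y3)).
have [c' cE'] : exists c', c' = oppV (x2 * y2) (x3 * y3) by exists (oppV (x2 * y2) (x3 * y3)).
have [h2 h2E] : exists h2, h2 = h_2 a a' b b' c c' by exists (h_2 a a' b b' c c').
have [h1 h1E] : exists h1, h1 = h_1 a a' b b' c c' by exists (h_1 a a' b b' c c').
have [h0 h0E] : exists h0, h0 = h_0 a a' b b' c c' by exists (h_0 a a' b b' c c').
have dvd1 := xi_poly_dvd F0 xI xfrac aE aE' bE bE' cE cE' h2E h1E h0E w1 xT1.
have dvd2 := xi_poly_dvd F0 xI xfrac aE aE' bE bE' cE cE' h2E h1E h0E w2 xT2.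
have root1 := xi_poly_xi F0 xI xfrac aE aE' bE bE' cE cE' h2E h1E h0E w1 xT1.
have root2 := xi_poly_xi F0 xI xfrac aE aE' bE bE' cE cE' h2E h1E h0E w2 xT2.
pose pt (R : Type) (x : 'I_4 -> R) (t : R) (i : 'I_5) :=
  if insub (i : nat) is Some j then x j else t.
pose hat : {mpoly F[5]} -> {poly L} :=
  mmap (@polyC L \o f0) (pt {poly L} (fun j => (x0 j)%:P) 'X).
have hatE (K : fieldType) (f : {rmorphism F -> K}) (psi : {rmorphism L -> K}) (x : 'I_4 -> K) t p :
    (forall c, psi (f0 c) = f c) -> (forall i, psi (x0 i) = x i) ->
    (map_poly psi (hat p)).[t] = mmap f (pt K x t) p.
  move=> pf px; rewrite -[LHS]/((horner_eval t \o map_poly psi) (hat p)) rmorph_mmap.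
  apply: eq_mmap => [c0|i] /=; first by rewrite map_polyC horner_evalE hornerC; exact: pf.
  by rewrite /pt horner_evalE; case: insubP => [j _ _|_]; rewrite ?map_polyC ?map_polyX ?hornerC ?hornerX //; exact: px.
pose q1 := pt K1 (xc T1) (xi T1'); pose q2 := pt K2 (xc T2) (xi T2').
have hat1 p : (map_poly psi1 (hat p)).[xi T1'] = mmap f1 q1 p by exact: hatE.
have hat2 p : (map_poly psi2 (hat p)).[xi T2'] = mmap f2 q2 p by exact: hatE.
(* Both conditions mean that [xi_poly] divides [hat p], over the common field [L]. *)
have ker5 p : mmap f1 q1 p = 0 <-> mmap f2 q2 p = 0.
  rewrite -hat1 -hat2; split=> [/dvd1|/dvd2] /dvdpP[e ->]; rewrite rmorphM hornerM.
    by rewrite root2 mulr0.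
  by rewrite root1 mulr0.
have [E [fE [z [phi1 [phi2 [kerE fracE [Ef1 Ez1] [Ef2 Ez2]]]]]]] := common_subfield ker5.
pose z4 k (lt : (k < 5)%N) := z (Ordinal lt).
pose e2 := z4 0%N isT; pose e3 := z4 1%N isT; pose d2 := z4 2%N isT; pose d3 := z4 3%N isT.
pose t := z4 4%N isT.
have coord (K : fieldType) (x : 'I_4 -> K) u (phi : {rmorphism E -> K}) :
    (forall i, phi (z i) = pt K x u i) -> [/\ phi e2 = x (@Ordinal 4 0 isT),
    phi e3 = x (@Ordinal 4 1 isT), phi d2 = x (@Ordinal 4 2 isT), phi d3 = x (@Ordinal 4 3 isT) & phi t = u].
  move=> H; rewrite /e2 /e3 /d2 /d3 /t /z4 !H /pt /=.
  split; case: insubP => //= j _ jj; by congr x; apply: val_inj.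
have [c12 c13 k12 k13 t1] := coord K1 (xc T1) (xi T1') phi1 Ez1.
have [c22 c23 k22 k23 t2] := coord K2 (xc T2) (xi T2') phi2 Ez2.
have push (K : fieldType) (psi : {rmorphism L -> K}) (phi : {rmorphism E -> K}) :
   phi e2 = psi x2 -> phi e3 = psi x3 -> phi d2 = psi y2 -> phi d3 = psi y3 ->
   [/\ phi (oppV e2 e3) = psi a /\ phi (oppS e2 e3) = psi a',
       phi (oppV d2 d3) = psi b /\ phi (oppS d2 d3) = psi b' &
       phi (oppS (e2 * d2) (e3 * d3)) = psi c /\ phi (oppV (e2 * d2) (e3 * d3)) = psi c'].
  move=> h1' h2' h3' h4'; rewrite aE aE' bE bE' cE cE' !oppV_morph !oppS_morph !rmorphM.
  by rewrite h1' h2' h3' h4'.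
have [[a1 a1'] [b1 b1'] [m1 m1']] := push K1 psi1 phi1 (etrans c12 (esym (px1 _)))
  (etrans c13 (esym (px1 _))) (etrans k12 (esym (px1 _))) (etrans k13 (esym (px1 _))).
have [[a2 a2'] [b2 b2'] [m2 m2']] := push K2 psi2 phi2 (etrans c22 (esym (px2 _)))
  (etrans c23 (esym (px2 _))) (etrans k22 (esym (px2 _))) (etrans k23 (esym (px2 _))).
have cop := coprime_chi_delta F0 xI xfrac w1 xT1 aE aE' bE bE' cE cE' h0E a1 a1' b1 b1' m1 m1' t1.
have /Bezout_eq1_coprimepP[[u v] /= uv] := cop.
pose row (m2 m3 : E) (j : 'I_3) := nth 1 [:: 1; m2; m3] j.
have rowP (K : fieldType) (phi : {rmorphism E -> K}) m n (g : 'I_3 -> K) : g 0 = 1 -> phi m = g 1 ->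
    phi n = g (1 + 1) -> forall j, phi (row m n j) = g j.
  by move=> h1' h2' h3'; apply: ord3_ind; rewrite /row /= ?rmorph1.
have [rho rhoE] : exists rho : {poly E}, rho = - (kappa (oppV e2 e3) (oppS e2 e3) (oppV d2 d3)
  (oppS d2 d3) (oppS (e2 * d2) (e3 * d3)) (oppV (e2 * d2) (e3 * d3)) * v) by eexists.
exists E, fE, (row e2 e3), (row d2 d3), rho,
  (fun k : 'I_3 => nth 0 [:: oppS e2 e3; oppV e2 e3 * t; t] k), phi1, phi2.
split=> //.
- by split=> j; split; apply: rowP => //; rewrite ?(w_norm w1) ?(w_norm w2).
- split=> j.
    exact: (rho_value w1 xT1 aE aE' bE bE' cE cE' a1 a1' b1 b1' m1 m1' t1 j uv rhoE).
  exact: (rho_value w2 xT2 aE aE' bE bE' cE cE' a2 a2' b2 b2' m2 m2' t2 j uv rhoE).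
- split=> k.
    exact: (mesym_value w1 xT1 aE aE' bE bE' cE cE' a1 a1' t1 k).
  exact: (mesym_value w2 xT2 aE aE' bE bE' cE cE' a2 a2' t2 k).
move=> v'; have [p [q [q0 ->]]] := fracE v'.
have phiE r : phi1 (mmap fE z r) = mmap f1 q1 r.
  by rewrite rmorph_mmap; apply: eq_mmap.
have q0' : (map_poly psi1 (hat q)).[xi T1'] != 0 by rewrite hat1 -phiE fmorph_eq0.
have [v0 [v1 vE]] := xi_linear F0 xI xfrac aE aE' bE bE' cE cE' h2E h1E h0E w1 xT1 (hat p) q0'.
rewrite fmorph_div /= !phiE -!hat1 vE.
exact: (vandermonde_not_linear F0 xI xfrac aE aE' bE bE' cE cE' h2E h1E h0E w1 xT1).
Qed.

End Pair.

Section Lift.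
Variables (F : closedFieldType) (E : fieldType) (fE : {rmorphism F -> E}).
Variables (u0 u1 : 'I_3 -> E) (rho : {poly E}).

(** At a generic point every coordinate is a polynomial over [E] in the first row of [T'], and a
    permutation of the columns of [T'] becomes one of the variables. *)
Definition lift_poly (r : {mpoly F[6 + 6]}) : {mpoly E[3]} :=
  mmap (@mpolyC 3 E \o fE) (two_blocks (fun j => (u0 j)%:MP) (fun j => 'X_j)
    (fun j => (u1 j)%:MP) (fun j => (map_poly (@mpolyC 3 E) rho).['X_j])) r.

Lemma lift_value (K : fieldType) (f : {rmorphism F -> K}) (phi : {rmorphism E -> K})
    (T T' : 'I_3 -> 'I_3 -> K) r :
  (forall c, phi (fE c) = f c) -> (forall j, phi (u0 j) = T 0 j /\ phi (u1 j) = T 1 j) ->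
  (forall j, T' 1 j = (map_poly phi rho).[T' 0 j]) ->
  mmap phi (T' 0) (lift_poly r) = mmap f (coords T T') r.
Proof.
move=> pf pu pr; rewrite /lift_poly rmorph_mmap; apply: eq_mmap => [c|i] /=.
  by rewrite mmapC; exact: pf.
rewrite /coords /two_blocks; case: split => j; case: split => k.
- by rewrite mmapC; exact: (pu k).1.
- by rewrite mmapX mmap1U.
- by rewrite mmapC; exact: (pu k).2.
rewrite pr -horner_map /= mmapX mmap1U -map_poly_comp; congr (_.[_]).
by apply: eq_map_poly => c /=; rewrite mmapC.
Qed.

End Lift.

(** Otherwise every polynomial without constant term would sum to zero over the [v i], whereas [g]
    vanishes at all the values but [v i0]. *)
Lemma power_sum_neq0 (K : fieldType) (I : finType) (v : I -> K) i0 :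
  [pchar K] =i pred0 -> v i0 != 0 -> exists k, \sum_i v i ^+ k.+1 != 0.
Proof.
move=> K0 vi; apply: contrapT => nk.
have pk k : \sum_i v i ^+ k.+1 = 0 by apply: contrapT => /eqP ?; apply: nk; exists k.
pose g : {poly K} := 'X * \prod_(i | v i != v i0) ('X - (v i)%:P).
have sg : \sum_i g.[v i] = 0.
  have -> : \sum_i g.[v i] = \sum_(j < size g) g`_j * \sum_i v i ^+ j.
    rewrite (eq_bigr _ (fun i _ => horner_coef g (v i))) exchange_big /=.
    by apply: eq_bigr => j _; rewrite mulr_sumr.
  apply: big1 => -[[|j] lt] _ /=; last by rewrite pk mulr0.
  by rewrite coefXM mul0r.
have gi i : g.[v i] = if v i == v i0 then g.[v i0] else 0.
  case: eqP => [->//|/eqP ne]; rewrite hornerM horner_prod (bigD1 i) //=.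
  by rewrite hornerXsubC subrr mul0r mulr0.
have g0 : g.[v i0] != 0.
  rewrite hornerM hornerX horner_prod mulf_neq0 //; apply/prodf_neq0 => i ne.
  by rewrite hornerXsubC subr_eq0 eq_sym.
move/eqP: sg; rewrite (eq_bigr _ (fun i _ => gi i)) -big_mkcond /= sumr_const.
rewrite -mulr_natr mulf_eq0 (negPf g0) /=.
have /card_gt0P/prednK <- : exists i, i \in [pred i | v i == v i0] by exists i0; rewrite inE.
by move/pcharf0P: K0 => ->.
Qed.

Lemma odd_perm3 (s : 'S_3) : odd_perm s -> exists x y, x != y /\ s = tperm x y.
Proof.
move=> os; have [x sx] : exists x, s x != x.
  apply: contrapT => nx; have s1 : s = 1%g.
    by apply/permP => x; rewrite perm1; apply: contrapT => /eqP ?; apply: nx; exists x.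
  by move: os; rewrite s1 odd_perm1.
pose u := (s * tperm x (s x))%g; have ux : u x = x by rewrite permM tpermR.
have sE : s = (u * tperm x (s x))%g by rewrite /u -mulgA tperm2 mulg1.
have [u1|u1] := eqVneq (u (x + 1)) (x + 1).
  have u2 : u (x + 1 + 1) = x + 1 + 1.
    have [e1 e2 e3] := ord3_neq x.
    have [e|e|e] := ord3_cases (u (x + 1 + 1)) x; last by rewrite -e.
      have /perm_inj/eqP : u (x + 1 + 1) = u x by rewrite ux -e.
      by rewrite e2.
    have /perm_inj/eqP : u (x + 1 + 1) = u (x + 1) by rewrite u1 -e.
    by rewrite e3.
  exists x, (s x); rewrite eq_sym; split=> //.
  rewrite {1}sE; suff -> : u = 1%g by rewrite mul1g.
  by apply/permP; apply: (@ord3_orbit _ x); rewrite perm1.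
have u12 : u (x + 1) = x + 1 + 1.
  have [e1 e2 e3] := ord3_neq x.
  have [e|e|e] := ord3_cases (u (x + 1)) x => //.
    have /perm_inj/eqP : u (x + 1) = u x by rewrite ux -e.
    by rewrite e1.
  by rewrite -e eqxx in u1.
have u21 : u (x + 1 + 1) = x + 1.
  have [e1 e2 e3] := ord3_neq x.
  have [e|e|e] := ord3_cases (u (x + 1 + 1)) x => //.
    have /perm_inj/eqP : u (x + 1 + 1) = u x by rewrite ux -e.
    by rewrite e2.
  have /perm_inj/eqP : u (x + 1 + 1) = u (x + 1) by rewrite u12 -e.
  by rewrite e3.
have [e1 e2 e3] := ord3_neq x.
have uE : u = tperm (x + 1) (x + 1 + 1).
  apply/permP; apply: (@ord3_orbit _ x); rewrite ?tpermL ?tpermR //.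
  by rewrite ux tpermD // ?e1 ?e2.
move: os; rewrite sE odd_permM uE !odd_tperm [x + 1 == _]eq_sym e3 /=.
by rewrite [x == _]eq_sym sx.
Qed.

Lemma vander_perm (K : fieldType) (X : 'I_3 -> K) (s : 'S_3) :
  vander (fun j => X (s j)) = (-1) ^+ s * vander X.
Proof.
have tp (Z : 'I_3 -> K) x y : x != y -> vander (fun j => Z (tperm x y j)) = - vander Z.
  rewrite /vander; have n1 : (1 == 0 :> 'I_3) = false by []. have n2 : (1 + 1 == 0 :> 'I_3) = false by [].
  have n3 : (1 + 1 == 1 :> 'I_3) = false by [].
  have n1' : (0 == 1 :> 'I_3) = false by []. have n2' : (0 == 1 + 1 :> 'I_3) = false by [].
  have n3' : (1 == 1 + 1 :> 'I_3) = false by [].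
  move: x y; apply: ord3_ind; apply: ord3_ind; rewrite ?eqxx // => _;
    rewrite !permE /= ?(n1, n2, n3, n1', n2', n3', eqxx) /=; ring.
have [ts -> dts] := prod_tpermP s; elim: ts dts X => [|[x y] ts IH] /=.
  by move=> _ X; rewrite big_nil odd_perm1 mul1r; congr vander; apply: funext => j; rewrite perm1.
move=> /andP[xy dts] X; rewrite big_cons odd_permM odd_tperm signr_addb xy expr1 mulN1r mulNr -IH //.
rewrite -(tp (fun j => X ((\prod_(t <- ts) tperm t.1 t.2)%g j)) x y) //.
by congr vander; apply: funext => j; rewrite permM.
Qed.

(** * Permutations of columns and uniqueness of the generic ideal *)

Section Classes.
Variable F : closedFieldType.
Hypothesis F0 : [pchar F] =i pred0.

(** Otherwise some [r] vanishes at the first point but at no permutation of the second. The product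
    of the conjugates of [r] is symmetric, so its value comes from [E]; yet it is zero at the first
    point and nonzero at the second. *)
Lemma perm_class (K1 K2 : fieldType) (f1 : {rmorphism F -> K1}) (f2 : {rmorphism F -> K2})
    T1 T1' T2 T2' : generic f1 T1 T1' -> generic f2 T2 T2' ->
  exists s, same f1 f2 T1 T1' T2 (rperm T2' s).
Proof.
move=> g1 g2.
have [E [fE [u0 [u1 [rho [e [p1 [p2 [[pf1 pf2] [pu1 pu2] [pr1 pr2] [pe1 pe2] _]]]]]]]]] :=
  pair_field F0 g1 g2.
suff [s sub] : exists s, (widl f1 T1 T1' `<=` widl f2 T2 (rperm T2' s))%classic.
  exists s; apply: generic_sub_same => //; first exact: char0_ext f1 F0.
  exact: generic_rperm.
apply: contrapT => ns.
pose Ps := [seq widl f2 T2 (rperm T2' s) | s <- enum {: 'S_3}].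
have nthE i : (i < size Ps)%N -> exists s, nth setT Ps i = widl f2 T2 (rperm T2' s).
  by rewrite size_map => lt; exists (nth 1%g (enum {: 'S_3}) i); rewrite (nth_map 1%g).
have [||r r1 r2] := @prime_avoidance F _ (widl f1 T1 T1') Ps (widl_prime f1 T1 T1').
- by move=> i /nthE[s ->]; exact: widl_prime.
- move=> i /nthE[s ->]; apply: contrapT => nr; apply: ns; exists s => r r1.
  by apply: contrapT => r2; apply: nr; exists r.
pose rt := lift_poly fE u0 u1 rho r.
have [v vP] := symmetric_value e (prod_msym_sym rt).
have := vP _ p1 (T1' 0) pe1; have := vP _ p2 (T2' 0) pe2.
rewrite !rmorph_prod /= => v2 v1.
have v0 : v = 0.
  apply/eqP; rewrite -(fmorph_eq0 p1) -v1 (bigD1 1%g) //= mmap_msym.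
  have -> : mmap p1 (fun i => T1' 0 ((1%g : 'S_3) i)) rt = 0.
    rewrite (eq_mmap _ (frefl p1) (_ : _ =1 T1' 0)) => [|i]; last by rewrite perm1.
    by rewrite (lift_value _ pf1 pu1 pr1).
  by rewrite mul0r.
move/eqP: v2; rewrite v0 rmorph0 => /prodf_eq0[s _ /eqP]; rewrite mmap_msym => rs.
have si : (index s (enum {: 'S_3}) < size Ps)%N by rewrite size_map index_mem mem_enum.
apply: (r2 _ si); rewrite (nth_map 1%g) -?(size_map (fun s => widl f2 T2 (rperm T2' s))) //.
rewrite nth_index ?mem_enum // /widl.
rewrite -(@lift_value _ _ fE u0 u1 rho _ f2 p2 T2 (rperm T2' s)) // => j; exact: pr2.
Qed.

(** Otherwise some [q] vanishes at all the odd permutations of the point but not at the point. The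
    symmetrised powers of [q] are not all zero there, and with the Vandermonde determinant as a
    factor only even permutations count again. Both symmetrisations have values in [E], and so does
    their ratio, the Vandermonde determinant. *)
Lemma odd_stable (K : fieldType) (f : {rmorphism F -> K}) T T' : generic f T T' ->
  exists2 s : 'S_3, odd_perm s & same f f T T' T (rperm T' s).
Proof.
move=> g; apply: contrapT => ns; have K0 := char0_ext f F0.
have [E [fE [u0 [u1 [rho [e [p1 [p2 [[pf1 _] [pu1 _] [pr1 _] [pe1 _] nV]]]]]]]]] :=
  pair_field F0 g g.
have E0 := char0_ext fE F0.
have H (s : 'S_3) : exists r, odd_perm s -> widl f T (rperm T' s) r /\ ~ widl f T T' r.
  have [os|] := boolP (odd_perm s); last by exists 0.
  apply: contrapT => nr; apply: ns; exists s => //.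
  suff sm : same f f T (rperm T' s) T T' by move=> p; split=> /sm.
  apply: generic_sub_same => //; first exact: generic_rperm.
  by move=> r r1; apply: contrapT => r2; apply: nr; exists r.
have [r rP] := boolp.choice H.
pose q := \prod_(s : 'S_3 | odd_perm s) r s.
have q0 (s : 'S_3) : odd_perm s -> mmap f (coords T (rperm T' s)) q = 0.
  by move=> os; rewrite rmorph_prod (bigD1 s) //= (rP s os).1 mul0r.
have q1 : mmap f (coords T T') q != 0.
  by rewrite rmorph_prod; apply/prodf_neq0 => s os; apply/eqP; exact: (rP s os).2.
pose qt := lift_poly fE u0 u1 rho q.
pose val (s : 'S_3) := mmap f (coords T (rperm T' s)) q.
have valE (s : 'S_3) : mmap p1 (fun i => T' 0 (s i)) qt = val s.
  by rewrite /val -(@lift_value _ _ fE u0 u1 rho _ f p1 T (rperm T' s)) // => j; exact: pr1.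
have val1 : val 1%g != 0.
  rewrite /val; suff -> : rperm T' 1 = T' by [].
  by apply: funext => i; apply: funext => j; rewrite /rperm perm1.
have [k sk] := power_sum_neq0 K0 val1.
pose vt : {mpoly E[3]} := vander (fun j => 'X_j).
have vtE (s : 'S_3) : mmap p1 (fun i => T' 0 (s i)) vt = (-1) ^+ s * vander (T' 0).
  by rewrite -vander_perm /vt /vander !(rmorphM, rmorphB) /= !mmapX !mmap1U.
have vte (s : 'S_3) : ~~ odd_perm s -> mmap p1 (fun i => T' 0 (s i)) vt = vander (T' 0).
  by rewrite vtE; case: (odd_perm s) => // _; rewrite mul1r.
have [v vP] := symmetric_value e (sum_msym_sym (qt ^+ k.+1)).
have [w wP] := symmetric_value e (sum_msym_sym (vt * qt ^+ k.+1)).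
have vE : p1 v = \sum_s val s ^+ k.+1.
  rewrite -(vP _ p1 (T' 0) pe1) rmorph_sum; apply: eq_bigr => s _ /=.
  by rewrite mmap_msym rmorphXn /= valE.
have wE : p1 w = vander (T' 0) * \sum_s val s ^+ k.+1.
  rewrite -(wP _ p1 (T' 0) pe1) rmorph_sum mulr_sumr; apply: eq_bigr => s _ /=.
  rewrite mmap_msym rmorphM rmorphXn /= valE.
  have [os|os] := boolP (odd_perm s); last first.
    by rewrite (vte _ os).
  by rewrite /val q0 // exprS mul0r !mulr0.
apply: (nV (w / v)); rewrite fmorph_div wE vE mulfK //.
Qed.

(** Exchange of the two halves, rescaled so that the first column is again 1. *)
Definition sw1 (K : fieldType) (T T' : 'I_3 -> 'I_3 -> K) := colratio T'.
Definition sw2 (K : fieldType) (T T' : 'I_3 -> 'I_3 -> K) := rescale (fun i => (T' i 0)^-1) T.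

Section Swap.
Variables (K : fieldType) (f : {rmorphism F -> K}).
Implicit Types T : 'I_3 -> 'I_3 -> K.

Lemma sw_wpoint T T' : wpoint T T' -> wpoint (sw1 T T') (sw2 T T').
Proof.
move=> [tT tT' T1 opp]; split.
- exact: colratio_triple.
- by apply: rescale_triple => //; exact: colratio1.
- by move=> i; rewrite /sw1 colratio0.
- by move=> i; rewrite !sumV_rescale !sum_rescale; have [-> ->] := opp i; rewrite mulNr mulrN !opprK.
Qed.

Lemma sw_sw T T' : wpoint T T' ->
  sw1 (sw1 T T') (sw2 T T') = T /\ sw2 (sw1 T T') (sw2 T T') = T'.
Proof.
move=> [tT tT' T1 _]; split; apply: funext => i; apply: funext => j.
  by rewrite /sw1 /sw2 /colratio /rescale T1 mulr1 invrK mulVKf ?triple_neq0.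
by rewrite /sw1 /sw2 /colratio /rescale T1 mulr1 invrK mulVKf ?triple_neq0.
Qed.

Lemma sw_generic T T' : generic f T T' -> generic f (sw1 T T') (sw2 T T').
Proof.
move=> [w xI]; apply: (generic_of_indep (char0_ext f F0) (sw_wpoint w) xI) => d dd _ k2.
apply: kills_xc => i j; have [e _] := sw_sw w; rewrite -e.
by apply: (kills_ratio dd).
Qed.

End Swap.

(** A construction natural in the field can be carried out in the common subfield of the two
    points. *)
Lemma same_natural (G : forall K : fieldType, ('I_3 -> 'I_3 -> K) -> ('I_3 -> 'I_3 -> K) -> 'I_(6 + 6) -> K)
  (K1 K2 : fieldType) (f1 : {rmorphism F -> K1}) (f2 : {rmorphism F -> K2}) T1 T1' T2 T2' :
  (forall (E K : fieldType) (phi : {rmorphism E -> K}) S S' (T T' : 'I_3 -> 'I_3 -> K),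
    (forall i j, phi (S i j) = T i j) -> (forall i j, phi (S' i j) = T' i j) ->
    forall i, phi (G E S S' i) = G K T T' i) ->
  is_triple T1 -> is_triple T1' -> is_triple T2 -> is_triple T2' ->
  same f1 f2 T1 T1' T2 T2' -> forall p, mmap f1 (G K1 T1 T1') p = 0 <-> mmap f2 (G K2 T2 T2') p = 0.
Proof.
move=> nat t1 t1' t2 t2' sm p.
have [E [fE [z [p1 [p2 [_ _ [e1 z1] [e2 z2]]]]]]] := common_subfield sm.
pose S x y (i j : 'I_3) : E := if i == 0 then z (x j) else if i == 1 then z (y j)
  else (z (x j) * z (y j))^-1.
pose S1 := S (fun j => @lshift 6 6 (@lshift 3 3 j)) (fun j => @rshift 6 6 (@lshift 3 3 j)).
pose S2 := S (fun j => @lshift 6 6 (@rshift 3 3 j)) (fun j => @rshift 6 6 (@rshift 3 3 j)).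
have go (K : fieldType) (phi : {rmorphism E -> K}) (T T' : 'I_3 -> 'I_3 -> K) :
    (forall i, phi (z i) = coords T T' i) -> is_triple T -> is_triple T' ->
    (forall i j, phi (S1 i j) = T i j) /\ (forall i j, phi (S2 i j) = T' i j).
  move=> pz tT tT'; have tb j := two_blocksE (T 0) (T' 0) (T 1) (T' 1) j.
  have third U j : is_triple U -> U (1 + 1) j = (U 0 j * U 1 j)^-1.
    by move=> tU; have := triple_third 0 j tU; rewrite !add0r.
  split=> i j; have [b1 b2 b3 b4] := tb j; move: i; apply: ord3_ind;
    rewrite /S1 /S2 /S /= ?third // ?fmorphV ?rmorphM /= !pz /coords ?b1 ?b2 ?b3 ?b4 //.
have [a1 a1'] := go K1 p1 T1 T1' z1 t1 t1'.
have [a2 a2'] := go K2 p2 T2 T2' z2 t2 t2'.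
have G1 := nat _ _ p1 _ _ _ _ a1 a1'; have G2 := nat _ _ p2 _ _ _ _ a2 a2'.
have H (K : fieldType) (g : {rmorphism F -> K}) (phi : {rmorphism E -> K}) y :
    (forall c, phi (fE c) = g c) -> (forall i, phi (G E S1 S2 i) = y i) ->
    phi (mmap fE (G E S1 S2) p) = mmap g y p.
  by move=> h1 h2; rewrite rmorph_mmap; apply: eq_mmap.
rewrite -(H _ _ p1 _ e1 G1) -(H _ _ p2 _ e2 G2).
by split=> /eqP; rewrite fmorph_eq0 => /eqP->; rewrite rmorph0.
Qed.

Section Uniqueness.
Variables (K1 K2 : fieldType) (f1 : {rmorphism F -> K1}) (f2 : {rmorphism F -> K2}).

Lemma same_sw T1 T1' T2 T2' : wpoint T1 T1' -> wpoint T2 T2' -> same f1 f2 T1 T1' T2 T2' ->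
  same f1 f2 (sw1 T1 T1') (sw2 T1 T1') (sw1 T2 T2') (sw2 T2 T2').
Proof.
move=> [t1 t1' _ _] [t2 t2' _ _].
apply: (same_natural (G := fun K T T' => coords (sw1 T T') (sw2 T T'))) => //.
move=> E K phi S S' T T' e e' i; rewrite /coords /two_blocks /sw1 /sw2 /colratio /rescale.
by case: split => j; case: split => k; rewrite rmorphM fmorphV /= ?e ?e'.
Qed.

Lemma same_rperm T1 T1' T2 T2' s : is_triple T1 -> is_triple T1' -> is_triple T2 -> is_triple T2' ->
  same f1 f2 T1 T1' T2 T2' -> same f1 f2 T1 (rperm T1' s) T2 (rperm T2' s).
Proof.
move=> t1 t1' t2 t2'.
apply: (same_natural (G := fun K T T' => coords T (rperm T' s))) => //.
move=> E K phi S S' T T' e e' i; rewrite /coords /two_blocks /rperm.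
by case: split => j; case: split => k; rewrite ?e ?e'.
Qed.

End Uniqueness.

(** Permutation of the first three columns, obtained from that of the last three by exchanging the
    halves. *)
Definition move_first (K : fieldType) (s : 'S_3) (T T' : 'I_3 -> 'I_3 -> K) :=
  let S := sw1 T T' in let S' := rperm (sw2 T T') s in (sw1 S S', sw2 S S').

Lemma move_first_rperm (K : fieldType) s t (T T' : 'I_3 -> 'I_3 -> K) :
  wpoint T T' ->
  move_first s T (rperm T' t) = ((move_first s T T').1, rperm (move_first s T T').2 t).
Proof.
move=> [tT tT' T1 _]; congr pair; apply: funext => i; apply: funext => j /=;
  rewrite /sw1 /sw2 /colratio /rescale /rperm; field; rewrite !triple_neq0 //.
Qed.

Lemma same_trans (K1 K2 K3 : fieldType) (f1 : {rmorphism F -> K1}) (f2 : {rmorphism F -> K2})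
    (f3 : {rmorphism F -> K3}) T1 T1' T2 T2' T3 T3' :
  same f1 f2 T1 T1' T2 T2' -> same f2 f3 T2 T2' T3 T3' -> same f1 f3 T1 T1' T3 T3'.
Proof. by move=> h1 h2 p; split=> [/h1/h2|/h2/h1]. Qed.

Lemma same_sym (K1 K2 : fieldType) (f1 : {rmorphism F -> K1}) (f2 : {rmorphism F -> K2})
    T1 T1' T2 T2' : same f1 f2 T1 T1' T2 T2' -> same f2 f1 T2 T2' T1 T1'.
Proof. by move=> h p; split=> /h. Qed.

Lemma rpermM (K : fieldType) (T : 'I_3 -> 'I_3 -> K) s t : rperm (rperm T s) t = rperm T (t * s)%g.
Proof. by apply: funext => i; apply: funext => j; rewrite /rperm permM. Qed.

Lemma rperm1 (K : fieldType) (T : 'I_3 -> 'I_3 -> K) : rperm T 1%g = T.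
Proof. by apply: funext => i; apply: funext => j; rewrite /rperm perm1. Qed.

Lemma rperm_same (K : fieldType) (f : {rmorphism F -> K}) T T' s :
  generic f T T' -> same f f T T' T (rperm T' s).
Proof.
move=> g; have [t ot st] := odd_stable g.
have [x [y [xy tE]]] := odd_perm3 ot.
have wp (L : fieldType) (h : {rmorphism F -> L}) S S' : generic h S S' ->
    [/\ wpoint S S', is_triple S & is_triple S'] by case=> w _; split=> //; case: w.
(* The same transposition [t] works for all generic points: up to [same], each of them arises from
   [T] and [T'] by a permutation of the first three columns, which commutes with [t]. *)
have stable (L : fieldType) (h : {rmorphism F -> L}) S S' : generic h S S' ->
    same h h S S' S (rperm S' t).
  move=> gS; have [u us] := perm_class (sw_generic gS) (sw_generic g).
  have [wS tS tS'] := wp _ _ _ _ gS; have [wT tT tT'] := wp _ _ _ _ g.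
  have gsw := generic_rperm u (sw_generic g).
  have [wu _ _] := wp _ _ _ _ gsw; have [wsS _ _] := wp _ _ _ _ (sw_generic gS).
  have s1 : same h f S S' (move_first u T T').1 (move_first u T T').2.
    by have := same_sw wsS wu us; have [-> ->] := sw_sw wS.
  have wm : wpoint (move_first u T T').1 (move_first u T T').2 := sw_wpoint wu.
  have [tm tm' _ _] := wm.
  have s2 := same_rperm t tS tS' tm tm' s1.
  apply: same_trans s1 _; apply: same_sym; apply: same_trans s2 _.
  have gt := generic_rperm t g; have [wt tt tt'] := wp _ _ _ _ gt.
  have s3 := same_sw wt wT (same_sym st).
  have [ws3 q1 q2] := wp _ _ _ _ (sw_generic gt); have [ws4 q3 q4] := wp _ _ _ _ (sw_generic g).
  have s4 := same_rperm u q1 q2 q3 q4 s3.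
  have [w5 _ _] := wp _ _ _ _ (generic_rperm u (sw_generic gt)).
  have s5 : same f f (move_first u T (rperm T' t)).1 (move_first u T (rperm T' t)).2
    (move_first u T T').1 (move_first u T T').2 := same_sw w5 wu s4.
  by move: s5; rewrite move_first_rperm.
(* Stability under [t] of the point permuted by [s1] is stability of the original point under a
   conjugate of [t], namely the exchange of [u] and [v]. *)
have transp (u v : 'I_3) (L : fieldType) (h : {rmorphism F -> L}) S S' : u != v -> generic h S S' ->
    same h h S S' S (rperm S' (tperm u v)).
  move=> uv gS; pose s1 := (tperm x u * tperm (tperm x u y) v)%g.
  have s1x : s1 x = u.
    rewrite permM tpermL tpermD //; last by rewrite eq_sym.
    by apply/eqP => e; move/eqP: xy; apply; apply: (@perm_inj _ (tperm x u)); rewrite tpermL e.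
  have s1y : s1 y = v by rewrite permM tpermL.
  have gs := generic_rperm s1 gS; have := stable _ _ _ _ gs.
  have [_ tS tS1] := wp _ _ _ _ gs; have [_ _ tS'] := wp _ _ _ _ gS.
  move=> /(same_rperm s1^-1%g tS tS1 tS (rperm_triple _ tS1)).
  by rewrite !rpermM mulVg rperm1 tE -mulgA -conjgE tpermJ s1x s1y.
have [ts -> dts] := prod_tpermP s; elim: ts dts => [|[u v] ts IH] /=.
  by rewrite big_nil rperm1.
move=> /andP[uv dts]; rewrite big_cons -rpermM.
by apply: same_trans (IH dts) _; apply: transp => //; exact: generic_rperm.
Qed.

Lemma generic_same (K1 K2 : fieldType) (f1 : {rmorphism F -> K1}) (f2 : {rmorphism F -> K2})
    T1 T1' T2 T2' : generic f1 T1 T1' -> generic f2 T2 T2' -> same f1 f2 T1 T1' T2 T2'.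
Proof.
move=> g1 g2; have [s ss] := perm_class g1 g2.
exact: same_trans ss (same_sym (rperm_same s g2)).
Qed.

End Classes.

(** * Equations of X(3,6) and of the fiber product *)

Definition rows (R : unitRingType) (g h : 'I_3 -> R) (i j : 'I_3) : R :=
  if i == 0 then g j else if i == 1 then h j else (g j * h j)^-1.

Lemma rows_triple (K : fieldType) (g h : 'I_3 -> K) :
  (forall j, g j != 0) -> (forall j, h j != 0) -> is_triple (rows g h).
Proof.
move=> g0 h0 j; rewrite (ord3_big _ _ 0) /= add0r /rows /= divff //.
by rewrite mulf_neq0.
Qed.

Definition tripL (R : unitRingType) (z : 'I_(6 + 6) -> R) :=
  rows (fun j => z (@lshift 6 6 (@lshift 3 3 j))) (fun j => z (@rshift 6 6 (@lshift 3 3 j))).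
Definition tripR (R : unitRingType) (z : 'I_(6 + 6) -> R) :=
  rows (fun j => z (@lshift 6 6 (@rshift 3 3 j))) (fun j => z (@rshift 6 6 (@rshift 3 3 j))).

Lemma coords_trip (K : fieldType) (z : 'I_(6 + 6) -> K) : coords (tripL z) (tripR z) =1 z.
Proof.
move=> i; rewrite /coords /two_blocks /tripL /tripR /rows /=.
by case: (split_ordP i) => j -> ; case: (split_ordP (j : 'I_(3 + 3))) => k ->.
Qed.

Lemma triple_rows (K : fieldType) (T : 'I_3 -> 'I_3 -> K) : is_triple T -> T = rows (T 0) (T 1).
Proof.
move=> tT; apply: funext => i; apply: funext => j; move: i; apply: ord3_ind; rewrite /rows //=.
by have := triple_third 0 j tT; rewrite !add0r.
Qed.

Lemma trip_coords (K : fieldType) (T T' : 'I_3 -> 'I_3 -> K) : is_triple T -> is_triple T' ->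
  tripL (coords T T') = T /\ tripR (coords T T') = T'.
Proof.
move=> tT tT'; have E k := two_blocksE (T 0) (T' 0) (T 1) (T' 1) k.
split; [rewrite [RHS]triple_rows //|rewrite [RHS]triple_rows //]; congr rows;
  by apply: funext => j; have [e1 e2 e3 e4] := E j.
Qed.

Section Equations.
Variable F : closedFieldType.
Let n := (6 + 6)%N.

Definition vx (j : 'I_6) : {mpoly F[n]} := 'X_(@lshift 6 6 j).
Definition vy (j : 'I_6) : {mpoly F[n]} := 'X_(@rshift 6 6 j).
Definition cleared (v : 'I_6 -> {mpoly F[n]}) := \sum_j \prod_(l | l != j) v l.

(** For each of the three rows the sum over six columns and the sum of inverses, the third row being
    the inverse of the product of the other two; then the normalisation of the first column. *)
Definition weq (i : 'I_8) : {mpoly F[n]} := nth 0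
  [:: \sum_j vx j; cleared vx; \sum_j vy j; cleared vy;
      \sum_j vx j * vy j; cleared (fun j => vx j * vy j); vx 0 - 1; vy 0 - 1] i.

Definition wg : {mpoly F[n]} := \prod_i 'X_i.

Variables (K : fieldType) (f : {rmorphism F -> K}) (z : 'I_n -> K).

Lemma wg_neq0 : mmap f z wg != 0 <-> forall i, z i != 0.
Proof.
rewrite rmorph_prod /=; split=> [/prodf_neq0 H i|H].
  by have := H i isT; rewrite mmapX mmap1U.
by apply/prodf_neq0 => i _; rewrite mmapX mmap1U.
Qed.

Lemma mmap_cleared v : (forall j, mmap f z (v j) != 0) ->
  mmap f z (cleared v) = (\prod_j mmap f z (v j)) * \sum_j (mmap f z (v j))^-1.
Proof.
move=> v0; rewrite rmorph_sum mulr_sumr; apply: eq_bigr => j _ /=.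
by rewrite rmorph_prod [in RHS](bigD1 j) //= mulrAC mulfV // mul1r.
Qed.

Lemma weqP : mmap f z wg != 0 ->
  (forall i, mmap f z (weq i) = 0) <-> wpoint (tripL z) (tripR z).
Proof.
move=> /wg_neq0 z0.
have tL : is_triple (tripL z) by apply: rows_triple.
have tR : is_triple (tripR z) by apply: rows_triple.
have ex j : mmap f z (vx j) = z (@lshift 6 6 j) by rewrite mmapX mmap1U.
have ey j : mmap f z (vy j) = z (@rshift 6 6 j) by rewrite mmapX mmap1U.
have exy j : mmap f z (vx j * vy j) = z (@lshift 6 6 j) * z (@rshift 6 6 j) by rewrite rmorphM /= ex ey.
have x0 j : mmap f z (vx j) != 0 by rewrite ex.
have y0 j : mmap f z (vy j) != 0 by rewrite ey.
have xy0 j : mmap f z (vx j * vy j) != 0 by rewrite exy mulf_neq0.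
have sV v (v0 : forall j, mmap f z (v j) != 0) :
    mmap f z (cleared v) = 0 <-> \sum_j (mmap f z (v j))^-1 = 0.
  rewrite mmap_cleared //; split=> [/eqP|->]; last by rewrite mulr0.
  by rewrite mulf_eq0 => /orP[/prodf_eq0[j _]|/eqP //]; rewrite (negPf (v0 j)).
have sp (g : 'I_6 -> K) : \sum_j g j = \sum_(j < 3) g (@lshift 3 3 j) + \sum_(j < 3) g (@rshift 3 3 j).
  exact: (@big_split_ord _ _ _ 3 3).
have opp (a b c d : K) : a + b = 0 -> c + d = 0 -> b = - a /\ d = - c.
  by move=> /eqP; rewrite addrC addr_eq0 => /eqP-> /eqP; rewrite addrC addr_eq0 => /eqP->.
have oppV (a b : K) : b = - a -> a + b = 0 by move=> ->; rewrite subrr.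
have E : [/\ mmap f z (\sum_j vx j) = sum (tripL z) 0 + sum (tripR z) 0,
   mmap f z (\sum_j vy j) = sum (tripL z) 1 + sum (tripR z) 1 &
   mmap f z (\sum_j vx j * vy j) = sumV (tripL z) (1 + 1) + sumV (tripR z) (1 + 1)].
  split; rewrite rmorph_sum /= sp /sum /sumV; congr (_ + _); apply: eq_bigr => j _;
    by rewrite /= ?exy ?ex ?ey /tripL /tripR /rows /= ?invrK.
have EV : [/\ \sum_j (mmap f z (vx j))^-1 = sumV (tripL z) 0 + sumV (tripR z) 0,
   \sum_j (mmap f z (vy j))^-1 = sumV (tripL z) 1 + sumV (tripR z) 1 &
   \sum_j (mmap f z (vx j * vy j))^-1 = sum (tripL z) (1 + 1) + sum (tripR z) (1 + 1)].
  split; rewrite sp /sum /sumV; congr (_ + _); apply: eq_bigr => j _;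
    by rewrite /= ?exy ?ex ?ey /tripL /tripR /rows /= ?invrK.
have [E0 E1 E2] := E; have [V0 V1 V2] := EV.
have L0 : @lshift 3 3 0 = 0 :> 'I_6 by apply: val_inj.
have o8 k (lt : (k < 8)%N) := Ordinal lt.
split=> [H|[_ _ n1 op] i].
  have H0 := H (@Ordinal 8 0 isT); have H1 := H (@Ordinal 8 1 isT); have H2 := H (@Ordinal 8 2 isT).
  have H3 := H (@Ordinal 8 3 isT); have H4 := H (@Ordinal 8 4 isT); have H5 := H (@Ordinal 8 5 isT).
  have H6 := H (@Ordinal 8 6 isT); have H7 := H (@Ordinal 8 7 isT).
  rewrite /weq /= in H0 H1 H2 H3 H4 H5 H6 H7.
  move/sV: H1 => /(_ x0); move/sV: H3 => /(_ y0); move/sV: H5 => /(_ xy0).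
  rewrite V0 V1 V2 => H5 H3 H1; rewrite E0 in H0; rewrite E1 in H2; rewrite E2 in H4.
  have n0 : z (@lshift 6 6 0) = 1.
    by have := H6; rewrite rmorphB rmorph1 /= ex => /eqP; rewrite subr_eq0 => /eqP.
  have n0' : z (@rshift 6 6 0) = 1.
    by have := H7; rewrite rmorphB rmorph1 /= ey => /eqP; rewrite subr_eq0 => /eqP.
  split=> //.
    by apply: ord3_ind; rewrite /tripL /rows /= L0 ?n0 ?n0' // mulr1 invr1.
  by apply: ord3_ind; [exact: opp|exact: opp|exact: opp].
have [op0 op0'] := op 0; have [op1 op1'] := op 1; have [op2 op2'] := op (1 + 1).
case: i => [[|[|[|[|[|[|[|[|//]]]]]]]] lt]; rewrite /weq /=.
- by rewrite E0; exact: oppV.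
- by apply/sV => //; rewrite V0; exact: oppV.
- by rewrite E1; exact: oppV.
- by apply/sV => //; rewrite V1; exact: oppV.
- by rewrite E2; exact: oppV.
- by apply/sV => //; rewrite V2; exact: oppV.
- by rewrite rmorphB rmorph1 /= ex; have := n1 0; rewrite /tripL /rows /= L0 => ->; rewrite subrr.
- by rewrite rmorphB rmorph1 /= ey; have := n1 1; rewrite /tripL /rows /= L0 => ->; rewrite subrr.
Qed.

End Equations.

Section IdealOfW.
Variable F : closedFieldType.
Hypothesis F0 : [pchar F] =i pred0.

Definition in_W (w : 'I_(6 + 6) -> F) := (wg F).@[w] != 0 /\ forall i, (weq F i).@[w] = 0.

Lemma in_WP w : in_W w <-> (forall i, w i != 0) /\ wpoint (tripL w) (tripR w).
Proof.
have := @wg_neq0 F F idfun w; have := @weqP F F idfun w => H1 H2.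
split=> [[g0 /(H1 g0) wp]|[/H2 g0 wp]]; first by split=> //; apply/H2.
by split=> //; apply/(H1 g0).
Qed.

(** The powers of a primitive cube root of unity in rows 0 and 1, with opposite signs in the second
    half: all the sums vanish. *)
Lemma W_point : exists w, in_W w.
Proof.
have [|om] := @closed_rootP F ('X^2 + 'X + 1) _.
  by rewrite -addrA size_polyDl size_polyXn // (leq_ltn_trans (size_polyD _ _)) // size_polyX size_poly1.
rewrite rootE !hornerE => /eqP om0.
have om_n : om != 0.
  by apply: contra_eq_neq om0 => ->; rewrite ?expr0n ?mulr0 /= !add0r oner_neq0.
pose X (j : 'I_3) := om ^+ j.
have n0 j : X j != 0 by rewrite expf_neq0.
have n0' j : - X j != 0 by rewrite oppr_eq0.
pose w := two_blocks X (fun j => - X j) X (fun j => - X j).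
have tb k := two_blocksE X (fun j => - X j) X (fun j => - X j) k.
exists w; apply/in_WP; split.
  by move=> i; rewrite /w /two_blocks; case: split => j; case: split => k.
have wL : tripL w = rows X X.
  by congr rows; apply: funext => j; have [e1 e2 e3 e4] := tb j.
have wR : tripR w = rows (fun j => - X j) (fun j => - X j).
  by congr rows; apply: funext => j; have [e1 e2 e3 e4] := tb j.
rewrite wL wR; have tL : is_triple (rows X X) := rows_triple n0 n0.
have tR : is_triple (rows (fun j => - X j) (fun j => - X j)) := rows_triple n0' n0'.
have om2 : om ^+ 2 = - om - 1.
  by apply/eqP; rewrite -subr_eq0 -[X in _ == X]om0; apply/eqP; ring.
have om3 : om ^+ 3 = 1 by rewrite exprS om2 mulrBr mulrN -expr2 om2; ring.
have s0 : 1 + om + om ^+ 2 = 0 by rewrite om2; ring.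
have vE : om^-1 = om ^+ 2 by apply: (mulfI om_n); rewrite mulfV // -exprS om3.
have v2E : (om ^+ 2)^-1 = om by rewrite -vE invrK.
have v4E : (om ^+ 2 * om ^+ 2)^-1 = om ^+ 2 by rewrite invfM v2E.
have v2E' : (om * om)^-1 = om by rewrite -expr2.
have X0 : X 0 = 1 by []. have X1 : X 1 = om by []. have X2 : X (1 + 1) = om ^+ 2 by [].
split=> //.
  by apply: ord3_ind; rewrite /rows /= ?X0 ?mulr1 ?invr1.
apply: ord3_ind; rewrite /sum /sumV !(ord3_big _ _ 0) /= !add0r /rows /= ?X0 ?X1 ?X2
  ?mulrNN ?mulr1 ?invrN ?invr1 ?invrK ?v4E ?v2E' ?v2E ?vE ?om2; split; try ring.
have -> : 1 + om * om + (- om - 1) * (- om - 1) = 2 * (om ^+ 2 + om + 1) by ring.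
have -> : om ^+ 2 + om + 1 = 0 by rewrite om2; ring.
by rewrite mulr0 oppr0.
Qed.

(** With 12 coordinates and 8 equations, [krull] gives a component of dimension at least 4 that
    meets the open set [h != 0]. *)
Lemma generic_near w h : in_W w -> h.@[w] != 0 ->
  exists (K : fieldType) (f : {rmorphism F -> K}) T T', generic f T T' /\
    mmap f (coords T T') h != 0.
Proof.
move=> [g0 ww] hw.
have [||P [pP PW Ph [g gI gP]]] := @krull F 12 8 (weq F) (h * wg F) w isT.
- by move=> i; exact: ww.
- by rewrite mevalM mulf_neq0.
have [K [f [z [zP _]]]] := kpoint pP.
have gz : mmap f z (wg F) != 0.
  by apply/eqP => /zP Pg; apply: Ph; exact: (idealM pP).
have hz : mmap f z h != 0.
  by apply/eqP => /zP Pg; apply: Ph; rewrite mulrC; exact: (idealM pP).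
have wz : wpoint (tripL z) (tripR z) by apply/(weqP gz) => i; apply/zP/PW.
exists K, f, (tripL z), (tripR z).
have E p : mmap f (coords (tripL z) (tripR z)) p = mmap f z p.
  by apply: eq_mmap => //; exact: coords_trip.
rewrite E; split=> //.
apply: (generic_of_indep (char0_ext f F0) wz (u := fun j => z (g j))).
  by move=> Q Qu; apply: gP; apply/zP; rewrite mmap_subvars.
move=> d dd k1 k2 j; have := kills_coords 'X_(g j) dd k1 k2.
by rewrite E mmapX mmap1U.
Qed.

Lemma generic_exists : exists (K : fieldType) (f : {rmorphism F -> K}) T T', generic f T T'.
Proof.
have [w ww] := W_point; have [|K [f [T [T' [g _]]]]] := @generic_near w 1 ww.
  by rewrite meval1 oner_neq0.
by exists K, f, T, T'.
Qed.

Section Generic.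
Variables (K : fieldType) (f : {rmorphism F -> K}) (T T' : 'I_3 -> 'I_3 -> K).
Hypothesis g : generic f T T'.

Lemma generic_wg : mmap f (coords T T') (wg F) != 0.
Proof.
have [[tT tT' _ _] _] := g; apply/wg_neq0 => i; rewrite /coords /two_blocks.
by case: split => j; case: split => k; exact: triple_neq0.
Qed.

Lemma generic_weq i : mmap f (coords T T') (weq F i) = 0.
Proof.
have [w _] := g; have [tT tT' _ _] := w; have [e1 e2] := trip_coords tT tT'.
by apply: (proj2 (weqP generic_wg)); rewrite e1 e2.
Qed.

(** There are generic points in each neighbourhood of each point of [W], and they all have the same
    ideal; so each of them is dense in [W]. *)
Lemma generic_vanish p : mmap f (coords T T') p = 0 <-> forall w, in_W w -> p.@[w] = 0.
Proof.
split=> [p0 w ww|H].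
  apply: contrapT => /eqP pw; have [K' [f' [S [S' [g' /eqP]]]]] := generic_near ww pw.
  by apply; apply/(generic_same F0 g g').
apply: contrapT => /eqP pn.
have [|y] := @exists_point F K f _ (coords T T') (p * wg F).
  by rewrite rmorphM mulf_neq0 // generic_wg.
rewrite mevalM mulf_eq0 negb_or => /andP[py gy] yP; move/eqP: py; apply; apply: H.
by split=> // i; apply/yP/generic_weq.
Qed.

End Generic.

Lemma alg_indep_sub (K : fieldType) (f : {rmorphism F -> K}) m k (u : 'I_m -> K) (g : 'I_k -> 'I_m) :
  injective g -> alg_indep f u -> alg_indep f (fun j => u (g j)).
Proof.
move=> gI uI Q Qu; apply: (subvars_eq0 gI); apply: uI.
by rewrite mmap_subvars.
Qed.

Lemma W_no5 (P : set {mpoly F[6 + 6]}) (u : 'I_5 -> {mpoly F[6 + 6]}) : is_prime P ->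
  (forall i, P (weq F i)) -> ~ P (wg F) -> indep_mod P u -> False.
Proof.
move=> pP PW Pg uI; have [K [f [z [zP _]]]] := kpoint pP.
have gz : mmap f z (wg F) != 0 by apply/eqP => /zP.
have wz : wpoint (tripL z) (tripR z) by apply/(weqP gz) => i; apply/zP/PW.
have E p : mmap f (coords (tripL z) (tripR z)) p = mmap f z p.
  by apply: eq_mmap => //; exact: coords_trip.
have vI := (indep_modP u zP).1 uI.
have kill d : derivation f d -> kills d (tripL z) -> kills d (tripR z) ->
    forall j, d (mmap f z (u j)) = 0.
  by move=> dd k1 k2 j; rewrite -E; exact: kills_coords.
have wI : injective (widen_ord (leqnSn 4)) by move=> i j /(congr1 val) /= ij; apply: val_inj.
have gen : generic f (tripL z) (tripR z).
  apply: (generic_of_indep (char0_ext f F0) wz (alg_indep_sub wI vI)) => d dd k1 k2 j.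
  exact: kill.
exact: (generic_no5 (char0_ext f F0) gen vI).
Qed.

(* The equations of the fiber product: up to constants, [invA], [invD] and [invE]
   are the traces of [p_(i+1) P p_i P], [p_0 P p_1 P p_2 P] and
   [p_0 P p_2 P p_1 P], and replacing [P] by [1 - P] changes the sign of the last
   two. *)
Definition matched (K : fieldType) (T S : 'I_3 -> 'I_3 -> K) :=
  [/\ forall i, invA S i = invA T i, invD S = - invD T & invE S = - invE T].

Definition matching_scale (K : fieldType) (T S : 'I_3 -> 'I_3 -> K) i := - (sum T i / sum S i).

(** The factors have product 1 by the relation between the [invE]. They make the sums opposite, and
    the equality of the [invA] then does the same for the sums of inverses. *)
Lemma matching_wpoint (K : fieldType) (T S : 'I_3 -> 'I_3 -> K) : is_triple T -> is_triple S ->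
  (forall i, T i 0 = 1) -> (forall i, S i 0 = 1) -> matched T S -> full T ->
  wpoint T (rescale (matching_scale T S) S) /\ colratio (rescale (matching_scale T S) S) = S.
Proof.
move=> tT tS T1 S1 [AE DE EE] fT.
have fS i : sumV S i != 0 /\ sum S i != 0.
  have := AE i; have [a0 b0] := fT i; rewrite /invA => e.
  have : sumV S i * sum S i != 0 by rewrite e mulf_neq0.
  by rewrite mulf_eq0 negb_or => /andP.
have l0 i : matching_scale T S i != 0.
  by rewrite oppr_eq0 mulf_neq0 ?invr_eq0 ?(fT i).2 ?(fS i).2.
have l1 : \prod_i matching_scale T S i = 1.
  have := EE; rewrite /invE !(ord3_big _ _ 0) /= !add0r /matching_scale => e.
  have E0 : sum S 0 * sum S 1 * sum S (1 + 1) != 0 by rewrite !mulf_neq0 ?(fS _).2.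
  transitivity (- (sum T 0 * sum T 1 * sum T (1 + 1)) / (sum S 0 * sum S 1 * sum S (1 + 1))).
    by field; rewrite !(fS _).2.
  by rewrite -e divff.
split; last first.
  apply: funext => i; apply: funext => j; rewrite /colratio /rescale S1 mulr1.
  by rewrite mulKf.
split=> //; first exact: rescale_triple.
move=> i; rewrite sumV_rescale sum_rescale /matching_scale.
have [a0 b0] := fT i; have [c0 d0] := fS i; split; last by field.
have e := AE i; rewrite /invA in e.
have -> : sumV S i = sumV T i * sum T i / sum S i by rewrite -e mulfK.
by field; rewrite ?oppr_eq0 ?b0 ?d0.
Qed.

(** A vanishing sum would leave only three parameters, by [zero_spans2]; without vanishing sums
    [matching_wpoint] applies. *)
Lemma matched_generic (K : fieldType) (f : {rmorphism F -> K}) (T S : 'I_3 -> 'I_3 -> K) (u : 'I_4 -> K) :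
  is_triple T -> is_triple S -> (forall i, T i 0 = 1) -> (forall i, S i 0 = 1) ->
  matched T S -> alg_indep f u ->
  (forall d, derivation f d -> kills d T -> kills d S -> forall j, d (u j) = 0) ->
  exists2 T', generic f T T' & colratio T' = S.
Proof.
move=> tT tS T1 S1 m uI uP; have K0 := char0_ext f F0; have [AE DE EE] := m.
have RT U : (forall i, U i 0 = 1) -> colratio U = U.
  by move=> U1; apply: funext => i; apply: funext => j; rewrite /colratio /rescale U1 invr1 mul1r.
have fT : full T.
  apply: contrapT => nf; have [i zi] : exists i, invA T i = 0.
    apply: contrapT => ni; apply: nf => k; have : invA T k != 0 by apply/eqP => ?; apply: ni; exists k.
    by rewrite mulf_eq0 negb_or => /andP[].
  have [t [t1 t2]] := zero_spans2 f K0 tT tS zi AE DE EE.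
  rewrite !RT // in t1 t2.
  have [d [dd dt [j /eqP dj]]] := derivation_kill K0 t uI (ltnSn 3).
  by case: dj; apply: uP => //; [exact: t1|exact: t2].
have [w cr] := matching_wpoint tT tS T1 S1 m fT.
exists (rescale (matching_scale T S) S) => //.
apply: (generic_of_indep K0 w uI) => d dd k1 k2; apply: uP => //.
by rewrite -cr; exact: (kills_ratio dd).
Qed.

End IdealOfW.

(** * Varieties given by equations *)

Local Open Scope classical_set_scope.
Local Open Scope ring_scope.

Section Presentation.
Variables (F : closedFieldType) (V : variety F) (n : nat).
Variables (c : V -> 'I_n -> F) (g : {mpoly F[n]}) (S : set {mpoly F[n]}).

(* [V] is the closed subvariety [S = 0] of the open subset [g != 0] of the
   affine space. *)
Record presentation : Prop := Presentation {
  pres_g : forall x, g.@[c x] != 0;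
  pres_S : forall x p, S p -> p.@[c x] = 0;
  pres_onto : forall y, g.@[y] != 0 -> (forall p, S p -> p.@[y] = 0) -> exists x, c x =1 y;
  pres_poly : forall p : {mpoly F[n]}, regular (fun x => p.@[c x]);
  pres_reg : forall h : V -> F, regular h ->
    exists (p : {mpoly F[n]}) N, forall x, h x * g.@[c x] ^+ N = p.@[c x] }.

Definition zero_set (Q : set {mpoly F[n]}) : set V := [set x | forall p, Q p -> p.@[c x] = 0].
Definition videal (Z : set V) : set {mpoly F[n]} := [set p | forall x, Z x -> p.@[c x] = 0].

Hypothesis pV : presentation.

Lemma zclosed_zero Q : zclosed (zero_set Q).
Proof.
exists [set h | exists2 p, Q p & h = fun x => p.@[c x]]; split.
  by move=> _ [p _ ->]; exact: pres_poly.
apply/seteqP; split=> x /= H; first by move=> _ [p Qp ->]; exact: H.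
by move=> p Qp; apply: (H (fun x => p.@[c x])); exists p.
Qed.

Lemma closed_zero Z : zclosed Z -> Z = zero_set (videal Z).
Proof.
move=> [S0 [S0r ZE]]; apply/seteqP; split=> [x Zx p|x zx]; first exact.
rewrite ZE => h S0h; have [p [N pE]] := pres_reg pV (S0r _ S0h).
have /zx : videal Z p.
  by move=> y; rewrite ZE -pE => /(_ _ S0h)->; rewrite mul0r.
by rewrite -pE => /eqP; rewrite mulf_eq0 expf_eq0 (negPf (pres_g pV x)) andbF orbF => /eqP.
Qed.

Lemma videal_ideal Z : is_ideal (videal Z).
Proof.
split=> [x _|p q pZ qZ x Zx|p q qZ x Zx]; first exact: meval0.
  by rewrite mevalD pZ // qZ // addr0.
by rewrite mevalM qZ // mulr0.
Qed.

Lemma videalS Z p : S p -> videal Z p.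
Proof. by move=> Sp x _; apply: pres_S Sp. Qed.

Lemma videal_g Z : Z !=set0 -> ~ videal Z g.
Proof. by move=> [x Zx] /(_ x Zx)/eqP; rewrite (negPf (pres_g pV x)). Qed.

Lemma irreducible_prime Z : irreducible Z -> is_prime (videal Z).
Proof.
move=> [[x0 Zx0] irr]; split; first exact: videal_ideal.
  by move=> /(_ x0 Zx0)/eqP; rewrite meval1 oner_eq0.
move=> p q pq; have [||x Zx||] := irr (zero_set [set p]) (zero_set [set q]).
- exact: zclosed_zero.
- exact: zclosed_zero.
- have /eqP := pq x Zx; rewrite mevalM mulf_eq0 => /orP[]/eqP e; [left|right];
    by move=> _ ->.
- by move=> Zp; left=> x /Zp; apply.
- by move=> Zq; right=> x /Zq; apply.
Qed.

Lemma prime_irreducible Z : Z !=set0 -> is_prime (videal Z) -> irreducible Z.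
Proof.
move=> Z0 pZ; split=> // A B cA cB ZAB.
have [ZA|/existsNP[x /not_implyP[Zx nAx]]] := pselect (Z `<=` A); [by left|right].
have [p [pA px]] : exists p, videal A p /\ p.@[c x] <> 0.
  apply: contrapT => np; apply: nAx; rewrite (closed_zero cA) => p pA.
  by apply: contrapT => px; apply: np; exists p.
rewrite (closed_zero cB) => y Zy q qB.
have : videal Z (p * q).
  by move=> z Zz; rewrite mevalM; have [/pA->|/qB->] := ZAB z Zz; rewrite ?mul0r ?mulr0.
by move=> /(primeM pZ)[/(_ x Zx)|/(_ y Zy)].
Qed.

(** The points are specialisations of the generic point of [P], chosen with [p * g] nonzero. *)
Lemma prime_zero P : is_prime P -> S `<=` P -> ~ P g ->
  zero_set P !=set0 /\ videal (zero_set P) = P.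
Proof.
move=> pP SP Pg; have [K [f [z [zP _]]]] := kpoint pP.
have pt p : ~ P p -> exists x, zero_set P x /\ p.@[c x] != 0.
  move=> np; have [|y] := @exists_point F K f n z (p * g).
    by rewrite rmorphM mulf_neq0 //; apply/eqP => /zP.
  rewrite mevalM mulf_eq0 negb_or => /andP[py gy] yP.
  have [|x cx] := pres_onto pV gy; first by move=> q /SP/zP/yP.
  exists x; split=> [q /zP/yP <-|]; first exact: meval_eq.
  by rewrite (meval_eq _ cx).
split; first by have [x [Px _]] := pt _ Pg; exists x.
apply/seteqP; split=> [p|p Pp x]; last exact.
by move=> vp; apply: contrapT => /pt[x [Px]]; rewrite vp ?eqxx.
Qed.

Lemma zero_irreducible P : is_prime P -> S `<=` P -> ~ P g -> irreducible (zero_set P).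
Proof.
move=> pP SP Pg; have [Z0 ZE] := prime_zero pP SP Pg.
by apply: prime_irreducible => //; rewrite ZE.
Qed.

Lemma videal_strict Z Z' : zclosed Z -> zclosed Z' -> Z `<` Z' -> videal Z' `<` videal Z.
Proof.
move=> cZ cZ' [sub nsub]; split=> [p pZ x /sub/pZ//|H]; apply: nsub.
rewrite (closed_zero cZ) => x Z'x p /H; exact.
Qed.

Lemma no_chain d : (forall P (u : 'I_d -> {mpoly F[n]}), is_prime P -> S `<=` P -> ~ P g ->
  ~ indep_mod P u) -> ~ has_chain V d.
Proof.
move=> nP [Z [Zci Zs]].
have [|i id|u uI] := @indep_chain F n d (fun i => videal (Z i)).
- by move=> i /Zci[_ /irreducible_prime].
- by apply: videal_strict; [case: (Zci i (ltnW id))|case: (Zci i.+1 id)|exact: Zs].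
have [cd id] := Zci d (leqnn d).
apply: (nP _ u (irreducible_prime id)) => //; first by move=> p; exact: videalS.
by apply: videal_g; case: id.
Qed.

Lemma exists_has_chain P d (u : 'I_d -> {mpoly F[n]}) : is_prime P -> S `<=` P -> ~ P g ->
  indep_mod P u -> has_chain V d.
Proof.
move=> pP SP Pg uI; have [Q [Qd Qp Qs]] := exists_chain pP Pg uI.
have SQ i : (i <= d)%N -> S `<=` Q i.
  move=> id; have [k ->] : exists k, i = (d - k)%N by exists (d - i)%N; rewrite subKn.
  elim: k => [|k IH]; first by rewrite subn0 Qd.
  have [dk|kd] := leqP d k; first by move: IH; rewrite (eqP (_ : d - k == 0)%N) ?subn_eq0 // (eqP (_ : d - k.+1 == 0)%N) ?subn_eq0 ?leqW.
  have lt : (d - k.+1 < d)%N by rewrite ltn_subrL (leq_ltn_trans _ kd).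
  have [sub _] := Qs _ lt; rewrite -subSn // subSS in sub.
  by move=> p /IH/sub.
exists (fun i => zero_set (Q i)); split=> i id.
  have [Qip Qig] := Qp i id; split; first exact: zclosed_zero.
  by apply: zero_irreducible => //; exact: SQ.
have [Qip Qig] := Qp i (ltnW id); have [Qip' Qig'] := Qp i.+1 id.
have [sub nsub] := Qs i id; split=> [x zx p /sub|H]; first exact: zx.
apply: nsub => p; rewrite -{1}(prime_zero Qip (SQ _ (ltnW id)) Qig).2 => vp.
by rewrite -(prime_zero Qip' (SQ _ id) Qig').2 => x /H/vp.
Qed.

End Presentation.

Lemma sub_presentation (F : closedFieldType) (V : variety F) n (c : V -> 'I_n -> F) g S (Z : set V) :
  presentation c g S -> zclosed Z ->
  presentation (V := subvariety Z) (fun z => c (sval z)) g (videal c Z).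
Proof.
move=> pV cZ; split=> [x|x p vp|y gy vy|p|h [h' rh' hE]].
- exact: (pres_g pV).
- by apply: vp; exact: (svalP x).
- have [|x cx] := pres_onto pV gy; first by move=> p /(videalS pV (Z := Z))/vy.
  have Zx : Z x.
    rewrite (closed_zero pV cZ) => p /vy <-; exact: meval_eq.
  by exists (exist _ x Zx).
- by exists (fun x => p.@[c x]) => //; exact: (pres_poly pV).
- have [p [N pE]] := pres_reg pV rh'; exists p, N => x.
  by rewrite hE.
Qed.

Lemma zclosed_setT (F : closedFieldType) (V : variety F) : zclosed [set: V].
Proof. exists set0; split; first by move=> ? [].
by apply/seteqP; split=> // x _ h []. Qed.

Lemma small_dim (F : closedFieldType) (V : variety F) k : is_irreducible V -> ~ has_chain V k ->
  exists2 d, (d < k)%N & has_dim V d.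
Proof.
move=> irr; have c0 : has_chain V 0.
  by exists (fun=> setT); split=> // i _; split=> //; exact: zclosed_setT.
elim: k => [//|k IH] nk; have [ck|nck] := pselect (has_chain V k); first by exists k.
by have [d dk hd] := IH nck; exists d => //; exact: ltnW.
Qed.

(** * Rational functions and a criterion for morphisms *)

Section Fractional.
Variables (F : closedFieldType) (V : variety F) (n : nat) (c : V -> 'I_n -> F) (U : set V).

Definition fractional (h : V -> F) := exists p q : {mpoly F[n]},
  forall x, U x -> q.@[c x] != 0 /\ h x = p.@[c x] / q.@[c x].

Lemma frac_poly p : fractional (fun x => p.@[c x]).
Proof. by exists p, 1 => x _; rewrite meval1 oner_neq0 divr1. Qed.

Lemma frac_const a : fractional (fun=> a).
Proof. by have [p [q H]] := frac_poly a%:MP; exists p, q => x /H; rewrite mevalC. Qed.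

Lemma eq_frac h h' : (forall x, U x -> h x = h' x) -> fractional h -> fractional h'.
Proof. by move=> e [p [q H]]; exists p, q => x Ux; rewrite -e //; exact: H. Qed.

Lemma fracD h h' : fractional h -> fractional h' -> fractional (fun x => h x + h' x).
Proof.
move=> [p [q H]] [p' [q' H']]; exists (p * q' + p' * q), (q * q') => x Ux.
have [q0 ->] := H x Ux; have [q'0 ->] := H' x Ux.
by rewrite mevalD !mevalM mulf_neq0 //; split=> //; field; rewrite q0 q'0.
Qed.

Lemma fracM h h' : fractional h -> fractional h' -> fractional (fun x => h x * h' x).
Proof.
move=> [p [q H]] [p' [q' H']]; exists (p * p'), (q * q') => x Ux.
have [q0 ->] := H x Ux; have [q'0 ->] := H' x Ux.
by rewrite !mevalM mulf_neq0 //; split=> //; field; rewrite q0 q'0.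
Qed.

Lemma fracV h : (forall x, U x -> h x != 0) -> fractional h -> fractional (fun x => (h x)^-1).
Proof.
move=> h0 [p [q H]]; exists q, p => x Ux; have [q0 hE] := H x Ux; have := h0 x Ux.
by rewrite hE mulf_eq0 negb_or => /andP[p0 _]; split=> //; rewrite invf_div.
Qed.

Lemma frac_sum (I : Type) (r : seq I) (h : I -> V -> F) : (forall i, fractional (h i)) ->
  fractional (fun x => \sum_(i <- r) h i x).
Proof.
move=> hf; elim: r => [|i r IH].
  by apply: eq_frac (frac_const 0) => x _; rewrite big_nil.
by apply: eq_frac (fracD (hf i) IH) => x _; rewrite big_cons.
Qed.

Lemma frac_prod (I : Type) (r : seq I) (h : I -> V -> F) : (forall i, fractional (h i)) ->
  fractional (fun x => \prod_(i <- r) h i x).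
Proof.
move=> hf; elim: r => [|i r IH].
  by apply: eq_frac (frac_const 1) => x _; rewrite big_nil.
by apply: eq_frac (fracM (hf i) IH) => x _; rewrite big_cons.
Qed.

Lemma fracX h k : fractional h -> fractional (fun x => h x ^+ k).
Proof.
move=> hf; elim: k => [|k IH]; first by apply: eq_frac (frac_const 1).
by apply: eq_frac (fracM hf IH) => x _; rewrite exprS.
Qed.

Lemma frac_mpoly m (h : 'I_m -> V -> F) p : (forall i, fractional (h i)) ->
  fractional (fun x => p.@[fun i => h i x]).
Proof.
move=> hf; have H := frac_sum (msupp p) (fun k => fracM (frac_const p@_k)
  (frac_prod (index_enum _) (fun i => fracX (k i) (hf i)))).
by apply: eq_frac H => x _; rewrite mevalE.
Qed.

End Fractional.

(** Regular functions pull back to fractions in the coordinates. The complement of a preimage is the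
    zero set of the numerators, multiplied by [u] so as to include the points outside the domain. *)
Lemma morphism_criterion (F : closedFieldType) (V1 V2 : variety F) n1 n2
    (c1 : V1 -> 'I_n1 -> F) g1 S1 (c2 : V2 -> 'I_n2 -> F) g2 S2 (u : {mpoly F[n1]})
    (W : set V2) (phi : V1 -> V2) :
  presentation c1 g1 S1 -> presentation c2 g2 S2 ->
  (forall x, u.@[c1 x] != 0 -> W (phi x)) ->
  (forall i, fractional c1 [set x | u.@[c1 x] != 0] (fun x => c2 (phi x) i)) ->
  morphism_on [set x | u.@[c1 x] != 0] W phi.
Proof.
move=> p1 p2 UW frac; split=> [x|Y f [S0 [S0r YE]] YW freg]; first exact: UW.
set U := [set x | u.@[c1 x] != 0].
have fr h : regular h -> fractional c1 U (h \o phi).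
  move=> /(pres_reg p2)[p [N pE]].
  have g0 x : U x -> g2.@[c2 (phi x)] ^+ N != 0 by move=> _; rewrite expf_neq0 ?(pres_g p2).
  apply: eq_frac (fracM (frac_mpoly p frac) (fracV g0 (fracX N (frac_mpoly g2 frac)))) => x Ux /=.
  by rewrite -pE mulfK // g0.
split.
  rewrite /zopen; have -> : ~` (U `&` phi @^-1` Y) = zero_set c1 [set q | exists h p r,
      [/\ S0 h, forall x, U x -> r.@[c1 x] != 0 /\ h (phi x) = p.@[c1 x] / r.@[c1 x] & q = u * p]].
    apply/seteqP; split=> [x nx q [h [p [r [S0h H ->]]]]|x zx [Ux Yx]].
      rewrite mevalM; have [->|ux] := eqVneq u.@[c1 x] 0; first by rewrite mul0r.
      have nY : (~` Y) (phi x) by move=> Yx; apply: nx.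
      move: nY; rewrite YE => /(_ _ S0h); have [r0 ->] := H x ux => /eqP.
      by rewrite mulf_eq0 invr_eq0 (negPf r0) orbF => /eqP->; rewrite mulr0.
    have : (~` Y) (phi x); last by apply.
    rewrite YE => h S0h; have [p [r H]] := fr _ (S0r _ S0h).
    have [r0 /= ->] := H x Ux; have /eqP := zx (u * p) (ex_intro _ h (ex_intro _ p (ex_intro _ r (And3 S0h H erefl)))).
    by rewrite mevalM mulf_eq0 (negPf Ux) /= => /eqP->; rewrite mul0r.
  exact: (zclosed_zero p1).
move=> x [Ux Yx]; have [a [b [ra rb bx abE]]] := freg _ Yx.
have [pa [qa Ha]] := fr _ ra; have [pb [qb Hb]] := fr _ rb.
exists (fun x => (pa * qb).@[c1 x]), (fun x => (qa * pb).@[c1 x]).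
split; [exact: (pres_poly p1)|exact: (pres_poly p1)| |].
  have [qa0 _] := Ha x Ux; have [qb0 /= bE] := Hb x Ux.
  rewrite mevalM mulf_neq0 //; apply: contraNneq bx; rewrite bE => ->; by rewrite mul0r.
move=> y [Uy Yy]; rewrite !mevalM mulf_eq0 negb_or => /andP[qay pby].
have [_ /= aE] := Ha y Uy; have [qby /= bE] := Hb y Uy.
rewrite /= abE // ?aE ?bE; last by rewrite mulf_neq0 ?invr_eq0.
by field; rewrite qay qby pby.
Qed.

(** * Quotients presented by finitely many invariants *)

Section GitPresentation.
Variables (F : closedFieldType) (R : variety F) (orb : R -> R -> Prop).
Variables (k : nat) (t : 'I_k -> invariants orb) (g : {mpoly F[k]}) (S : set {mpoly F[k]}).
Let tv rho i := sval (t i) rho.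
Hypothesis poly_reg : forall p : {mpoly F[k]}, regular (fun rho => p.@[tv rho]).

Lemma poly_invariant p : Defs.invariant orb (fun rho => p.@[tv rho]).
Proof.
split=> [|x y xy]; first exact: poly_reg.
apply: meval_eq => i; rewrite /tv; case: (t i) => h [_ hi] /=; exact: hi.
Qed.

Definition poly_inv p : invariants orb := exist _ _ (poly_invariant p).

Lemma character_poly (chi : invariants orb -> F) p : is_character chi ->
  chi (poly_inv p) = p.@[fun i => chi (t i)].
Proof.
move=> [cC cD cM]; pose phi p := chi (poly_inv p).
have phi_zmod : zmod_morphism phi.
  move=> a b; apply/eqP; rewrite eq_sym subr_eq; apply/eqP.
  by apply: cD => rho /=; rewrite mevalB subrK.
have phi_mon : monoid_morphism phi.
  split=> [|a b]; first by apply: cC => rho /=; rewrite meval1.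
  by apply: cM => rho /=; rewrite mevalM.
pose gA := GRing.isZmodMorphism.Build _ F phi phi_zmod.
pose gM := GRing.isMonoidMorphism.Build _ F phi phi_mon.
have := mmap_unique (HB.pack phi gA gM : {rmorphism {mpoly F[k]} -> F}) p.
rewrite /= -/(phi p) => ->; apply: eq_mmap => [c|i] /=.
  by apply: cC => rho /=; rewrite mevalC.
have zE : chi (poly_inv 0) = 0 by apply: cC => rho /=; rewrite meval0.
rewrite /phi -[chi (t i)]addr0 -zE; apply: cD => rho /=.
by rewrite mevalXU meval0 addr0.
Qed.

Hypothesis g_inv : exists s : invariants orb, forall rho, g.@[tv rho] * sval s rho = 1.
Hypothesis S_zero : forall rho p, S p -> p.@[tv rho] = 0.
Hypothesis t_onto : forall y, g.@[y] != 0 -> (forall p, S p -> p.@[y] = 0) ->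
  exists rho, tv rho =1 y.
Hypothesis t_reg : forall a : invariants orb, exists (p : {mpoly F[k]}) N,
  forall rho, sval a rho * g.@[tv rho] ^+ N = p.@[tv rho].

Definition git_coord (chi : git_quotient orb) i := sval chi (t i).

Lemma eval_character rho : is_character (fun a : invariants orb => sval a rho).
Proof. by split=> [c a|a b s|a b s]; apply. Qed.

Definition eval_point rho : git_quotient orb := exist _ _ (eval_character rho).

Lemma git_presentation : presentation git_coord g S.
Proof.
split=> [[chi cchi]|[chi cchi] p Sp|y gy Sy|p|h [a hE]].
- have [s sE] := g_inv; have [cC cD cM] := cchi; rewrite /git_coord /=.
  rewrite -(character_poly _ cchi); apply/eqP => g0.
  pose one := poly_inv 1.
  have : chi one = chi (poly_inv g) * chi s.
    by apply: cM => rho /=; rewrite meval1 sE.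
  rewrite g0 mul0r (cC 1) => [/eqP|rho]; first by rewrite oner_eq0.
  by rewrite /= meval1.
- rewrite /git_coord /= -(character_poly _ cchi); have [cC _ _] := cchi.
  by apply: cC => rho /=; exact: S_zero.
- have [rho rhoE] := t_onto gy Sy; by exists (eval_point rho).
- exists (poly_inv p) => -[chi cchi]; by rewrite /git_coord /= character_poly.
- have [p [N pE]] := t_reg a; exists p, N => -[chi cchi].
  rewrite hE /git_coord /= -(character_poly p cchi).
  have -> : g.@[fun i => chi (t i)] ^+ N = (g ^+ N).@[fun i => chi (t i)] by rewrite rmorphXn.
  rewrite -(character_poly (g ^+ N) cchi); have [_ _ cM] := cchi.
  by symmetry; apply: cM => rho /=; rewrite -pE rmorphXn.
Qed.

(** Surjectivity of the quotient map, which allows points of the moduli spaces to be computed on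
    representations. *)
Lemma character_eval (chi : git_quotient orb) : exists rho, forall a, sval chi a = sval a rho.
Proof.
have pg := git_presentation.
have [|rho rhoE] := t_onto (pres_g pg chi); first by move=> p Sp; exact: (pres_S pg chi Sp).
exists rho => a; have [p [N pE]] := t_reg a.
have [cC cD cM] := svalP chi.
have g0 := pres_g pg chi.
apply: (mulIf (expf_neq0 N g0)).
have -> : sval a rho * g.@[git_coord chi] ^+ N = p.@[git_coord chi].
  by have := pE rho; rewrite (meval_eq _ rhoE) (meval_eq _ rhoE).
have -> : g.@[git_coord chi] ^+ N = (g ^+ N).@[git_coord chi] by rewrite rmorphXn.
rewrite -!(character_poly _ (svalP chi)).
by symmetry; apply: cM => rho' /=; rewrite -pE rmorphXn.
Qed.

Lemma git_coord_inj (chi chi' : git_quotient orb) : git_coord chi =1 git_coord chi' -> chi = chi'.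
Proof.
move=> e; case: chi chi' e => [chi cchi] [chi' cchi'] e.
apply: eq_exist; apply: funext => a.
have pg := git_presentation; pose h (x : git_quotient orb) := sval x a.
have [p [N pE]] : exists (p : {mpoly F[k]}) N, forall x, h x * g.@[git_coord x] ^+ N = p.@[git_coord x].
  by apply: (pres_reg pg); exists a.
have E := pE (exist _ chi cchi); have E' := pE (exist _ chi' cchi').
apply: (mulIf (expf_neq0 N (pres_g pg (exist _ chi cchi)))).
rewrite [LHS]E [in RHS](meval_eq _ e) [RHS]E'; exact: meval_eq.
Qed.

End GitPresentation.

Section LocalFunctions.
Variables (F : closedFieldType) (n : nat).
Definition coord_prod : {mpoly F[n]} := \prod_i 'X_i.
Let g := coord_prod.

Lemma coord_prodE y : g.@[y] = \prod_i y i.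
Proof. by rewrite rmorph_prod; apply: eq_bigr => i _; rewrite /= mevalXU. Qed.

Lemma coord_prod_neq0 y : g.@[y] != 0 <-> forall i, y i != 0.
Proof.
rewrite coord_prodE; split=> [/prodf_neq0 H i|H]; first exact: H.
by apply/prodf_neq0 => i _.
Qed.

(** Laurent polynomials, as functions on the torus; the values elsewhere are irrelevant. *)
Definition local (phi : ('I_n -> F) -> F) := exists (p : {mpoly F[n]}) N,
  forall y, g.@[y] != 0 -> phi y * g.@[y] ^+ N = p.@[y].

Lemma local_const c : local (fun=> c).
Proof. by exists c%:MP, 0%N => y _; rewrite expr0 mulr1 mevalC. Qed.

Lemma local_coord i : local (fun y => y i).
Proof. by exists 'X_i, 0%N => y _; rewrite expr0 mulr1 mevalXU. Qed.

Lemma local_coordV i : local (fun y => (y i)^-1).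
Proof.
exists (\prod_(j | j != i) 'X_j), 1%N => y /coord_prod_neq0 y0.
rewrite expr1 coord_prodE (bigD1 i) //= mulKf // rmorph_prod.
by apply: eq_bigr => j _; rewrite /= mevalXU.
Qed.

Lemma localD a b : local a -> local b -> local (fun y => a y + b y).
Proof.
move=> [p [N H]] [q [M H']]; exists (p * g ^+ M + q * g ^+ N), (N + M)%N => y y0.
by rewrite mevalD !mevalM !rmorphXn /= -H // -H' // exprD; ring.
Qed.

Lemma localM a b : local a -> local b -> local (fun y => a y * b y).
Proof.
move=> [p [N H]] [q [M H']]; exists (p * q), (N + M)%N => y y0.
by rewrite mevalM -H // -H' // exprD; ring.
Qed.

Lemma eq_local a b : (forall y, g.@[y] != 0 -> a y = b y) -> local a -> local b.
Proof. by move=> e [p [N H]]; exists p, N => y y0; rewrite -e // H. Qed.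

Lemma local_mpoly m (h : 'I_m -> ('I_n -> F) -> F) p : (forall i, local (h i)) ->
  local (fun y => p.@[fun i => h i y]).
Proof.
move=> hf; pose Q (p : {mpoly F[m]}) := local (fun y => p.@[fun i => h i y]).
have QD a b : Q a -> Q b -> Q (a + b).
  by move=> qa qb; apply: eq_local (localD qa qb) => y _; rewrite mevalD.
have QM a b : Q a -> Q b -> Q (a * b).
  by move=> qa qb; apply: eq_local (localM qa qb) => y _; rewrite mevalM.
have QC c : Q c%:MP by apply: eq_local (local_const c) => y _; rewrite mevalC.
have QX i : Q 'X_i by apply: eq_local (hf i) => y _; rewrite mevalXU.
suff : Q p by [].
rewrite [p]mpolyE; elim/big_ind: _ => [|//|k _]; first by rewrite -mpolyC0.
rewrite -mul_mpolyC; apply/QM => //; rewrite mpolyXE_id.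
elim/big_ind: _ => [|//|i _]; first by rewrite -mpolyC1.
by elim: (k i) => [|l IH]; rewrite ?expr0 -?mpolyC1 // exprS; apply/QM.
Qed.

End LocalFunctions.

Section RegularReps.
Variables (F : closedFieldType) (n : nat) (I : finType) (C : set (I -> 'M[F]_n)).
Local Notation R := (rep_variety C).

Lemma reg_const c : regular (fun _ : R => c).
Proof. by exists c%:MP => rho; rewrite mevalC. Qed.

Lemma regD (a b : R -> F) : regular a -> regular b -> regular (fun x => a x + b x).
Proof. by move=> [p pE] [q qE]; exists (p + q) => rho; rewrite mevalD pE qE. Qed.

Lemma regM (a b : R -> F) : regular a -> regular b -> regular (fun x => a x * b x).
Proof. by move=> [p pE] [q qE]; exists (p * q) => rho; rewrite mevalM pE qE. Qed.

Lemma reg_entry i a b : regular (fun rho : R => sval rho i a b).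
Proof. by exists 'X_(enum_rank (i, a, b)) => rho; rewrite mevalXU entryE. Qed.

Lemma reg_sum (J : Type) (r : seq J) (h : J -> R -> F) : (forall j, regular (h j)) ->
  regular (fun x => \sum_(j <- r) h j x).
Proof.
move=> hf; elim: r => [|j r IH].
  by exists 0 => rho; rewrite big_nil meval0.
by have [p H] := regD (hf j) IH; exists p => rho; rewrite big_cons H.
Qed.

Lemma reg_mpoly m (h : 'I_m -> R -> F) p : (forall i, regular (h i)) ->
  regular (fun x => p.@[fun i => h i x]).
Proof.
move=> hf.
have /boolp.choice[q qE] : forall i, exists q : {mpoly F[#|{: I * 'I_n * 'I_n}|]},
    forall rho : R, h i rho = q.@[entry (sval rho)] by move=> i; exact: hf.
exists (p \mPo [tuple q i | i < m]) => rho.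
by rewrite comp_mpoly_meval; apply: meval_eq => i; rewrite tnth_mktuple qE.
Qed.

Definition mreg (A : R -> 'M[F]_n) := forall a b, regular (fun rho => A rho a b).

Lemma mreg_gen i : mreg (fun rho => sval rho i).
Proof. by move=> a b; exact: reg_entry. Qed.

Lemma mregM A B : mreg A -> mreg B -> mreg (fun rho => A rho *m B rho).
Proof.
move=> rA rB a b; have [p H] := reg_sum (index_enum _) (fun j => regM (rA a j) (rB j b)).
by exists p => rho; rewrite -H mxE.
Qed.

Lemma reg_trace A : mreg A -> regular (fun rho => \tr (A rho)).
Proof. by move=> rA; apply: reg_sum. Qed.

End RegularReps.

(** An algebraic substitute for continuity, used to pass to the limit in a degeneration: if [r] were
    not zero, it would take the value -1 somewhere. *)
Lemma extend_to_zero (F : closedFieldType) (q : {poly F}) a :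
  (forall s, s != 0 -> q.[s] = a) -> q.[0] = a.
Proof.
move=> qa; pose r := (q - a%:P) * 'X.
have r0 s : r.[s] = 0.
  rewrite !hornerE; have [->|/qa->] := eqVneq s 0; first by rewrite mulr0.
  by rewrite subrr mul0r.
have [s1|s1] := eqVneq (size (r + 1)) 1%N; last first.
  have [s] := closed_rootP _ s1.
  by rewrite rootE hornerD r0 hornerC add0r oner_eq0.
have : r = 0.
  have /size_poly1P[c _ E] : size (r + 1) == 1%N by rewrite s1.
  have cE : r = (c - 1)%:P by rewrite polyCB -E polyC1 addrK.
  by have := r0 0; rewrite cE hornerC => ->.
move/eqP; rewrite mulf_eq0 polyX_eq0 orbF subr_eq0 => /eqP->.
by rewrite hornerC.
Qed.

Lemma meval_poly (F : closedFieldType) m (p : {mpoly F[m]}) (v : F -> 'I_m -> F) :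
  (forall i, exists q : {poly F}, forall s, v s i = q.[s]) ->
  exists q : {poly F}, forall s, p.@[v s] = q.[s].
Proof.
move=> /boolp.choice[q qE]; exists (mmap (@polyC F) q p) => s.
rewrite -[RHS]/(horner_eval s (mmap (@polyC F) q p)) rmorph_mmap.
by apply: eq_mmap => i /=; rewrite horner_evalE ?hornerC.
Qed.

Local Close Scope classical_set_scope.

(** * Normal forms of representations *)

Section Dyads.
Variables (F : closedFieldType) (m : nat).
Hypothesis F0 : [pchar F] =i pred0.
Local Notation I := ('I_3 + 'I_m.+1)%type.
Implicit Types (u : I -> 'cV[F]_6) (a : I -> 'rV[F]_6) (g : I -> I -> F).

Lemma six_neq0 : 6%:R != 0 :> F.
Proof. by have /pcharf0P -> := F0. Qed.

Definition gram u a k l := (a k *m u l) 0 0.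
Definition dyads u a k : 'M[F]_6 := u k *m a k.

Lemma gramE u a k l : a k *m u l = (gram u a k l)%:M.
Proof. exact: mx11_scalar. Qed.

Lemma mul_dyad u a x k l j : x *: (u k *m a l) *m dyads u a j = (x * gram u a l j) *: (u k *m a j).
Proof.
rewrite /dyads -scalemxAl mulmxA -[u k *m a l *m u j]mulmxA gramE mul_mx_scalar -scalemxAl.
by rewrite scalerA.
Qed.

Lemma dyadE u a k : dyads u a k = 1 *: (u k *m a k).
Proof. by rewrite scale1r. Qed.

Lemma dyadsM u a k l : dyads u a k *m dyads u a l = gram u a k l *: (u k *m a l).
Proof. by rewrite {1}dyadE mul_dyad mul1r. Qed.

Lemma tr_dyad u a x k l : \tr (x *: (u k *m a l)) = x * gram u a l k.
Proof. by rewrite mxtraceZ mxtrace_mulC gramE mxtrace_scalar. Qed.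

Lemma tr_dyads4 u a k1 k2 k3 k4 :
  \tr (dyads u a k1 *m dyads u a k2 *m dyads u a k3 *m dyads u a k4) =
  gram u a k1 k2 * gram u a k2 k3 * gram u a k3 k4 * gram u a k4 k1.
Proof. by rewrite dyadsM !mul_dyad tr_dyad. Qed.

Lemma dyad_inj u a x y k l : gram u a k k = 1 -> gram u a l l = 1 ->
  x *: (u k *m a l) = y *: (u k *m a l) -> x = y.
Proof.
move=> gk gl e; have E z : (a k *m (z *: (u k *m a l)) *m u l) 0 0 = z.
  rewrite -scalemxAr -scalemxAl mulmxA gramE gk -mulmxA gramE gl mul_scalar_mx scale1r.
  by rewrite !mxE eqxx mulr1n mulr1.
by rewrite -[x]E e E.
Qed.

(** The relations of [B] for idempotents [u k *m a k], expressed by the scalars [a k *m u l]. *)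
Record is_gram g : Prop := IsGram {
  g_diag : forall k, g k k = 1;
  g_row : forall i i', i != i' -> g (inl i) (inl i') = 0;
  g_col : forall j j', j != j' -> g (inr j) (inr j') = 0;
  g_cross : forall i j, g (inl i) (inr j) * g (inr j) (inl i) = 6%:R^-1 }.

Lemma dyads_rep u a : is_gram (gram u a) -> X_rep (dyads u a).
Proof.
move=> [gd gr gc gx]; split; last first.
  move=> k; apply/eqP; rewrite eqn_leq mulmx_max_rank lt0n mxrank_eq0.
  apply/eqP => e; have := tr_dyad u a 1 k k; rewrite -dyadE [dyads u a k]e gd mulr1 mxtrace0.
  by move/eqP; rewrite eq_sym oner_eq0.
split.
- split=> [i|i i' ii]; rewrite -mulmxE dyadsM ?gd ?scale1r //.
  by rewrite gr // scale0r.
- split=> [i|i i' ii]; rewrite -mulmxE dyadsM ?gd ?scale1r //.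
  by rewrite gc // scale0r.
- by move=> i j; rewrite -!mulmxE dyadsM mul_dyad gx.
- by move=> i j; rewrite -!mulmxE dyadsM mul_dyad mulrC gx.
Qed.

Lemma rank1_dyad (e : 'M[F]_6) : \rank e = 1%N -> e *m e = e ->
  exists (v : 'cV[F]_6) (b : 'rV[F]_6), e = v *m b /\ b *m v = 1%:M.
Proof.
move=> rk; have e0 : e != 0 by rewrite -mxrank_eq0 rk.
move: (col_base e) (row_base e) (mulmx_base e); rewrite rk => v b E ee.
exists v, b; split=> //; have /eqP : ((b *m v) 0 0 - 1) *: e = 0.
  apply/eqP; rewrite scalerBl scale1r subr_eq0 -{2}ee -E -[in X in _ == X]mulmxA [b *m (v *m b)]mulmxA; apply/eqP.
  by rewrite [b *m v in RHS]mx11_scalar [_%:M *m b]mul_scalar_mx -scalemxAr.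
rewrite scaler_eq0 (negPf e0) orbF subr_eq0 => /eqP e1.
by rewrite [LHS]mx11_scalar e1.
Qed.

Lemma rep_dyads (rho : I -> 'M[F]_6) : X_rep rho ->
  exists u a, rho =1 dyads u a /\ is_gram (gram u a).
Proof.
move=> [[[pi po] [qi qo] pqp qpq] rk].
have idem k : rho k *m rho k = rho k by case: k => k; [exact: pi|exact: qi].
have /boolp.choice[u uP] : forall k, exists (v : 'cV[F]_6) (b : 'rV[F]_6),
    rho k = v *m b /\ b *m v = 1%:M.
  by move=> k; exact: rank1_dyad.
have /boolp.choice[a ua] := uP.
exists u, a; have rE k : rho k = dyads u a k := (ua k).1.
have gd k : gram u a k k = 1 by rewrite /gram (ua k).2 mxE eqxx.
split=> //; split=> // [i i' ii|j j' jj|i j].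
- apply: (@dyad_inj u a _ _ (inl i) (inl i')) => //; rewrite scale0r -dyadsM -!rE.
  exact: po.
- apply: (@dyad_inj u a _ _ (inr j) (inr j')) => //; rewrite scale0r -dyadsM -!rE.
  exact: qo.
- apply: (@dyad_inj u a _ _ (inl i) (inl i)) => //; rewrite -mul_dyad -dyadsM.
  by have := pqp i j; rewrite -!mulmxE !rE.
Qed.

Definition normal_gram g :=
  [/\ is_gram g, forall j, g (inl 0) (inr j) = 1 & forall i, g (inl i) (inr 0) = 1].

Lemma cross_neq0 g i j : is_gram g -> g (inl i) (inr j) != 0.
Proof.
case=> _ _ _ /(_ i j); apply: contra_eq_neq => ->.
by rewrite mul0r eq_sym invr_eq0 six_neq0.
Qed.

Lemma rep_normal (rho : I -> 'M[F]_6) : X_rep rho ->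
  exists u a, rho =1 dyads u a /\ normal_gram (gram u a).
Proof.
move=> /rep_dyads[u [a [rE ig]]]; pose g := gram u a; have [gd gr gc gx] := ig.
pose s k := match k with inl i => g (inl i) (inr 0) / g (inl 0) (inr 0)
  | inr j => (g (inl 0) (inr j))^-1 end.
have n i j : g (inl i) (inr j) != 0 by exact: cross_neq0.
have s0 k : s k != 0 by case: k => k /=; rewrite ?mulf_neq0 ?invr_eq0.
pose u' k := s k *: u k; pose a' k := (s k)^-1 *: a k.
have g' k l : gram u' a' k l = g k l * s l / s k.
  rewrite /gram /u' /a' -scalemxAl -scalemxAr scalerA mxE -/(gram u a k l) -/g.
  by rewrite mulrC mulrA mulrAC.
exists u', a'; split.
  by move=> k; rewrite rE /dyads /u' /a' -scalemxAl -scalemxAr scalerA divff // scale1r.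
split.
- split=> [k|i i' ii|j j' jj|i j]; rewrite !g'.
  + by rewrite [g _ _]gd mul1r divff.
  + by rewrite [g _ _]gr // !mul0r.
  + by rewrite [g _ _]gc // !mul0r.
  + rewrite -[RHS](gx i j) -/g; have := s0 (inl i); have := s0 (inr j).
    by move: (s (inl i)) (s (inr j)) => x y x0 y0; field; rewrite x0 y0.
- by move=> j; rewrite g' /= divff // divff // divr1.
- move=> i; rewrite g' /=; move: (n i 0) (n 0 0); move: (g _ _) (g _ _) => x y x0 y0.
  by field; rewrite x0 y0.
Qed.

(** An entry [g (inr j) (inl i)] is the inverse of [6 * g (inl i) (inr j)]; two such entries occur
    in the trace, hence the factor 36. *)
Definition tratio (rho : I -> 'M[F]_6) (i : 'I_3) j :=
  36%:R * \tr (rho (inl (i + 1)) *m rho (inr j) *m rho (inl i) *m rho (inr 0)).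
Definition tratioV (rho : I -> 'M[F]_6) (i : 'I_3) j :=
  36%:R * \tr (rho (inl i) *m rho (inr j) *m rho (inl (i + 1)) *m rho (inr 0)).

Definition gratio g (i : 'I_3) j := g (inl (i + 1)) (inr j) / g (inl i) (inr j).

Lemma g_crossV g i j : is_gram g -> g (inr j) (inl i) = (6%:R * g (inl i) (inr j))^-1.
Proof.
move=> ig; have n := cross_neq0 i j ig; have [_ _ _ gx] := ig.
by apply: (mulfI n); rewrite gx invfM mulrCA divff ?mulr1.
Qed.

Lemma tratioE u a i j : normal_gram (gram u a) ->
  tratio (dyads u a) i j = gratio (gram u a) i j /\
  tratioV (dyads u a) i j = (gratio (gram u a) i j)^-1.
Proof.
move=> [ig g0j gi0]; have n k l := cross_neq0 k l ig.
have s := six_neq0; have E36 : 36%:R = 6%:R * 6%:R :> F by rewrite -natrM.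
rewrite /tratio /tratioV !tr_dyads4 !g_crossV // !gi0 /gratio E36.
move: (n (i + 1) j) (n i j) s; move: (gram _ _ _ _) (gram _ _ _ _) 6%:R => x y z x0 y0 z0.
by split; field; rewrite ?x0 ?y0 ?z0.
Qed.

Definition acoef (t : 'I_3 -> 'I_m.+1 -> F) (i : 'I_3) j :=
  if i == 0 then 1 else if i == 1 then t 0 j else t 0 j * t 1 j.

(** The normalised Gram matrix rebuilt from its ratios, starting with row 0 equal to 1. *)
Definition grid t (k l : I) : F :=
  match k, l with
  | inl i, inl i' => (i == i')%:R
  | inr j, inr j' => (j == j')%:R
  | inl i, inr j => acoef t i j
  | inr j, inl i => 6%:R^-1 * acoef (fun i j => (t i j)^-1) i j
  end.

Lemma acoefV t i j : acoef (fun i j => (t i j)^-1) i j = (acoef t i j)^-1.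
Proof. by rewrite /acoef; case: eqP => _; rewrite ?invr1 //; case: eqP => _ //; rewrite invfM. Qed.

Lemma normal_grid g k l : normal_gram g -> g k l = grid (gratio g) k l.
Proof.
move=> [ig g0j gi0]; have [gd gr gc gx] := ig; have n i j := cross_neq0 i j ig.
have A i j : g (inl i) (inr j) = acoef (gratio g) i j.
  rewrite /acoef /gratio !add0r !g0j divr1; move: i; apply: ord3_ind => //=.
  by rewrite mulrC divfK.
case: k l => [i|j] [i'|j'] //=.
- by case: eqP => [->|/eqP /gr//]; rewrite gd.
- by rewrite acoefV -A g_crossV // invfM.
- by case: eqP => [->|/eqP /gc//]; rewrite gd.
Qed.

Lemma acoef_neq0 t i j : (forall i j, t i j != 0) -> acoef t i j != 0.
Proof.
by move=> t0; rewrite /acoef; do 2?case: ifP => _; rewrite ?oner_eq0 ?mulf_neq0.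
Qed.

Lemma grid_gram t : (forall i j, t i j != 0) -> is_gram (grid t).
Proof.
move=> t0; split=> [[k|k]|i i' /negPf ii|j j' /negPf jj|i j] /=; rewrite ?eqxx ?ii ?jj //.
by rewrite acoefV mulrCA divff ?mulr1 // acoef_neq0.
Qed.

Lemma grid_normal t : (forall i j, t i j != 0) -> (forall i, t i 0 = 1) -> normal_gram (grid t).
Proof.
move=> t0 t1; split=> // [|i]; first exact: grid_gram.
by rewrite /= /acoef !t1; case: eqP => _ //; case: eqP => _ //; rewrite mulr1.
Qed.

Lemma gratio_grid t i j : (forall i j, t i j != 0) -> t 0 j * t 1 j * t (1 + 1) j = 1 ->
  gratio (grid t) i j = t i j.
Proof.
move=> t0 e; rewrite /gratio /=; move: i; apply: ord3_ind; rewrite /acoef /= ?divr1 //.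
  by rewrite mulrAC divff ?mul1r.
by rewrite div1r -[LHS]mulr1 -e mulKf // mulf_neq0.
Qed.

End Dyads.

(** * Invariants depend on the Gram matrix only *)

Section Degeneration.
Variable F : closedFieldType.
Local Notation I := ('I_3 + 'I_3)%type.
Implicit Types M N g : 'M[F]_6.

Definition slot (k : I) : 'I_6 := @unsplit 3 3 k.
(** As [3 + 3 = 6], the six vectors and the six covectors form square matrices, and the Gram matrix
    is [N *m M]; conjugation by [g] replaces them by [g *m M] and [N *m invmx g]. *)
Definition mrep M N : I -> 'M[F]_6 := dyads (fun k => col (slot k) M) (fun k => row (slot k) N).

Lemma gram_mrep M N k l :
  gram (fun k => col (slot k) M) (fun k => row (slot k) N) k l = (N *m M) (slot k) (slot l).
Proof. by rewrite /gram !mxE; apply: eq_bigr => i _; rewrite !mxE. Qed.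

Definition grammx (G : 'M[F]_6) := is_gram (fun k l : I => G (slot k) (slot l)).

Lemma mrep_rep M N : grammx (N *m M) -> X_rep (mrep M N).
Proof.
move=> G; apply: dyads_rep.
by have [d r c x] := G; split=> *; rewrite !gram_mrep; auto.
Qed.

Lemma dyads_mrep (u : I -> 'cV[F]_6) (a : I -> 'rV[F]_6) :
  exists M N, [/\ forall k, col (slot k) M = u k, forall k, row (slot k) N = a k &
    dyads u a =1 mrep M N].
Proof.
exists (\matrix_(i, j) u (@split 3 3 j) i 0), (\matrix_(i, j) a (@split 3 3 i) 0 j).
have e1 k : col (slot k) (\matrix_(i, j) u (@split 3 3 j) i 0) = u k.
  by apply/colP => i; rewrite !mxE unsplitK.
have e2 k : row (slot k) (\matrix_(i, j) a (@split 3 3 i) 0 j) = a k.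
  by apply/rowP => i; rewrite !mxE unsplitK.
by split=> // k; rewrite /mrep /dyads e1 e2.
Qed.

Lemma mrep_conj M N g k : mrep (g *m M) (N *m invmx g) k = g *m mrep M N k *m invmx g.
Proof. by rewrite /mrep /dyads !colE !rowE !mulmxA. Qed.

Lemma line_extend (p : {mpoly F[#|{: I * 'I_6 * 'I_6}|]}) (A B : I -> 'M[F]_6) c :
  (forall s, s != 0 -> p.@[entry (fun k => A k + s *: B k)] = c) -> p.@[entry A] = c.
Proof.
move=> H; have [|q qE] := @meval_poly F #|{: I * 'I_6 * 'I_6}| p (fun s => entry (fun k => A k + s *: B k)).
  move=> k; exists ((entry A k)%:P + (entry B k)%:P * 'X) => s.
  by rewrite /entry !mxE !hornerE mulrC.
have := @extend_to_zero F q c; rewrite -qE => <-; last by move=> s s0; rewrite -qE H.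
by apply: meval_eq => k; rewrite /entry !mxE mul0r addr0.
Qed.

Variable p : {mpoly F[#|{: I * 'I_6 * 'I_6}|]}.
Hypothesis p_inv : forall M N g, grammx (N *m M) -> g \in unitmx ->
  p.@[entry (mrep (g *m M) (N *m invmx g))] = p.@[entry (mrep M N)].

(* With [e] a projector onto the image of [M], first [N] degenerates to [N e]
   through the conjugations by [e + s^-1 (1 - e)], which fix [M]; then [M] is
   perturbed to an invertible matrix inside the kernel of [N e]. *)
Lemma degeneration M N : grammx (N *m M) ->
  p.@[entry (mrep M N)] = p.@[entry (mrep 1%:M (N *m M))].
Proof.
move=> G; pose L := col_ebase M; pose R := row_ebase M; pose r := \rank M.
have uL : L \in unitmx := col_ebase_unit M; have uR : R \in unitmx := row_ebase_unit M.
have ME : L *m pid_mx r *m R = M := mulmx_ebase M.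
have r6 : (r <= 6)%N := rank_leq_row M.
pose e := L *m pid_mx r *m invmx L; pose h := L *m copid_mx r *m invmx L.
have pp : (pid_mx r : 'M[F]_6) *m (pid_mx r : 'M[F]_6) = pid_mx r :> 'M[F]_6 by rewrite pid_mx_id.
have pc : (pid_mx r : 'M[F]_6) *m (copid_mx r : 'M[F]_6) = 0 :> 'M[F]_6 by rewrite mul_pid_mx_copid.
have cp : (copid_mx r : 'M[F]_6) *m (pid_mx r : 'M[F]_6) = 0 :> 'M[F]_6 by rewrite mul_copid_mx_pid.
have cc : (copid_mx r : 'M[F]_6) *m (copid_mx r : 'M[F]_6) = copid_mx r :> 'M[F]_6 by rewrite copid_mx_id.
have LL A B : (L *m A *m invmx L) *m (L *m B *m invmx L) = L *m (A *m B) *m invmx L.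
  by rewrite !mulmxA mulmxKV.
have eh1 : e + h = 1%:M by rewrite -mulmxDl -mulmxDr addrC subrK mulmx1 mulmxV.
have ee : e *m e = e by rewrite LL pp.
have eh : e *m h = 0 by rewrite LL pc mulmx0 mul0mx.
have he : h *m e = 0 by rewrite LL cp mulmx0 mul0mx.
have hh : h *m h = h by rewrite LL cc.
have eM : e *m M = M by rewrite -ME /e !mulmxA mulmxKV // -[L *m _ *m pid_mx r]mulmxA pp.
have hM : h *m M = 0 by rewrite -eM mulmxA he mul0mx.
have step1 : p.@[entry (mrep M (N *m e))] = p.@[entry (mrep M N)].
  apply: (@line_extend p (mrep M (N *m e)) (mrep M (N *m h))) => s s0.
  pose gs := e + s^-1 *: h; pose gi := e + s *: h.
  have gg : gs *m gi = 1%:M.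
    rewrite mulmxDl !mulmxDr -!scalemxAl -!scalemxAr ee eh he hh !scaler0 addr0 add0r.
    by rewrite scalerA mulVf // scale1r.
  have [ug _] := mulmx1_unit gg; have gV : invmx gs = gi by rewrite -[gi]mul1mx -(mulVmx ug) -mulmxA gg mulmx1.
  have := p_inv G ug; rewrite gV mulmxDl eM -scalemxAl hM scaler0 addr0 => <-.
  apply: meval_eq => k; rewrite /entry; congr ((_ : 'M_6) _ _).
  by rewrite /mrep /dyads !rowE mulmxDr -!scalemxAr !mulmxDr -!scalemxAr.
rewrite -step1; apply: (@line_extend p (mrep M (N *m e)) (mrep (L *m copid_mx r *m R) (N *m e))) => s s0.
pose Ms := M + s *: (L *m copid_mx r *m R).
have NM : N *m e *m Ms = N *m M.
  rewrite mulmxDr -scalemxAr -[N *m e *m M]mulmxA eM -[N *m e *m _]mulmxA.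
  have -> : e *m (L *m copid_mx r *m R) = 0.
    by rewrite /e !mulmxA mulmxKV // -[L *m _ *m copid_mx r]mulmxA pc mulmx0 mul0mx.
  by rewrite mulmx0 scaler0 addr0.
have uM : Ms \in unitmx.
  have -> : Ms = L *m (pid_mx r + s *: copid_mx r) *m R.
    by rewrite mulmxDr mulmxDl ME -scalemxAr -scalemxAl.
  rewrite !unitmx_mul uL uR andbT /=.
  have : (pid_mx r + s *: copid_mx r) *m (pid_mx r + s^-1 *: copid_mx r) = 1%:M :> 'M[F]_6.
    rewrite mulmxDl !mulmxDr -!scalemxAl -!scalemxAr pp pc cp cc !scaler0 addr0 add0r.
    by rewrite scalerA mulfV // scale1r addrC subrK.
  by case/mulmx1_unit.
have G' : grammx (N *m e *m Ms) by rewrite NM.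
have uV : invmx Ms \in unitmx by rewrite unitmx_inv.
have := p_inv G' uV; rewrite invmxK mulVmx // NM => ->.
apply: meval_eq => k; rewrite /entry; congr ((_ : 'M_6) _ _).
by rewrite /mrep /dyads !colE !mulmxDl -!scalemxAl.
Qed.

End Degeneration.

Section EquivariantMatrices.
Variables (F : closedFieldType) (n : nat) (I : finType) (C : set (I -> 'M[F]_n)).
Local Notation R := (rep_variety C).

Definition equi (A : R -> 'M[F]_n) := mreg A /\
  forall (rho rho' : R) (g : 'M[F]_n), g \in unitmx ->
    (forall i, sval rho' i = g *m sval rho i *m invmx g) -> A rho' = g *m A rho *m invmx g.

Lemma equi_gen i : equi (fun rho => sval rho i).
Proof. by split=> [|rho rho' g _ H]; [exact: mreg_gen|exact: H]. Qed.

Lemma equiM A B : equi A -> equi B -> equi (fun rho => A rho *m B rho).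
Proof.
move=> [rA eA] [rB eB]; split=> [|rho rho' g ug H]; first exact: mregM.
by rewrite (eA _ _ _ ug H) (eB _ _ _ ug H) !mulmxA mulmxKV.
Qed.

Lemma tr_equi A c : equi A -> Defs.invariant (@Defs.conjugate F n I C) (fun rho => c * \tr (A rho)).
Proof.
move=> [rA eA]; split=> [|rho rho' [g ug H]].
  by apply: regM; [exact: reg_const|exact: reg_trace].
by rewrite (eA _ _ _ ug H) mxtrace_mulC mulmxA mulVmx // mul1mx.
Qed.

End EquivariantMatrices.

Section RatioInvariants.
Variables (F : closedFieldType) (m : nat) (C : set ('I_3 + 'I_m.+1 -> 'M[F]_6)).

Lemma tratio_invariant i j : Defs.invariant (@Defs.conjugate F 6 _ C) (fun rho => tratio (sval rho) i j).
Proof. by apply: tr_equi; do 3?apply: equiM; exact: equi_gen. Qed.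

Lemma tratioV_invariant i j : Defs.invariant (@Defs.conjugate F 6 _ C) (fun rho => tratioV (sval rho) i j).
Proof. by apply: tr_equi; do 3?apply: equiM; exact: equi_gen. Qed.

Definition tratio_inv i j : invariants (@Defs.conjugate F 6 _ C) := exist _ _ (tratio_invariant i j).

Lemma invariants_prod k (s : 'I_k -> invariants (@Defs.conjugate F 6 _ C)) :
  exists r : invariants (@Defs.conjugate F 6 _ C), forall rho, sval r rho = \prod_i sval (s i) rho.
Proof.
have reg : Defs.invariant (@Defs.conjugate F 6 _ C) (fun rho => \prod_i sval (s i) rho).
  split=> [|x y xy].
    have [p pE] := reg_mpoly (\prod_i 'X_i) (fun i => (svalP (s i)).1).
    exists p => rho; rewrite -pE rmorph_prod; apply: eq_bigr => i _ /=.
    by rewrite mevalXU.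
  by apply: eq_bigr => i _; apply: (svalP (s i)).2.
by exists (exist _ _ reg).
Qed.

Hypothesis F0 : [pchar F] =i pred0.

Lemma grid_local n (t : ('I_n -> F) -> 'I_3 -> 'I_m.+1 -> F) k l :
  (forall i j, local (fun y => t y i j)) -> (forall i j, local (fun y => (t y i j)^-1)) ->
  local (fun y => grid (t y) k l).
Proof.
have ac (s : ('I_n -> F) -> 'I_3 -> 'I_m.+1 -> F) i j :
    (forall i j, local (fun y => s y i j)) -> local (fun y => acoef (s y) i j).
  move=> sl; rewrite /acoef; case: (i == 0) => /=; first exact: local_const.
  by case: (i == 1) => //=; exact: localM.
move=> tl tV; case: k l => k [l|l] /=; try exact: local_const; first exact: ac.
by apply: localM; [exact: local_const|exact: (ac (fun y i j => (t y i j)^-1))].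
Qed.

Lemma gratio_neq0 (g : 'I_3 + 'I_m.+1 -> 'I_3 + 'I_m.+1 -> F) i j : normal_gram g -> gratio g i j != 0.
Proof. by case=> ig _ _; rewrite mulf_neq0 ?invr_eq0 ?cross_neq0. Qed.

Lemma gratio0 (g : 'I_3 + 'I_m.+1 -> 'I_3 + 'I_m.+1 -> F) i : normal_gram g -> gratio g i 0 = 1.
Proof. by case=> _ _ g0; rewrite /gratio !g0 divr1. Qed.

Lemma gratio_prod (g : 'I_3 + 'I_m.+1 -> 'I_3 + 'I_m.+1 -> F) j : normal_gram g ->
  gratio g 0 j * gratio g 1 j * gratio g (1 + 1) j = 1.
Proof.
case=> ig _ _; rewrite /gratio add0r.
have -> : (1 + 1 + 1 : 'I_3) = 0 by exact: val_inj.
have n i := cross_neq0 F0 i j ig; move: (n 0) (n 1) (n (1 + 1)).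
by move: (g _ _) (g _ _) (g _ _) => x y z x0 y0 z0; field; rewrite x0 y0 z0.
Qed.

End RatioInvariants.

(** * [X] as a torus of dimension 4 *)

Section ModuliX.
Variable F : closedFieldType.
Hypothesis F0 : [pchar F] =i pred0.
Local Notation C := (@X_rep F 3).

Definition one3 (R : pzSemiRingType) (x x' : R) (j : 'I_3) : R :=
  if j == 0 then 1 else if j == 1 then x else x'.
Definition trip4 (R : unitRingType) (y : 'I_4 -> R) : 'I_3 -> 'I_3 -> R :=
  rows (one3 (y 0) (y 1)) (one3 (y (1 + 1)) (y (1 + 1 + 1))).

Lemma one3E (R : pzSemiRingType) (T : 'I_3 -> R) : T 0 = 1 -> one3 (T 1) (T (1 + 1)) = T.
Proof. by move=> T0; apply: funext; apply: ord3_ind; rewrite /one3 //= T0. Qed.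

Lemma trip4_xc (K : fieldType) (T : 'I_3 -> 'I_3 -> K) : is_triple T -> (forall i, T i 0 = 1) ->
  trip4 (xc T) = T.
Proof.
move=> tT T1; rewrite [RHS]triple_rows // /trip4 /=.
by congr rows; rewrite -[RHS]one3E.
Qed.

Lemma xc_trip4 (K : fieldType) (y : 'I_4 -> K) : xc (trip4 y) =1 y.
Proof.
case=> -[|[|[|[|//]]]] lt; rewrite /xc /vec4 /trip4 /rows /one3 /=; congr (y _); exact: val_inj.
Qed.

Lemma one3_neq0 (K : fieldType) (x x' : K) j : x != 0 -> x' != 0 -> one3 x x' j != 0.
Proof. by move=> x0 y0; rewrite /one3; do 2?case: ifP => _; rewrite ?oner_eq0. Qed.

Lemma trip4_triple (K : fieldType) (y : 'I_4 -> K) : (forall i, y i != 0) -> is_triple (trip4 y).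
Proof. by move=> y0; apply: rows_triple => j; exact: one3_neq0. Qed.

Lemma trip4_0 (K : fieldType) (y : 'I_4 -> K) i : trip4 y i 0 = 1.
Proof. by move: i; apply: ord3_ind; rewrite /trip4 /rows /one3 //= mulr1 invr1. Qed.

Definition row4 : 'I_4 -> 'I_3 := vec4 0 0 1 1.
Definition col4 : 'I_4 -> 'I_3 := vec4 1 (1 + 1) 1 (1 + 1).

Lemma xcE (K : fieldType) (T : 'I_3 -> 'I_3 -> K) k : xc T k = T (row4 k) (col4 k).
Proof. by case: k => -[|[|[|[|//]]]] lt. Qed.

Definition tX (k : 'I_4) : invariants (@Defs.conjugate F 6 _ C) := tratio_inv C (row4 k) (col4 k).

Lemma tXE u a : normal_gram (gram u a) ->
  [/\ is_triple (gratio (gram u a)), forall i, gratio (gram u a) i 0 = 1 &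
  forall rho : rep_variety C, sval rho =1 dyads u a ->
    (fun k => sval (tX k) rho) =1 xc (gratio (gram u a))].
Proof.
move=> ng; split.
- by move=> j; rewrite (ord3_big _ _ 0) /= add0r; exact: gratio_prod.
- by move=> i; exact: gratio0.
move=> rho e k; rewrite xcE -(tratioE F0 (row4 k) (col4 k) ng).1 /=.
by rewrite (funext e).
Qed.

Definition gridmx (t : 'I_3 -> 'I_3 -> F) : 'M[F]_6 :=
  \matrix_(i, j) grid t (@split 3 3 i) (@split 3 3 j).

Lemma gridmxE t k l : gridmx t (slot k) (slot l) = grid t k l.
Proof. by rewrite mxE !unsplitK. Qed.

Lemma grid_grammx t : is_triple t -> grammx (gridmx t *m 1%:M).
Proof.
move=> tt; rewrite mulmx1; have [d r c x] := grid_gram (fun i j => triple_neq0 i j tt).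
by split=> *; rewrite !gridmxE; auto.
Qed.

Lemma gram_grid t : gram (fun k => col (slot k) 1%:M) (fun k => row (slot k) (gridmx t)) = grid t.
Proof.
apply: funext => k; apply: funext => l.
by rewrite gram_mrep mulmx1 gridmxE.
Qed.

Lemma X_onto (y : 'I_4 -> F) : (coord_prod F 4).@[y] != 0 ->
  exists rho : rep_variety C, (fun k => sval (tX k) rho) =1 y.
Proof.
move=> /coord_prod_neq0 y0; have tt := trip4_triple y0; have t0 i j := triple_neq0 i j tt.
pose rho : rep_variety C := exist _ _ (mrep_rep (grid_grammx tt)).
exists rho => k; have := grid_normal t0 (trip4_0 y); rewrite -gram_grid => ng.
have [_ _ H] := tXE ng; rewrite (H rho) // gram_grid xcE gratio_grid // -?xcE ?xc_trip4 //.
by have := triple_row 0 (col4 k) tt; rewrite !add0r.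
Qed.

(** By [degeneration] an invariant can be evaluated at the representation with [M = 1] and the same
    Gram matrix, whose entries are Laurent polynomials in the coordinates. *)
Lemma X_reg (a : invariants (@Defs.conjugate F 6 _ C)) : exists (p : {mpoly F[4]}) N,
  forall rho, sval a rho * (coord_prod F 4).@[fun k => sval (tX k) rho] ^+ N =
              p.@[fun k => sval (tX k) rho].
Proof.
have [[p pE] ainv] := svalP a.
have [q [N qE]] : local (fun y : 'I_4 -> F => p.@[entry (mrep 1%:M (gridmx (trip4 y)))]).
  apply: local_mpoly => k; rewrite /entry; case: (enum_val k) => -[i b c] /=.
  have E y : mrep 1%:M (gridmx (trip4 y)) i b c =
      (1%:M : 'M[F]_6) b (slot i) * grid (trip4 y) i (@split 3 3 c).
    by rewrite /mrep /dyads mxE big_ord1 !mxE unsplitK.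
  have one x x' : local x -> local x' -> forall j, local (fun y : 'I_4 -> F => one3 (x y) (x' y) j).
    by move=> lx lx' j; rewrite /one3; case: (j == 0) => /=; [exact: local_const|case: (j == 1)].
  have oneV x x' : local (fun y => (x y)^-1) -> local (fun y => (x' y)^-1) ->
      forall j, local (fun y : 'I_4 -> F => (one3 (x y) (x' y) j)^-1).
    move=> lx lx' j; rewrite /one3; case: (j == 0) => /=; last by case: (j == 1).
    by apply: eq_local (@local_const F 4 1) => y _; rewrite invr1.
  apply: (eq_local (a := fun y => (1%:M : 'M[F]_6) b (slot i) * grid (trip4 y) i (@split 3 3 c))).
    by move=> y _; rewrite E.
  apply: localM; first exact: local_const.
  have c1 := @local_coord F 4; have cV := @local_coordV F 4.
  apply: grid_local => r s; rewrite /trip4 /rows; (case: (r == 0) => /=; [|case: (r == 1) => /=]).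
  - exact: one.
  - exact: one.
  - apply: (eq_local (a := fun y => (one3 (y 0) (y 1) s)^-1 * (one3 (y (1+1)) (y (1+1+1)) s)^-1)).
      by move=> y _; rewrite invfM.
    by apply: localM; exact: oneV.
  - exact: oneV.
  - exact: oneV.
  - apply: (eq_local (a := fun y => one3 (y 0) (y 1) s * one3 (y (1+1)) (y (1+1+1)) s)).
      by move=> y _; rewrite invrK.
    by apply: localM; exact: one.
exists q, N => rho.
have [u [b [e ng]]] := rep_normal F0 (svalP rho).
have [tt t1 tE] := tXE ng; have {}tE := tE rho e.
have [M [N' [eM eN e']]] := dyads_mrep u b.
have GE : N' *m M = gridmx (gratio (gram u b)).
  apply/matrixP => i j; rewrite -[i](@splitK 3 3) -[j](@splitK 3 3) -/(slot _) gridmxE.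
  by rewrite -(normal_grid F0 _ _ ng) -gram_mrep /gram eM eN.
have G : grammx (N' *m M) by rewrite GE -[gridmx _]mulmx1; exact: grid_grammx.
have <- : p.@[entry (mrep 1%:M (gridmx (trip4 (fun k => sval (tX k) rho))))] = sval a rho.
  rewrite (funext tE) trip4_xc // -GE -(degeneration _ G).
    by rewrite pE; congr p.@[entry _]; apply: funext => k; rewrite e e'.
  move=> M0 N0 g G0 ug.
  have G1 : grammx (N0 *m invmx g *m (g *m M0)) by rewrite mulmxA mulmxKV.
  pose r0 : rep_variety C := exist _ _ (mrep_rep G0).
  pose r1 : rep_variety C := exist _ _ (mrep_rep G1).
  rewrite -(pE r0) -(pE r1); symmetry; apply: ainv; exists g => // k.
  exact: mrep_conj.
rewrite qE // (meval_eq _ tE); apply/coord_prod_neq0 => k.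
by rewrite xcE triple_neq0.
Qed.

Lemma X_poly_reg p : regular (fun rho : rep_variety C => p.@[fun k => sval (tX k) rho]).
Proof. by apply: reg_mpoly => k; have [] := svalP (tX k). Qed.

Lemma X_g_inv : exists s : invariants (@Defs.conjugate F 6 _ C),
  forall rho, (coord_prod F 4).@[fun k => sval (tX k) rho] * sval s rho = 1.
Proof.
have [s sE] := invariants_prod (fun k => exist _ _ (tratioV_invariant C (row4 k) (col4 k))).
exists s => rho; rewrite sE coord_prodE -big_split; apply: big1 => k _ /=.
have [u [b [e ng]]] := rep_normal F0 (svalP rho).
have [E1 E2] := tratioE F0 (row4 k) (col4 k) ng.
by rewrite (funext e) E1 E2 divff // gratio_neq0.
Qed.

Definition cX : X F -> 'I_4 -> F := git_coord tX.

Lemma X_presentation : presentation cX (coord_prod F 4) set0.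
Proof.
apply: git_presentation; [exact: X_poly_reg|exact: X_g_inv|by []| |exact: X_reg].
by move=> y y0 _; exact: X_onto.
Qed.

Lemma X_eval (chi : X F) : exists rho, forall a, sval chi a = sval a rho.
Proof.
apply: (character_eval (S := set0)); [exact: X_poly_reg|exact: X_g_inv|by []| |exact: X_reg].
by move=> y y0 _; exact: X_onto.
Qed.

Lemma cX_inj (chi chi' : X F) : cX chi =1 cX chi' -> chi = chi'.
Proof.
apply: (git_coord_inj (S := set0)); [exact: X_poly_reg|exact: X_g_inv|by []| |exact: X_reg].
by move=> y y0 _; exact: X_onto.
Qed.

End ModuliX.

(** * X(3,6) as a closed subset of a torus *)

Section ModuliX36.
Variable F : closedFieldType.
Hypothesis F0 : [pchar F] =i pred0.
Local Notation C := (@X36_rep F).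
Local Notation I := ('I_3 + 'I_6)%type.

Definition row12 (k : 'I_(6 + 6)) : 'I_3 := if split k is inl _ then 0 else 1.
Definition col12 (k : 'I_(6 + 6)) : 'I_6 := match split k with inl j => j | inr j => j end.
Definition t36 (k : 'I_(6 + 6)) : invariants (@Defs.conjugate F 6 _ C) := tratio_inv C (row12 k) (col12 k).

Definition grid6 (w : 'I_(6 + 6) -> F) (i : 'I_3) (j : 'I_6) : F :=
  if i == 0 then w (lshift 6 j) else if i == 1 then w (rshift 6 j)
  else (w (lshift 6 j) * w (rshift 6 j))^-1.

Lemma grid6_trip w i j :
  grid6 w i (@lshift 3 3 j) = tripL w i j /\ grid6 w i (@rshift 3 3 j) = tripR w i j.
Proof. by []. Qed.

Lemma grid6_neq0 w i j : (forall k, w k != 0) -> grid6 w i j != 0.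
Proof. by move=> w0; rewrite /grid6; do 2?case: ifP => _; rewrite ?invr_eq0 ?mulf_neq0. Qed.

Lemma grid6_prod w j : (forall k, w k != 0) -> grid6 w 0 j * grid6 w 1 j * grid6 w (1 + 1) j = 1.
Proof. by move=> w0; rewrite /grid6 /= divff // mulf_neq0. Qed.

Lemma sum6 (h : 'I_6 -> F) : \sum_j h j = \sum_(j < 3) h (@lshift 3 3 j) + \sum_(j < 3) h (@rshift 3 3 j).
Proof. exact: (@big_split_ord _ _ _ 3 3). Qed.

Lemma in_W_sums w : (forall k, w k != 0) -> in_W w <->
  (forall i, grid6 w i 0 = 1) /\
  forall i, \sum_j grid6 w i j = 0 /\ \sum_j (grid6 w i j)^-1 = 0.
Proof.
move=> w0; rewrite in_WP //; have L0 : @lshift 3 3 0 = 0 :> 'I_6 by apply: val_inj.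
have eL i : grid6 w i 0 = tripL w i 0 by rewrite -L0.
split=> [[_ [tL tR n o]]|[n s]].
  split=> [i|i]; first by rewrite eL.
  have [o1 o2] := o i; rewrite !sum6; split.
    by rewrite -/(sum (tripL w) i) -/(sum (tripR w) i) o2 subrr.
  by rewrite -/(sumV (tripL w) i) -/(sumV (tripR w) i) o1 subrr.
split=> //; split=> [| |i|i]; try by apply: rows_triple.
  by rewrite -eL.
have [s1 s2] := s i; rewrite sum6 in s1; rewrite sum6 in s2.
by split; apply/eqP; rewrite -addr_eq0 addrC; apply/eqP.
Qed.

(** The representation in the basis given by the vectors of the [q_j]: each [q_j] becomes a diagonal
    matrix unit, and the [p_i] are read off the Gram matrix. *)
Definition split_rep (g : I -> I -> F) : I -> 'M[F]_6 :=
  dyads (fun l => \col_j g (inr j) l) (fun k => \row_j g k (inr j)).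

(** A Gram entry of [p_i] and [p_k] is a sum over the six [q_j]. For [i != k] it is, up to the
    factor 1/6, one of the sums that vanish by [in_W_sums]. *)
Lemma split_gram w : in_W w ->
  gram (fun l => \col_j grid (grid6 w) (inr j) l) (fun k => \row_j grid (grid6 w) k (inr j)) =
  grid (grid6 w).
Proof.
move=> ww; have w0 := ((in_WP w).1 ww).1; have [_ ws] := (in_W_sums w0).1 ww.
have a0 i j : acoef (grid6 w) i j != 0 by apply: acoef_neq0 => *; exact: grid6_neq0.
have aE i j : acoef (grid6 w) (i + 1) j / acoef (grid6 w) i j = grid6 w i j.
  rewrite -[RHS](@gratio_grid F 5) //; first by move=> *; exact: grid6_neq0.
  exact: grid6_prod.
apply: funext => k; apply: funext => l; rewrite /gram !mxE.
under eq_bigr => j _ do rewrite !mxE.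
case: k l => [i|j] [i'|j'].
- rewrite /=; under eq_bigr => j _ do rewrite acoefV mulrCA.
  rewrite -mulr_sumr; have [->|ii] := eqVneq i i'.
    rewrite (eq_bigr (fun=> 1)) => [|j _]; last by rewrite divff.
    by rewrite sumr_const card_ord mulVf // six_neq0.
  have [ws1 ws2] := ws i; have [ws1' ws2'] := ws i'.
  case: (ord3_cases i i') => e; first by rewrite e eqxx in ii.
    rewrite (eq_bigr (grid6 w i')) ?ws1' ?mulr0 // => j _.
    by rewrite -e aE.
  have {}e : i + 1 = i' by rewrite -e; case: (i') => [[|[|[|//]]] ?]; apply: val_inj.
  rewrite (eq_bigr (fun j => (grid6 w i j)^-1)) ?ws2 ?mulr0 // => j _.
  by rewrite -e -aE invf_div.
- by rewrite (bigD1 j') //= eqxx mulr1 big1 ?addr0 // => j /negPf->; rewrite mulr0.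
- by rewrite (bigD1 j) //= eqxx mul1r big1 ?addr0 // => l; rewrite eq_sym => /negPf->; rewrite mul0r.
- by rewrite /= (bigD1 j) //= eqxx mul1r big1 ?addr0 // => l; rewrite eq_sym => /negPf->; rewrite mul0r.
Qed.

Lemma split_repP w : in_W w -> C (split_rep (grid (grid6 w))).
Proof.
move=> ww; have w0 := ((in_WP w).1 ww).1; split.
  by apply: dyads_rep; rewrite split_gram //; apply: grid_gram => // i j; exact: grid6_neq0.
apply/matrixP => a b; rewrite summxE !mxE (bigD1 a) //= big1 ?addr0.
  by rewrite /split_rep /dyads mxE big_ord1 !mxE /= eqxx mul1r.
by move=> j /negPf ja; rewrite /split_rep /dyads mxE big_ord1 !mxE /= eq_sym ja mul0r.
Qed.

Lemma gratio_grid6 (g : I -> I -> F) : normal_gram g -> 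
  gratio g = grid6 (fun k => gratio g (row12 k) (col12 k)).
Proof.
move=> ng; apply: funext => i; apply: funext => j.
have l (k : 'I_6) : split (@lshift 6 6 k) = inl k by exact: (unsplitK (inl _)).
have r (k : 'I_6) : split (@rshift 6 6 k) = inr k by exact: (unsplitK (inr _)).
rewrite /grid6 /row12 /col12 !(l, r); move: i; apply: ord3_ind => //=.
have := gratio_prod F0 j ng; set x := gratio g 0 j; set y := gratio g 1 j => e.
have xy : x * y != 0 by rewrite mulf_neq0 ?gratio_neq0.
by apply: (mulfI xy); rewrite e divff.
Qed.

Lemma X36_normal (rho : rep_variety C) : exists u a,
  [/\ sval rho =1 dyads u a, normal_gram (gram u a),
      (fun k => sval (t36 k) rho) =1 (fun k => gratio (gram u a) (row12 k) (col12 k)) &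
      (\matrix_(i, j) u (inr j) i 0) *m (\matrix_(i, j) a (inr i) 0 j) = 1%:M].
Proof.
have [Xr sr] := svalP rho; have [u [a [e ng]]] := rep_normal F0 Xr.
exists u, a; split=> // [k|]; first by rewrite -(tratioE F0 _ _ ng).1 /= (funext e).
rewrite -[RHS]sr; apply/matrixP => i j; rewrite summxE mxE; apply: eq_bigr => k _.
by rewrite e /dyads !mxE big_ord1.
Qed.

Lemma split_gramE (u : I -> 'cV[F]_6) (a : I -> 'rV[F]_6) k l : 
  (\matrix_(i, j) u (inr j) i 0) *m (\matrix_(i, j) a (inr i) 0 j) = 1%:M ->
  \sum_j gram u a k (inr j) * gram u a (inr j) l = gram u a k l.
Proof.
move=> VB; rewrite {3}/gram -[a k]mulmx1 -VB !mulmxA -mulmxA [RHS]mxE.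
by apply: eq_bigr => j _; congr (_ * _); rewrite /gram !mxE; apply: eq_bigr => i _; rewrite !mxE.
Qed.

Lemma X36_in_W (rho : rep_variety C) : in_W (fun k => sval (t36 k) rho).
Proof.
have [u [a [e ng tE VB]]] := X36_normal rho; rewrite (funext tE).
set w := fun k => _; have w0 k : w k != 0 by exact: gratio_neq0.
apply/(in_W_sums w0); rewrite -/(grid6 w) -gratio_grid6 //.
split=> [i|i]; first exact: gratio0.
have [ig _ _] := ng; have [_ gr _ _] := ig; have ii : i + 1 != i by have [-> _ _] := ord3_neq i.
have s k l : \sum_j gram u a (inl k) (inr j) / gram u a (inl l) (inr j) = 6%:R * gram u a (inl k) (inl l).
  rewrite -(split_gramE _ _ VB) mulr_sumr; apply: eq_bigr => j _.
  by rewrite (g_crossV F0) // invfM mulrCA mulVKf // six_neq0.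
split; first by rewrite s gr // mulr0.
transitivity (\sum_j gram u a (inl i) (inr j) / gram u a (inl (i + 1)) (inr j)).
  by apply: eq_bigr => j _; rewrite /gratio invf_div.
by rewrite s gr ?mulr0 // eq_sym.
Qed.

Lemma X36_onto w : in_W w -> exists rho : rep_variety C, (fun k => sval (t36 k) rho) =1 w.
Proof.
move=> ww; have w0 := ((in_WP w).1 ww).1; have [w1 _] := (in_W_sums w0).1 ww.
have := grid_normal (fun i j => grid6_neq0 i j w0) w1; rewrite -split_gram // => ng.
exists (exist _ _ (split_repP ww)) => k /=.
have E := (tratioE F0 (row12 k) (col12 k) ng).1; rewrite split_gram // in E.
rewrite [LHS]E gratio_grid; last exact: grid6_prod.
  by rewrite /grid6 /row12 /col12; case: split_ordP => j ->.
by move=> i j; exact: grid6_neq0.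
Qed.

(** Each representation is conjugate to its [split_rep], through the matrix [B] whose rows are the
    covectors of the [q_j]. *)
Lemma X36_reg (a : invariants (@Defs.conjugate F 6 _ C)) : exists (p : {mpoly F[6 + 6]}) N,
  forall rho, sval a rho * (wg F).@[fun k => sval (t36 k) rho] ^+ N =
              p.@[fun k => sval (t36 k) rho].
Proof.
have [[p pE] ainv] := svalP a.
have [q [N qE]] : local (fun w : 'I_(6 + 6) -> F => p.@[entry (split_rep (grid (grid6 w)))]).
  apply: local_mpoly => k; rewrite /entry; case: (enum_val k) => -[i b c] /=.
  have lg k1 k2 : local (fun w => grid (grid6 w) k1 k2).
    have c1 := @local_coord F (6 + 6); have cV := @local_coordV F (6 + 6).
    apply: grid_local => r s; rewrite /grid6; (case: (r == 0) => /=; [|case: (r == 1) => /=]) => //.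
      apply: (eq_local (a := fun y => (y (lshift 6 s))^-1 * (y (rshift 6 s))^-1)).
        by move=> y _; rewrite invfM.
      exact: localM.
    apply: (eq_local (a := fun y => y (lshift 6 s) * y (rshift 6 s))).
      by move=> y _; rewrite invrK.
    exact: localM.
  apply: eq_local (localM (lg (inr b) i) (lg i (inr c))) => w _.
  by rewrite /split_rep /dyads mxE big_ord1 !mxE.
exists q, N => rho; have ww := X36_in_W rho; rewrite -qE; last by case: ww.
congr (_ * _); have [u [b [e ng tE VB]]] := X36_normal rho.
pose rho' : rep_variety C := exist _ _ (split_repP ww).
rewrite -(pE rho'); apply: ainv.
set V := \matrix_(i, j) u (inr j) i 0 in VB; set B := \matrix_(i, j) b (inr i) 0 j in VB.
have [uV uB] := mulmx1_unit VB; have BV : invmx B = V by rewrite -[V]mulmx1 -(mulmxV uB) mulmxA VB mul1mx.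
exists B => // k; rewrite BV e /rho' /= (funext tE) -gratio_grid6 //.
have -> : grid (gratio (gram u b)) = gram u b.
  by apply: funext => k1; apply: funext => k2; rewrite -(normal_grid F0 _ _ ng).
rewrite /dyads !mulmxA -mulmxA; congr (_ *m _).
  by apply/colP => j; rewrite /gram !mxE; apply: eq_bigr => i _; rewrite !mxE.
by apply/rowP => j; rewrite /gram !mxE; apply: eq_bigr => i _; rewrite !mxE.
Qed.

Lemma X36_poly_reg p : regular (fun rho : rep_variety C => p.@[fun k => sval (t36 k) rho]).
Proof. by apply: reg_mpoly => k; have [] := svalP (t36 k). Qed.

Lemma X36_g_inv : exists s : invariants (@Defs.conjugate F 6 _ C),
  forall rho, (wg F).@[fun k => sval (t36 k) rho] * sval s rho = 1.
Proof.
have [s sE] := invariants_prod (fun k => exist _ _ (tratioV_invariant C (row12 k) (col12 k))).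
exists s => rho; rewrite sE [(wg F).@[_]]coord_prodE -big_split; apply: big1 => k _ /=.
have [u [b [e ng tE _]]] := X36_normal rho.
have [E1 E2] := tratioE F0 (row12 k) (col12 k) ng.
by rewrite (funext e) E1 E2 divff // gratio_neq0.
Qed.

Definition c36 : X36 F -> 'I_(6 + 6) -> F := git_coord t36.
Definition S36 : set {mpoly F[6 + 6]} := [set p | exists i, p = weq F i]%classic.

Lemma S36P w : (wg F).@[w] != 0 -> (forall p, S36 p -> p.@[w] = 0) <-> in_W w.
Proof.
move=> g0; split=> [H|[_ H] _ [i ->]] //; split=> // i; apply: H; by exists i.
Qed.

Lemma X36_S_zero (rho : rep_variety C) p : S36 p -> p.@[fun k => sval (t36 k) rho] = 0.
Proof. by case=> i ->; have [_] := X36_in_W rho; exact. Qed.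

Lemma X36_S_onto y : (wg F).@[y] != 0 -> (forall p, S36 p -> p.@[y] = 0) ->
  exists rho : rep_variety C, (fun k => sval (t36 k) rho) =1 y.
Proof. by move=> g0 /(S36P g0); exact: X36_onto. Qed.

Lemma X36_presentation : presentation c36 (wg F) S36.
Proof.
exact: (git_presentation X36_poly_reg X36_g_inv X36_S_zero X36_S_onto X36_reg).
Qed.

Lemma X36_eval (chi : X36 F) : exists rho, forall a, sval chi a = sval a rho.
Proof.
exact: (character_eval X36_poly_reg X36_g_inv X36_S_zero X36_S_onto X36_reg).
Qed.

Lemma c36_inj (chi chi' : X36 F) : c36 chi =1 c36 chi' -> chi = chi'.
Proof.
exact: (git_coord_inj X36_poly_reg X36_g_inv X36_S_zero X36_S_onto X36_reg).
Qed.

End ModuliX36.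

(** * The fiber product *)

Section HalfPolynomials.
Variable R : comNzRingType.

Definition inL (p : {mpoly R[4]}) : {mpoly R[4 + 4]} := p \mPo [tuple 'X_(lshift 4 i) | i < 4].
Definition inR (p : {mpoly R[4]}) : {mpoly R[4 + 4]} := p \mPo [tuple 'X_(rshift 4 i) | i < 4].

Lemma inLE p c : (inL p).@[c] = p.@[fun i => c (lshift 4 i)].
Proof. by rewrite comp_mpoly_meval; apply: meval_eq => i; rewrite tnth_mktuple mevalXU. Qed.

Lemma inRE p c : (inR p).@[c] = p.@[fun i => c (rshift 4 i)].
Proof. by rewrite comp_mpoly_meval; apply: meval_eq => i; rewrite tnth_mktuple mevalXU. Qed.

End HalfPolynomials.

(** * The effect of the involution on traces *)

Section CyclicTraces.
Variable F : closedFieldType.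
Hypothesis F0 : [pchar F] =i pred0.
Local Notation I := ('I_3 + 'I_3)%type.
Variables (u : I -> 'cV[F]_6) (a : I -> 'rV[F]_6).
Hypothesis ng : normal_gram (gram u a).
Let T := gratio (gram u a).
Let d := dyads u a.
Let Q := \sum_j d (inr j).

(** The scalar [a k *m Q *m u l]. *)
Definition w2 k l := \sum_j gram u a k (inr j) * gram u a (inr j) l.

Lemma w2_next i : w2 (inl i) (inl (i + 1)) = 6%:R^-1 * sumV T i /\
  w2 (inl (i + 1)) (inl i) = 6%:R^-1 * sum T i.
Proof.
have [ig _ _] := ng; split; rewrite mulr_sumr; apply: eq_bigr => j _.
  by rewrite (g_crossV F0) // /T /gratio invf_div invfM mulrCA.
by rewrite (g_crossV F0) // /T /gratio invfM mulrCA.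
Qed.

Lemma dyad_Q k' k l x : x *: (u k' *m a k) *m Q *m d l = (x * w2 k l) *: (u k' *m a l).
Proof.
rewrite /Q mulmx_sumr mulmx_suml /w2 mulr_sumr scaler_suml; apply: eq_bigr => j _.
by rewrite !mul_dyad mulrA.
Qed.

(** Between orthogonal idempotents, replacing [Q] by [1 - Q] changes the sign only. Traces in which
    this happens twice are unchanged, and those in which it happens three times change sign. *)
Lemma dyad_Q' k' k l x : gram u a k l = 0 ->
  x *: (u k' *m a k) *m (1 - Q) *m d l = (- (x * w2 k l)) *: (u k' *m a l).
Proof.
move=> g0; rewrite mulmxBr mulmx1 mulmxBl dyad_Q mul_dyad g0 mulr0 scale0r sub0r.
by rewrite scaleNr.
Qed.

Let trE k x : \tr (x *: (u k *m a k)) = x.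
Proof. by have [[gd _ _ _] _ _] := ng; rewrite tr_dyad gd mulr1. Qed.

Lemma tr_walk2 (B : 'M[F]_6) e (eE : B = if e then 1 - Q else Q) i :
  \tr (d (inl (i + 1)) *m B *m d (inl i) *m B *m d (inl (i + 1))) = 36%:R^-1 * invA T i.
Proof.
have [ig _ _] := ng; have [_ gr _ _] := ig; have [n _ _] := ord3_neq i.
have g1 : gram u a (inl (i + 1)) (inl i) = 0 by apply: gr; rewrite n.
have g2 : gram u a (inl i) (inl (i + 1)) = 0 by apply: gr; rewrite eq_sym n.
have [e1 e2] := w2_next i; have E36 : 36%:R = 6%:R * 6%:R :> F by rewrite -natrM.
have s := six_neq0 F0; transitivity (w2 (inl (i + 1)) (inl i) * w2 (inl i) (inl (i + 1))).
  rewrite {1}/d [dyads _ _ (inl (i + 1))]dyadE eE; case: e {eE}.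
    by rewrite dyad_Q' // dyad_Q' // trE; ring.
  by rewrite !dyad_Q trE; ring.
rewrite e1 e2 E36 /invA; move: s; move: (6%:R : F) => x x0; field; exact: x0.
Qed.

Lemma tr_walk3 (B : 'M[F]_6) e (eE : B = if e then 1 - Q else Q) :
  \tr (d (inl 0) *m B *m d (inl 1) *m B *m d (inl (1 + 1)) *m B *m d (inl 0)) =
    (-1) ^+ e * 216%:R^-1 * invD T /\
  \tr (d (inl 0) *m B *m d (inl (1 + 1)) *m B *m d (inl 1) *m B *m d (inl 0)) =
    (-1) ^+ e * 216%:R^-1 * invE T.
Proof.
have [ig _ _] := ng; have [_ gr _ _] := ig.
have g1 (i k : 'I_3) : i != k -> gram u a (inl i) (inl k) = 0 by apply: gr.
have [e01 e10] := w2_next 0; have [e12 e21] := w2_next 1; have [e20 e02] := w2_next (1 + 1).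
have z3 : (1 + 1 + 1 : 'I_3) = 0 by exact: val_inj.
rewrite add0r in e01 e10; rewrite z3 in e20 e02.
have E216 : 216%:R = 6%:R * 6%:R * 6%:R :> F by rewrite -!natrM.
have s := six_neq0 F0; rewrite {1 5}/d [dyads _ _ (inl 0)]dyadE eE /invD /invE !(ord3_big _ _ 0) /= !add0r E216.
case: e {eE}.
  split.
    rewrite dyad_Q' ?g1 // dyad_Q' ?g1 // dyad_Q' ?g1 // trE e01 e12 e20.
    by rewrite expr1; move: s; move: (6%:R : F) => x x0; field; exact: x0.
  rewrite dyad_Q' ?g1 // dyad_Q' ?g1 // dyad_Q' ?g1 // trE e02 e21 e10.
  by rewrite expr1; move: s; move: (6%:R : F) => x x0; field; exact: x0.
split; rewrite !dyad_Q trE ?e01 ?e12 ?e20 ?e02 ?e21 ?e10 expr0;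
  move: s; move: (6%:R : F) => x x0; field; exact: x0.
Qed.

End CyclicTraces.

Section FiberProduct.
Variable F : closedFieldType.
Hypothesis F0 : [pchar F] =i pred0.
Local Notation CX := (@X_rep F 3).
Local Notation CY := (@Y_rep F).
Local Notation tv rho := (fun k => sval (tX F k) rho).
Local Notation g4 := (coord_prod F 4).
Local Notation g8 := (coord_prod F (4 + 4)).

Definition cXYX (z : XYX F0) (i : 'I_(4 + 4)) : F :=
  match split i with inl k => cX (sval z).1 k | inr k => cX (sval z).2 k end.

Definition expands (b : rep_variety CX -> F) (p : {mpoly F[4]}) N :=
  forall rho, b rho * g4.@[tv rho] ^+ N = p.@[tv rho].

(** The equality of the two images in [Y], tested on each invariant [b] of [Y] and cleared of
    denominators. *)
Definition gluing (p : {mpoly F[4 + 4]}) :=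
  exists (b : invariants (@Defs.conjugate F 6 _ CY)) p1 N1 p2 N2,
    [/\ expands (fun rho => sval b (fprime_rep F0 rho)) p1 N1,
        expands (fun rho => sval b (sigma_rep F0 (fprime_rep F0 rho))) p2 N2 &
        p = inL p1 * inR (g4 ^+ N2) - inR p2 * inL (g4 ^+ N1)].

Lemma gluing_exists (b : invariants (@Defs.conjugate F 6 _ CY)) : exists p1 N1 p2 N2,
  expands (fun rho => sval b (fprime_rep F0 rho)) p1 N1 /\
  expands (fun rho => sval b (sigma_rep F0 (fprime_rep F0 rho))) p2 N2.
Proof.
have [p1 [N1 H1]] := X_reg F0 (pullback (fprime_equivariant F0) b).
have [p2 [N2 H2]] := X_reg F0 (pullback (fprime_equivariant F0) (pullback (sigma_equivariant F0) b)).
by exists p1, N1, p2, N2.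
Qed.

Lemma gluingE (b : invariants (@Defs.conjugate F 6 _ CY)) p1 N1 p2 N2 rho1 rho2 (c : 'I_(4 + 4) -> F) :
  expands (fun rho => sval b (fprime_rep F0 rho)) p1 N1 ->
  expands (fun rho => sval b (sigma_rep F0 (fprime_rep F0 rho))) p2 N2 ->
  (fun i => c (lshift 4 i)) =1 tv rho1 -> (fun i => c (rshift 4 i)) =1 tv rho2 ->
  (inL p1 * inR (g4 ^+ N2) - inR p2 * inL (g4 ^+ N1)).@[c] =
  (sval b (fprime_rep F0 rho1) - sval b (sigma_rep F0 (fprime_rep F0 rho2))) *
    (g4.@[tv rho1] ^+ N1 * g4.@[tv rho2] ^+ N2).
Proof.
move=> H1 H2 e1 e2; rewrite mevalB !mevalM !inLE !inRE !rmorphXn /=.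
rewrite !(meval_eq _ e1) !(meval_eq _ e2) -H1 -H2; ring.
Qed.

Lemma g4_neq0 rho : g4.@[tv rho] != 0.
Proof.
have [s sE] := X_g_inv F0; apply: contra_eq_neq (sE rho) => ->.
by rewrite mul0r eq_sym oner_eq0.
Qed.

Lemma cXYXE z : (fun i => cXYX z (lshift 4 i)) =1 cX (sval z).1 /\
  (fun i => cXYX z (rshift 4 i)) =1 cX (sval z).2.
Proof.
by split=> i; rewrite /cXYX ?(unsplitK (inl _) : split (lshift _ _) = _) ?(unsplitK (inr _) : split (rshift _ _) = _).
Qed.

Lemma XYX_eval (z : XYX F0) : exists rho1 rho2,
  [/\ forall a : invariants (@Defs.conjugate F 6 _ CX), sval (sval z).1 a = sval a rho1,
    forall a : invariants (@Defs.conjugate F 6 _ CX), sval (sval z).2 a = sval a rho2,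
    (fun i => cXYX z (lshift 4 i)) =1 tv rho1, (fun i => cXYX z (rshift 4 i)) =1 tv rho2 &
    forall b : invariants (@Defs.conjugate F 6 _ CY), sval b (fprime_rep F0 rho1) = sval b (sigma_rep F0 (fprime_rep F0 rho2))].
Proof.
have [e1 e2] := cXYXE z; move: z e1 e2 => [[x1 x2] /= e] e1 e2.
have [rho1 H1] := X_eval F0 x1; have [rho2 H2] := X_eval F0 x2.
exists rho1, rho2; split=> // [i|i|b].
- by rewrite e1 /cX /git_coord H1.
- by rewrite e2 /cX /git_coord H2.
have := congr1 (fun y => sval y b) e; rewrite /fprime /sigma /git_map /=.
by rewrite H1 H2.
Qed.

Lemma XYX_product_regular (p : {mpoly F[4 + 4]}) : regular (fun z => p.@[cXYX z]).
Proof.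
pose q1 (mm : 'X_{1..4 + 4}) : {mpoly F[4]} := p@_mm *: \prod_(i < 4) 'X_i ^+ mm (lshift 4 i).
pose q2 (mm : 'X_{1..4 + 4}) : {mpoly F[4]} := \prod_(i < 4) 'X_i ^+ mm (rshift 4 i).
pose s := in_tuple (msupp p).
exists (fun x : product (X F) (X F) => \sum_(i < size (msupp p))
   (q1 (tnth s i)).@[cX x.1] * (q2 (tnth s i)).@[cX x.2]).
  exists (size (msupp p)), (fun i x => (q1 (tnth s i)).@[cX x]), (fun i x => (q2 (tnth s i)).@[cX x]).
  by split=> // i; exact: (pres_poly (X_presentation F0)).
move=> z; rewrite mevalE (big_tnth _ _ (msupp p)); apply: eq_bigr => i _.
rewrite big_split_ord /= /q1 /q2 mevalZ !rmorph_prod /= -mulrA; congr (_ * (_ * _)).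
  by apply: eq_bigr => k _; rewrite rmorphXn /= mevalXU (cXYXE z).1.
by apply: eq_bigr => k _; rewrite rmorphXn /= mevalXU (cXYXE z).2.
Qed.

Lemma g8E (z : XYX F0) : g8.@[cXYX z] = g4.@[cX (sval z).1] * g4.@[cX (sval z).2].
Proof.
by rewrite !coord_prodE big_split_ord /=; congr (_ * _); apply: eq_bigr => i _;
  rewrite ?(cXYXE z).1 ?(cXYXE z).2.
Qed.

Lemma XYX_regular_clear (f : XYX F0 -> F) : regular f ->
  exists (p : {mpoly F[4 + 4]}) N, forall z, f z * g8.@[cXYX z] ^+ N = p.@[cXYX z].
Proof.
move=> [f' [m [a [b [ra rb f'E]]]] fE].
pose Q (h : XYX F0 -> F) := exists (p : {mpoly F[4 + 4]}) N,
  forall z, h z * g8.@[cXYX z] ^+ N = p.@[cXYX z].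
have QD h h' : Q h -> Q h' -> Q (fun z => h z + h' z).
  move=> [p [N H]] [q [M H']]; exists (p * g8 ^+ M + q * g8 ^+ N), (N + M)%N => z.
  by rewrite mevalD !mevalM !rmorphXn /= -H -H' exprD; ring.
have QM h h' : Q h -> Q h' -> Q (fun z => h z * h' z).
  move=> [p [N H]] [q [M H']]; exists (p * q), (N + M)%N => z.
  by rewrite mevalM -H -H' exprD; ring.
have Q1 h : regular h -> Q (fun z => h (sval z).1).
  move=> /(pres_reg (X_presentation F0))[p [N pE]]; exists (inL p * inR (g4 ^+ N)), N => z.
  rewrite mevalM inLE inRE rmorphXn /= (meval_eq _ (cXYXE z).1) (meval_eq _ (cXYXE z).2).
  by rewrite -pE g8E exprMn mulrA.
have Q2 h : regular h -> Q (fun z => h (sval z).2).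
  move=> /(pres_reg (X_presentation F0))[p [N pE]]; exists (inR p * inL (g4 ^+ N)), N => z.
  rewrite mevalM inLE inRE rmorphXn /= (meval_eq _ (cXYXE z).1) (meval_eq _ (cXYXE z).2).
  by rewrite -pE g8E exprMn; ring.
have : Q (fun z => \sum_(i < m) a i (sval z).1 * b i (sval z).2).
  elim: m a b ra rb {f'E} => [|m IH] a b ra rb.
    by exists 0, 0%N => z; rewrite big_ord0 mul0r meval0.
  have [p [N H]] := QD _ _ (QM _ _ (Q1 _ (ra ord0)) (Q2 _ (rb ord0)))
    (IH _ _ (fun i => ra (lift ord0 i)) (fun i => rb (lift ord0 i))).
  by exists p, N => z; rewrite -H big_ord_recl.
by move=> [p [N H]]; exists p, N => z; rewrite -H fE f'E.
Qed.

Lemma XYX_presentation : presentation cXYX g8 gluing.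
Proof.
split.
- by move=> z; rewrite g8E mulf_neq0 //; apply: (pres_g (X_presentation F0)).
- move=> z p [b [p1 [N1 [p2 [N2 [H1 H2 ->]]]]]].
  have [rho1 [rho2 [_ _ e1 e2 eb]]] := XYX_eval z.
  by rewrite (gluingE H1 H2 e1 e2) eb subrr mul0r.
- move=> y /coord_prod_neq0 y0 Sy.
  have [|rho1 r1] := X_onto F0 (y := fun i => y (lshift 4 i)).
    by apply/coord_prod_neq0 => i; exact: y0.
  have [|rho2 r2] := X_onto F0 (y := fun i => y (rshift 4 i)).
    by apply/coord_prod_neq0 => i; exact: y0.
  pose x1 : X F := eval_point (@Defs.conjugate F 6 _ CX) rho1.
  pose x2 : X F := eval_point (@Defs.conjugate F 6 _ CX) rho2.
  have E : fprime F0 x1 = sigma F0 (fprime F0 x2).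
    apply: eq_exist; apply: funext => b /=.
    have [p1 [N1 [p2 [N2 [H1 H2]]]]] := gluing_exists b.
    have /Sy : gluing (inL p1 * inR (g4 ^+ N2) - inR p2 * inL (g4 ^+ N1)) by exists b, p1, N1, p2, N2.
    rewrite (gluingE H1 H2 (fun i => esym (r1 i)) (fun i => esym (r2 i))) => /eqP.
    by rewrite mulf_eq0 mulf_eq0 !expf_eq0 !(negPf (g4_neq0 _)) !andbF !orbF subr_eq0 => /eqP.
  exists (exist _ (x1, x2) E) => i.
  rewrite /cXYX; case: split_ordP => k -> /=; first exact: (r1 k).
  exact: (r2 k).
- exact: XYX_product_regular.
- exact: XYX_regular_clear.
Qed.

Lemma cXYX_inj z z' : cXYX z =1 cXYX z' -> z = z'.
Proof.
move=> e; have [e1 e2] := cXYXE z; have [e1' e2'] := cXYXE z'.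
have E1 : (sval z).1 = (sval z').1 by apply: (cX_inj F0) => i; rewrite -e1 -e1' e.
have E2 : (sval z).2 = (sval z').2 by apply: (cX_inj F0) => i; rewrite -e2 -e2' e.
move: z z' E1 E2 {e e1 e2 e1' e2'} => [[x1 x2] p] [[x1' x2'] p'] /= E1 E2.
by apply: eq_exist; rewrite /= E1 E2.
Qed.

Lemma tX_trip (rho : rep_variety CX) : exists u a,
  [/\ sval rho =1 dyads u a, normal_gram (gram u a) & trip4 (tv rho) = gratio (gram u a)].
Proof.
have [u [a [e ng]]] := rep_normal F0 (svalP rho); exists u, a; split=> //.
by have [tt t1 tE] := tXE F0 ng; rewrite (funext (tE rho e)) trip4_xc.
Qed.

Lemma XYX_matched (z : XYX F0) :
  matched (trip4 (fun i => cXYX z (lshift 4 i))) (trip4 (fun i => cXYX z (rshift 4 i))).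
Proof.
have [rho1 [rho2 [_ _ e1 e2 eb]]] := XYX_eval z; rewrite (funext e1) (funext e2).
have [u1 [a1 [E1 n1 ->]]] := tX_trip rho1; have [u2 [a2 [E2 n2 ->]]] := tX_trip rho2.
pose q i (rho : rep_variety CY) := sval rho (Some i); pose P (rho : rep_variety CY) := sval rho None.
have eq_ i : equi (q i) := equi_gen CY (Some i); have eP : equi P := equi_gen CY None.
have ev (A : rep_variety CY -> 'M[F]_6) : equi A ->
    \tr (A (fprime_rep F0 rho1)) = \tr (A (sigma_rep F0 (fprime_rep F0 rho2))).
  by move=> /(tr_equi 1) H; have := eb (exist _ _ H); rewrite /= !mul1r.
have f1 i : sval (fprime_rep F0 rho1) (Some i) = dyads u1 a1 (inl i) by exact: E1.
have f2 i : sval (sigma_rep F0 (fprime_rep F0 rho2)) (Some i) = dyads u2 a2 (inl i) by exact: E2.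
have P1 : sval (fprime_rep F0 rho1) None = \sum_j dyads u1 a1 (inr j).
  by apply: eq_bigr => j _; exact: E1.
have P2 : sval (sigma_rep F0 (fprime_rep F0 rho2)) None = 1 - \sum_j dyads u2 a2 (inr j).
  by rewrite /=; congr (_ - _); apply: eq_bigr => j _; exact: E2.
have nz k : k.+1%:R != 0 :> F by have /pcharf0P -> := F0.
have sgn (x y : F) : (-1) ^+ false * 216%:R^-1 * x = (-1) ^+ true * 216%:R^-1 * y -> y = - x.
  rewrite expr0 expr1 mul1r mulN1r mulNr => e; apply: (mulfI (invr_neq0 (nz 215))).
  by rewrite mulrN e opprK.
split.
- move=> i; have := ev (fun rho => q (i + 1) rho *m P rho *m q i rho *m P rho *m q (i + 1) rho).
  rewrite /q /P !f1 !f2 P1 P2 (tr_walk2 F0 n1 (e := false)) // (tr_walk2 F0 n2 (e := true)) //.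
  move=> H; apply/esym/(mulfI (invr_neq0 (nz 35))); apply: H.
  by do 4?apply: equiM; try exact: eP; exact: eq_.
- have := ev (fun rho => q 0 rho *m P rho *m q 1 rho *m P rho *m q (1 + 1) rho *m P rho *m q 0 rho).
  rewrite /q /P !f1 !f2 P1 P2 (tr_walk3 F0 n1 (e := false) erefl).1 // (tr_walk3 F0 n2 (e := true) erefl).1 //.
  by move=> H; apply/sgn/H; do 6?apply: equiM; try exact: eP; exact: eq_.
- have := ev (fun rho => q 0 rho *m P rho *m q (1 + 1) rho *m P rho *m q 1 rho *m P rho *m q 0 rho).
  rewrite /q /P !f1 !f2 P1 P2 (tr_walk3 F0 n1 (e := false) erefl).2 // (tr_walk3 F0 n2 (e := true) erefl).2 //.
  by move=> H; apply/sgn/H; do 6?apply: equiM; try exact: eP; exact: eq_.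
Qed.

End FiberProduct.

(** * The main component *)

Section Clearable.
Variables (F : closedFieldType) (n : nat).

(** The quantification over fields makes one polynomial clear the denominators both at the
    [F]-points and at generic points. *)
Definition family := forall K : fieldType, {rmorphism F -> K} -> ('I_n -> K) -> K.
Implicit Types A B : family.

Definition clearable A := exists (p : {mpoly F[n]}) N,
  forall (K : fieldType) (f : {rmorphism F -> K}) z, (forall i, z i != 0) ->
    A K f z * (\prod_i z i) ^+ N = mmap f z p.

Lemma eq_cl A B : (forall K f z, A K f z = B K f z) -> clearable A -> clearable B.
Proof. by move=> e [p [N H]]; exists p, N => K f z z0; rewrite -e H. Qed.

Lemma cl_const c : clearable (fun K f z => f c).
Proof. by exists c%:MP, 0%N => K f z _; rewrite expr0 mulr1 mmapC. Qed.

Lemma cl_coord i : clearable (fun K f z => z i).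
Proof. by exists 'X_i, 0%N => K f z _; rewrite expr0 mulr1 mmapX mmap1U. Qed.

Lemma cl_coordV i : clearable (fun K f z => (z i)^-1).
Proof.
exists (\prod_(j | j != i) 'X_j), 1%N => K f z z0.
rewrite expr1 (bigD1 i) //= mulKf // rmorph_prod.
by apply: eq_bigr => j _; rewrite /= mmapX mmap1U.
Qed.

Lemma mmap_coord_prod (K : fieldType) (f : {rmorphism F -> K}) z :
  mmap f z (coord_prod F n) = \prod_i z i.
Proof. by rewrite rmorph_prod; apply: eq_bigr => i _; rewrite /= mmapX mmap1U. Qed.

Lemma clD A B : clearable A -> clearable B -> clearable (fun K f z => A K f z + B K f z).
Proof.
move=> [p [N H]] [q [M H']]; exists (p * coord_prod F n ^+ M + q * coord_prod F n ^+ N), (N + M)%N.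
move=> K f z z0; rewrite rmorphD !rmorphM !rmorphXn /= mmap_coord_prod -H // -H' // exprD; ring.
Qed.

Lemma clM A B : clearable A -> clearable B -> clearable (fun K f z => A K f z * B K f z).
Proof.
move=> [p [N H]] [q [M H']]; exists (p * q), (N + M)%N => K f z z0.
by rewrite rmorphM /= -H // -H' // exprD; ring.
Qed.

Lemma cl_sum (J : Type) (r : seq J) (A : J -> family) : (forall j, clearable (A j)) ->
  clearable (fun K f z => \sum_(j <- r) A j K f z).
Proof.
move=> cA; elim: r => [|j r IH].
  by apply: eq_cl (cl_const 0) => K f z; rewrite big_nil rmorph0.
by apply: eq_cl (clD (cA j) IH) => K f z; rewrite big_cons.
Qed.

Lemma cl_prod (J : Type) (r : seq J) (A : J -> family) : (forall j, clearable (A j)) ->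
  clearable (fun K f z => \prod_(j <- r) A j K f z).
Proof.
move=> cA; elim: r => [|j r IH].
  by apply: eq_cl (cl_const 1) => K f z; rewrite big_nil rmorph1.
by apply: eq_cl (clM (cA j) IH) => K f z; rewrite big_cons.
Qed.

Lemma clX A k : clearable A -> clearable (fun K f z => A K f z ^+ k).
Proof.
move=> cA; elim: k => [|k IH]; first by apply: eq_cl (cl_const 1) => K f z; rewrite rmorph1.
by apply: eq_cl (clM cA IH) => K f z; rewrite exprS.
Qed.

Lemma cl_mpoly m (A : 'I_m -> family) p : (forall i, clearable (A i)) ->
  clearable (fun K f z => mmap f (fun i => A i K f z) p).
Proof.
move=> cA; have H := cl_sum (msupp p) (fun k => clM (cl_const p@_k)
  (cl_prod (index_enum _) (fun i => clX (k i) (cA i)))).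
by apply: eq_cl H.
Qed.

Definition clearable_triple
    (T : forall K : fieldType, {rmorphism F -> K} -> ('I_n -> K) -> 'I_3 -> 'I_3 -> K) :=
  forall i j, clearable (fun K f z => T K f z i j) /\ clearable (fun K f z => (T K f z i j)^-1).

Lemma cl_rows (G H : 'I_3 -> family) :
  (forall j, clearable (G j)) -> (forall j, clearable (fun K f z => (G j K f z)^-1)) ->
  (forall j, clearable (H j)) -> (forall j, clearable (fun K f z => (H j K f z)^-1)) ->
  clearable_triple (fun K f z => rows (fun j => G j K f z) (fun j => H j K f z)).
Proof.
move=> cG cGV cH cHV i j; rewrite /rows; case: (i == 0) => //=; case: (i == 1) => //=.
split.
  by apply: eq_cl (clM (cGV j) (cHV j)) => K f z; rewrite invfM.
by apply: eq_cl (clM (cG j) (cH j)) => K f z; rewrite invrK.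
Qed.

Lemma cl_invA T i : clearable_triple T -> clearable (fun K f z => invA (T K f z) i).
Proof. by move=> cT; apply: clM; apply: cl_sum => j; have [] := cT i j. Qed.

Lemma cl_trip4 (s : 'I_4 -> 'I_n) : clearable_triple (fun K f z => trip4 (fun i => z (s i))).
Proof.
have c1 i j k : clearable (fun K f z => one3 (z i) (z j) k).
  rewrite /one3; case: (k == 0) => /=.
    by apply: eq_cl (cl_const 1) => K f z; rewrite rmorph1.
  by case: (k == 1) => /=; exact: cl_coord.
have cV i j k : clearable (fun K f z => (one3 (z i) (z j) k)^-1).
  rewrite /one3; case: (k == 0) => /=.
    by apply: eq_cl (cl_const 1) => K f z; rewrite rmorph1 invr1.
  by case: (k == 1) => /=; exact: cl_coordV.
exact: (@cl_rows (fun j K f z => one3 (z (s 0)) (z (s 1)) j)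
  (fun j K f z => one3 (z (s (1 + 1))) (z (s (1 + 1 + 1))) j)).
Qed.

Lemma frac_clearable (V : variety F) (c : V -> 'I_n -> F) U A :
  (forall x i, c x i != 0) -> clearable A -> fractional c U (fun x => A F idfun (c x)).
Proof.
move=> c0 [p [N H]]; exists p, (coord_prod F n ^+ N) => x _.
have g0 : (coord_prod F n).@[c x] != 0 by apply/coord_prod_neq0.
rewrite rmorphXn /= expf_neq0 //; split=> //.
have -> : p.@[c x] = A F idfun (c x) * (\prod_i c x i) ^+ N by rewrite (H F idfun).
by rewrite coord_prodE mulfK // expf_neq0 // -coord_prodE.
Qed.

End Clearable.

Section Pairs.

Definition pair_coords (K : Type) (T S : 'I_4 -> K) (i : 'I_(4 + 4)) : K :=
  match split i with inl k => T k | inr k => S k end.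

(** The coordinates of the image under [h], by [cXYX_h]: the second half has to be renormalised
    along its first column. *)
Definition image_coords (K : fieldType) (w : 'I_(6 + 6) -> K) : 'I_(4 + 4) -> K :=
  pair_coords (xc (tripL w)) (xc (colratio (tripR w))).

Lemma pair_coordsL (K : Type) (T S : 'I_4 -> K) k : pair_coords T S (lshift 4 k) = T k.
Proof. by rewrite /pair_coords (unsplitK (inl _) : split (lshift _ _) = _). Qed.

Lemma pair_coordsR (K : Type) (T S : 'I_4 -> K) k : pair_coords T S (rshift 4 k) = S k.
Proof. by rewrite /pair_coords (unsplitK (inr _) : split (rshift _ _) = _). Qed.

Lemma pair_coordsE (K : Type) (z : 'I_(4 + 4) -> K) :
  pair_coords (fun i => z (lshift 4 i)) (fun i => z (rshift 4 i)) =1 z.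
Proof. by move=> i; rewrite /pair_coords; case: split_ordP => k ->. Qed.

Lemma cl_tripL (F : closedFieldType) : clearable_triple (fun (K : fieldType) (f : {rmorphism F -> K}) z => tripL z).
Proof. by apply: (@cl_rows F) => j; first [exact: cl_coord|exact: cl_coordV]. Qed.

Lemma cl_tripR (F : closedFieldType) : clearable_triple (fun (K : fieldType) (f : {rmorphism F -> K}) z => tripR z).
Proof. by apply: (@cl_rows F) => j; first [exact: cl_coord|exact: cl_coordV]. Qed.

Lemma cl_image (F : closedFieldType) i :
  clearable (fun (K : fieldType) (f : {rmorphism F -> K}) z => image_coords z i).
Proof.
rewrite /image_coords /pair_coords; case: split => k.
  by apply: eq_cl (cl_tripL F (row4 k) (col4 k)).1 => K f z; rewrite xcE.
have [c _] := cl_tripR F (row4 k) (col4 k); have [_ c0] := cl_tripR F (row4 k) 0.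
by apply: eq_cl (clM c0 c) => K f z; rewrite xcE.
Qed.

End Pairs.

Section Generic.
Variable F : closedFieldType.
Hypothesis F0 : [pchar F] =i pred0.

Lemma c36_W (x : X36 F) : in_W (c36 x).
Proof.
have P := X36_presentation F0; apply/(S36P (pres_g P x)) => p Sp.
exact: (pres_S P).
Qed.

Lemma c36_onto w : in_W w -> exists x : X36 F, c36 x =1 w.
Proof.
move=> ww; have g0 := ww.1; have P := X36_presentation F0.
by apply: (pres_onto P g0); apply/(S36P g0).
Qed.

Lemma X36_irreducible : is_irreducible (X36 F).
Proof.
have [K [f [T [T' g]]]] := generic_exists F0; have P := X36_presentation F0.
have [w ww] := W_point F; have [x _] := c36_onto ww.
apply: (prime_irreducible P); first by exists x.
suff -> : videal (@c36 F) setT = widl f T T' by exact: widl_prime.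
apply/seteqP; split=> p /= H.
  by apply/(generic_vanish F0 g) => v /c36_onto[y yE]; rewrite -(meval_eq _ yE); exact: H.
by move=> y _; apply: (generic_vanish F0 g p).1 (c36_W y).
Qed.

Lemma X36_dim : has_dim (X36 F) 4.
Proof.
have [K [f [T [T' g]]]] := generic_exists F0; have P := X36_presentation F0; split.
  apply: (exists_has_chain P (widl_prime f T T') _ _ (xpoly_indep g)).
    by move=> _ [i ->]; exact: generic_weq.
  by move=> H; have /eqP := generic_wg g; apply.
apply: (no_chain P) => Q u pQ SQ Qg uI; apply: (W_no5 F0 pQ _ Qg uI) => i.
by apply: SQ; exists i.
Qed.

Definition image_ideal : set {mpoly F[4 + 4]} :=
  [set p | forall w : 'I_(6 + 6) -> F, in_W w -> p.@[image_coords w] = 0]%classic.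

Lemma generic_image (K : fieldType) (f : {rmorphism F -> K}) T T' p : generic f T T' ->
  mmap f (pair_coords (xc T) (xc (colratio T'))) p = 0 <-> image_ideal p.
Proof.
move=> g; have [[tT tT' _ _] _] := g; have [eL eR] := trip_coords tT tT'.
have [q [N qE]] := cl_mpoly p (@cl_image F).
have z0 : forall i, coords T T' i != 0 by apply/(@wg_neq0 F K f); exact: generic_wg.
have := qE K f (coords T T') z0; rewrite /image_coords eL eR => E.
have pz : \prod_i coords T T' i != 0 by apply/prodf_neq0 => i _.
have Ew w : in_W w -> p.@[image_coords w] * (\prod_i w i) ^+ N = q.@[w].
  by move=> /in_WP[w0 _]; exact: (qE F idfun w w0).
split=> [p0 w ww|H].
  have := (generic_vanish F0 g q).1; rewrite -E p0 mul0r => /(_ erefl w ww).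
  rewrite -Ew // => /eqP; rewrite mulf_eq0 expf_eq0 => /orP[/eqP//|/andP[_]].
  by have [w0 _] := (in_WP w).1 ww; rewrite (negPf (_ : \prod_i w i != 0)) //; apply/prodf_neq0 => i _.
apply/eqP; rewrite -(mulIr_eq0 _ (mulIf (expf_neq0 N pz))) E; apply/eqP/(generic_vanish F0 g) => w ww.
by rewrite -Ew // H // mul0r.
Qed.

Lemma image_prime : is_prime image_ideal.
Proof.
have [K [f [T [T' g]]]] := generic_exists F0.
suff <- : (fun p => mmap f (pair_coords (xc T) (xc (colratio T'))) p = 0) = image_ideal.
  exact: (prime_kernel (mmap f _)).
by apply/seteqP; split=> p; [exact: (generic_image p g).1|exact: (generic_image p g).2].
Qed.

Lemma image_indep : indep_mod image_ideal (fun k : 'I_4 => 'X_(lshift 4 k)).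
Proof.
have [K [f [T [T' g]]]] := generic_exists F0.
apply/(indep_modP _ (fun p => generic_image p g)) => Q Q0; apply: g.2; rewrite -[RHS]Q0.
by apply: eq_mmap => // k; rewrite mmapX mmap1U pair_coordsL.
Qed.

Lemma tratio_restrict (u : 'I_3 + 'I_6 -> 'cV[F]_6) (a : 'I_3 + 'I_6 -> 'rV[F]_6) (s : 'I_3 -> 'I_6) i j :
  normal_gram (gram u a) -> tratio (restrict_tuple s (dyads u a)) i j =
    gratio (gram u a) i (s j) / gratio (gram u a) i (s 0).
Proof.
move=> [ig _ _]; have n k l := cross_neq0 F0 k l ig.
have s0 := six_neq0 F0; have E36 : 36%:R = 6%:R * 6%:R :> F by rewrite -natrM.
rewrite /tratio /= tr_dyads4 !(g_crossV F0) // /gratio E36.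
move: (n (i + 1) (s j)) (n i (s j)) (n (i + 1) (s 0)) (n i (s 0)) s0.
move: (gram _ _ _ _) (gram _ _ _ _) (gram _ _ _ _) (gram _ _ _ _) (6%:R : F) => x y x' y' c x0 y0 x0' y0' c0.
by field; rewrite ?x0 ?y0 ?x0' ?y0' ?c0.
Qed.

Lemma cXYX_h (x : X36 F) : cXYX (h F0 x) =1 image_coords (c36 x).
Proof.
have [rho rE] := X36_eval F0 x; have [u [a [e ng tE _]]] := X36_normal F0 rho.
have cE : c36 x = fun k => gratio (gram u a) (row12 k) (col12 k).
  by apply: funext => k; rewrite /c36 /git_coord rE; exact: tE.
have gE i j : grid6 (c36 x) i j = gratio (gram u a) i j by rewrite cE -gratio_grid6.
have E (s : 'I_3 -> 'I_6) (sI : injective s) k :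
    sval (restrict sI x) (tX F k) = gratio (gram u a) (row4 k) (s (col4 k)) / gratio (gram u a) (row4 k) (s 0).
  by rewrite -tratio_restrict // -(funext e); exact: rE.
have L0 : @lshift 3 3 0 = 0 :> 'I_6 by apply: val_inj.
move=> i; rewrite /cXYX /image_coords /pair_coords; case: split => k; rewrite xcE.
  by rewrite [LHS]E L0 (gratio0 _ ng) divr1 -gE; have [-> _] := grid6_trip (c36 x) (row4 k) (col4 k).
rewrite [LHS]E -!gE /colratio /rescale mulrC.
by have [_ ->] := grid6_trip (c36 x) (row4 k) (col4 k); have [_ ->] := grid6_trip (c36 x) (row4 k) 0.
Qed.

Lemma gluing_image : (@gluing F F0 `<=` image_ideal)%classic.
Proof.
move=> p Sp w /c36_onto[x xE]; rewrite -(funext xE) -(meval_eq _ (cXYX_h x)).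
exact: (pres_S (XYX_presentation F0)).
Qed.

Lemma image_g8 : ~ image_ideal (coord_prod F (4 + 4)).
Proof.
move=> H; have [w /c36_onto[x xE]] := W_point F; have := H _ (c36_W x).
by rewrite -(meval_eq _ (cXYX_h x)) => /eqP; rewrite (negPf (pres_g (XYX_presentation F0) _)).
Qed.

(** The generic point of [P] is matched, so by [matched_generic] it is the image of a generic point
    of X(3,6); the images of all such points have the ideal [image_ideal]. *)
Lemma large_prime (P : set {mpoly F[4 + 4]}) (u : 'I_4 -> {mpoly F[4 + 4]}) : is_prime P ->
  (@gluing F F0 `<=` P)%classic -> ~ P (coord_prod F (4 + 4)) -> indep_mod P u ->
  P = image_ideal.
Proof.
move=> pP SP Pg uI; have [K [f [z [zP _]]]] := kpoint pP.
have zp : \prod_i z i != 0 by rewrite -(mmap_coord_prod f); apply/eqP => /zP.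
have z0 i : z i != 0 by have /prodf_neq0 /(_ i isT) := zp.
pose TL (K : fieldType) (f : {rmorphism F -> K}) (z : 'I_(4 + 4) -> K) := trip4 (fun i => z (lshift 4 i)).
pose TR (K : fieldType) (f : {rmorphism F -> K}) (z : 'I_(4 + 4) -> K) := trip4 (fun i => z (rshift 4 i)).
have cL : clearable_triple TL := cl_trip4 F _; have cR : clearable_triple TR := cl_trip4 F _.
have [_ PE] := prime_zero (XYX_presentation F0) pP SP Pg.
(* By [PE], [P] is the ideal of its [F]-points, so what vanishes at all the [F]-points of the fiber
   product vanishes at [z]. *)
have van (A : family F (4 + 4)) : clearable A -> (forall x : XYX F0, A F idfun (cXYX x) = 0) -> A K f z = 0.
  move=> [p [N pN]] A0; have Pp : P p.
    rewrite -PE => x _; have c0 : forall i, cXYX x i != 0.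
      by apply/coord_prod_neq0; exact: (pres_g (XYX_presentation F0)).
    by have := pN F idfun (cXYX x) c0; rewrite A0 mul0r => /esym.
  have /eqP := pN K f z z0; rewrite (zP p).2 // mulf_eq0 expf_eq0 => /orP[/eqP//|/andP[_]].
  by rewrite (negPf (_ : \prod_i z i != 0)) //; apply/prodf_neq0 => i _.
have cN A B : clearable A -> clearable B -> clearable (fun K f z => A K f z - B K f z).
  by move=> cA cB; apply: eq_cl (clD cA (clM (cl_const _ (-1)) cB)) => K' f' z'; rewrite rmorphN1 mulN1r.
have m : matched (TL K f z) (TR K f z).
  have X x : matched (TL F idfun (cXYX x)) (TR F idfun (cXYX x)) := XYX_matched (F0 := F0) x.
  have cD T : clearable_triple T -> clearable (fun K f z => invD (T K f z)) /\
      clearable (fun K f z => invE (T K f z)).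
    by move=> cT; split; apply: cl_prod => i; apply: cl_sum => j; have [] := cT i j.
  have [DL EL] := cD _ _ _ cL; have [DR ER] := cD _ _ _ cR.
  split=> [i||].
  - apply/eqP; rewrite -subr_eq0; apply/eqP.
    apply: (van (fun K f z => invA (TR K f z) i - invA (TL K f z) i)) => [|x].
      exact: cN (cl_invA i cR) (cl_invA i cL).
    by have [-> _ _] := X x; rewrite subrr.
  - apply/eqP; rewrite -addr_eq0; apply/eqP.
    apply: (van (fun K f z => invD (TR K f z) + invD (TL K f z))) => [|x]; first exact: clD DR DL.
    by have [_ -> _] := X x; rewrite addNr.
  - apply/eqP; rewrite -addr_eq0; apply/eqP.
    apply: (van (fun K f z => invE (TR K f z) + invE (TL K f z))) => [|x]; first exact: clD ER EL.
    by have [_ _ ->] := X x; rewrite addNr.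
have zL : pair_coords (xc (TL K f z)) (xc (TR K f z)) =1 z.
  by move=> i; rewrite -[RHS]pair_coordsE /pair_coords; case: split => k; exact: xc_trip4.
have [||i|i|d dd kL kR j|T' g cE] := @matched_generic F F0 K f (TL K f z) (TR K f z)
    (fun j => mmap f z (u j)) _ _ _ _ m ((indep_modP u zP).1 uI) _.
- by apply: trip4_triple => i; exact: z0.
- by apply: trip4_triple => i; exact: z0.
- exact: trip4_0.
- exact: trip4_0.
- rewrite (der_mmap dd) big1 // => i _; suff -> : d (z i) = 0 by rewrite mulr0.
  by rewrite -zL /pair_coords; case: split => k; exact: kills_xc.
apply/seteqP; split=> p /=; rewrite -zP -(generic_image p g) cE (eq_mmap (g := f) p _ zL) //.
Qed.

Definition main_component : set (XYX F0) := zero_set (cXYX (F0 := F0)) image_ideal.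
Local Notation Z := main_component.
Local Notation pX := (XYX_presentation F0).

Lemma main_closed : zclosed Z.
Proof. exact: zclosed_zero pX _. Qed.

Lemma videal_main : videal (cXYX (F0 := F0)) Z = image_ideal.
Proof. by have [] := prime_zero pX image_prime gluing_image image_g8. Qed.

Lemma h_main x : Z (h F0 x).
Proof. by move=> p pI; rewrite (meval_eq _ (cXYX_h x)); apply/pI/c36_W. Qed.

Lemma main_irreducible_component : irreducible_component Z.
Proof.
split; [exact: main_closed|exact: (zero_irreducible pX image_prime gluing_image image_g8)|].
move=> Z' cZ' iZ' sZ; have pP := irreducible_prime pX iZ'.
have sI : (videal (cXYX (F0 := F0)) Z' `<=` image_ideal)%classic.
  by rewrite -videal_main => p H x /sZ; exact: H.
have E : videal (cXYX (F0 := F0)) Z' = image_ideal.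
  apply: (large_prime pP (u := fun k : 'I_4 => 'X_(lshift 4 k))).
  - by move=> p; exact: (videalS pX).
  - exact: (videal_g pX iZ'.1).
  - by move=> Q /sI; exact: image_indep.
by rewrite (closed_zero pX cZ') E.
Qed.

Lemma main_dim : has_dim (subvariety Z) 4.
Proof.
have P := sub_presentation pX main_closed; rewrite videal_main in P; split.
  exact: (exists_has_chain P image_prime _ image_g8 image_indep).
apply: (no_chain P) => Q u pQ SQ Qg uI.
have wI : injective (widen_ord (leqnSn 4)) by move=> i j /(congr1 val) /= ij; apply: val_inj.
have [K [f [T [T' g]]]] := generic_exists F0.
have QE : Q = image_ideal.
  apply: (large_prime pQ (u := fun j => u (widen_ord (leqnSn 4) j))) => //.
    by move=> p /gluing_image/SQ.
  have [K' [f' [z [zP _]]]] := kpoint pQ; apply/(indep_modP _ zP).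
  exact: (alg_indep_sub wI ((indep_modP u zP).1 uI)).
rewrite {}QE in uI; have vI := (indep_modP u (fun p => generic_image p g)).1 uI.
apply: (generic_no5 (char0_ext f F0) g vI) => d dd k k' j.
rewrite (der_mmap dd) big1 // => i _.
suff -> : d (pair_coords (xc T) (xc (colratio T')) i) = 0 by rewrite mulr0.
by rewrite /pair_coords; case: split => l; apply: kills_xc; [exact: k|exact: (kills_ratio dd k')].
Qed.

(** A chain of length 4 would give a prime above the ideal of [Z'] with 4 independent elements, that
    is [image_ideal]; then [Z'] would contain the main component. *)
Lemma other_components (Z' : set (XYX F0)) : irreducible_component Z' -> Z' <> Z ->
  exists2 d, (d < 4)%N & has_dim (subvariety Z') d.
Proof.
move=> [cZ' iZ' _] nZ; have P := sub_presentation pX cZ'.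
have [[x0 Z'x0] _] := iZ'; have pP := irreducible_prime pX iZ'.
apply: small_dim.
  apply: (prime_irreducible P); first by exists (exist _ x0 Z'x0).
  suff -> : videal (fun z : subvariety Z' => cXYX (sval z)) setT = videal (cXYX (F0 := F0)) Z' by [].
  apply/seteqP; split=> p H; first by move=> x Zx; exact: (H (exist _ x Zx)).
  by move=> [x Zx] _; exact: H.
apply: (no_chain P) => Q u pQ SQ Qg uI; apply: nZ.
have QE : Q = image_ideal.
  by apply: (large_prime pQ _ Qg uI) => p Sp; apply: SQ; exact: (videalS pX).
have [_ _ mZ] := main_irreducible_component.
suff sZ : (Z `<=` Z')%classic by exact: mZ.
rewrite (closed_zero pX cZ') => x Zx p pZ'; apply: Zx; rewrite -QE; exact: SQ.
Qed.

End Generic.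

(** * The inverse of [h] on an open set *)

Section Birational.
Variable F : closedFieldType.
Hypothesis F0 : [pchar F] =i pred0.
Local Notation Z := (@main_component F F0).
Local Notation pX := (XYX_presentation F0).
Local Notation p36 := (X36_presentation F0).

(** The product of the [invA] is a Laurent polynomial, and [u] is its numerator. *)
Lemma full_locus n (T : forall K : fieldType, {rmorphism F -> K} -> ('I_n -> K) -> 'I_3 -> 'I_3 -> K) :
  clearable_triple T -> exists u : {mpoly F[n]}, forall (K : fieldType) (f : {rmorphism F -> K}) z,
    (forall i, z i != 0) -> mmap f z u != 0 <-> full (T K f z).
Proof.
move=> cT; have [u [N H]] := cl_prod (index_enum 'I_3) (fun i => cl_invA i cT).
exists u => K f z z0; have pz : \prod_i z i != 0 by apply/prodf_neq0 => i _.
rewrite -H // mulf_eq0 negb_or expf_neq0 // andbT; split=> [/prodf_neq0 n0 i|fT].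
  by have := n0 i isT; rewrite mulf_eq0 negb_or => /andP.
by apply/prodf_neq0 => i _; have [a b] := fT i; rewrite mulf_neq0.
Qed.

Lemma matching_colratio (K : fieldType) (T T' : 'I_3 -> 'I_3 -> K) : wpoint T T' -> full T ->
  rescale (matching_scale T (colratio T')) (colratio T') = T'.
Proof.
move=> [tT tT' _ opp] fT; apply: funext => i; apply: funext => j.
have [_ o] := opp i; have [_ s0] := fT i; have t0 := triple_neq0 i 0 tT'.
rewrite /rescale /matching_scale sum_rescale o /colratio /rescale; field.
by rewrite oppr_eq0 s0 t0.
Qed.

Definition leftT (y : subvariety Z) := trip4 (fun i => cXYX (sval y) (lshift 4 i)).
Definition rightT (y : subvariety Z) := trip4 (fun i => cXYX (sval y) (rshift 4 i)).
Definition matching_triple y := rescale (matching_scale (leftT y) (rightT y)) (rightT y).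

Lemma cXYX_neq0 (y : XYX F0) i : cXYX y i != 0.
Proof. by move: i; apply/coord_prod_neq0; exact: (pres_g pX). Qed.

Lemma c36_neq0 (x : X36 F) i : c36 x i != 0.
Proof. by have [] := (in_WP (c36 x)).1 (c36_W F0 x). Qed.

Lemma matching_W y : full (leftT y) ->
  [/\ is_triple (leftT y), is_triple (matching_triple y), in_W (coords (leftT y) (matching_triple y)) &
      colratio (matching_triple y) = rightT y].
Proof.
move=> fT; have tL : is_triple (leftT y) by apply: trip4_triple => i; exact: cXYX_neq0.
have tR : is_triple (rightT y) by apply: trip4_triple => i; exact: cXYX_neq0.
have [w cE] := matching_wpoint tL tR (trip4_0 _) (trip4_0 _) (XYX_matched (F0 := F0) (sval y)) fT.
have tM := w_triple' w; split=> //; have [eL eR] := trip_coords tL tM.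
apply/in_WP; rewrite eL eR; split=> // i; rewrite /coords /two_blocks.
by case: split => j; case: split => k; exact: triple_neq0.
Qed.

Lemma leftT_h x : leftT (h_into (@h_main F F0) x) = tripL (c36 x).
Proof.
have [_ [tL _ n _]] := (in_WP (c36 x)).1 (c36_W F0 x).
rewrite -[RHS]trip4_xc // /leftT; congr trip4; apply: funext => i.
by rewrite [LHS](cXYX_h F0 x) /image_coords pair_coordsL.
Qed.

Lemma rightT_h x : rightT (h_into (@h_main F F0) x) = colratio (tripR (c36 x)).
Proof.
have [_ [_ tR _ _]] := (in_WP (c36 x)).1 (c36_W F0 x).
rewrite -[RHS]trip4_xc; [|exact: colratio_triple|by move=> i; exact: colratio0].
rewrite /rightT; congr trip4; apply: funext => i.
by rewrite [LHS](cXYX_h F0 x) /image_coords pair_coordsR.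
Qed.

Lemma zopen_neq0 (V : variety F) n (c : V -> 'I_n -> F) g S (u : {mpoly F[n]}) :
  presentation c g S -> zopen [set x | u.@[c x] != 0]%classic.
Proof.
move=> P; have := zclosed_zero P [set u]%classic; rewrite /zopen.
suff -> : zero_set c [set u]%classic = (~` [set x | u.@[c x] != 0])%classic by [].
apply/seteqP; split=> [x H|x /= H p ->]; first by move=> /=; rewrite (H u) // eqxx.
by apply/eqP/negPn/negP.
Qed.

Theorem h_birational : birational (h_into (@h_main F F0)).
Proof.
have [u uP] := full_locus (cl_tripL F).
have [v vP] := full_locus (cl_trip4 F (@lshift 4 4)).
pose U := [set x : X36 F | u.@[c36 x] != 0]%classic.
pose V := [set y : subvariety Z | v.@[cXYX (sval y)] != 0]%classic.
have UP x : U x <-> full (tripL (c36 x)) by exact: (uP F idfun (c36 x) (c36_neq0 x)).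
have VP y : V y <-> full (leftT y) by exact: (vP F idfun _ (cXYX_neq0 (sval y))).
have [w0 w0W] := W_point F.
(* Outside the full locus [psi] takes a default value, found with the point [w0] of [W]. *)
have /boolp.choice[psi psiE] : forall y : subvariety Z, exists x : X36 F,
    full (leftT y) -> c36 x =1 coords (leftT y) (matching_triple y).
  move=> y; have [fT|nf] := pselect (full (leftT y)).
    by have [_ _ ww _] := matching_W fT; have [x xE] := c36_onto F0 ww; exists x.
  by have [x _] := c36_onto F0 w0W; exists x.
have psiT y : full (leftT y) -> tripL (c36 (psi y)) = leftT y /\ tripR (c36 (psi y)) = matching_triple y.
  move=> fT; have [tL tM _ _] := matching_W fT.
  by rewrite (funext (psiE y fT)); exact: trip_coords.
have hpsi y : V y -> h_into (@h_main F F0) (psi y) = y.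
  move=> /VP fT; have [_ _ _ cE] := matching_W fT; have [eL eR] := psiT y fT.
  have se (s : subvariety Z) a (p : Z a) : a = sval s -> exist _ a p = s.
    by case: s => b q /= ab; exact: eq_exist.
  apply: se; apply: (@cXYX_inj F F0) => i; rewrite [LHS](cXYX_h F0 (psi y)).
  rewrite /image_coords eL eR cE -[RHS]pair_coordsE /pair_coords.
  by case: split => k; exact: xc_trip4.
have psih x : U x -> psi (h_into (@h_main F F0) x) = x.
  move=> /UP fT; have [_ wx] := (in_WP (c36 x)).1 (c36_W F0 x).
  apply: (c36_inj F0) => i; rewrite psiE leftT_h //.
  by rewrite /matching_triple leftT_h rightT_h matching_colratio // coords_trip.
have UV x : U x -> V (h_into (@h_main F F0) x) by move=> /UP fT; apply/VP; rewrite leftT_h.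
have VU y : V y -> U (psi y) by move=> /VP fT; apply/UP; have [-> _] := psiT y fT.
have pZ := sub_presentation pX (main_closed F0).
(* If [U] were empty, [u] would vanish on [W], hence at a generic point, where no sum vanishes. *)
have [x0 Ux0] : exists x, U x.
  have [K [f [T [T' g]]]] := generic_exists F0; apply: contrapT => nU.
  have [[tT tT' _ _] _] := g; have [eL _] := trip_coords tT tT'.
  have uW w : in_W w -> u.@[w] = 0.
    move=> /(c36_onto F0)[x xE]; rewrite -(meval_eq _ xE); apply: contrapT => /eqP Ux.
    by apply: nU; exists x.
  have c0 : forall i, coords T T' i != 0 by apply/(@wg_neq0 F K f); exact: generic_wg.
  have : full (tripL (coords T T')) by rewrite eL; have [] := generic_kills (char0_ext f F0) g.
  by move/(uP K f _ c0)/eqP; apply; apply/(generic_vanish F0 g).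
exists U, V, psi; split=> //.
- split; first exact: zopen_neq0 p36.
  by exists x0.
- split; first exact: (zopen_neq0 v pZ).
  by exists (h_into (@h_main F F0) x0); exact: UV.
split.
  apply: (morphism_criterion p36 pZ) => // i.
  apply: (eq_frac (h := fun x => image_coords (c36 x) i)) => [x _|]; first by rewrite -(cXYX_h F0 x).
  exact: (frac_clearable _ (fun x i => c36_neq0 x i) (cl_image F i)).
apply: (morphism_criterion pZ p36) => // i.
have entry_frac s r j : fractional (fun y : subvariety Z => cXYX (sval y)) V
    (fun y => trip4 (fun i => cXYX (sval y) (s i)) r j).
  have [c _] := cl_trip4 F s r j.
  exact: (frac_clearable _ (fun (y : subvariety Z) i => cXYX_neq0 (sval y) i) c).
have fL r j := entry_frac (@lshift 4 4) r j; have fR r j := entry_frac (@rshift 4 4) r j.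
have fM r j : fractional (fun y : subvariety Z => cXYX (sval y)) V (fun y => matching_triple y r j).
  have sL := frac_sum (index_enum 'I_3) (fL r); have sR := frac_sum (index_enum 'I_3) (fR r).
  have sV := fracV _ sR; apply: (eq_frac (h := fun y => -1 * (sum (leftT y) r * (sum (rightT y) r)^-1) * rightT y r j)).
    by move=> y _; rewrite /matching_triple /rescale /matching_scale mulN1r.
  apply: fracM; last exact: fR.
  apply: fracM; [exact: frac_const|apply: fracM; [exact: sL|apply: sV]].
  move=> y /VP fT; have [AE _ _] := XYX_matched (F0 := F0) (sval y).
  have [a0 b0] := fT r; have := AE r; rewrite /invA => e.
  have : sumV (rightT y) r * sum (rightT y) r != 0 by rewrite [_ * _]e mulf_neq0.
  by rewrite mulf_eq0 negb_or => /andP[].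
apply: (eq_frac (h := fun y => coords (leftT y) (matching_triple y) i)).
  by move=> y /VP fT; rewrite psiE.
rewrite /coords /two_blocks; case: split => j; case: split => k; by [exact: fL|exact: fM].
Qed.

End Birational.

Theorem theorem9 (F : closedFieldType) (F0 : [pchar F]%R =i pred0) :
  [/\ is_irreducible (X36 F),
      has_dim (X36 F) 4 &
      exists Z : set (XYX F0),
        [/\ irreducible_component Z,
            has_dim (subvariety Z) 4,
            forall Z' : set (XYX F0), irreducible_component Z' -> Z' <> Z ->
              exists2 d, (d < 4)%N & has_dim (subvariety Z') d &
            exists hZ : forall x, Z (h F0 x), birational (h_into hZ)]].
Proof.
split; [exact: X36_irreducible|exact: X36_dim|].
exists (@main_component F F0); split.
- exact: main_irreducible_component.
- exact: main_dim.
- exact: other_components.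
- by exists (@h_main F F0); exact: h_birational.
Qed.
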